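(* Consider the discrete-time Rayleigh fading MIMO channel (no channel state information) with $N_T$ transmit and $N_R$ receive antennas described in the context. For fixed $\beta\ge 1$, $$\lim_{\rho\to0}\frac{C_{mimo-s}(\rho,\beta)}{\rho^2}=\lim_{\rho\to0}\frac{U_{mimo-s}(\rho,\beta)}{\rho^2}=\frac12\max_{\underline{a}\in\mathcal{A}(\beta)}\ \sum_{l=0}^{N_R-1}\left\{\sum_{k=0}^{N_T-1}a_k\lambda_{k,l}-\Big(\sum_{k=0}^{N_T-1}a_kR_{k,l}(0)\Big)^2\right\}.$$
   Context: Channel model. For $n\in\mathbb{N}$ the input is $\sqrt{\rho}\,\underline{Z}(n)$ ($\rho>0$) with $\underline{Z}(n)=(Z_0(n),\dots,Z_{N_T-1}(n))\in\mathbb{C}^{N_T}$, and the output $\underline{Y}(n)\in\mathbb{C}^{N_R}$ is $$Y_l(n)=\sqrt{\rho}\sum_{k=0}^{N_T-1}H_{k,l}(n)Z_k(n)+W_l(n),\qquad 0\le l\le N_R-1 .$$ The fading processes $H_{k,l}=(H_{k,l}(n):n\in\mathbb{Z})$ are zero-mean, stationary and ergodic, jointly proper complex normal (i.e. jointly circularly symmetric complex Gaussian), and mutually independent for distinct pairs $(k,l)$. $H_{k,l}$ has autocorrelation function $R_{k,l}(n)=E[H_{k,l}(n)H_{k,l}^*(0)]$ and spectral density $S_{k,l}(\omega)$, with $R_{k,l}(n)=\int_{-\pi}^{\pi}S_{k,l}(\omega)e^{jn\omega}\frac{d\omega}{2\pi}$. The $W_l(n)$ are iid (over $l$ and $n$)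 proper complex normal with zero mean and unit variance. Fading, additive noise and input are mutually independent (neither transmitter nor receiver observes the fading). Logarithms are natural. Define $\phi_{k,l}=\sum_{n=1}^\infty|R_{k,l}(n)|^2$ (assumed finite for all $k,l$), $\lambda_{k,l}=(R_{k,l}(0))^2+2\phi_{k,l}$, and $I_{k,l}(\rho)=\int_{-\pi}^{\pi}\log(1+\rho S_{k,l}(\omega))\frac{d\omega}{2\pi}$. Let $$\mathcal{A}(\beta)=\Big\{(a_0,\dots,a_{N_T-1}): a_k\ge 0\ \forall k,\ \sum_{k=0}^{N_T-1}a_k\le \tfrac1\beta\Big\},$$ $$U_{mimo-s}(\rho,\beta)=\max_{\underline{a}\in\mathcal{A}(\beta)}\ \sum_{l=0}^{N_R-1}\left\{\log\Big(1+\rho\sum_{k=0}^{N_T-1}R_{k,l}(0)\,a_k\Big)-\sum_{k=0}^{N_T-1}a_k I_{k,l}(\rho)\right\}.$$ Sum power constraints: $\|\underline{Z}(n)\|_2^2\le 1$ for all $n$ and $E[\|\underline{Z}(n)\|_2^2]\le 1/\beta$ for all $n$. $C_{mimo-s}(\rho,\beta)$ denotes the information theoretic capacity under these constraints, i.e. $\lim_{N\to\infty}\frac1N\sup I(\underline{Z}(1),\dots,\underline{Z}(N);\underline{Y}(1),\dots,\underline{Y}(N))$, the supremum being over joint distributions of $(\underline{Z}(1),\dots,\underline{Z}(N))$ satisfying the constraints for $1\le n\le N$. *)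

(* Defs.v *)
(* MathComp-Analysis; complex numbers are R[i] from mathcomp real-closed. *)
From HB Require Import structures.
From mathcomp Require Import all_boot all_order all_algebra.
From mathcomp Require Import complex.
From mathcomp Require Import all_classical all_reals all_analysis.
From mathcomp Require Import measurable_realfun.

Set Implicit Arguments.
Unset Strict Implicit.
Unset Printing Implicit Defensive.

Import Order.TTheory GRing.Theory Num.Theory ComplexField.
Import numFieldNormedType.Exports.

Local Open Scope classical_set_scope.
Local Open Scope ring_scope.
Local Open Scope complex_scope.
Local Open Scope charge_scope.

Local Notation Re := complex.Re.
Local Notation Im := complex.Im.
Local Notation normc := Normc.normc.

(* R[i] carries the Borel sigma-algebra of R^2, generated by Re and Im. *)
Section measurable_complex.
Variable R : realType.

HB.instance Definition _ := isPointed.Build R[i] 0.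

Definition complex_measurable : set (set R[i]) :=
  g_sigma_preimageU (@Re R : R[i] -> measurableTypeR R)
                    (@Im R : R[i] -> measurableTypeR R).

Let complex_measurable0 : complex_measurable set0.
Proof. exact: sigma_algebra0. Qed.

Let complex_measurableC A : complex_measurable A -> complex_measurable (~` A).
Proof. exact: sigma_algebraC. Qed.

Let complex_measurable_bigcup (F : (set R[i])^nat) :
  (forall i, complex_measurable (F i)) -> complex_measurable (\bigcup_i F i).
Proof. exact: sigma_algebra_bigcup. Qed.

HB.instance Definition _ := @isMeasurable.Build default_measure_display R[i]
  complex_measurable complex_measurable0 complex_measurableC
  complex_measurable_bigcup.

Lemma measurable_Re : measurable_fun setT (@Re R : R[i] -> R).
Proof.
move=> _ B mB; apply: sub_sigma_algebra; left; exists B => //.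
Qed.

Lemma measurable_Im : measurable_fun setT (@Im R : R[i] -> R).
Proof.
move=> _ B mB; apply: sub_sigma_algebra; right; exists B => //.
Qed.

Lemma measurable_fun_complexP d (T : measurableType d) (f : T -> R[i]) :
  measurable_fun setT f <->
  measurable_fun setT (fun x => Re (f x)) /\
  measurable_fun setT (fun x => Im (f x)).
Proof.
split=> [mf|[mre mim]].
  split.
    exact: (measurableT_comp measurable_Re mf).
  exact: (measurableT_comp measurable_Im mf).
apply: measurability; first reflexivity.
move=> _ [_ [[B mB <-]|[B mB <-]] <-].
  have := mre measurableT B mB; congr measurable.
  by apply/seteqP; split=> x /=; tauto.
have := mim measurableT B mB; congr measurable.
by apply/seteqP; split=> x /=; tauto.
Qed.

Lemma measurable_funDc d (T : measurableType d) (f g : T -> R[i]) :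
  measurable_fun setT f -> measurable_fun setT g ->
  measurable_fun setT (fun x => f x + g x).
Proof.
move=> /measurable_fun_complexP[fr fi] /measurable_fun_complexP[gr gi].
apply/measurable_fun_complexP; split.
  rewrite (_ : (fun _ => _) = (fun x => Re (f x) + Re (g x))).
    exact: measurable_funD.
  by apply/funext => x; case: (f x) (g x) => ? ? [].
rewrite (_ : (fun _ => _) = (fun x => Im (f x) + Im (g x))).
  exact: measurable_funD.
by apply/funext => x; case: (f x) (g x) => ? ? [].
Qed.

Lemma measurable_funMc d (T : measurableType d) (f g : T -> R[i]) :
  measurable_fun setT f -> measurable_fun setT g ->
  measurable_fun setT (fun x => f x * g x).
Proof.
move=> /measurable_fun_complexP[fr fi] /measurable_fun_complexP[gr gi].
apply/measurable_fun_complexP; split.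
  rewrite (_ : (fun _ => _) =
      (fun x => Re (f x) * Re (g x) - Im (f x) * Im (g x))).
    by apply: measurable_funB; exact: measurable_funM.
  by apply/funext => x; case: (f x) (g x) => ? ? [].
rewrite (_ : (fun _ => _) =
    (fun x => Re (f x) * Im (g x) + Im (f x) * Re (g x))).
  by apply: measurable_funD; exact: measurable_funM.
by apply/funext => x; case: (f x) (g x) => ? ? [].
Qed.

Lemma measurable_sumc d (T : measurableType d) I (s : seq I)
    (f : I -> T -> R[i]) :
  (forall i, measurable_fun setT (f i)) ->
  measurable_fun setT (fun x => \sum_(i <- s) f i x).
Proof.
move=> mf; elim: s => [|i s IHs].
  rewrite (_ : (fun _ => _) = cst 0); first exact: measurable_cst.
  by apply/funext => x; rewrite big_nil.
rewrite (_ : (fun _ => _) = (fun x => f i x + \sum_(j <- s) f j x)).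
  exact: measurable_funDc.
by apply/funext => x; rewrite big_cons.
Qed.

End measurable_complex.

Section maximum.
Variable R : realType.

(* The greatest element of S (0 when there is none). *)
Definition max_of (S : set R) : R := xget 0 (S `&` ubound S).

End maximum.

Section gaussian_processes.
Context d (Omega : measurableType d) (R : realType) (P : probability Omega R).

Definition cexpectation (X : Omega -> R[i]) : R[i] :=
  fine 'E_P[fun w => Re (X w)] +i* fine 'E_P[fun w => Im (X w)].

(* The degenerate laws have to be treated apart, as [normal_prob m 0] is not
   the Dirac measure at m. *)
Definition gaussian (X : Omega -> R) : Prop :=
  exists m s : R, 0 <= s /\
    forall B : set R, measurable B ->
      P (X @^-1` B) = if s == 0 then \d_m B else normal_prob m s B.

(* A family of complex random variables is jointly normal when its real and
   imaginary parts are jointly Gaussian, and proper when its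
   pseudo-covariances E[(X_i - E X_i)(X_j - E X_j)] vanish. *)
Definition jointly_proper_normal (I : Type) (X : I -> Omega -> R[i]) : Prop :=
  (forall (s : seq I) (a b : I -> R),
     gaussian (fun w => \sum_(i <- s) (a i * Re (X i w) + b i * Im (X i w)))) /\
  (forall i j : I,
     cexpectation (fun w => (X i w - cexpectation (X i)) *
                            (X j w - cexpectation (X j))) = 0).

Definition mutually_independent (I : eqType) (G : I -> set (set Omega)) : Prop :=
  forall (s : seq I) (A : I -> set Omega), uniq s ->
    (forall i, i \in s -> G i (A i)) ->
    P (\big[setI/setT]_(i <- s) A i) = (\prod_(i <- s) P (A i))%E.

Definition generated_sigma_algebra (I : Type) (X : I -> {RV P >-> R[i]}) :
    set (set Omega) :=
  <<s \bigcup_i g_sigma_algebra_preimage (X i) >>.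

Implicit Types X : int -> {RV P >-> R[i]}.

(* The product sigma-algebra on the space of paths. *)
Definition path_measurable : set (set (int -> R[i])) :=
  <<s \bigcup_n preimage_set_system setT (fun x : int -> R[i] => x n)
                                    measurable >>.

Definition path_shift (x : int -> R[i]) : int -> R[i] := fun n => x (n + 1).

Definition path_of X (w : Omega) : int -> R[i] := fun n => X n w.

Definition stationary X : Prop :=
  forall B, path_measurable B ->
    P (path_of X @^-1` (path_shift @^-1` B)) = P (path_of X @^-1` B).

Definition ergodic X : Prop :=
  forall B, path_measurable B -> path_shift @^-1` B = B ->
    P (path_of X @^-1` B) = 0%E \/ P (path_of X @^-1` B) = 1%E.

Definition autocorrelation X (n : int) : R[i] :=
  cexpectation (fun w => X n w * (X 0 w)^*).

(* R(0) = E|X(0)|^2 as a real number. *)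
Definition autocorrelation0 X : R := Re (autocorrelation X 0).

Definition phi X : \bar R :=
  (\sum_(1 <= n <oo) (normc (autocorrelation X n%:Z) ^+ 2)%:E)%E.

Definition lambda X : R := autocorrelation0 X ^+ 2 + 2 * fine (phi X).

Definition spectral_density X (S : R -> R) : Prop :=
  let D := `[- pi, pi] in
  [/\ {in D, forall t, 0 <= S t},
      lebesgue_measure.-integrable [set` D] (EFin \o S) &
      forall n : int, autocorrelation X n =
        (\int[lebesgue_measure]_(t in [set` D])
            (S t * cos (n%:~R * t) / (2 * pi))) +i*
        (\int[lebesgue_measure]_(t in [set` D])
            (S t * sin (n%:~R * t) / (2 * pi)))].

End gaussian_processes.

Section information.
Context d (T : measurableType d) (R : realType).

(* Relative entropy, in nats. *)
Definition relative_entropy (nu mu : probability T R) : \bar R :=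
  if `[< nu `<< mu >] then
    (\int[nu]_x lne (('d (charge_of_finite_measure nu) '/d mu) x))%E
  else +oo%E.

Context d1 d2 (A : measurableType d1) (B : measurableType d2).

Definition pairing (X : T -> A) (Y : T -> B) (t : T) : A * B := (X t, Y t).

Lemma measurable_pairing (X : {mfun T >-> A}) (Y : {mfun T >-> B}) :
  measurable_fun setT (pairing X Y).
Proof. exact: measurable_fun_pair. Qed.

HB.instance Definition _ (X : {mfun T >-> A}) (Y : {mfun T >-> B}) :=
  isMeasurableFun.Build _ _ _ _ (pairing X Y) (measurable_pairing X Y).

End information.

Definition mutual_information d (T : measurableType d) (R : realType)
    d1 d2 (A : measurableType d1) (B : measurableType d2)
    (Q : probability T R) (X : {RV Q >-> A}) (Y : {RV Q >-> B}) : \bar R :=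
  relative_entropy (distribution Q (pairing X Y))
                   (distribution Q X \x distribution Q Y)%E.

Section channel.
Context d (Omega : measurableType d) (R : realType) (P : probability Omega R).
Variables NT NR : nat.
Variable H : 'I_NT -> 'I_NR -> int -> {RV P >-> R[i]}.
Variable W : 'I_NR -> nat -> {RV P >-> R[i]}.

Record rayleigh_fading_channel : Prop := {
  fading_zero_mean : forall k l n, cexpectation P (H k l n) = 0;
  fading_stationary : forall k l, stationary (H k l);
  fading_ergodic : forall k l, ergodic (H k l);
  fading_normal : jointly_proper_normal P
    (fun i : 'I_NT * 'I_NR * int => H i.1.1 i.1.2 i.2);
  fading_independent : mutually_independent P
    (fun i : 'I_NT * 'I_NR => generated_sigma_algebra (H i.1 i.2));
  noise_zero_mean : forall l n, cexpectation P (W l n) = 0;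
  noise_unit_variance :
    forall l n, ('E_P[fun w => (normc (W l n w) ^+ 2)%R] = 1)%E;
  noise_normal :
    forall l n, jointly_proper_normal P (fun _ : unit => W l n : _ -> _);
  noise_independent : mutually_independent P
    (fun i : 'I_NR * nat => g_sigma_algebra_preimage (W i.1 i.2));
  fading_noise_independent : forall A B : set Omega,
    generated_sigma_algebra
      (fun i : 'I_NT * 'I_NR * int => H i.1.1 i.1.2 i.2) A ->
    generated_sigma_algebra (fun i : 'I_NR * nat => W i.1 i.2) B ->
    P (A `&` B) = (P A * P B)%E
}.

(* A block (Z(1), ..., Z(N)) is an N-tuple of NT-tuples; its entry of index
   n < N is Z(n+1). *)
Local Notation input_block N := (N.-tuple (NT.-tuple R[i])).
Local Notation output_block N := (N.-tuple (NR.-tuple R[i])).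

Section block.
Variables (rho : R) (N : nat).

Definition channel_output (p : input_block N * Omega) : output_block N :=
  [tuple [tuple (Num.sqrt rho)%:C *
                  (\sum_(k < NT) H k l n.+1%:Z p.2 * tnth (tnth p.1 n) k) +
                W l n.+1 p.2
         | l < NR] | n < N].

Lemma measurable_channel_output : measurable_fun setT channel_output.
Proof.
apply/measurable_fun_tnthP => n; apply/measurable_fun_tnthP => l.
rewrite (_ : _ \o _ = (fun p => (Num.sqrt rho)%:C *
    (\sum_(k < NT) H k l n.+1%:Z p.2 * tnth (tnth p.1 n) k) + W l n.+1 p.2)).
  apply: measurable_funDc; last exact: measurableT_comp.
  apply: measurable_funMc; first exact: measurable_cst.
  apply: measurable_sumc => k; apply: measurable_funMc.
    exact: measurableT_comp.
  apply: (measurableT_comp (measurable_tnth k)).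
  exact: (measurableT_comp (measurable_tnth n)).
by apply/funext => p /=; rewrite !tnth_mktuple.
Qed.

HB.instance Definition _ :=
  isMeasurableFun.Build _ _ _ _ channel_output measurable_channel_output.

Definition channel_input (p : input_block N * Omega) : input_block N := p.1.

Lemma measurable_channel_input : measurable_fun setT channel_input.
Proof. exact: measurable_fst. Qed.

HB.instance Definition _ :=
  isMeasurableFun.Build _ _ _ _ channel_input measurable_channel_input.

(* I(Z(1), ..., Z(N); Y(1), ..., Y(N)) when the input block has law mu; the
   product measure makes it independent of the fading and of the noise. *)
Definition block_information (mu : probability (input_block N) R) : \bar R :=
  mutual_information (Q := (mu \x P)%E) channel_input channel_output.

End block.

Definition sqr_norm2 (z : NT.-tuple R[i]) : R :=
  \sum_(k < NT) normc (tnth z k) ^+ 2.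

Definition sum_power_constraints (beta : R) (N : nat)
    (mu : probability (input_block N) R) : Prop :=
  {ae mu, forall z, forall n : 'I_N, sqr_norm2 (tnth z n) <= 1} /\
  forall n : 'I_N,
    ('E_mu[fun z => sqr_norm2 (tnth z n)] <= (beta^-1)%:E)%E.

Definition capacity (rho beta : R) : \bar R :=
  limn (fun N : nat => (N%:R^-1)%:E *
    ereal_sup [set block_information rho mu |
               mu in @sum_power_constraints beta N])%E.

Variable S : 'I_NT -> 'I_NR -> R -> R.

Definition I_ (k : 'I_NT) (l : 'I_NR) (rho : R) : R :=
  \int[lebesgue_measure]_(t in `[- pi, pi])
    (ln (1 + rho * S k l t) / (2 * pi)).

Definition A_ (beta : R) : set ('I_NT -> R) :=
  [set a | (forall k, 0 <= a k) /\ \sum_(k < NT) a k <= beta^-1].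

Definition U_mimo_s (rho beta : R) : R :=
  max_of [set \sum_(l < NR)
    (ln (1 + rho * \sum_(k < NT) autocorrelation0 (H k l) * a k)
       - \sum_(k < NT) a k * I_ k l rho) | a in A_ beta].

End channel.

(* Main.v *)
(** For small ρ all quantities are of order ρ², and the limit comes from matching
second-order bounds for a block of N channel uses.

Upper bound. The mutual information is the relative entropy of the joint law of
input and output with respect to the product of its marginals, and it can only
grow when the output marginal is replaced by independent complex normals with
the same variances. Given the input, the output is Gaussian with covariance
I + ρB, so its divergence from the noise is at most ρ²‖B‖²/2. By the peak
constraint the |Z_k(n)|² are the weights of a sub-probability, so convexity bounds
E‖B‖² by the sum over n of the λ-term; subtracting the squares of the mean
variances leaves at most N times the quadratic maximum.

Lower bound. With probabilities given by a maximiser, the input is either a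
zero block or a block of random signs sent by a single random antenna. It is
tested in the Donsker-Varadhan inequality with g = 1 + u + u²/2, where u is the
centred quadratic form of the output that approximates the log-likelihood.

Superadditivity in N makes the limit defining the capacity a supremum, and both
bounds pass to it. For U, expanding log(1 + ρS) to second order reduces the claim
to Parseval's identity for S; that S is square integrable follows from testing it
against trigonometric polynomials. *)

From HB Require Import structures.
Require Import Defs.
From mathcomp Require Import all_boot all_order all_algebra.
From mathcomp Require Import complex.
From mathcomp Require Import all_classical all_reals all_analysis.
From mathcomp Require Import measurable_realfun.
From mathcomp Require Import ring lra zify.

Set Implicit Arguments.
Unset Strict Implicit.
Unset Printing Implicit Defensive.

Import Order.TTheory GRing.Theory Num.Theory ComplexField.
Import numFieldNormedType.Exports.

Local Open Scope classical_set_scope.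
Local Open Scope ring_scope.
Local Open Scope charge_scope.
Local Notation Re := complex.Re.
Local Notation Im := complex.Im.
Local Notation normc := Normc.normc.
Local Notation "x %:C" := (real_complex _ x) (format "x %:C") : ring_scope.
Local Notation "x +i* y" := (Complex x y) : ring_scope.

(** Everything is measured against the law of the noise. Given the input, the output then has a
    positive density whatever the covariance of the fading, singular or not, and no determinant or
    inverse matrix occurs. Gaussian laws enter through characteristic functions, which identify even
    a degenerate law. The test function is quadratic because exp u need not be integrable: 1 + u +
    u^2/2 is at least 1/2, its mean takes second moments only, and its logarithm is at least u -
    |u|^3/6. With V the variance of the input covariance, u has mean rho^2 V under the joint law,
    the normalisation costs rho^2 V/2, and rho^2 V/2 is left, up to an error of order rho^(5/2). The
    error of the lower bound depends on N. As the capacity dominates the rate of every block length,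
    N may be fixed before rho tends to 0. The upper bound is uniform in N, since each row of squared
    autocorrelations sums to at most lambda. Even with S square integrable, S^3 need not be
    integrable, so the third-order expansion of log(1 + rho S) is applied to truncations of S. *)

Section integrable_real.
Context d (T : measurableType d) (R : realType).
Variables (mu : {measure set T -> \bar R}) (D : set T) (mD : measurable D).
Implicit Types f g : T -> R.
Local Notation int f := (mu.-integrable D (EFin \o f)).

Lemma integrable_EFinZl k f : int f -> int (fun x => k * f x).
Proof. by move=> /(integrableZl mD k). Qed.

Lemma integrable_EFinZr k f : int f -> int (fun x => f x * k).
Proof.
by move=> /(integrable_EFinZl k); apply: eq_integrable => // x _ /=; rewrite mulrC.
Qed.

Lemma integrable_EFinD f g : int f -> int g -> int (fun x => f x + g x).
Proof. by move=> fi gi; exact: (integrableD mD fi gi). Qed.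

Lemma integrable_EFinN f : int f -> int (fun x => - f x).
Proof. by move=> fi; exact: (integrableN fi). Qed.

Lemma integrable_EFinB f g : int f -> int g -> int (fun x => f x - g x).
Proof. by move=> fi gi; apply: integrable_EFinD => //; exact: integrable_EFinN. Qed.

Lemma integrable_EFin_sum I (s : seq I) (p : pred I) (f : I -> T -> R) :
  (forall i, p i -> int (f i)) -> int (fun x => \sum_(i <- s | p i) f i x).
Proof.
move=> fi; have := integrable_sum mD s fi.
by apply: eq_integrable => // x _ /=; rewrite sumEFin.
Qed.

Lemma Rintegral_sum I (s : seq I) (p : pred I) (f : I -> T -> R) :
  (forall i, p i -> int (f i)) ->
  \int[mu]_(x in D) (\sum_(i <- s | p i) f i x) =
  \sum_(i <- s | p i) \int[mu]_(x in D) f i x.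
Proof.
move=> fi; elim: s => [|i s IH].
  rewrite big_nil; under eq_Rintegral do rewrite big_nil.
  by rewrite /Rintegral integral0.
under eq_Rintegral do rewrite big_cons.
rewrite big_cons; case: ifP => pi; last by rewrite IH.
by rewrite RintegralD// ?IH//; [exact: fi|exact: integrable_EFin_sum].
Qed.

Lemma le_integrable_EFin f g : measurable_fun D f ->
  (forall x, D x -> `|f x| <= `|g x|) -> int g -> int f.
Proof.
by move=> mf fg; apply: le_integrable => //; exact/measurable_EFinP.
Qed.

End integrable_real.

(** * Measures with a density, and laws of random elements *)

Section measure_tools.
Context d (T : measurableType d) (R : realType).

Lemma integrable_bounded (P : probability T R) (f : T -> R) (K : R) :
  measurable_fun setT f -> (forall x, `|f x| <= K) ->
  P.-integrable setT (EFin \o f).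
Proof.
move=> mf fK; apply: measurable_bounded_integrable => //.
  by rewrite (le_lt_trans (probability_le1 _ _)) ?ltry.
exists K; split; first by rewrite num_real.
by move=> M KM x _; apply: le_trans (fK x) (ltW KM).
Qed.

(** Integrals over all measurable sets determine a density up to null sets. The Radon-Nikodym
    derivative in the definition of relative entropy is thereby replaced with an explicit [g]. *)
Lemma density_ae (m : {finite_measure set T -> \bar R})
    (mu : {sigma_finite_measure set T -> \bar R}) (g : T -> R) :
  measurable_fun setT g -> (forall x, 0 <= g x) ->
  (forall E, measurable E -> m E = (\int[mu]_(x in E) (g x)%:E)%E) ->
  m `<< mu /\
  ae_eq mu setT ('d (charge_of_finite_measure m) '/d mu) (EFin \o g).
Proof.
move=> mg g0 mE; have mg' : measurable_fun setT (EFin \o g) by exact/measurable_EFinP.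
have mmu : m `<< mu.
  apply/null_content_dominatesP => A mA A0; rewrite mE//.
  by apply: null_set_integral => //; exact: measurable_funTS.
split=> //.
have ig : mu.-integrable setT (EFin \o g).
  apply/integrableP; split => //.
  under eq_integral do rewrite gee0_abs//= ?lee_fin//.
  by rewrite -mE// -ge0_fin_numE// fin_num_measure.
apply: integral_ae_eq => //.
  exact: Radon_Nikodym_integrable.
move=> E _ mE'; rewrite -Radon_Nikodym_integral//.
exact: mE.
Qed.

Lemma ge0_integral_density (m : {finite_measure set T -> \bar R})
    (mu : {sigma_finite_measure set T -> \bar R}) (g : T -> R) :
  measurable_fun setT g -> (forall x, 0 <= g x) ->
  (forall E, measurable E -> m E = (\int[mu]_(x in E) (g x)%:E)%E) ->
  forall f : T -> \bar R, measurable_fun setT f -> (forall x, (0 <= f x)%E) ->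
  (\int[m]_x f x = \int[mu]_x (f x * (g x)%:E))%E.
Proof.
move=> mg g0 mE f mf f0; have mg' : measurable_fun setT (EFin \o g) by exact/measurable_EFinP.
have [mmu aeg] := density_ae mg g0 mE.
have aeg' := ae_eq_Radon_Nikodym_SigmaFinite mmu measurableT.
rewrite -(Radon_Nikodym_SigmaFinite.change_of_variables mmu)//.
have iRN := Radon_Nikodym_SigmaFinite.f_integrable mmu.
apply: ae_eq_integral => //.
- by apply: emeasurable_funM => //; exact: (measurable_int _ iRN).
- exact: emeasurable_funM.
- by apply: ae_eqe_mul2l; exact: ae_eq_trans aeg' aeg.
Qed.

Lemma integrable_density (m : {finite_measure set T -> \bar R})
    (mu : {sigma_finite_measure set T -> \bar R}) (g : T -> R) :
  measurable_fun setT g -> (forall x, 0 <= g x) ->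
  (forall E, measurable E -> m E = (\int[mu]_(x in E) (g x)%:E)%E) ->
  forall f : T -> \bar R, measurable_fun setT f ->
  m.-integrable setT f <-> mu.-integrable setT (f \* (EFin \o g))%E.
Proof.
move=> mg g0 mE f mf; have mg' : measurable_fun setT (EFin \o g) by exact/measurable_EFinP.
have mfg : measurable_fun setT (f \* (EFin \o g))%E by exact: emeasurable_funM.
have eqI : (\int[m]_x `|f x| = \int[mu]_x `|(f \* (EFin \o g))%E x|)%E.
  rewrite (ge0_integral_density mg g0 mE)//; last exact: measurableT_comp.
  by apply: eq_integral => x _; rewrite abseM/= ger0_norm.
by split=> /integrableP[_ foo]; apply/integrableP; split=> //;
  [rewrite -eqI|rewrite eqI].
Qed.

Lemma integral_density (m : {finite_measure set T -> \bar R})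
    (mu : {sigma_finite_measure set T -> \bar R}) (g : T -> R) :
  measurable_fun setT g -> (forall x, 0 <= g x) ->
  (forall E, measurable E -> m E = (\int[mu]_(x in E) (g x)%:E)%E) ->
  forall f : T -> \bar R, measurable_fun setT f ->
  (\int[m]_x f x = \int[mu]_x (f x * (g x)%:E))%E.
Proof.
move=> mg g0 mE f mf; rewrite integralE [RHS]integralE.
rewrite (ge0_integral_density mg g0 mE)//; last exact: measurable_funepos.
rewrite (ge0_integral_density mg g0 mE)//; last exact: measurable_funeneg.
congr (_ - _)%E; apply: eq_integral => x _.
  by rewrite !funeposE maxe_pMl ?lee_fin// mul0e.
by rewrite !funenegE maxe_pMl ?lee_fin// mul0e mulNe.
Qed.

Lemma EFin_Rintegral (mu : {measure set T -> \bar R}) (D : set T) (f : T -> R) :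
  measurable D -> mu.-integrable D (EFin \o f) ->
  (\int[mu]_(x in D) f x)%:E = (\int[mu]_(x in D) (f x)%:E)%E.
Proof. by move=> mD fi; rewrite fineK//; exact: integrable_fin_num. Qed.

Lemma Rintegral_prob_cst (P : probability T R) (c : R) : \int[P]_x c = c.
Proof.
rewrite Rintegral_cst// (_ : fine _ = 1) ?mulr1//.
exact: (congr1 fine (probability_setT P)).
Qed.

Lemma integral_prob_cst (P : probability T R) (c : \bar R) :
  (\int[P]_x c = c)%E.
Proof.
rewrite integral_cst//; transitivity (c * 1)%E; last by rewrite mule1.
by congr (_ * _)%E; exact: probability_setT.
Qed.

End measure_tools.

Section density_measure.
Context d (T : measurableType d) (R : realType).
Variables (mu : {measure set T -> \bar R}) (g : T -> R).
Hypotheses (ig : mu.-integrable setT (EFin \o g)) (g0 : forall x, 0 <= g x).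

(** Integrability and sign of [g] are arguments of the definition, so that the measure structure and
    finiteness can be attached to it. *)
Definition density_measure of mu.-integrable setT (EFin \o g) &
  (forall x, 0 <= g x) := fun A : set T => (\int[mu]_(x in A) (g x)%:E)%E.

Local Notation m := (density_measure ig g0).

Let m0 : m set0 = 0%E.
Proof. by rewrite /density_measure integral_set0. Qed.

Let m_ge0 A : (0 <= m A)%E.
Proof. by apply: integral_ge0 => x _; rewrite lee_fin. Qed.

Let m_sigma_additive : semi_sigma_additive m.
Proof.
move=> /= A mA tA mUA; rewrite /density_measure integral_bigcup//; last first.
  exact: integrableS ig.
apply: is_cvg_ereal_nneg_natsum_cond => n _ _.
by apply: integral_ge0 => x _; rewrite lee_fin.
Qed.

HB.instance Definition _ := isMeasure.Build _ _ _ m m0 m_ge0 m_sigma_additive.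

Let m_fin : fin_num_fun m.
Proof.
move=> A mA; apply: (@integrable_fin_num _ _ _ mu A mA).
exact: integrableS ig.
Qed.

HB.instance Definition _ := Measure_isFinite.Build _ _ _ m m_fin.

End density_measure.

Section factor.
Context d (T : measurableType d) d' (T' : measurableType d') (R : realType).
Variables (P : probability T R) (Q : probability T' R) (X : T -> T').
Hypothesis mX : measurable_fun setT X.

Import HBNNSimple.

(** The hypothesis on preimages says that the measure of density [Psi] is pushed forward by [X] to
    [c] times [Q]; what follows is a change of variables. It serves to integrate one coordinate at a
    time out of a product. *)
Lemma ge0_factor_integral (Psi : T -> R) (c : R) :
  P.-integrable setT (EFin \o Psi) -> (forall x, 0 <= Psi x) -> 0 <= c ->
  (forall B, measurable B ->
    \int[P]_(x in X @^-1` B) (Psi x)%:E = c%:E * Q B)%E ->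
  forall f : T' -> \bar R, measurable_fun setT f -> (forall x, (0 <= f x)%E) ->
  (\int[P]_x ((Psi x)%:E * f (X x)) = c%:E * \int[Q]_x f x)%E.
Proof.
move=> iPsi Psi0 c0 fact f mf f0.
have mPsi : measurable_fun setT Psi.
  by apply/measurable_EFinP; exact: measurable_int iPsi.
pose m := density_measure iPsi Psi0.
have mfX : measurable_fun setT (f \o X) by exact: measurableT_comp.
transitivity (\int[m]_x (f \o X) x)%E.
  rewrite (ge0_integral_density (mu := P) mPsi Psi0 _ mfX)//; last by move=> x; exact: f0.
  by apply: eq_integral => x _; rewrite muleC.
rewrite -(ge0_integral_pushforward mX _ measurableT)//.
transitivity (\int[mscale (NngNum c0) Q]_x f x)%E.
  by apply: eq_measure_integral => B mB _; exact: fact.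
by rewrite ge0_integral_mscale.
Qed.

Hypothesis XQ : forall B, measurable B -> P (X @^-1` B) = Q B.

Lemma integral_law (f : T' -> \bar R) : measurable_fun setT f ->
  (forall x, (0 <= f x)%E) -> (\int[P]_x f (X x) = \int[Q]_x f x)%E.
Proof.
move=> mf f0; rewrite -[LHS](ge0_integral_pushforward mX _ measurableT)//.
by apply: eq_measure_integral => B mB _; exact: XQ.
Qed.

Lemma integrable_law (f : T' -> R) : measurable_fun setT f ->
  P.-integrable setT (EFin \o (f \o X)) <-> Q.-integrable setT (EFin \o f).
Proof.
move=> mf.
have e : (\int[P]_x `|(f (X x))%:E| = \int[Q]_x `|(f x)%:E|)%E.
  rewrite (@integral_law (fun x => `|(f x)%:E|)%E)//.
  by apply: measurableT_comp => //; exact/measurable_EFinP.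
split=> /integrableP[_ h]; apply/integrableP; split.
- exact/measurable_EFinP.
- by rewrite -e.
- by apply/measurable_EFinP; exact: measurableT_comp.
- by rewrite e.
Qed.

Lemma Rintegral_law (f : T' -> R) : measurable_fun setT f ->
  \int[P]_x f (X x) = \int[Q]_x f x.
Proof.
move=> mf; have mf' : measurable_fun setT (EFin \o f) by exact/measurable_EFinP.
rewrite /Rintegral; congr fine; rewrite integralE [RHS]integralE.
rewrite -(integral_law (measurable_funepos mf'))//.
rewrite -(integral_law (measurable_funeneg mf'))//.
by congr (_ - _)%E; apply: eq_integral => x _; rewrite ?funeposE ?funenegE.
Qed.

(** Signed version, for a [Psi] that contains a cosine. Adding [K] to [Psi] and [M] to [f] makes
    both nonnegative; the shifts are then removed by linearity, the law of [X] being [Q]. *)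
Lemma factor_integral (Psi : T -> R) (c K : R) (f : T' -> R) (M : R) :
  measurable_fun setT Psi -> (forall x, `|Psi x| <= K) ->
  measurable_fun setT f -> (forall x, `|f x| <= M) ->
  (forall B, measurable B ->
    \int[P]_(x in X @^-1` B) Psi x = c * fine (Q B)) ->
  \int[P]_x (Psi x * f (X x)) = c * \int[Q]_x f x.
Proof.
move=> mPsi PsiK mf fM fact.
have iPsi := integrable_bounded P mPsi PsiK.
have mfX : measurable_fun setT (f \o X) by exact: measurableT_comp.
have ifX : P.-integrable setT (EFin \o (f \o X)).
  by apply: (integrable_bounded _ (K := M)) => // x /=; exact: fM.
have ifQ := integrable_bounded Q mf fM.
have iPf : P.-integrable setT (EFin \o (fun x => Psi x * f (X x))).
  apply: (integrable_bounded _ (K := K * M)); first exact: measurable_funM.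
  by move=> x; rewrite normrM ler_pM.
have iPsiK : P.-integrable setT (EFin \o (fun x => Psi x + K)).
  apply: (integrable_bounded _ (K := K + `|K|)); first exact: measurable_funD.
  by move=> x; rewrite (le_trans (ler_normD _ _))// lerD2r.
have PK0 x : 0 <= Psi x + K.
  by have := PsiK x; rewrite ler_norml => /andP[+ _]; lra.
have fM0 x : 0 <= f x + M.
  by have := fM x; rewrite ler_norml => /andP[+ _]; lra.
have cE : c = \int[P]_x Psi x.
  have := fact setT measurableT; rewrite preimage_setT => ->.
  by rewrite probability_setT/= mulr1.
have ccst D (k : R) : measurable D -> P.-integrable D (EFin \o cst k).
  by move=> mD; exact: finite_measure_integrable_cst.
have cK0 : 0 <= c + K.
  rewrite cE -[X in _ + X](Rintegral_prob_cst P) -RintegralD//; last exact: ccst.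
  by apply: Rintegral_ge0 => x _.
have factK B : measurable B ->
    (\int[P]_(x in X @^-1` B) (Psi x + K)%:E = (c + K)%:E * Q B)%E.
  move=> mB; have mXB : measurable (X @^-1` B).
    by rewrite -[X @^-1` B]setTI; exact: mX.
  rewrite -EFin_Rintegral//; last exact: integrableS iPsiK.
  rewrite RintegralD//; [|exact: integrableS iPsi|exact: ccst].
  rewrite fact// [X in _ + X](_ : _ = K * fine (Q B)); last first.
    by rewrite Rintegral_cst//; congr (_ * fine _); exact: XQ.
  by rewrite -mulrDl EFinM fineK// fin_num_measure.
have mfE : measurable_fun setT (fun x => (f x + M)%:E).
  by apply/measurable_EFinP; exact: measurable_funD.
have := @ge0_factor_integral (fun x => Psi x + K) (c + K) iPsiK PK0 cK0 factK
  (fun x => (f x + M)%:E) mfE fM0.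
move=> /(congr1 fine).
under eq_integral do rewrite -EFinM.
rewrite fineM//; last first.
  apply: integrable_fin_num => //.
  apply: (integrable_bounded _ (K := M + `|M|)); first exact: measurable_funD.
  by move=> x; rewrite (le_trans (ler_normD _ _))// lerD2r.
rewrite -/(Rintegral _ _ _) -/(Rintegral Q _ _).
rewrite [X in _ = _ * X](_ : _ = \int[Q]_x f x + M); last first.
  rewrite RintegralD//; last exact: finite_measure_integrable_cst.
  by rewrite Rintegral_prob_cst.
rewrite [LHS](_ : _ = \int[P]_x (Psi x * f (X x)) + M * \int[P]_x Psi x +
    K * \int[P]_x f (X x) + K * M); last first.
  rewrite -!RintegralZl// -RintegralD//; last exact: integrable_EFinZl.
  rewrite -RintegralD//; last 2 first.
  - by apply: integrable_EFinD => //; exact: integrable_EFinZl.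
  - exact: integrable_EFinZl.
  rewrite -[X in _ + X](Rintegral_prob_cst P) -RintegralD//; last 2 first.
  - apply: integrable_EFinD => //; last exact: integrable_EFinZl.
    by apply: integrable_EFinD => //; exact: integrable_EFinZl.
  - exact: ccst.
  by apply: eq_Rintegral => x _; ring.
rewrite -cE (@Rintegral_law f)//.
rewrite [fine _%:E]/= => h; lra.
Qed.

End factor.

(** * Gaussian moments and characteristic functions *)

Section normal_moments.
Variable R : realType.
Local Notation leb := (@lebesgue_measure R).

Lemma is_derive1_eq (f : R -> R) (x a b : R) :
  is_derive x 1 f a -> a = b -> is_derive x 1 f b.
Proof. by move=> + <-. Qed.

(** Integration by parts on the line rests on this. Over [[-n, n]] the integral is a difference of
    values of [G], and dominated convergence, with dominating function |g|, removes the cutoff. *)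
Lemma Rintegral_derive_eq0 (G g : R -> R) :
  (forall x : R, is_derive x 1 G (g x)) -> continuous g ->
  leb.-integrable setT (EFin \o g) ->
  G n%:R @[n --> \oo] --> (0:R) -> G (- n%:R) @[n --> \oo] --> (0:R) ->
  \int[leb]_x g x = 0.
Proof.
move=> dG cg ig G1 G2.
have mg : measurable_fun setT g.
  by apply/measurable_EFinP; exact: measurable_int ig.
pose f_ (n : nat) : R -> \bar R := EFin \o (g \_ `[- n%:R, n%:R]).
have [_ _] : [/\ leb.-integrable setT (EFin \o g),
    [sequence \int[leb]_x `|f_ n x - (EFin \o g) x|]_n @ \oo --> 0%E &
    [sequence \int[leb]_x f_ n x]_n @ \oo --> \int[leb]_x (EFin \o g) x]%E.
  apply: (@dominated_convergence _ _ _ leb setT measurableT f_ (EFin \o g)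
    (fun x => `|(g x)%:E|%E)).
  - move=> n; apply/measurable_EFinP; apply/(measurable_restrictT _ _).1 => //.
    exact: measurable_funTS.
  - exact/measurable_EFinP.
  - apply: aeW => x _; apply: cvg_near_cst; near=> n.
    rewrite /f_ /= patchE mem_set//= in_itv/= -ler_norml.
    near: n; exact: nbhs_infty_ger.
  - exact: integrable_abse.
  - apply: aeW => x n _; rewrite /f_ /= patchE; case: ifP => _ //.
    by rewrite normr0 lee_fin.
move=> lim1.
have e n : (0 < n)%N -> (\int[leb]_x f_ n x = (G n%:R - G (- n%:R))%:E)%E.
  move=> n0; rewrite /f_.
  rewrite (_ : EFin \o _ = (EFin \o g) \_ `[- n%:R, n%:R]); last first.
    by rewrite restrict_EFin.
  rewrite -integral_mkcond (continuous_FTC2 (F := G)) ?EFinB//.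
  - by rewrite (@lt_trans _ _ 0)// ?oppr_lt0 ltr0n.
  - by apply: continuous_subspaceT => x; exact: cg.
  - split.
    + by move=> x _; exact: ex_derive.
    + apply: cvg_at_right_filter; apply/differentiable_continuous.
      by apply/derivable1_diffP; exact: ex_derive.
    + apply: cvg_at_left_filter; apply/differentiable_continuous.
      by apply/derivable1_diffP; exact: ex_derive.
  - by move=> x _; rewrite derive1E; exact: derive_val.
have lim2 : (G n%:R - G (- n%:R))%:E @[n --> \oo] --> (0 : R)%:E.
  apply: cvg_EFin; first by near=> n.
  by rewrite -[X in _ --> X](subrr 0); exact: cvgB.
rewrite /Rintegral (_ : (\int[leb]_x _)%E = 0%E)//.
apply: (cvg_unique _ lim1) => //.
apply: cvg_trans lim2; apply: near_eq_cvg; near=> n.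
by apply/esym/e; near: n; exists 1%N.
Unshelve. all: by end_near. Qed.

(** Doubling the standard deviation absorbs any power: the quotient of the two exponentials still
    decays like a Gaussian. *)
Lemma exprn_gauss_bound (s : R) (k : nat) : s != 0 ->
  exists C : R, 0 < C /\ forall y,
    `|y| ^+ k * expR (- y ^+ 2 / (s ^+ 2 *+ 2)) <=
    C * expR (- y ^+ 2 / ((2 * s) ^+ 2 *+ 2)).
Proof.
move=> s0; have s2 : 0 < s ^+ 2 by rewrite exprn_even_gt0.
(* 1/c is the difference 1/(2 s^2) - 1/(8 s^2) of the two exponents. *)
pose c := s ^+ 2 * 8 / 3.
have c0 : 0 < c by rewrite /c divr_gt0// mulr_gt0.
pose D := c ^+ k * (k.*2)`!%:R.
exists (1 + c ^+ k.+1 * (k.+1)`!%:R); split.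
  by rewrite addr_gt0// mulr_gt0 ?exprn_gt0 ?ltr0n ?fact_gt0.
move=> y.
have -> : - y ^+ 2 / (s ^+ 2 *+ 2) =
    - (y ^+ 2 / c) + (- y ^+ 2 / ((2 * s) ^+ 2 *+ 2)).
  by rewrite /c; field; rewrite s0.
rewrite expRD mulrA ler_wpM2r ?expR_ge0// expRN ler_pdivrMr ?expR_gt0//.
have u0 : 0 <= y ^+ 2 / c by rewrite divr_ge0 ?sqr_ge0// ltW.
have e1 : 1 <= expR (y ^+ 2 / c) by rewrite -expR0 ler_expR.
(* A single term of the exponential series bounds the even power 2(k + 1), which in turn bounds the
   power [k] as soon as |y| exceeds 1. *)
have e2 : `|y| ^+ (k.+1).*2 <= c ^+ k.+1 * (k.+1)`!%:R * expR (y ^+ 2 / c).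
  have := expR_ge1Dxn k u0; rewrite expr_div_n -exprM mul2n.
  rewrite -(normrX _ y) ger0_norm ?exprn_even_ge0 ?odd_double// => h.
  rewrite mulrC -ler_pdivrMr; last by rewrite mulr_gt0 ?exprn_gt0 ?ltr0n ?fact_gt0.
  by apply: le_trans h; rewrite invfM mulrA lerDr.
rewrite mulrDl mul1r.
have [y1|y1] := leP `|y| 1.
  rewrite (le_trans (exprn_ile1 _ (normr_ge0 y) y1))// (le_trans e1)// lerDl.
  by rewrite mulr_ge0 ?expR_ge0// mulr_ge0 ?exprn_ge0// ltW.
rewrite (@le_trans _ _ (`|y| ^+ (k.+1).*2))//.
  by rewrite ler_eXn2l// -addnn; apply: leq_trans (leq_addr _ _).
by rewrite (le_trans e2)// lerDr expR_ge0.
Qed.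

Section fixed.
Variables (m s : R).
Hypothesis s0 : s != 0.
Local Notation phi := (normal_pdf m s).
Local Notation N := (normal_prob m s).

Lemma normal_pdf_expR x :
  phi x = normal_peak s * expR (- (x - m) ^+ 2 / (s ^+ 2 *+ 2)).
Proof. by rewrite normal_pdfE. Qed.

Lemma is_derive_normal_pdf (x : R) :
  is_derive x 1 phi (- (x - m) / s ^+ 2 * phi x).
Proof.
have -> : phi = (fun x => normal_peak s *
    expR (- (x - m) ^+ 2 / (s ^+ 2 *+ 2))).
  by apply/funext => y; rewrite normal_pdf_expR.
rewrite (_ : - (x - m) / s ^+ 2 * _ = normal_peak s *:
  ((- (x - m) / s ^+ 2) * expR (- (x - m) ^+ 2 / (s ^+ 2 *+ 2)))); last first.
  by rewrite /GRing.scale/=; ring.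
apply: is_deriveZ.
rewrite [X in is_derive _ _ _ X]mulrC.
refine (@is_derive1_comp R expR _ x _ _ _ _).
rewrite (_ : (fun _ => _) = (fun y => (s ^+ 2 *+ 2)^-1 *: - (y - m) ^+ 2)); last first.
  by apply/funext => y; rewrite /GRing.scale/= mulrC.
apply: is_derive_eq.
by rewrite /GRing.scale /=; field.
Qed.

Lemma Rintegral_normal_pdf : \int[leb]_x phi x = 1.
Proof. by rewrite /Rintegral integral_normal_pdf. Qed.

Lemma integral_normal (f : R -> R) : measurable_fun setT f ->
  \int[N]_x f x = \int[leb]_x (f x * phi x).
Proof.
move=> mf; rewrite /Rintegral; congr fine.
have := @integral_density _ _ R N leb phi (measurable_normal_pdf m s)
  (normal_pdf_ge0 m s) (fun E mE => erefl) (EFin \o f).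
by move=> ->//; exact/measurable_EFinP.
Qed.

Lemma integrable_normal (f : R -> R) : measurable_fun setT f ->
  N.-integrable setT (EFin \o f) <->
  leb.-integrable setT (EFin \o (fun x => f x * phi x)).
Proof.
move=> mf.
have := @integrable_density _ _ R N leb phi (measurable_normal_pdf m s)
  (normal_pdf_ge0 m s) (fun E mE => erefl) (EFin \o f).
by move=> ->//; exact/measurable_EFinP.
Qed.

Lemma exprn_pdf_bound k : exists C : R, 0 < C /\ forall x,
  `|x - m| ^+ k * phi x <= C * normal_pdf m (2 * s) x.
Proof.
have [C [C0 hC]] := exprn_gauss_bound k s0.
have s20 : 2 * s != 0 by rewrite mulf_neq0// pnatr_eq0.
have p1 := normal_peak_gt0 s0; have p2 := normal_peak_gt0 s20.
exists (C * normal_peak s / normal_peak (2 * s)); split.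
  by rewrite divr_gt0// mulr_gt0.
move=> x; rewrite normal_pdf_expR normal_pdfE// -[normal_fun _ _ _]/(expR _).
rewrite mulrCA mulrA (mulrC C) -!mulrA ler_wpM2l ?normal_peak_ge0//.
by rewrite (le_trans (hC _))// mulKf// gt_eqF.
Qed.

Lemma measurable_exprn_pdf k : measurable_fun setT (fun x : R => (x - m) ^+ k * phi x).
Proof.
apply: measurable_funM; last exact: measurable_normal_pdf.
by apply: measurable_funX; exact: measurable_funB.
Qed.

Lemma integrable_exprn_pdf k :
  leb.-integrable setT (EFin \o (fun x => (x - m) ^+ k * phi x)).
Proof.
have [C [C0 hC]] := exprn_pdf_bound k.
apply: (@le_integrable_EFin _ _ _ leb setT measurableT _
  (fun x => C * normal_pdf m (2 * s) x)).
- exact: measurable_exprn_pdf.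
- move=> x _; rewrite normrM normrX (ger0_norm (normal_pdf_ge0 _ _ _)).
  by rewrite (le_trans (hC x))// ler_norm.
- by apply: integrable_EFinZl => //; exact: integrable_normal_pdf.
Qed.

(** One power of |u n - m| more is still bounded by a constant, and that factor tends to infinity.
    Stating it along sequences with |u n| at least n covers both ends of the line. *)
Lemma cvg_exprn_pdf k (u : nat -> R) : (forall n, n%:R <= `|u n|) ->
  (u n - m) ^+ k * phi (u n) @[n --> \oo] --> (0 : R).
Proof.
move=> hu; have [C [C0 hC]] := exprn_pdf_bound k.+1.
have s20 : 2 * s != 0 by rewrite mulf_neq0// pnatr_eq0.
pose K := C * normal_peak (2 * s).
have K0 : 0 < K by rewrite mulr_gt0// normal_peak_gt0.
apply/cvgrPdist_le => e e0; near=> n.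
rewrite sub0r normrN normrM normrX (ger0_norm (normal_pdf_ge0 _ _ _)).
have big : K / e <= `|u n - m|.
  have : K / e + `|m| <= n%:R by near: n; exact: nbhs_infty_ger.
  have := hu n; have := ler_normB (u n - m) (- m); rewrite opprK subrK normrN.
  lra.
have d0 : 0 < `|u n - m| by rewrite (lt_le_trans _ big)// divr_gt0.
rewrite -(ler_pM2l d0) mulrA -exprS (le_trans (hC _))//.
rewrite (@le_trans _ _ K)//.
  by rewrite ler_wpM2l ?(ltW C0)//; exact: normal_pdf_ub.
by rewrite -ler_pdivrMr.
Unshelve. all: by end_near. Qed.

Lemma ler_nat_norm (n : nat) : n%:R <= `|- n%:R : R|.
Proof. by rewrite normrN ger0_norm. Qed.

Lemma normal_moment0 : \int[leb]_x ((x - m) ^+ 0 * phi x) = 1.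
Proof.
under eq_Rintegral do rewrite expr0 mul1r.
by rewrite /Rintegral integral_normal_pdf.
Qed.

Lemma continuous_exprn_pdf k : continuous (fun x => (x - m) ^+ k * phi x).
Proof.
move=> x; apply: (@continuousM _ _ (fun x => (x - m) ^+ k) phi).
  apply: (@continuous_comp _ _ _ (fun x => x - m) (fun x => x ^+ k)).
    by apply: continuousB; [exact: cvg_id|exact: cvg_cst].
  exact: exprn_continuous.
exact: continuous_normal_pdf.
Qed.

Lemma normal_moment1 : \int[leb]_x ((x - m) ^+ 1 * phi x) = 0.
Proof.
have i1 := integrable_exprn_pdf 1.
have s2 : s ^+ 2 != 0 by rewrite expf_neq0.
have : \int[leb]_x (- (s ^+ 2)^-1 * ((x - m) ^+ 1 * phi x)) = 0.
  apply: (@Rintegral_derive_eq0 phi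
    (fun x : R => - (s ^+ 2)^-1 * ((x - m) ^+ 1 * phi x))).
  - move=> x; have := is_derive_normal_pdf x.
    by rewrite expr1 (_ : - (x - m) / _ * _ = - (s ^+ 2)^-1 * ((x - m) * phi x))//; ring.
  - by move=> x; apply: cvgM; [exact: cvg_cst|exact: continuous_exprn_pdf].
  - exact: integrable_EFinZl.
  - have := @cvg_exprn_pdf 0 (fun n => n%:R); under eq_fun do rewrite expr0 mul1r.
    by apply => n; exact: ler_norm.
  - have := @cvg_exprn_pdf 0 (fun n => - n%:R); under eq_fun do rewrite expr0 mul1r.
    by apply => n; exact: ler_nat_norm.
rewrite RintegralZl// => /eqP; rewrite mulf_eq0 oppr_eq0 invr_eq0 (negbTE s2)/=.
by move/eqP.
Qed.

(** Stein's identity: the derivative of (x - m)^(k+1) times the density integrates to 0. *)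
Lemma normal_moment_rec k : \int[leb]_x ((x - m) ^+ k.+2 * phi x) =
  s ^+ 2 * k.+1%:R * \int[leb]_x ((x - m) ^+ k * phi x).
Proof.
have i1 := integrable_exprn_pdf k.+2; have i2 := integrable_exprn_pdf k.
have s2 : s ^+ 2 != 0 by rewrite expf_neq0.
have : \int[leb]_x (k.+1%:R * ((x - m) ^+ k * phi x) -
    (s ^+ 2)^-1 * ((x - m) ^+ k.+2 * phi x)) = 0.
  apply: (@Rintegral_derive_eq0 (fun x : R => (x - m) ^+ k.+1 * phi x)
    (fun x : R => k.+1%:R * ((x - m) ^+ k * phi x) -
      (s ^+ 2)^-1 * ((x - m) ^+ k.+2 * phi x))).
  - move=> x.
    have d1 := is_derive_normal_pdf x.
    have d2 : is_derive x 1 (fun x => (x - m) ^+ k.+1) (k.+1%:R * (x - m) ^+ k).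
      rewrite (_ : (fun x => _) = (fun x : R => x - m) ^+ k.+1); last first.
        by apply/funext => y; rewrite exprfctE.
      apply: is_derive_eq.
      by rewrite /GRing.scale/= subr0 mulr1 -mulr_natl.
    have := is_deriveM d2 d1; rewrite /GRing.scale/=.
    rewrite (_ : _ + _ = k.+1%:R * ((x - m) ^+ k * phi x) -
      (s ^+ 2)^-1 * ((x - m) ^+ k.+2 * phi x))//.
    by rewrite !exprS; ring.
  - move=> x; apply: cvgB.
      by apply: cvgM; [exact: cvg_cst|exact: continuous_exprn_pdf].
    by apply: cvgM; [exact: cvg_cst|exact: continuous_exprn_pdf].
  - by apply: integrable_EFinB => //; exact: integrable_EFinZl.
  - by apply: cvg_exprn_pdf => n; exact: ler_norm.
  - by apply: cvg_exprn_pdf => n; exact: ler_nat_norm.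
rewrite RintegralB//; [|exact: integrable_EFinZl..].
rewrite !RintegralZl// => /eqP; rewrite subr_eq0 => /eqP e.
by rewrite -mulrA e mulrA divff// mul1r.
Qed.

End fixed.

Section characteristic.
Variables s : R.
Hypothesis s0 : s != 0.
Local Notation phi := (normal_pdf 0 s).

Let mcos t c : measurable_fun setT (fun x : R => cos (t * x + c)).
Proof.
apply: continuous_measurable_fun => x.
apply: (@continuous_comp _ _ _ (fun x => t * x + c) cos); last exact: continuous_cos.
by apply: continuousD; [apply: continuousM; [exact: cvg_cst|exact: cvg_id]|exact: cvg_cst].
Qed.

(** The phase [c] treats cosine and sine at once. Differentiation under the integral followed by
    integration by parts gives F' = - s^2 t F, so F times exp(s^2 t^2 / 2) has derivative 0. *)
Lemma normal_cos_lebesgue t c :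
  \int[leb]_x (cos (t * x + c) * phi x) = cos c * expR (- (s ^+ 2 * t ^+ 2 / 2)).
Proof.
pose F t := \int[leb]_x (cos (t * x + c) * phi x).
pose E t := expR (s ^+ 2 * t ^+ 2 / 2).
have icos t' c' : leb.-integrable setT (EFin \o (fun x => cos (t' * x + c') * phi x)).
  apply: (@le_integrable_EFin _ _ _ leb setT measurableT _ phi).
  - exact: measurable_funM (mcos _ _) (measurable_normal_pdf _ _).
  - move=> x _; rewrite normrM ler_piMl ?cos_max//.
  - exact: integrable_normal_pdf.
have msin t' : measurable_fun setT (fun x : R => sin (t' * x + c)).
  rewrite (_ : (fun _ => _) = (fun x : R => cos (t' * x + (c - pi / 2)))).
    exact: mcos.
  by apply/funext => x; rewrite addrA cosB cos_pihalf sin_pihalf mulr0 add0r mulr1.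
have mxsin t' : measurable_fun setT (fun x : R => - (x * sin (t' * x + c) * phi x)).
  apply: measurableT_comp => //; apply: measurable_funM; last exact: measurable_normal_pdf.
  exact: measurable_funM.
have xsin_le t' x : `|- (x * sin (t' * x + c) * phi x)| <= `|(x - 0) ^+ 1 * phi x|.
  rewrite normrN subr0 expr1 !normrM ler_wpM2r// ler_piMr// sin_max.
  by [].
have ixsin t' : leb.-integrable setT
    (EFin \o (fun x : R => - (x * sin (t' * x + c) * phi x))).
  apply: (@le_integrable_EFin _ _ _ leb setT measurableT _
    (fun x : R => (x - 0) ^+ 1 * phi x)).
  - exact: mxsin.
  - by move=> x _; exact: xsin_le.
  - exact: integrable_exprn_pdf.
have dcos (t' x : R) : is_derive t' 1 (fun t : R => cos (t * x + c) * phi x)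
    (- (x * sin (t' * x + c) * phi x)).
  have d0 : is_derive t' 1 (fun t : R => t * x + c) x.
    rewrite (_ : (fun t => _) = (fun t => x *: t + c)); last first.
      by apply/funext => y; rewrite /GRing.scale/= mulrC.
    by apply: is_derive_eq; rewrite /GRing.scale/= addr0 mulr1.
  have d1 := @is_derive1_comp R cos _ t' _ _ (is_derive_cos (t' * x + c)) d0.
  rewrite (_ : (fun t => _) = (fun t => phi x *: (cos \o (fun t => t * x + c)) t)).
    apply: is_derive_eq; rewrite /GRing.scale/=; ring.
  by apply/funext => y; rewrite /GRing.scale/= mulrC.
have IBP t' : \int[leb]_x (- (x * sin (t' * x + c) * phi x)) = - (s ^+ 2 * t') * F t'.
  have : \int[leb]_x (t' * (cos (t' * x + c) * phi x) +
      (s ^+ 2)^-1 * (- (x * sin (t' * x + c) * phi x))) = 0.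
    have hlim (u : nat -> R) : (forall n, n%:R <= `|u n|) ->
        sin (t' * u n + c) * phi (u n) @[n --> \oo] --> (0 : R).
      move=> hu; have := cvg_exprn_pdf 0 s0 0 hu.
      under eq_fun do rewrite expr0 mul1r.
      move=> /cvgrPdist_le h; apply/cvgrPdist_le => e e0; near=> n.
      have : `|0 - phi (u n)| <= e by near: n; exact: h.
      rewrite !sub0r !normrN; apply: le_trans.
      by rewrite normrM ler_piMl// sin_max.
    apply: (@Rintegral_derive_eq0 (fun x : R => sin (t' * x + c) * phi x)
      (fun x : R => t' * (cos (t' * x + c) * phi x) +
      (s ^+ 2)^-1 * (- (x * sin (t' * x + c) * phi x)))).
    - move=> x.
      have d0 : is_derive x 1 (fun x : R => t' * x + c) t'.
        rewrite (_ : (fun t => _) = (fun t => t' *: t + c)); last first.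
          by apply/funext => y; rewrite /GRing.scale/= mulrC.
        by apply: is_derive_eq; rewrite /GRing.scale/= addr0 mulr1.
      have d1 := @is_derive1_comp R sin _ x _ _ (is_derive_sin (t' * x + c)) d0.
      have d2 := is_derive_normal_pdf 0 s0 x.
      apply: (is_derive1_eq (is_deriveM d1 d2)).
      by rewrite /GRing.scale/= subr0; ring.
    - move=> x.
      have cl : {for x, continuous (fun x : R => t' * x + c)}.
        by apply: continuousD; [apply: continuousM; [exact: cvg_cst|exact: cvg_id]|exact: cvg_cst].
      have cp : {for x, continuous phi} by exact: continuous_normal_pdf.
      have cc : {for x, continuous (cos \o (fun x : R => t' * x + c))}.
        by apply: continuous_comp => //; exact: continuous_cos.
      have cs : {for x, continuous (sin \o (fun x : R => t' * x + c))}.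
        by apply: continuous_comp => //; exact: continuous_sin.
      apply: cvgD; (apply: cvgM; first exact: cvg_cst); first exact: cvgM cc cp.
      apply: cvgN; apply: cvgM cp; apply: cvgM cs; exact: cvg_id.
    - by apply: integrable_EFinD => //; exact: integrable_EFinZl.
    - by apply: hlim => n; exact: ler_norm.
    - by apply: hlim => n; exact: ler_nat_norm.
  rewrite RintegralD//; [|exact: integrable_EFinZl..].
  rewrite !RintegralZl// -/(F t') => /eqP; rewrite addr_eq0 => /eqP e.
  rewrite mulNr -mulrA e mulrN opprK mulrA divff ?mul1r//.
  by rewrite expf_neq0.
have dF (t' : R) : is_derive t' 1 F (- (s ^+ 2 * t') * F t').
  have t'I : t' \in `]t' - 1, t' + 1[ by rewrite in_itv/=; apply/andP; split; lra.
  pose f (t x : R) := cos (t * x + c) * phi x.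
  have d1f a x : (partial1of2 f) a x = - (x * sin (a * x + c) * phi x).
    by rewrite partial1of2E; exact: (@derive_val _ _ _ _ _ _ _ (dcos a x)).
  pose G x := `|(x - 0) ^+ 1 * phi x|.
  have G0 x : 0 <= G x by exact: normr_ge0.
  have iG : leb.-integrable setT (EFin \o G).
    by have := integrable_norm (integrable_exprn_pdf 0 s0 1).
  have G_ub a x : a \in `]t' - 1, t' + 1[ -> setT x -> `|(partial1of2 f) a x| <= G x.
    by move=> _ _; rewrite d1f; exact: xsin_le.
  have dd a x : a \in `]t' - 1, t' + 1[ -> setT x -> derivable (f ^~ x) a 1.
    by move=> _ _; exact: (@ex_derive _ _ _ _ _ _ _ (dcos a x)).
  have ii a : a \in `]t' - 1, t' + 1[ -> leb.-integrable setT (EFin \o f a).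
    by move=> _; exact: icos.
  have D1 := derivable_under_integral measurableT t'I ii dd G0 iG G_ub.
  have D2 := differentiation_under_integral measurableT t'I ii dd G0 iG G_ub.
  apply: DeriveDef => //.
  rewrite -derive1E D2 -IBP; apply: eq_Rintegral => x _.
  exact: d1f.
have dE (t' : R) : is_derive t' 1 E (s ^+ 2 * t' * E t').
  have d0 : is_derive t' 1 (fun t : R => s ^+ 2 * t ^+ 2 / 2) (s ^+ 2 * t').
    rewrite (_ : (fun t => _) = (fun t : R => (s ^+ 2 / 2) *: t ^+ 2)); last first.
      by apply/funext => y; rewrite /GRing.scale/=; ring.
    by apply: is_derive_eq; rewrite /GRing.scale/=; field.
  have := @is_derive1_comp R expR _ t' _ _ (is_derive_expR _) d0.
  by rewrite mulrC.
have dFE (t' : R) : is_derive t' 1 (fun t => F t * E t) 0.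
  apply: (is_derive1_eq (is_deriveM (dF t') (dE t'))).
  by rewrite /GRing.scale/=; ring.
have := @is_derive_0_is_cst R (fun t => F t * E t) t 0 dFE.
rewrite /F {2}/E expr0n/= mulr0 mul0r expR0 mulr1.
under [in RHS]eq_Rintegral do rewrite mul0r add0r.
rewrite RintegralZl//; last exact: integrable_normal_pdf.
rewrite [X in _ = _ * X](_ : _ = 1) ?mulr1; last first.
  exact: Rintegral_normal_pdf.
by move=> <-; rewrite /E -[_ * expR _ * expR _]mulrA -expRD subrr expR0 mulr1.
Unshelve. all: by end_near. Qed.

End characteristic.

End normal_moments.

Section real_integrals.
Variable R : realType.

Lemma Rintegral_fubini d1 d2 (T1 : measurableType d1) (T2 : measurableType d2)
  (m1 : {sigma_finite_measure set T1 -> \bar R})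
  (m2 : {sigma_finite_measure set T2 -> \bar R}) (F : T1 * T2 -> R) :
  (m1 \x m2)%E.-integrable setT (EFin \o F) ->
  (forall x, m2.-integrable setT (EFin \o (fun y => F (x, y)))) ->
  (forall y, m1.-integrable setT (EFin \o (fun x => F (x, y)))) ->
  \int[m1]_x \int[m2]_y F (x, y) = \int[m2]_y \int[m1]_x F (x, y).
Proof.
move=> iF i2 i1; rewrite /Rintegral; congr fine.
transitivity (\int[m1]_x \int[m2]_y (EFin \o F) (x, y))%E.
  by apply: eq_integral => x _; rewrite fineK//; exact: integrable_fin_num (i2 x).
rewrite Fubini//.
by apply: eq_integral => y _; rewrite fineK//; exact: integrable_fin_num (i1 y).
Qed.

Lemma cvg_Rintegral_bounded d (T : measurableType d) (P : probability T R)
  (f_ : nat -> T -> R) (f : T -> R) (K : R) :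
  (forall n, measurable_fun setT (f_ n)) -> measurable_fun setT f ->
  (forall n x, `|f_ n x| <= K) ->
  (forall x, f_ n x @[n --> \oo] --> f x) ->
  \int[P]_x f_ n x @[n --> \oo] --> \int[P]_x f x.
Proof.
move=> mf_ mf fK cvf.
have fK' x : `|f x| <= K.
  have h : `|f_ n x| @[n --> \oo] --> `|f x| by exact: cvg_norm (cvf x).
  rewrite -(cvg_lim _ h)//.
  by apply: limr_le; [apply/cvg_ex; eexists; exact: h|exact: nearW].
have [_ _] : [/\ P.-integrable setT (EFin \o f),
    [sequence \int[P]_x `|(f_ n x)%:E - (EFin \o f) x|]_n @ \oo --> 0%E &
    [sequence \int[P]_x (f_ n x)%:E]_n @ \oo --> \int[P]_x (EFin \o f) x]%E.
  apply: (@dominated_convergence _ _ _ P setT measurableT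
    (fun n x => (f_ n x)%:E) (EFin \o f) (cst K%:E)).
  - by move=> n; exact/measurable_EFinP.
  - exact/measurable_EFinP.
  - by apply: aeW => x _; apply: cvg_EFin; [exact: nearW|exact: cvf].
  - exact: finite_measure_integrable_cst.
  - by apply: aeW => x n _; rewrite /= lee_fin.
have iff : (\int[P]_x (f x)%:E)%E \is a fin_num.
  by apply: integrable_fin_num => //; exact: integrable_bounded mf fK'.
rewrite -[(\int[P]_x (EFin \o f) x)%E](fineK iff) => h; exact: fine_cvg h.
Qed.

End real_integrals.

(** * Uniqueness of laws from characteristic functions *)

Section cramer_wold_1d.
Variable R : realType.
Local Notation leb := (@lebesgue_measure R).

Section transform.
Context d (T : measurableType d) (P : probability T R).
Variables (Psi X : T -> R) (K : R).
Hypotheses (mPsi : measurable_fun setT Psi) (PsiK : forall x, `|Psi x| <= K)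
  (mX : measurable_fun setT X).

(** The characteristic function of a centred normal law is again Gaussian, so a Gaussian kernel in
    [X w - u] is a mixture of cosines over the frequency [t]. The weight [Psi] may change sign, as
    the induction on coordinates requires. *)
Lemma gauss_transform (s u : R) : s != 0 ->
  \int[P]_w (Psi w * expR (- (s ^+ 2 * (X w - u) ^+ 2 / 2))) =
  \int[normal_prob 0 s]_t \int[P]_w (Psi w * cos (t * X w + - (t * u))).
Proof.
move=> s0.
have mcos2 : measurable_fun setT
    (fun p : T * R => cos (p.2 * X p.1 + - (p.2 * u))).
  apply: measurableT_comp; first by apply: continuous_measurable_fun => x; exact: continuous_cos.
  apply: measurable_funD.
    by apply: measurable_funM => //; exact: measurableT_comp.
  by apply: measurableT_comp => //; exact: measurable_funM.
have mF : measurable_fun setT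
    (fun p : T * R => Psi p.1 * cos (p.2 * X p.1 + - (p.2 * u))).
  by apply: measurable_funM => //; exact: measurableT_comp.
have FK p : `|Psi p.1 * cos (p.2 * X p.1 + - (p.2 * u))| <= K.
  by rewrite normrM -[K]mulr1 ler_pM// cos_max.
rewrite -(@Rintegral_fubini _ _ _ _ _ P (normal_prob 0 s)
  (fun p : T * R => Psi p.1 * cos (p.2 * X p.1 + - (p.2 * u)))).
- apply: eq_Rintegral => w _ /=.
  have mc : measurable_fun setT (fun t : R => cos (t * X w + - (t * u))).
    exact: measurableT_comp mcos2 (measurable_pair1 w).
  rewrite RintegralZl//.
    congr (_ * _); rewrite integral_normal//.
    under eq_Rintegral => t _.
      rewrite (_ : t * X w + _ = (X w - u) * t + 0); last by rewrite addr0; ring.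
      over.
    by rewrite normal_cos_lebesgue// cos0 mul1r.
  apply: (@integrable_bounded _ _ _ (normal_prob 0 s) _ 1 mc) => t; exact: cos_max.
- exact: (@integrable_bounded _ _ _ (P \x normal_prob 0 s)%E _ K mF).
- move=> w; apply: (integrable_bounded _ _ (K := K)) => [|t].
    exact: measurableT_comp mF (measurable_pair1 w).
  exact: FK (w, t).
- move=> t; apply: (integrable_bounded _ _ (K := K)) => [|w].
    exact: measurableT_comp mF (measurable_pair2 t).
  exact: FK (w, t).
Qed.

(** The probability that a normal variable of mean [x] and deviation [s] is at least [a]: the
    indicator of a half-line convolved with a Gaussian. *)
Definition smooth_step (s a x : R) : R :=
  \int[leb]_u (\1_`[a, +oo[ u * normal_pdf x s u).

Lemma measurable_pdf2 s : s != 0 ->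
  measurable_fun setT (fun p : T * R => normal_pdf (X p.1) s p.2).
Proof.
move=> s0; rewrite (_ : (fun _ => _) = (fun p : T * R => normal_peak s *
    expR (- (p.2 - X p.1) ^+ 2 / (s ^+ 2 *+ 2)))); last first.
  by apply/funext => p; rewrite normal_pdf_expR.
apply: measurable_funM => //; apply: measurableT_comp => //.
apply: measurable_funM => //; apply: measurableT_comp => //.
apply: measurable_funX; apply: measurable_funB => //.
exact: measurableT_comp.
Qed.

Lemma smooth_step_transform (s a : R) : s != 0 ->
  \int[P]_w (Psi w * smooth_step s a (X w)) =
  \int[leb]_u \int[P]_w (Psi w * (\1_`[a, +oo[ u * normal_pdf (X w) s u)).
Proof.
move=> s0.
pose F (p : T * R) := Psi p.1 * (\1_`[a, +oo[ p.2 * normal_pdf (X p.1) s p.2).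
have mF : measurable_fun setT F.
  apply: measurable_funM; first exact: measurableT_comp.
  apply: measurable_funM; last exact: measurable_pdf2.
  by apply: measurableT_comp => //; exact: measurable_indic.
have F_le w u : `|F (w, u)| <= K * normal_pdf (X w) s u.
  rewrite /F/= !normrM ler_pM ?mulr_ge0// (ger0_norm (normal_pdf_ge0 _ _ _)).
  rewrite ler_piMl ?normal_pdf_ge0// indicE.
  by case: (_ \in _); rewrite ?normr1 ?normr0.
have ipdf w : leb.-integrable setT (EFin \o (fun u => K * normal_pdf (X w) s u)).
  by apply: integrable_EFinZl => //; exact: integrable_normal_pdf.
have i2 w : leb.-integrable setT (EFin \o (fun u => F (w, u))).
  apply: (le_integrable_EFin measurableT _ _ (ipdf w)).
    exact: measurableT_comp mF (measurable_pair1 w).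
  by move=> u _; rewrite (le_trans (F_le w u))// ler_norm.
have i1 u : P.-integrable setT (EFin \o (fun w => F (w, u))).
  apply: (@integrable_bounded _ _ _ P _ (K * normal_peak s)).
    exact: measurableT_comp mF (measurable_pair2 u).
  move=> w; rewrite (le_trans (F_le w u))// ler_wpM2l//.
    exact: le_trans (PsiK w).
  exact: normal_pdf_ub.
rewrite -(@Rintegral_fubini _ _ _ _ _ P leb F)//.
  apply: eq_Rintegral => w _; rewrite /F/= RintegralZl//.
  apply: (le_integrable_EFin measurableT _ _ (integrable_normal_pdf (X w) s)).
    apply: measurable_funM; last exact: measurable_normal_pdf.
    exact: measurable_indic.
  move=> u _; rewrite normrM ler_piMl// indicE.
  by case: (_ \in _); rewrite ?normr1 ?normr0.
apply/integrable12ltyP; first exact/measurable_EFinP.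
apply: (@le_lt_trans _ _ (\int[P]_w K%:E)%E); last first.
  by rewrite integral_prob_cst ltry.
apply: ge0_le_integral => //.
- by move=> w _; exact: integral_ge0.
- have mF' : measurable_fun setT (fun p : T * R => `|(F p)%:E|%E).
    by apply: measurableT_comp => //; exact/measurable_EFinP.
  exact: (measurable_fun_fubini_tonelli_F (m2 := leb) _ mF').
- move=> w _.
  apply: (@le_trans _ _ (\int[leb]_u (K * normal_pdf (X w) s u)%:E)%E).
    apply: ge0_le_integral => //.
    - by have /integrableP[m _] := i2 w; exact: measurableT_comp m.
    - by have /integrableP[m _] := ipdf w.
    - by move=> u _; rewrite lee_fin; exact: F_le.
  under eq_integral do rewrite EFinM.
  rewrite integralZl//; last exact: integrable_normal_pdf.
  by rewrite integral_normal_pdf mule1.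
Qed.

End transform.

(** Chebyshev's inequality: on [A] the weight (u - x)^2 / e^2 is at least 1, and its integral is the
    variance over e^2. *)
Lemma normal_tail (x s : R) (A : set R) (e : R) : s != 0 -> 0 < e ->
  measurable A -> (forall u, A u -> e <= `|u - x|) ->
  \int[leb]_u (\1_A u * normal_pdf x s u) <= s ^+ 2 / e ^+ 2.
Proof.
move=> s0 e0 mA hA.
have e2 : 0 < e ^+ 2 by rewrite exprn_gt0.
have i2 := integrable_exprn_pdf x s0 2.
have i0 := integrable_normal_pdf x s.
have <- : \int[leb]_u ((e ^+ 2)^-1 * ((u - x) ^+ 2 * normal_pdf x s u)) = s ^+ 2 / e ^+ 2.
  by rewrite RintegralZl// normal_moment_rec// normal_moment0// !mulr1 mulrC.
apply: le_Rintegral => //.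
- apply: (le_integrable_EFin measurableT _ _ i0).
    apply: measurable_funM; last exact: measurable_normal_pdf.
    exact: measurable_indic.
  move=> u _; rewrite normrM ler_piMl// indicE.
  by case: (_ \in _); rewrite ?normr1 ?normr0.
- exact: integrable_EFinZl.
- move=> u _; rewrite mulrA ler_wpM2r ?normal_pdf_ge0// indicE.
  have [uA|uA] := boolP (u \in A); last by rewrite mulr_ge0 ?sqr_ge0// invr_ge0 ltW.
  rewrite mulrC ler_pdivlMr// mul1r -(real_normK (num_real (u - x))).
  by rewrite ler_pXn2r// ?nnegrE ?(ltW e0)//; apply: hA; exact: set_mem.
Qed.

Lemma smooth_step_ge0 s a x : 0 <= smooth_step s a x.
Proof. by apply: Rintegral_ge0 => u _; rewrite mulr_ge0 ?normal_pdf_ge0. Qed.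

Lemma smooth_stepC s a x : s != 0 ->
  smooth_step s a x = 1 - \int[leb]_u (\1_`]-oo, a[ u * normal_pdf x s u).
Proof.
move=> s0; rewrite -(Rintegral_normal_pdf x s) -RintegralB//; last 2 first.
- exact: integrable_normal_pdf.
- apply: (le_integrable_EFin measurableT _ _ (integrable_normal_pdf x s)).
    apply: measurable_funM; last exact: measurable_normal_pdf.
    exact: measurable_indic.
  move=> u _; rewrite normrM ler_piMl// indicE.
  by case: (_ \in _); rewrite ?normr1 ?normr0.
apply: eq_Rintegral => u _; rewrite !indicE.
rewrite -[X in _ = X - _]mul1r -mulrBl; congr (_ * _).
have [ua|ua] := leP a u.
  rewrite mem_set/=; last by rewrite in_itv/= ua.
  by rewrite memNset/= ?subr0// in_itv/= ltNge ua.
rewrite memNset/=; last by rewrite in_itv/= leNgt ua.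
by rewrite mem_set/= ?subrr// in_itv/= ua.
Qed.

Lemma smooth_step_le1 s a x : s != 0 -> smooth_step s a x <= 1.
Proof.
move=> s0; rewrite smooth_stepC// lerBlDr lerDl.
by apply: Rintegral_ge0 => u _; rewrite mulr_ge0 ?normal_pdf_ge0.
Qed.

(** The threshold is lowered by [sh], and the deviation [sig] is the square of [sh]. Lowering makes
    the limit 1 at [x = a], as the closed half-line requires, and Chebyshev leaves sig^2 / sh^2 =
    1/(n + 1)^2. *)
Let sig (n : nat) : R := n.+1%:R ^- 2.
Let sh (n : nat) : R := n.+1%:R^-1.

Let sig0 n : sig n != 0.
Proof. by rewrite /sig invr_eq0 expf_neq0// pnatr_eq0. Qed.

Lemma smooth_step_cvg a x :
  smooth_step (sig n) (a - sh n) x @[n --> \oo] --> (\1_`[a, +oo[ x : R).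
Proof.
have sh_cvg : sh n @[n --> \oo] --> (0 : R) by exact: cvg_harmonic.
have [ax|ax] := leP a x.
  rewrite indicE mem_set; last by rewrite /= in_itv/= ax.
  apply: (@squeeze_cvgr _ _ _ _ (fun n => 1 - sh n) (cst 1)).
  - near=> n; rewrite smooth_step_le1 ?sig0// andbT smooth_stepC ?sig0//.
    rewrite lerD2l lerN2.
    have sh0 : 0 < sh n by rewrite invr_gt0.
    apply: le_trans (normal_tail (sig0 n) sh0 _ _) _ => //.
      move=> u /=; rewrite in_itv/= => ua.
      by rewrite ler0_norm; lra.
    rewrite /sig /sh (_ : _ / _ = n.+1%:R^-1 * n.+1%:R^-1); last first.
      by field; rewrite addrC natr1 pnatr_eq0.
    by rewrite ler_piMl ?invr_ge0// invf_le1// ler1n.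
  - by rewrite -[X in _ --> X]subr0; apply: cvgB => //; exact: cvg_cst.
  - exact: cvg_cst.
rewrite indicE memNset; last by rewrite /= in_itv/= andbT; apply/negP; rewrite -ltNge.
pose e := (a - x) / 2.
have e0 : 0 < e by rewrite /e; lra.
apply: (@squeeze_cvgr _ _ _ _ (cst 0) (fun n => sh n * (e ^+ 2)^-1)).
- near=> n; rewrite smooth_step_ge0/=.
  have she : sh n <= e.
    have : `|0 - sh n| <= e by near: n; move/cvgrPdist_le : sh_cvg; exact.
    by rewrite sub0r normrN ger0_norm ?invr_ge0.
  apply: le_trans (normal_tail (sig0 n) e0 _ _) _ => //.
    move=> u /=; rewrite in_itv/= andbT => ua.
    by rewrite ger0_norm; move: she ua; rewrite /e; lra.
  rewrite ler_wpM2r ?invr_ge0 ?sqr_ge0// /sig /sh -!exprVn -exprM.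
  rewrite (_ : (2 * 2)%N = 4%N)// exprS ler_piMr ?invr_ge0//.
  by rewrite exprn_ile1// ?invr_ge0// invf_le1// ler1n.
- exact: cvg_cst.
- by rewrite -[X in _ --> X](mul0r (e ^+ 2)^-1); apply: cvgM => //; exact: cvg_cst.
Unshelve. all: by end_near. Qed.

Section uniqueness.
Context d (T : measurableType d) (P : probability T R).
Context d' (T' : measurableType d') (P' : probability T' R).
Variables (Psi X : T -> R) (Psi' X' : T' -> R) (K : R).
Hypotheses (mPsi : measurable_fun setT Psi) (PsiK : forall x, `|Psi x| <= K)
  (mX : measurable_fun setT X).
Hypotheses (mPsi' : measurable_fun setT Psi') (PsiK' : forall x, `|Psi' x| <= K)
  (mX' : measurable_fun setT X').

(* A finite signed measure on the line is determined by its characteristic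
   function: cosines average to Gaussian kernels, which average to smoothed
   step functions. *)
Lemma signed_cf_unique :
  (forall t c, \int[P]_w (Psi w * cos (t * X w + c)) =
               \int[P']_w (Psi' w * cos (t * X' w + c))) ->
  forall a, \int[P]_w (Psi w * \1_`[a, +oo[ (X w)) =
            \int[P']_w (Psi' w * \1_`[a, +oo[ (X' w)).
Proof.
move=> cf a.
have step s b : s != 0 -> \int[P]_w (Psi w * smooth_step s b (X w)) =
    \int[P']_w (Psi' w * smooth_step s b (X' w)).
  move=> s0.
  rewrite (smooth_step_transform P mPsi PsiK)// (smooth_step_transform P' mPsi' PsiK')//.
  apply: eq_Rintegral => u _.
  (* Frequencies of deviation 1/s produce a kernel of deviation [s] in space. *)
  have sV0 : s^-1 != 0 by rewrite invr_eq0.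
  have pdfE x : normal_pdf x s u =
      normal_peak s * expR (- (s^-1 ^+ 2 * (x - u) ^+ 2 / 2)).
    rewrite normal_pdf_expR//; congr (_ * expR _); field.
    by rewrite s0.
  have aux d0 (T0 : measurableType d0) (P0 : probability T0 R) (Psi0 X0 : T0 -> R) :
      measurable_fun setT Psi0 -> (forall w, `|Psi0 w| <= K) ->
      measurable_fun setT X0 ->
      \int[P0]_w (Psi0 w * (\1_`[b, +oo[ u * normal_pdf (X0 w) s u)) =
      \1_`[b, +oo[ u * normal_peak s *
      \int[P0]_w (Psi0 w * expR (- (s^-1 ^+ 2 * (X0 w - u) ^+ 2 / 2))).
    move=> m0 K0 mX0; rewrite -RintegralZl//.
      by apply: eq_Rintegral => w _; rewrite pdfE; ring.
    apply: (@integrable_bounded _ _ _ P0 _ K).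
      apply: measurable_funM => //; apply: measurableT_comp => //.
      apply: measurableT_comp => //; apply: measurable_funM => //.
      apply: measurable_funM => //; apply: measurable_funX.
      exact: measurable_funB.
    move=> w; rewrite normrM -[K]mulr1 ler_pM// ger0_norm ?expR_ge0//.
    by rewrite -[leRHS]expR0 ler_expR oppr_le0 divr_ge0// mulr_ge0// sqr_ge0.
  rewrite !aux//; congr (_ * _).
  rewrite (gauss_transform P mPsi PsiK)// (gauss_transform P' mPsi' PsiK')//.
  by apply: eq_Rintegral => t _; exact: cf.
have lim d0 (T0 : measurableType d0) (P0 : probability T0 R) (Psi0 X0 : T0 -> R) :
    measurable_fun setT Psi0 -> (forall w, `|Psi0 w| <= K) ->
    measurable_fun setT X0 ->
    \int[P0]_w (Psi0 w * smooth_step (sig n) (a - sh n) (X0 w)) @[n --> \oo] -->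
    \int[P0]_w (Psi0 w * \1_`[a, +oo[ (X0 w)).
  move=> m0 K0 mX0; apply: (cvg_Rintegral_bounded (K := K)).
  - move=> n; apply: measurable_funM => //.
    apply: (measurableT_comp (f := smooth_step _ _)) => //.
    have mF : measurable_fun setT (fun p : R * R => (\1_`[a - sh n, +oo[ p.2 *
        normal_pdf p.1 (sig n) p.2)%:E).
      apply/measurable_EFinP; apply: measurable_funM.
        by apply: measurableT_comp => //; exact: measurable_indic.
      by have := @measurable_pdf2 _ R id (@measurable_id _ _ _) (sig n) (sig0 n).
    apply: measurableT_comp => //.
    apply: (measurable_fun_fubini_tonelli_F (m2 := leb) _ mF) => p.
    by rewrite lee_fin mulr_ge0// normal_pdf_ge0.
  - by apply: measurable_funM => //; apply: measurableT_comp.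
  - move=> n w; rewrite normrM -[K]mulr1 ler_pM// ger0_norm ?smooth_step_ge0//.
    by rewrite smooth_step_le1.
  - by move=> w; apply: cvgM; [exact: cvg_cst|exact: smooth_step_cvg].
have h1 := lim _ _ P Psi X mPsi PsiK mX.
have h2 := lim _ _ P' Psi' X' mPsi' PsiK' mX'.
rewrite (_ : (fun n => _) =
    (fun n => \int[P']_w (Psi' w * smooth_step (sig n) (a - sh n) (X' w)))) in h1.
  exact: cvg_unique h1 h2.
by apply/funext => n; exact: step.
Qed.

End uniqueness.

End cramer_wold_1d.

Section cramer_wold.
Context (R : realType) (J : finType).
Context d (T : measurableType d) (P : probability T R).
Context d' (T' : measurableType d') (P' : probability T' R).
Variables (X : J -> T -> R) (X' : J -> T' -> R).
Hypotheses (mX : forall j, measurable_fun setT (X j))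
  (mX' : forall j, measurable_fun setT (X' j)).
Hypothesis cf : forall (t : J -> R) c,
  \int[P]_w cos (\sum_j t j * X j w + c) = \int[P']_w cos (\sum_j t j * X' j w + c).

Lemma measurable_cos_sum d0 (T0 : measurableType d0) (Y : J -> T0 -> R)
    (t : J -> R) c : (forall j, measurable_fun setT (Y j)) ->
  measurable_fun setT (fun w => cos (\sum_j t j * Y j w + c)).
Proof.
move=> mY; apply: measurableT_comp.
  by apply: continuous_measurable_fun => x; exact: continuous_cos.
apply: measurable_funD => //; apply: measurable_sum => j.
exact: measurable_funM.
Qed.

Lemma prod_indic_bound (s : seq J) (a y : J -> R) :
  `|\prod_(j <- s) (\1_`[a j, +oo[ (y j) : R)| <= 1.
Proof.
elim: s => [|j s IH]; first by rewrite big_nil normr1.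
rewrite big_cons normrM mulr_ile1// indicE.
by case: (_ \in _); rewrite ?normr1 ?normr0.
Qed.

Lemma measurable_prod_indic d0 (T0 : measurableType d0) (Y : J -> T0 -> R)
    (s : seq J) (a : J -> R) : (forall j, measurable_fun setT (Y j)) ->
  measurable_fun setT (fun w => \prod_(j <- s) (\1_`[a j, +oo[ (Y j w) : R)).
Proof.
move=> mY; apply: measurable_prod => j _; exact: measurableT_comp.
Qed.

(** Induction on the coordinates already converted into indicators, all of them staying in the
    cosine. When [j] is converted, the product of two cosines becomes a sum, which only changes the
    frequency of [j] and the phase, and the induction hypothesis feeds [signed_cf_unique]. *)
Lemma cramer_wold_cos (s : seq J) (a t : J -> R) c :
  \int[P]_w (\prod_(j <- s) \1_`[a j, +oo[ (X j w) * cos (\sum_j t j * X j w + c)) =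
  \int[P']_w (\prod_(j <- s) \1_`[a j, +oo[ (X' j w) * cos (\sum_j t j * X' j w + c)).
Proof.
elim: s t c => [|j s IH] t c.
  under eq_Rintegral do rewrite big_nil mul1r.
  by under [RHS]eq_Rintegral do rewrite big_nil mul1r.
have mPC d0 (T0 : measurableType d0) (Y : J -> T0 -> R) (t0 : J -> R) c0 :
    (forall j, measurable_fun setT (Y j)) ->
    measurable_fun setT (fun w => \prod_(j <- s) (\1_`[a j, +oo[ (Y j w) : R) *
      cos (\sum_j t0 j * Y j w + c0)).
  move=> mY; apply: measurable_funM; first exact: measurable_prod_indic.
  exact: measurable_cos_sum.
have PC1 (y : J -> R) u : `|\prod_(j <- s) (\1_`[a j, +oo[ (y j) : R) * cos u| <= 1.
  by rewrite normrM mulr_ile1// ?prod_indic_bound ?cos_max.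
have shuffle d0 (T0 : measurableType d0) (P0 : probability T0 R) (Y : J -> T0 -> R) :
    \int[P0]_w (\prod_(j0 <- (j :: s)) \1_`[a j0, +oo[ (Y j0 w) *
      cos (\sum_j t j * Y j w + c)) =
    \int[P0]_w ((\prod_(j <- s) (\1_`[a j, +oo[ (Y j w) : R) *
      cos (\sum_j t j * Y j w + c)) * \1_`[a j, +oo[ (Y j w)).
  by apply: eq_Rintegral => w _; rewrite big_cons; ring.
rewrite !shuffle.
apply: (signed_cf_unique (K := 1)) => //; [exact: mPC|exact: mPC|].
move=> tau e.
have expand d0 (T0 : measurableType d0) (P0 : probability T0 R) (Y : J -> T0 -> R) :
    (forall j, measurable_fun setT (Y j)) ->
    \int[P0]_w (\prod_(j <- s) (\1_`[a j, +oo[ (Y j w) : R) *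
      cos (\sum_j t j * Y j w + c) * cos (tau * Y j w + e)) =
    2^-1 * (\int[P0]_w (\prod_(j <- s) (\1_`[a j, +oo[ (Y j w) : R) *
        cos (\sum_j0 (t j0 + tau * (j0 == j)%:R) * Y j0 w + (c + e))) +
     \int[P0]_w (\prod_(j <- s) (\1_`[a j, +oo[ (Y j w) : R) *
        cos (\sum_j0 (t j0 - tau * (j0 == j)%:R) * Y j0 w + (c - e)))).
  move=> mY.
  have ib t0 c0 : P0.-integrable setT (EFin \o (fun w =>
      \prod_(j <- s) (\1_`[a j, +oo[ (Y j w) : R) * cos (\sum_j t0 j * Y j w + c0))).
    by apply: (@integrable_bounded _ _ _ P0 _ 1) => [|w]; [exact: mPC|exact: PC1].
  rewrite -RintegralD// -RintegralZl//; last exact: integrable_EFinD.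
  apply: eq_Rintegral => w _.
  have sumE (k : R) : \sum_j0 (t j0 + k * (j0 == j)%:R) * Y j0 w =
      \sum_j0 t j0 * Y j0 w + k * Y j w.
    under eq_bigr do rewrite mulrDl; rewrite big_split/=; congr (_ + _).
    rewrite (bigD1 j)//= eqxx mulr1 big1 ?addr0// => i /negbTE ->.
    by rewrite mulr0 mul0r.
  rewrite sumE (_ : \sum_j0 (t j0 - _) * _ = \sum_j0 t j0 * Y j0 w - tau * Y j w); last first.
    by rewrite -mulNr -sumE; apply: eq_bigr => i _; rewrite mulNr.
  set A := \sum_j0 _; set B := tau * _.
  rewrite (_ : A + B + (c + e) = (A + c) + (B + e)); last by ring.
  rewrite (_ : A - B + (c - e) = (A + c) - (B + e)); last by ring.
  move: (A + c) (B + e) => a1 b1.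
  by rewrite cosD cosB; field.
by rewrite !expand// !IH.
Qed.

Lemma cramer_wold_orthant (a : J -> R) :
  P [set w | forall j, a j <= X j w] = P' [set w | forall j, a j <= X' j w].
Proof.
have aux d0 (T0 : measurableType d0) (P0 : probability T0 R) (Y : J -> T0 -> R) :
    (forall j, measurable_fun setT (Y j)) ->
    P0 [set w | forall j, a j <= Y j w] = (\int[P0]_w (\prod_(j <- enum J)
      \1_`[a j, +oo[ (Y j w) * cos (\sum_j 0 * Y j w + 0)))%:E.
  move=> mY.
  have mA : measurable [set w | forall j, a j <= Y j w].
    rewrite (_ : [set _ | _] = \bigcap_(j in [set: J]) (Y j @^-1` `[a j, +oo[)).
      apply: fin_bigcap_measurable => // j _; rewrite -[_ @^-1` _]setTI.
      by apply: mY => //; exact: measurable_itv.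
    apply/seteqP; split => w /= h j; first by move=> _; rewrite /= in_itv/= h.
    by have := h j I; rewrite /= in_itv/= andbT.
  rewrite EFin_Rintegral//; last first.
    apply: (@integrable_bounded _ _ _ P0 _ 1).
      apply: measurable_funM; first exact: measurable_prod_indic.
      exact: measurable_cos_sum.
    by move=> w; rewrite normrM mulr_ile1// ?prod_indic_bound ?cos_max.
  rewrite -[X in P0 X]setIT -integral_indic//.
  apply: eq_integral => w _; congr EFin.
  rewrite (_ : \sum_j 0 * _ = 0); last by rewrite big1// => j _; rewrite mul0r.
  rewrite addr0 cos0 mulr1.
  rewrite indicE; have [/set_mem/= h|h] := boolP (w \in _).
    rewrite big1// => j _; rewrite indicE mem_set//= in_itv/= h//.
  apply/esym/eqP; rewrite prodf_seq_eq0; apply: contraNT h => /hasPn h.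
  apply/mem_set => j /=; have := h j; rewrite mem_enum => /(_ isT)/=.
  rewrite indicE; have [/set_mem/=|_] := boolP (_ \in _); last by rewrite eqxx.
  by rewrite in_itv/= andbT.
by rewrite !aux// cramer_wold_cos.
Qed.

End cramer_wold.

Section law_unique.
Context (R : realType) (J : finType).
Context d (T : measurableType d) (P : probability T R).
Context d' (T' : measurableType d') (P' : probability T' R).
Context d0 (D : measurableType d0) (pi : J -> D -> R).
Hypothesis mpi : forall j, measurable_fun setT (pi j).
Hypothesis gen : forall d1 (S : measurableType d1) (f : S -> D),
  (forall j, measurable_fun setT (pi j \o f)) -> measurable_fun setT f.
Variables (F : T -> D) (F' : T' -> D).
Hypotheses (mF : measurable_fun setT F) (mF' : measurable_fun setT F').

Let G : set (set D) := [set A | exists B : J -> set R,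
  (forall j, measurable (B j)) /\ A = [set y | forall j, B j (pi j y)]].

Let O : set (set D) := [set A | exists a : J -> R, A = [set y | forall j, a j <= pi j y]].

(** The property [gen] says that the [pi j] generate the measurable sets of [D]. Applied to the
    identity starting from the sigma-algebra generated by [C], it shows that the latter is already
    everything. *)
Let gen_sub (C : set (set D)) : (forall A, C A -> measurable A) ->
  (forall j (B : set R), measurable B -> <<s C >> (pi j @^-1` B)) ->
  @measurable _ D = <<s C >>.
Proof.
move=> Cm h; apply/seteqP; split; last first.
  apply: smallest_sub; first exact: sigma_algebra_measurable.
  by move=> A /Cm.
move=> A mA.
have : measurable_fun setT (idfun : g_sigma_algebraType C -> D).
  apply: gen => j _ B mB; rewrite setTI; exact: h.
by move=> /(_ measurableT A mA); rewrite setTI.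
Qed.

Let law_unique_pi (C : set (set D)) : @measurable _ D = <<s C >> ->
  setI_closed C ->
  (forall A, C A -> P (F @^-1` A) = P' (F' @^-1` A)) ->
  forall A, measurable A -> P (F @^-1` A) = P' (F' @^-1` A).
Proof.
move=> mC IC eqC A mA.
have mp d1 (S : measurableType d1) (f : S -> D) B :
    measurable_fun setT f -> measurable B -> measurable (f @^-1` B).
  by move=> mf mB; rewrite -[_ @^-1` _]setTI; exact: mf.
apply: (@dynkin_induction _ D C (fun A => P (F @^-1` A) = P' (F' @^-1` A)) mC IC) => //.
- change (P setT = P' setT); transitivity (1%E : \bar R); [exact: probability_setT|].
  by apply/esym; exact: probability_setT.
- move=> S mS PS.
  change (P (~` (F @^-1` S)) = P' (~` (F' @^-1` S))).
  transitivity (1 - P (F @^-1` S))%E.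
    by apply: probability_setC; exact: mp.
  by rewrite PS; apply/esym/probability_setC; exact: mp.
- move=> H mH tH PH; rewrite (preimage_bigcup setT F) (preimage_bigcup setT F').
  have tri d1 (S : measurableType d1) (f : S -> D) :
      trivIset setT (fun n => f @^-1` H n).
    apply/trivIsetP => i j _ _ ij; rewrite -preimage_setI.
    by move/trivIsetP : tH => ->//; rewrite preimage_set0.
  have add d1 (S : measurableType d1) (Q : probability S R) (f : S -> D) :
      measurable_fun setT f -> Q (\bigcup_n (f @^-1` H n)) =
      limn (fun n => \sum_(0 <= i < n) Q (f @^-1` H i))%E.
    move=> mf; apply/esym/cvg_lim => //.
    apply: (@measure_sigma_additive _ _ _ Q (fun n => f @^-1` H n)) => //.
    - by move=> n; exact: mp.
    - exact: tri.
  rewrite !add//; congr (limn _); apply/funext => n.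
  by apply: eq_bigr => i _; exact: PH.
- by rewrite -mC.
Qed.

Lemma law_unique_box :
  (forall B : J -> set R, (forall j, measurable (B j)) ->
    P (F @^-1` [set y | forall j, B j (pi j y)]) =
    P' (F' @^-1` [set y | forall j, B j (pi j y)])) ->
  forall A, measurable A -> P (F @^-1` A) = P' (F' @^-1` A).
Proof.
move=> eqB; apply: (law_unique_pi (C := G)).
- apply: gen_sub.
    move=> A [B [mB ->]].
    rewrite (_ : [set _ | _] = \bigcap_(j in [set: J]) (pi j @^-1` B j)).
      apply: fin_bigcap_measurable => // j _; rewrite -[_ @^-1` _]setTI.
      exact: mpi.
    by apply/seteqP; split => w /= h j; [move=> _; exact: h|exact: h].
  move=> j B mB; apply: sub_sigma_algebra.
  exists (fun i => if i == j then B else setT); split.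
    by move=> i; case: ifP.
  apply/seteqP; split => w /=; last by move=> /(_ j); rewrite eqxx.
  by move=> h i; case: eqP => [->|].
- move=> A1 A2 [B1 [mB1 ->]] [B2 [mB2 ->]]; exists (fun j => B1 j `&` B2 j).
  split; first by move=> j; exact: measurableI.
  apply/seteqP; split => w /=; first by move=> [h1 h2] j; split.
  by move=> h; split => j; have [] := h j.
- by move=> A [B [mB ->]]; exact: eqB.
Qed.

Lemma law_unique_orthant :
  (forall a : J -> R,
    P (F @^-1` [set y | forall j, a j <= pi j y]) =
    P' (F' @^-1` [set y | forall j, a j <= pi j y])) ->
  forall A, measurable A -> P (F @^-1` A) = P' (F' @^-1` A).
Proof.
move=> eqB; apply: (law_unique_pi (C := O)).
- apply: gen_sub.
    move=> A [a ->].
    rewrite (_ : [set _ | _] = \bigcap_(j in [set: J]) (pi j @^-1` `[a j, +oo[)).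
      apply: fin_bigcap_measurable => // j _; rewrite -[_ @^-1` _]setTI.
      by apply: mpi => //; exact: measurable_itv.
    apply/seteqP; split => w /= h j; first by move=> _; rewrite /= in_itv/= h.
    by have := h j I; rewrite /= in_itv/= andbT.
  move=> j B mB.
  have : measurable_fun setT (pi j : g_sigma_algebraType O -> R).
    apply: (measurability (@RGenCInfty.G R)); first exact: RGenCInfty.measurableE.
    move=> _ [_ [r ->] <-]; rewrite setTI.
    (* A half-space in the coordinate [j] alone is a countable union of orthants: the other bounds
       are sent to - oo along the integers. *)
    rewrite (_ : pi j @^-1` _ = \bigcup_n [set y | forall i,
        (if i == j then r else - n%:R) <= pi i y]).
      by apply: bigcupT_measurable => n; apply: sub_sigma_algebra; eexists.
    apply/seteqP; split => w /=; rewrite in_itv/= andbT.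
      move=> rw; exists (Num.bound (\sum_i `|pi i w|)) => // i.
      case: eqP => [->//|_].
      rewrite lerNl (le_trans (ler_norm _))// normrN.
      apply: le_trans (ltW (archi_boundP _)); last by apply: sumr_ge0.
      by rewrite (bigD1 i)//= lerDl sumr_ge0.
    by move=> [n _ /(_ j)]; rewrite eqxx.
  by move=> /(_ measurableT B mB); rewrite setTI.
- move=> A1 A2 [a1 ->] [a2 ->]; exists (fun j => Num.max (a1 j) (a2 j)).
  apply/seteqP; split => w /=.
    by move=> [h1 h2] j; rewrite ge_max h1 h2.
  by move=> h; split => j; have := h j; rewrite ge_max => /andP[].
- by move=> A [a ->]; exact: eqB.
Qed.

End law_unique.

(** * Independence, Gaussian variables and independent families *)

Section independence.
Context d (T : measurableType d) (R : realType) (P : probability T R).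

Definition mfun_of d' (T' : measurableType d') (X : T -> T')
  (mX : measurable_fun setT X) : {mfun T >-> T'} :=
  HB.pack X (isMeasurableFun.Build _ _ _ _ X mX).

Section pair.
Context d1 (T1 : measurableType d1) d2 (T2 : measurableType d2).
Variables (X : T -> T1) (Y : T -> T2).
Hypotheses (mX : measurable_fun setT X) (mY : measurable_fun setT Y).
Hypothesis indep : forall A B, measurable A -> measurable B ->
  P (X @^-1` A `&` Y @^-1` B) = (P (X @^-1` A) * P (Y @^-1` B))%E.

Let LX : probability T1 R := distribution P (mfun_of mX).
Let LY : probability T2 R := distribution P (mfun_of mY).

Lemma indep_law C : measurable C ->
  P ((fun w => (X w, Y w)) @^-1` C) = (LX \x LY)%E C.
Proof.
move=> mC; have mXY : measurable_fun setT (fun w => (X w, Y w)).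
  exact: measurable_fun_pair.
apply/esym; apply: (@product_measure_unique _ _ _ _ R LX LY
  (distribution P (mfun_of mXY))) => //.
Qed.

(** Independence on rectangles gives the pair the product law, by uniqueness of product measures;
    both claims are then Tonelli and Fubini for that law. *)
Lemma indep_Rintegral (f : T1 -> R) (g : T2 -> R) :
  measurable_fun setT f -> measurable_fun setT g ->
  P.-integrable setT (EFin \o (f \o X)) -> P.-integrable setT (EFin \o (g \o Y)) ->
  P.-integrable setT (EFin \o (fun w => f (X w) * g (Y w))) /\
  \int[P]_w (f (X w) * g (Y w)) = \int[P]_w f (X w) * \int[P]_w g (Y w).
Proof.
move=> mf mg if_ ig.
have mXY : measurable_fun setT (fun w => (X w, Y w)).
  exact: measurable_fun_pair.
pose F (p : T1 * T2) := f p.1 * g p.2.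
have mF : measurable_fun setT F.
  by apply: measurable_funM; exact: measurableT_comp.
have LXf : LX.-integrable setT (EFin \o f).
  by apply: (integrable_law (P := P) (Q := LX) mX (fun B mB => erefl) mf).1.
have LYg : LY.-integrable setT (EFin \o g).
  by apply: (integrable_law (P := P) (Q := LY) mY (fun B mB => erefl) mg).1.
have nf : LX.-integrable setT (EFin \o (fun x => `|f x|)) by exact: integrable_norm LXf.
have ng : LY.-integrable setT (EFin \o (fun x => `|g x|)) by exact: integrable_norm LYg.
have iF : (LX \x LY)%E.-integrable setT (EFin \o F).
  apply/integrable12ltyP; first exact/measurable_EFinP.
  rewrite (_ : (\int[LX]_x _)%E = (\int[LX]_x (`|f x| * \int[LY]_y `|g y|)%:E)%E).
    apply: (integrable_lty measurableT); exact: integrable_EFinZr.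
  apply: eq_integral => x _.
  under eq_integral do rewrite /F/= normrM EFinM.
  by rewrite integralZl// EFinM EFin_Rintegral.
split.
  by apply: (integrable_law (P := P) (Q := (LX \x LY)%E) mXY indep_law mF).2.
rewrite (Rintegral_law (Q := (LX \x LY)%E) mXY indep_law mF).
rewrite (Rintegral_law mX (Q := LX) (fun B mB => erefl) mf).
rewrite (Rintegral_law mY (Q := LY) (fun B mB => erefl) mg).
rewrite /Rintegral -(integral12_prod_meas1 (f := EFin \o F))// /fubini_F.
transitivity (fine (\int[LX]_x (f x * \int[LY]_y g y)%:E)%E).
  congr fine; apply: eq_integral => x _.
  under eq_integral do rewrite /F/= EFinM.
  by rewrite integralZl// EFinM EFin_Rintegral.
exact: (RintegralZr _ measurableT LXf).
Qed.

End pair.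
End independence.

Section gaussian_variable.
Context d (T : measurableType d) (R : realType) (P : probability T R).
Variable X : T -> R.
Hypotheses (mX : measurable_fun setT X) (gX : gaussian P X).

(** The definition of [gaussian] has two branches, and centring forces the mean parameter to vanish
    in each: what remains is a Dirac mass at 0 or a normal law whose integrals are known. *)
Lemma gaussian_centered : \int[P]_w X w = 0 ->
  let v := \int[P]_w (X w ^+ 2) in
  [/\ 0 <= v, forall k, P.-integrable setT (EFin \o (fun w => X w ^+ k)),
      forall c, \int[P]_w cos (X w + c) = cos c * expR (- (v / 2)) &
      \int[P]_w (X w ^+ 4) = 3 * v ^+ 2].
Proof.
move=> EX v.
have v0 : 0 <= v by apply: Rintegral_ge0 => w _; exact: sqr_ge0.
have mk k : measurable_fun setT (fun x : R => x ^+ k) by exact: measurable_funX.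
have mc c : measurable_fun setT (fun x : R => cos (x + c)).
  apply: measurableT_comp; last exact: measurable_funD.
  by apply: continuous_measurable_fun => x; exact: continuous_cos.
case: gX => m [s [s0 law]].
have [s00|sn0] := eqVneq s 0.
  have law' B : measurable B -> P (X @^-1` B) = (\d_m : probability _ R) B.
    by move=> mB; rewrite law// s00 eqxx.
  have E f : measurable_fun setT f -> \int[P]_w f (X w) = f m.
    move=> mf; rewrite (Rintegral_law (Q := \d_m) mX law' mf) /Rintegral.
    have mf' : measurable_fun setT (fun x => (f x)%:E) by exact/measurable_EFinP.
    by rewrite integral_dirac// diracT mul1e.
  have m0 : m = 0 by rewrite -EX (E idfun)//; exact: measurable_id.
  have vE : v = 0 by rewrite /v (E (fun x => x ^+ 2))// m0 expr0n.
  split => //.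
  - move=> k; apply: (integrable_law (P := P) (Q := \d_m) mX law' (mk k)).2.
    apply/integrableP; split; first exact/measurable_EFinP.
    rewrite integral_dirac//; last by apply: measurableT_comp => //; exact/measurable_EFinP.
    by rewrite diracT mul1e ltry.
  - by move=> c; rewrite (E (fun x => cos (x + c)))// m0 add0r vE mul0r oppr0 expR0 mulr1.
  - by rewrite (E (fun x => x ^+ 4))// m0 vE !expr0n/= mulr0.
have law' B : measurable B -> P (X @^-1` B) = (normal_prob m s : probability _ R) B.
  by move=> mB; rewrite law// (negbTE sn0).
have E f : measurable_fun setT f -> \int[P]_w f (X w) =
    \int[lebesgue_measure]_x (f x * normal_pdf m s x).
  by move=> mf; rewrite (Rintegral_law (Q := normal_prob m s) mX law' mf) integral_normal.
have m0 : m = 0.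
  rewrite -EX (E idfun); last exact: measurable_id.
  transitivity (\int[lebesgue_measure]_x ((x - m) ^+ 1 * normal_pdf m s x +
    m * normal_pdf m s x)); last by apply: eq_Rintegral => x _ /=; ring.
  have i1 := integrable_normal_pdf m s.
  rewrite RintegralD//; [|exact: integrable_exprn_pdf|exact: integrable_EFinZl].
  by rewrite normal_moment1// RintegralZl// Rintegral_normal_pdf mulr1 add0r.
rewrite m0 {m0} in E law'.
have Ek k : \int[P]_w (X w ^+ k) =
    \int[lebesgue_measure]_x ((x - 0) ^+ k * normal_pdf 0 s x).
  by rewrite (E (fun x => x ^+ k))//; apply: eq_Rintegral => x _; rewrite subr0.
have vE : v = s ^+ 2 by rewrite /v Ek normal_moment_rec// normal_moment0 !mulr1.
split => //.
- move=> k; apply: (integrable_law (P := P) (Q := normal_prob 0 s) mX law' (mk k)).2.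
  apply: (integrable_normal 0 s (mk k)).2.
  have := integrable_exprn_pdf 0 sn0 k.
  by apply: eq_integrable => // x _ /=; rewrite subr0.
- move=> c; rewrite (E (fun x => cos (x + c)))// vE.
  rewrite -[in RHS](mulr1 (s ^+ 2)) -[X in s ^+ 2 * X](expr1n _ 2).
  rewrite -normal_cos_lebesgue//.
  by apply: eq_Rintegral => x _; rewrite mul1r.
- by rewrite Ek !normal_moment_rec// normal_moment0 vE; ring.
Qed.

End gaussian_variable.

Section independent_family.
Context d (T : measurableType d) (R : realType) (P : probability T R).
Context (J : finType) (xi : J -> T -> R) (Q : probability (measurableTypeR R) R).
Hypothesis mxi : forall j, measurable_fun setT (xi j).
Hypothesis iid : forall B : J -> set R, (forall j, measurable (B j)) ->
  P [set w | forall j, B j (xi j w)] = (\prod_j Q (B j))%E.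

Let mB_set (B : J -> set R) : (forall j, measurable (B j)) ->
  measurable [set w | forall j, B j (xi j w)].
Proof.
move=> mB; rewrite (_ : [set _ | _] = \bigcap_(j in [set: J]) (xi j @^-1` B j)).
  apply: fin_bigcap_measurable => // j _; rewrite -[_ @^-1` _]setTI; exact: mxi.
by apply/seteqP; split => w /= h j; [move=> _; exact: h|exact: h].
Qed.

Let prod_indicE (B : J -> set R) w :
  \prod_j (\1_(B j) (xi j w) : R) = \1_[set w | forall j, B j (xi j w)] w.
Proof.
rewrite [RHS]indicE; have [/set_mem/= h|h] := boolP (w \in _).
  by rewrite big1// => j _; rewrite indicE mem_set.
apply/eqP; rewrite prodf_seq_eq0; apply: contraNT h => /hasPn h.
apply/mem_set => j /=; have := h j; rewrite mem_index_enum => /(_ isT)/=.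
by rewrite indicE; have [/set_mem|_] := boolP (_ \in _); last by rewrite eqxx.
Qed.

Let Q_indic (B : set R) : measurable B -> \int[Q]_x (\1_B x : R) = fine (Q B).
Proof.
move=> mB; rewrite /Rintegral; congr fine.
by have := @integral_indic _ _ R Q setT measurableT B mB; rewrite setIT.
Qed.

(** One coordinate at a time passes from an indicator to its function. The generalised claim lets
    [g] be [f] on the coordinates in [s] and an indicator elsewhere; for empty [s] it is the
    hypothesis [iid]. *)
Lemma ge0_integral_prod_iid (f : J -> R -> R) :
  (forall j, measurable_fun setT (f j)) -> (forall j x, 0 <= f j x) ->
  (forall j, Q.-integrable setT (EFin \o f j)) ->
  P.-integrable setT (EFin \o (fun w => \prod_j f j (xi j w))) /\
  \int[P]_w (\prod_j f j (xi j w)) = \prod_j \int[Q]_x f j x.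
Proof.
move=> mf f0 if_.
suff H (s : seq J) : uniq s -> forall g : J -> R -> R,
    (forall j, j \in s -> g j = f j) ->
    (forall j, j \notin s -> exists2 B, measurable B & g j = \1_B) ->
    (\int[P]_w (\prod_j g j (xi j w))%:E = (\prod_j \int[Q]_x g j x)%:E)%E.
  have e := H (enum J) (enum_uniq _) f (fun _ _ => erefl).
  have {}e := e (fun j => ltac:(by rewrite mem_enum)).
  have ip : P.-integrable setT (EFin \o (fun w => \prod_j f j (xi j w))).
    apply/integrableP; split.
      apply/measurable_EFinP; apply: measurable_prod => j _.
      exact: measurableT_comp.
    under eq_integral do rewrite /= ger0_norm ?prodr_ge0//.
    by rewrite e ltry.
  by split => //; apply: EFin_inj; rewrite EFin_Rintegral.
elim: s => [|j s IH] /=.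
  move=> _ g _ hg.
  have hB j : {B : set R | measurable B /\ g j = \1_B}.
    by apply: cid; have [B mB ->] := hg j isT; exists B.
  pose B j := sval (hB j).
  have gE j : g j = \1_(B j) by have [] := svalP (hB j).
  have mB j : measurable (B j) by have [] := svalP (hB j).
  under eq_integral do (under eq_bigr do rewrite gE; rewrite prod_indicE).
  rewrite integral_indic//; last exact: mB_set.
  transitivity (\prod_j Q (B j))%E; first by rewrite setIT; exact: iid.
  rewrite -prodEFin; apply: eq_bigr => j _.
  by rewrite gE Q_indic//; apply/esym/fineK/fin_num_measure; exact: mB.
move=> /andP[js us] g gs gns.
pose Psi w := \prod_(i | i != j) g i (xi i w).
pose C := \prod_(i | i != j) \int[Q]_x g i x.
have mg i : measurable_fun setT (g i).
  have [iin|iin] := boolP (i \in j :: s); first by rewrite gs.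
  by have [B mB ->] := gns i iin; exact: measurable_indic.
have g0 i x : 0 <= g i x.
  have [iin|iin] := boolP (i \in j :: s); first by rewrite gs.
  by have [B mB ->] := gns i iin; rewrite indicE.
have mPsi : measurable_fun setT Psi.
  rewrite /Psi; under eq_fun do rewrite -big_filter.
  by apply: measurable_prod => i _; exact: measurableT_comp.
have Psi0 w : 0 <= Psi w by exact: prodr_ge0.
have C0 : 0 <= C by apply: prodr_ge0 => i _; exact: Rintegral_ge0.
have fact B : measurable B ->
    (\int[P]_(w in xi j @^-1` B) (Psi w)%:E = C%:E * Q B)%E.
  move=> mB; pose g' i := if i == j then \1_B else g i.
  have g's i : i \in s -> g' i = f i.
    move=> is_; rewrite /g'; case: eqP => [ij|_]; first by rewrite ij (negbTE js) in is_.
    by rewrite gs// inE is_ orbT.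
  have g'ns i : i \notin s -> exists2 B, measurable B & g' i = \1_B.
    move=> is_; rewrite /g'; case: eqP => [_|/eqP ij]; first by exists B.
    by apply: gns; rewrite inE negb_or ij.
  have := IH us g' g's g'ns.
  have split_prod (F G : (R -> R) -> J -> R) : (forall i, i != j -> F (g' i) i = G (g i) i) ->
      \prod_i F (g' i) i = F \1_B j * \prod_(i | i != j) G (g i) i.
    move=> FG; rewrite (bigD1 j)//=; congr (F _ _ * _); first by rewrite /g' eqxx.
    by apply: eq_bigr => i; exact: FG.
  rewrite (split_prod (fun h i => \int[Q]_x h x) (fun h i => \int[Q]_x h x)); last first.
    by move=> i /negbTE ij; rewrite /g' ij.
  rewrite Q_indic// EFinM fineK; last by apply: fin_num_measure.
  rewrite muleC => <-; rewrite integral_mkcond; apply: eq_integral => w _.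
  rewrite patchE (split_prod (fun h i => h (xi i w)) (fun h i => h (xi i w))); last first.
    by move=> i /negbTE ij; rewrite /g' ij.
  rewrite indicE.
  have -> : (w \in xi j @^-1` B) = (xi j w \in B) by apply/idP/idP => /set_mem h; apply/mem_set.
  by case: (_ \in _); rewrite ?mul1r ?mul0r.
have iPsi : P.-integrable setT (EFin \o Psi).
  apply/integrableP; split; first exact/measurable_EFinP.
  under eq_integral do rewrite /= ger0_norm//.
  have := fact setT measurableT; rewrite preimage_setT => ->.
  by rewrite lte_mul_pinfty// (le_lt_trans (probability_le1 _ _))// ltry.
have := ge0_factor_integral (Q := Q) (mxi j) iPsi Psi0 C0 fact
  (f := fun x => (g j x)%:E) _ _.
have mgj : measurable_fun setT (fun x => (g j x)%:E) by exact/measurable_EFinP.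
move=> /(_ mgj (fun x => ltac:(by rewrite lee_fin))) e.
have igj : Q.-integrable setT (EFin \o g j) by rewrite gs ?mem_head.
transitivity (C%:E * \int[Q]_x (g j x)%:E)%E.
  rewrite -e; apply: eq_integral => w _.
  by rewrite (bigD1 j)//= -EFinM mulrC.
by rewrite -EFin_Rintegral// -EFinM [in RHS](bigD1 j)//= mulrC.
Qed.

Hypothesis Qsym : forall t, \int[Q]_x sin (t * x) = 0.

(** Same passage from indicators to functions. Taking one coordinate out of the cosine leaves a
    cosine term and a sine term; the second integrates to 0 by [Qsym]. The sine of the remaining sum
    is a cosine with its phase advanced by pi/2, so one induction covers both. *)
Lemma Rintegral_cos_sum_iid (t : J -> R) c :
  \int[P]_w cos (\sum_j t j * xi j w + c) =
  cos c * \prod_j \int[Q]_x cos (t j * x).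
Proof.
pose e j := \int[Q]_x cos (t j * x).
have mPsi s c0 (B : J -> set R) (p : pred J) : (forall j, measurable (B j)) ->
    measurable_fun setT (fun w => cos (\sum_(j <- s) t j * xi j w + c0) *
      \prod_(j | p j) (\1_(B j) (xi j w) : R)).
  move=> mB; apply: measurable_funM.
    apply: measurableT_comp.
      by apply: continuous_measurable_fun => x; exact: continuous_cos.
    apply: measurable_funD => //; apply: measurable_sum => j.
    exact: measurable_funM.
  under eq_fun do rewrite -big_filter.
  by apply: measurable_prod => i _; exact: measurableT_comp.
have bPsi s c0 (B : J -> set R) (p : pred J) w : `|cos (\sum_(j <- s) t j * xi j w + c0) *
      \prod_(j | p j) (\1_(B j) (xi j w) : R)| <= 1.
  rewrite normrM mulr_ile1// ?cos_max// normr_prod.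
  apply: prodr_ile1 => j; rewrite indicE.
  by case: (_ \in _); rewrite ?normr1 ?normr0 ?lexx ?ler01.
suff H (s : seq J) : uniq s -> forall c0 (B : J -> set R),
    (forall j, measurable (B j)) ->
    \int[P]_w (cos (\sum_(j <- s) t j * xi j w + c0) *
      \prod_(j | j \notin s) \1_(B j) (xi j w)) =
    cos c0 * \prod_(j <- s) e j * \prod_(j | j \notin s) fine (Q (B j)).
  have := H (index_enum J) (index_enum_uniq _) c (fun=> setT) (fun=> measurableT).
  rewrite [X in _ * X](big_pred0 _ _ _ _); last by move=> j; rewrite mem_index_enum.
  rewrite mulr1 => <-; apply: eq_Rintegral => w _.
  by rewrite big_pred0 ?mulr1// => j; rewrite mem_index_enum.
elim: s => [|j s IH] /=.
  move=> _ c0 B mB.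
  under eq_Rintegral => w _.
    rewrite big_nil add0r prod_indicE; over.
  rewrite RintegralZl//; last exact: integrable_indic (mB_set mB).
  rewrite big_nil mulr1; congr (_ * _).
  rewrite /Rintegral integral_indic//; last exact: mB_set.
  transitivity (fine (\prod_j Q (B j))%E).
    by rewrite setIT; congr fine; exact: iid.
  rewrite (eq_bigr (fun j => (fine (Q (B j)))%:E)); last first.
    by move=> j _; rewrite fineK//; apply: fin_num_measure; exact: mB.
  by rewrite prodEFin.
move=> /andP[js us] c0 B mB.
pose Psi c0 w := cos (\sum_(j <- s) t j * xi j w + c0) *
  \prod_(i | i \notin j :: s) (\1_(B i) (xi i w) : R).
pose K c0 := cos c0 * \prod_(i <- s) e i * \prod_(i | i \notin j :: s) fine (Q (B i)).
have fact c1 D : measurable D ->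
    \int[P]_(w in xi j @^-1` D) Psi c1 w = K c1 * fine (Q D).
  move=> mD; pose B' i := if i == j then D else B i.
  have mB' i : measurable (B' i) by rewrite /B'; case: ifP.
  have := IH us c1 B' mB'.
  have pE (F G : J -> R) : (forall i, i != j -> F i = G i) ->
      \prod_(i | i \notin s) F i = F j * \prod_(i | i \notin j :: s) G i.
    move=> FG; rewrite (bigD1 j)//=; congr (_ * _); apply: eq_big => i.
      by rewrite inE negb_or andbC.
    by move=> /andP[_]; exact: FG.
  rewrite (pE _ (fun i => fine (Q (B i)))) => [|i /negbTE ij]; last by rewrite /B' ij.
  rewrite /B' eqxx => h.
  have -> : K c1 * fine (Q D) = cos c1 * \prod_(i <- s) e i *
      (fine (Q D) * \prod_(i | i \notin j :: s) fine (Q (B i))) by rewrite /K; ring.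
  rewrite -h Rintegral_mkcond; apply: eq_Rintegral => w _.
  rewrite patchE (pE _ (fun i => \1_(B i) (xi i w))) => [|i /negbTE ij]; last by rewrite ij.
  rewrite eqxx indicE /Psi.
  have -> : (w \in xi j @^-1` D) = (xi j w \in D) by apply/idP/idP => /set_mem h'; apply/mem_set.
  by case: (_ \in _); rewrite ?mul1r ?mul0r ?mulr0.
have mC (f : R -> R) : continuous f -> measurable_fun setT (fun x : R => f (t j * x)).
  move=> cf; apply: measurableT_comp; last exact: measurable_funM.
  by apply: continuous_measurable_fun => x; exact: cf.
have lawj D : measurable D -> P (xi j @^-1` D) = Q D.
  move=> mD; have := iid (B := fun i => if i == j then D else setT).
  rewrite (bigD1 j)//= eqxx big1 ?mule1; last first.
    by move=> i /negbTE ->; exact: probability_setT.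
  rewrite (_ : [set w | _] = xi j @^-1` D); last first.
    apply/seteqP; split => w /=; first by move=> /(_ j); rewrite eqxx.
    by move=> h i; case: eqP => [->|].
  by apply => i; case: ifP.
have mcos : measurable_fun setT (fun x : R => cos (t j * x)).
  by apply: mC; exact: continuous_cos.
have msin : measurable_fun setT (fun x : R => sin (t j * x)).
  by apply: mC; exact: continuous_sin.
have hc c1 := factor_integral (Q := Q) (mxi j) lawj (mPsi s c1 B [pred i | i \notin j :: s] mB)
  (bPsi s c1 B [pred i | i \notin j :: s]) mcos (fun x => cos_max _) (fact c1).
have hs c1 := factor_integral (Q := Q) (mxi j) lawj (mPsi s c1 B [pred i | i \notin j :: s] mB)
  (bPsi s c1 B [pred i | i \notin j :: s]) msin (fun x => sin_max _) (fact c1).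
rewrite big_cons.
transitivity (\int[P]_w (Psi c0 w * cos (t j * xi j w) +
    Psi (c0 + pi / 2) w * sin (t j * xi j w))).
  apply: eq_Rintegral => w _; rewrite /Psi big_cons addrA cosDpihalf.
  rewrite [X in cos X](_ : _ = (\sum_(i <- s) t i * xi i w + c0) + t j * xi j w).
    by rewrite cosD; ring.
  by ring.
have mxc (f : R -> R) : continuous f -> measurable_fun setT (fun w => f (t j * xi j w)).
  move=> cf; apply: measurableT_comp; last exact: measurable_funM.
  by apply: continuous_measurable_fun => x; exact: cf.
have ib (f : R -> R) c1 : continuous f -> (forall x, `|f x| <= 1) ->
    P.-integrable setT (EFin \o (fun w => Psi c1 w * f (t j * xi j w))).
  move=> cf f1; apply: (@integrable_bounded _ _ _ P _ 1).
    apply: measurable_funM; last exact: mxc.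
    exact: (mPsi s c1 B [pred i | i \notin j :: s] mB).
  move=> w; rewrite normrM mulr_ile1//.
  exact: (bPsi s c1 B [pred i | i \notin j :: s]).
rewrite RintegralD//; last 2 first.
- by apply: ib; [exact: continuous_cos|exact: cos_max].
- by apply: ib; [exact: continuous_sin|exact: sin_max].
rewrite hc hs Qsym mulr0 addr0 /K /e; ring.
Qed.

End independent_family.

(** * Relative entropy *)

Section integral_comparison.
Context d (T : measurableType d) (R : realType).
Variable mu : {measure set T -> \bar R}.

Lemma ae_le_integral (k h : T -> \bar R) :
  measurable_fun setT k -> measurable_fun setT h ->
  (mu.-integrable setT k \/ mu.-integrable setT h) ->
  {ae mu, forall x, (k x <= h x)%E} ->
  (\int[mu]_x k x <= \int[mu]_x h x)%E.
Proof.
move=> mk mh _ kh; rewrite [leLHS]integralE [leRHS]integralE.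
apply: leeB; apply: ae_ge0_le_integral => //; do ?[exact: measurable_funepos|exact: measurable_funeneg].
  apply: filterS kh => x kh _; rewrite !funeposE.
  by rewrite ge_max le_max kh/= le_max lexx orbT.
apply: filterS kh => x kh _; rewrite !funenegE.
by rewrite ge_max le_max leeN2 kh/= le_max lexx orbT.
Qed.

End integral_comparison.

(** Away from 0 the inverse is exp(- ln), whose measurability is known; the test at 0 matches the
    convention that 0 is its own inverse. *)
Lemma measurable_fun_inv_ge0 d (T : measurableType d) (R : realType) (g : T -> R) :
  measurable_fun setT g -> (forall x, 0 <= g x) ->
  measurable_fun setT (fun x => (g x)^-1).
Proof.
move=> mg g0.
rewrite (_ : (fun x => _) = (fun x => if g x == 0 then 0 else expR (- ln (g x)))).
  apply: measurable_fun_ifT => //; first exact: measurable_fun_eqr.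
  do 2 apply: measurableT_comp => //.
  by apply: measurableT_comp => //; exact: measurable_ln.
apply/funext => x; have [->|gx] := eqVneq (g x) 0; first by rewrite invr0.
by rewrite expRN lnK// posrE lt_def gx g0.
Qed.

Section relative_entropy.
Context d (T : measurableType d) (R : realType).
Variables nu mu : probability T R.

Lemma measurable_lne_EFin (g : T -> R) : measurable_fun setT g ->
  measurable_fun setT (fun x => lne (g x)%:E).
Proof.
move=> mg.
rewrite (_ : (fun x => _) = (fun x => if g x <= 0 then -oo%E else (ln (g x))%:E)).
  apply: measurable_fun_ifT => //.
    exact: measurable_fun_ler.
  by apply/measurable_EFinP; apply: measurableT_comp => //; exact: measurable_ln.
by apply/funext => x.
Qed.

(** The derivative agrees with [f] almost everywhere for [mu], hence for [nu] by domination, which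
    is all that an integral against [nu] sees. *)
Lemma relative_entropy_density (f : T -> R) :
  measurable_fun setT f -> (forall x, 0 <= f x) ->
  (forall E, measurable E -> nu E = (\int[mu]_(x in E) (f x)%:E)%E) ->
  relative_entropy nu mu = (\int[nu]_x lne (f x)%:E)%E.
Proof.
move=> mf f0 fE; have [numu ae] := density_ae mf f0 fE.
rewrite /relative_entropy asboolT//.
have aenu : ae_eq nu setT ('d (charge_of_finite_measure nu) '/d mu) (EFin \o f).
  exact: null_dominates_ae_eq ae.
have fin x : ('d (charge_of_finite_measure nu) '/d mu) x \is a fin_num.
  exact: Radon_Nikodym_fin_num.
apply: ae_eq_integral => //.
- rewrite (_ : (fun _ => _) = (fun x => lne (fine (('d (charge_of_finite_measure nu) '/d mu) x))%:E)).
    by apply: measurable_lne_EFin; apply: measurableT_comp.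
  by apply/funext => x; rewrite fineK.
- exact: measurable_lne_EFin.
- by apply: filterS aenu => x /(_ I) + _ => ->.
Qed.

(* The Donsker-Varadhan variational bound, without its logarithm. *)
Lemma relative_entropy_ge (g : T -> R) (C : R) :
  measurable_fun setT g -> (forall x, 0 < g x) ->
  nu.-integrable setT (EFin \o (@ln R \o g)) ->
  (\int[mu]_x (g x)%:E <= C%:E)%E ->
  ((\int[nu]_x ln (g x) + 1 - C)%:E <= relative_entropy nu mu)%E.
Proof.
move=> mg g0 ig gC.
have [numu|nnumu] := pselect (nu `<< mu); last first.
  by rewrite /relative_entropy asboolF// leey.
pose f0 := Radon_Nikodym_SigmaFinite.f nu mu.
have f00 : forall x, (0 <= f0 x)%E by exact: Radon_Nikodym_SigmaFinite.f_ge0.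
have f0fin x : f0 x \is a fin_num by exact: Radon_Nikodym_SigmaFinite.f_fin_num.
have if0 : mu.-integrable setT f0 by exact: Radon_Nikodym_SigmaFinite.f_integrable.
pose f x := fine (f0 x).
have mf : measurable_fun setT f.
  by apply: measurableT_comp => //; exact: measurable_int if0.
have f_ge0 x : 0 <= f x by exact: fine_ge0.
have fE E : measurable E -> nu E = (\int[mu]_(x in E) (f x)%:E)%E.
  move=> mE; rewrite (Radon_Nikodym_SigmaFinite.f_integral numu)//.
  by apply: eq_integral => x _; rewrite /f fineK.
rewrite (relative_entropy_density mf f_ge0 fE).
(* Off the zero set of [f], this is g/f; against [nu] the factor [f] cancels and the integral is at
   most that of [g] against [mu]. *)
pose h x := if f x == 0 then 0 else g x / f x.
have mh : measurable_fun setT h.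
  apply: measurable_fun_ifT => //; first exact: measurable_fun_eqr.
  by apply: measurable_funM => //; exact: measurable_fun_inv_ge0.
have h0 x : 0 <= h x by rewrite /h; case: ifP => // _; rewrite divr_ge0// ltW.
have hC : (\int[nu]_x (h x)%:E <= C%:E)%E.
  rewrite (ge0_integral_density mf f_ge0 fE)//; last exact/measurable_EFinP.
  apply: le_trans gC; apply: ge0_le_integral => //.
  - by move=> x _; rewrite mule_ge0// lee_fin.
  - by apply: emeasurable_funM; exact/measurable_EFinP.
  - exact/measurable_EFinP.
  - move=> x _; rewrite -EFinM lee_fin /h; case: ifPn => [_|fx]; first by rewrite mul0r ltW.
    by rewrite divfK.
have ih : nu.-integrable setT (EFin \o h).
  apply/integrableP; split; first exact/measurable_EFinP.
  under eq_integral do rewrite /= ger0_norm//.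
  by rewrite (le_lt_trans hC)// ltry.
have f_ae : {ae nu, forall x, f x != 0}.
  exists [set x | f x = 0]; split.
  - rewrite -[X in measurable X]setTI; apply: (mf measurableT [set 0]); exact: measurable_set1.
  - rewrite fE; last by rewrite -[X in measurable X]setTI; apply: (mf measurableT [set 0]); exact: measurable_set1.
    by rewrite (eq_integral (cst 0%E)) ?integral0// => x /set_mem/= ->.
  - by move=> x /= /negP; rewrite negbK => /eqP.
have ik : nu.-integrable setT (EFin \o (fun x => ln (g x) + 1 - h x)).
  apply: integrable_EFinB => //; apply: integrable_EFinD => //.
  exact: finite_measure_integrable_cst.
(* The inequality ln x <= x - 1 at x = g/f. It needs [f] to be nonzero, which holds almost
   everywhere for [nu]. *)
have : (\int[nu]_x (ln (g x) + 1 - h x)%:E <= \int[nu]_x lne (f x)%:E)%E.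
  apply: ae_le_integral.
  - by have /integrableP[] := ik.
  - exact: measurable_lne_EFin.
  - by left.
  - apply: filterS f_ae => x fx0.
    have fx : 0 < f x by rewrite lt_def fx0 f_ge0.
    rewrite lne_EFin// lee_fin /h (negbTE fx0).
    have := @le_ln1Dx R (g x / f x - 1); rewrite addrCA subrr addr0 => /(_ _).
    rewrite ltrBrDl subrr divr_gt0// => /(_ isT).
    rewrite ln_div ?posrE//; lra.
apply: le_trans.
rewrite -EFin_Rintegral// lee_fin RintegralB//; last first.
  by apply: integrable_EFinD => //; exact: finite_measure_integrable_cst.
rewrite RintegralD//; last exact: finite_measure_integrable_cst.
rewrite Rintegral_prob_cst lerD2l lerN2 -lee_fin EFin_Rintegral//.
Qed.

End relative_entropy.

(** * Mutual information of a channel with a density *)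

Section density_channel.
Context d1 (A : measurableType d1) d2 (B : measurableType d2) (R : realType).
Variables (mu : probability A R) (gamma : probability B R) (p : A * B -> R).
Hypotheses (mp : measurable_fun setT p) (p0 : forall x, 0 < p x).
Hypothesis pfin : forall y, (\int[mu]_z (p (z, y))%:E < +oo)%E.
Variables (nu : probability (A * B)%type R) (la : probability B R).
Hypothesis nuE : forall C, measurable C ->
  nu C = (\int[mu \x gamma]_(x in C) (p x)%:E)%E.
Hypothesis laE : forall E, measurable E -> la E = nu (setT `*` E).

Definition output_density (y : B) : R := fine (\int[mu]_z (p (z, y))%:E)%E.

Let mpE : measurable_fun setT (EFin \o p). Proof. exact/measurable_EFinP. Qed.
Let p_ge0 x : (0 <= (EFin \o p) x)%E. Proof. by rewrite lee_fin ltW. Qed.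

Lemma output_densityE y :
  (output_density y)%:E = (\int[mu]_z (p (z, y))%:E)%E.
Proof.
rewrite fineK// ge0_fin_numE//; apply: integral_ge0 => z _.
by rewrite lee_fin ltW.
Qed.

Lemma measurable_output_density : measurable_fun setT output_density.
Proof.
apply: measurableT_comp => //.
exact: (measurable_fun_fubini_tonelli_G (m1 := mu) _ mpE).
Qed.

(** If the integral of the positive [p] vanished, [p] would vanish almost everywhere and [mu] would
    have no mass. *)
Lemma output_density_gt0 y : 0 < output_density y.
Proof.
have mpy : measurable_fun setT (fun z => (p (z, y))%:E).
  exact: measurableT_comp mpE (measurable_pair2 y).
rewrite lt_def; apply/andP; split; last first.
  by apply: fine_ge0; apply: integral_ge0 => z _; rewrite lee_fin ltW.
apply/eqP => h.
have : (\int[mu]_z `|(p (z, y))%:E| = 0)%E.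
  under eq_integral do rewrite gee0_abs ?lee_fin ?ltW//.
  by rewrite -output_densityE h.
move/(ae_eq_integral_abs mu measurableT mpy).1 => [N [mN N0 subN]].
have : mu setT = 0%E.
  apply: (subset_measure0 _ _ _ N0) => // z _; apply: subN => /= /(_ I) /eqP.
  by rewrite eqe gt_eqF.
by rewrite probability_setT => /eqP; rewrite onee_eq0.
Qed.

Lemma output_law E : measurable E ->
  la E = (\int[gamma]_(y in E) (output_density y)%:E)%E.
Proof.
move=> mE; rewrite laE// nuE; last exact: measurableX.
rewrite integral_mkcond.
have mpE' : measurable_fun setT ((EFin \o p) \_ (setT `*` E)).
  by apply/(measurable_restrictT _ _).1; [exact: measurableX|exact: measurable_funTS].
rewrite (fubini_tonelli2 (m1 := mu) (m2 := gamma))//; last first.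
  by move=> x; rewrite patchE; case: ifP => // _; rewrite lee_fin ltW.
rewrite [RHS]integral_mkcond; apply: eq_integral => y _.
rewrite patchE /fubini_G; case: ifPn => yE.
  rewrite output_densityE; apply: eq_integral => z _.
  by rewrite patchE ifT//; apply/mem_set; split => //; exact: set_mem.
rewrite integral0_eq// => z _; rewrite patchE ifF//.
by apply: contraNF yE => /set_mem[_ /= ?]; exact/mem_set.
Qed.

Lemma integral_output (f : B -> \bar R) : measurable_fun setT f ->
  (forall y, (0 <= f y)%E) ->
  (\int[la]_y f y = \int[gamma]_y (f y * (output_density y)%:E))%E.
Proof.
move=> mf f0; apply: ge0_integral_density => //; first exact: measurable_output_density.
- by move=> y; exact/ltW/output_density_gt0.
- exact: output_law.
Qed.

(** Its logarithm is the information density, whose mean under the joint law is the mutual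
    information. *)
Definition information_ratio (x : A * B) : R := p x / output_density x.2.

Lemma information_ratio_gt0 x : 0 < information_ratio x.
Proof. by rewrite divr_gt0// output_density_gt0. Qed.

Lemma measurable_information_ratio : measurable_fun setT information_ratio.
Proof.
apply: measurable_funM => //; apply: measurable_fun_inv_ge0.
- by apply: measurableT_comp => //; exact: measurable_output_density.
- by move=> x; exact/ltW/output_density_gt0.
Qed.

Lemma joint_density C : measurable C ->
  nu C = (\int[mu \x la]_(x in C) (information_ratio x)%:E)%E.
Proof.
move=> mC; rewrite nuE// integral_mkcond [RHS]integral_mkcond.
have mr f : measurable_fun setT f -> measurable_fun setT ((EFin \o (f : (A * B)%type -> R)) \_ C).
  by move=> mf; apply/(measurable_restrictT _ _).1 => //; apply: measurable_funTS; exact/measurable_EFinP.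
have m1 := mr _ mp; have m2 := mr _ measurable_information_ratio.
have ge1 f : (forall x : A * B, 0 < f x) -> forall x, (0 <= ((EFin \o f) \_ C) x)%E.
  by move=> f0 x; rewrite patchE; case: ifP => // _; rewrite lee_fin ltW.
rewrite (fubini_tonelli1 (m1 := mu) (m2 := gamma))//; last exact: ge1.
rewrite (fubini_tonelli1 (m1 := mu) (m2 := la))//; last exact: ge1 information_ratio_gt0.
apply: eq_integral => z _; rewrite /fubini_F.
rewrite integral_output; last 2 first.
- exact: measurableT_comp m2 (measurable_pair1 z).
- by move=> y; exact: ge1 information_ratio_gt0 (z, y).
apply: eq_integral => y _; rewrite !patchE; case: ifP => _; last by rewrite mul0e.
by rewrite -EFinM/= /information_ratio divfK// gt_eqF// output_density_gt0.
Qed.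

Lemma information_formula :
  relative_entropy nu (mu \x la)%E = (\int[nu]_x (ln (information_ratio x))%:E)%E.
Proof.
rewrite (relative_entropy_density measurable_information_ratio _ joint_density).
  by apply: eq_integral => x _; rewrite lne_EFin// information_ratio_gt0.
by move=> x; exact/ltW/information_ratio_gt0.
Qed.

(* Gibbs' inequality: replacing the output law by any other one can only
   increase the mean log-likelihood ratio. *)
Lemma information_le (q : B -> R) : measurable_fun setT q -> (forall y, 0 < q y) ->
  (\int[gamma]_y (q y)%:E <= 1)%E ->
  nu.-integrable setT (EFin \o (fun x => ln (p x / q x.2))) ->
  (relative_entropy nu (mu \x la) <= (\int[nu]_x ln (p x / q x.2))%:E)%E.
Proof.
move=> mq q0 q1 iq; rewrite information_formula.
(* Reference density over true output density. Its mean is at most the [gamma]-integral of [q],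
   hence at most 1, so ln r <= r - 1 has a nonpositive mean on the right: this is the price of the
   replacement. *)
pose r (x : A * B) := q x.2 / output_density x.2.
have r0 x : 0 < r x by rewrite divr_gt0// output_density_gt0.
pose s (y : B) := q y / output_density y.
have ms : measurable_fun setT s.
  apply: measurable_funM => //; apply: measurable_fun_inv_ge0.
  - exact: measurable_output_density.
  - by move=> y; exact/ltW/output_density_gt0.
have mr : measurable_fun setT r by exact: (measurableT_comp ms measurable_snd).
have s0 y : 0 < s y by rewrite divr_gt0// output_density_gt0.
have ir1 : (\int[nu]_x (r x)%:E <= 1)%E.
  have e : (\int[nu]_x (r x)%:E = \int[la]_y (s y)%:E)%E.
    apply: (@integral_law _ _ _ _ _ nu la snd _ _ (fun y => (s y)%:E)) => //.
    - by move=> E mE; rewrite laE// setTX.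
    - exact/measurable_EFinP.
    - by move=> y; rewrite lee_fin ltW.
  rewrite e integral_output//; [|exact/measurable_EFinP|by move=> y; rewrite lee_fin ltW].
  apply: le_trans q1; rewrite le_eqVlt; apply/orP; left; apply/eqP.
  apply: eq_integral => y _; rewrite -EFinM /s divfK// gt_eqF//.
  exact: output_density_gt0.
have ir : nu.-integrable setT (EFin \o r).
  apply/integrableP; split; first exact/measurable_EFinP.
  under eq_integral do rewrite /= ger0_norm ?(ltW (r0 _))//.
  by rewrite (le_lt_trans ir1)// ltry.
have ik : nu.-integrable setT (EFin \o (fun x => ln (p x / q x.2) + (r x - 1))).
  apply: integrable_EFinD => //; apply: integrable_EFinB => //.
  exact: finite_measure_integrable_cst.
apply: (@le_trans _ _ (\int[nu]_x (ln (p x / q x.2) + (r x - 1))%:E)%E).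
  apply: ae_le_integral.
  - apply/measurable_EFinP; apply: measurableT_comp; first exact: measurable_ln.
    exact: measurable_information_ratio.
  - by have /integrableP[] := ik.
  - by right.
  - apply: aeW => x; rewrite lee_fin.
    have -> : information_ratio x = (p x / q x.2) * r x.
      rewrite /information_ratio /r; field.
      by rewrite !gt_eqF// output_density_gt0.
    have -> : ln (p x / q x.2 * r x) = ln (p x / q x.2) + ln (r x).
      by rewrite lnM ?posrE// divr_gt0.
    rewrite lerD2l.
    by have := @le_ln1Dx R (r x - 1); rewrite addrCA subrr addr0; apply; rewrite ltrBrDl subrr.
rewrite -EFin_Rintegral// lee_fin RintegralD//; last first.
  by apply: integrable_EFinB => //; exact: finite_measure_integrable_cst.
rewrite RintegralB//; last exact: finite_measure_integrable_cst.
rewrite Rintegral_prob_cst gerDl subr_le0 -lee_fin EFin_Rintegral//.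
Qed.

End density_channel.

(** * Normal laws under affine maps *)

Section affine_normal.
Variable R : realType.
Local Notation leb := (@lebesgue_measure R).

Lemma normal_pdf_affine (s a b x : R) : s != 0 -> 0 < a ->
  normal_pdf 0 s ((x - b) / a) * a^-1 = normal_pdf b (a * s) x.
Proof.
move=> s0 a0; have as0 : a * s != 0 by rewrite mulf_neq0// (lt0r_neq0 a0).
rewrite !normal_pdf_expR// mulrAC; congr (_ * _).
  rewrite /normal_peak -invfM; congr (_^-1).
  rewrite (_ : (a * s) ^+ 2 * pi *+ 2 = a ^+ 2 * (s ^+ 2 * pi *+ 2)); last by ring.
  by rewrite sqrtrM ?sqr_ge0// sqrtr_sqr gtr0_norm// mulrC.
congr expR; field.
by rewrite s0 gt_eqF.
Qed.

(** Half-lines determine a law on the line, by [law_unique_orthant] with a single coordinate; on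
    them the claim is the substitution x -> (x - b)/a. *)
Lemma normal_prob_affine (s a b : R) : s != 0 -> 0 < a -> forall B : set R,
  measurable B ->
  normal_prob 0 s ((fun x : R => a * x + b) @^-1` B) = normal_prob b (a * s) B.
Proof.
move=> s0 a0 B mB; have an0 : a != 0 by rewrite gt_eqF.
have mF : measurable_fun setT (fun x : R => a * x + b).
  by apply: measurable_funD => //; exact: measurable_funM.
have := @law_unique_orthant R unit _ (measurableTypeR R) (normal_prob 0 s)
  _ (measurableTypeR R) (normal_prob b (a * s)) _ (measurableTypeR R)
  (fun _ x => x) (fun _ => @measurable_id _ _ _) _ (fun x => a * x + b) idfun
  mF (@measurable_id _ _ _).
apply => //; first by move=> d1 S f /(_ tt).
move=> c; pose g x : R := (x - b) / a.
have dg (x : R) : is_derive x 1 g a^-1.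
  apply: (@is_derive1_eq _ _ _ (a^-1 *: (1 - 0))); last by rewrite subr0 scaler1.
  rewrite (_ : g = (a^-1 \*: (id \- cst b))); last first.
    by apply/funext => y; rewrite /g /= mulrC.
  by apply: is_deriveZ.
have g' : derive1 g = cst a^-1.
  by apply/funext => x; rewrite derive1E; have [_ ->] := dg x.
have cg : continuous g.
  by move=> x; apply/differentiable_continuous/derivable1_diffP; have [] := dg x.
transitivity (\int[leb]_(x in `[g (c tt), +oo[) (normal_pdf 0 s x)%:E)%E.
  rewrite /normal_prob; congr (integral _ _ _); apply/seteqP; split => x /=.
    by move=> /(_ tt); rewrite in_itv/= andbT ler_pdivrMr// => h; rewrite mulrC; lra.
  by rewrite in_itv/= andbT ler_pdivrMr// => h [] ; rewrite mulrC in h; lra.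
rewrite increasing_ge0_integration_by_substitutiony; first last.
- by move=> x _; exact: normal_pdf_ge0.
- by apply: continuous_subspaceT; exact: continuous_normal_pdf.
- apply/cvgryPge => A; near=> x.
  by rewrite /g ler_pdivlMr// lerBrDr; near: x; apply: nbhs_pinfty_ge; rewrite num_real.
- split; last by apply: cvg_at_right_filter; exact: cg.
  by move=> x _; have [] := dg x.
- by rewrite g'; exact: is_cvg_cst.
- by rewrite g'; exact: is_cvg_cst.
- by rewrite g' => x _; exact: cvg_cst.
- by move=> x y _ _ xy; rewrite /g ltr_pM2r ?invr_gt0// ltrD2r.
rewrite /normal_prob [LHS](_ : _ = \int[leb]_(x in `[c tt, +oo[) (normal_pdf b (a * s) x)%:E)%E; last first.
  apply: eq_integral => x _; congr EFin.
  by rewrite -normal_pdf_affine// g'.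
congr (integral _ _ _); apply/seteqP; split => x /=.
  by rewrite in_itv/= andbT => h [].
by move=> /(_ tt); rewrite in_itv/= andbT.
Unshelve. all: by end_near.
Qed.

(* The density of N(b, a^2/2) with respect to N(0, 1/2). *)
Definition affine_density (a b y : R) : R :=
  a^-1 * expR (y ^+ 2 - ((y - b) / a) ^+ 2).

Lemma affine_density_gt0 a b y : 0 < a -> 0 < affine_density a b y.
Proof. by move=> a0; rewrite mulr_gt0 ?invr_gt0 ?expR_gt0. Qed.

Lemma measurable_affine_density a b : measurable_fun setT (affine_density a b).
Proof.
apply: measurable_funM => //; apply: measurableT_comp => //.
apply: measurable_funB; first exact: measurable_funX.
apply: measurable_funX; apply: measurable_funM => //.
exact: measurable_funB.
Qed.

Variable s : R.
Hypothesis s2 : s ^+ 2 *+ 2 = 1.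

Let s0 : s != 0.
Proof. by apply/eqP => s0; move/eqP: s2; rewrite s0 expr0n/= mul0rn eq_sym oner_eq0. Qed.

(** With s^2 = 1/2, the variance of each real part of a unit complex normal variable, the exponent
    of the centred density is exactly - x^2. This is why no constant appears in [affine_density]. *)
Lemma affine_densityE a b x : 0 < a ->
  affine_density a b x * normal_pdf 0 s x = normal_pdf b (a * s) x.
Proof.
move=> a0; rewrite -normal_pdf_affine// !normal_pdf_expR// s2 !divr1 !subr0.
rewrite /affine_density.
transitivity (normal_peak s * (expR (x ^+ 2 - ((x - b) / a) ^+ 2) * expR (- x ^+ 2)) * a^-1).
  by ring.
by rewrite -expRD addrAC subrr add0r.
Qed.

Lemma normal_affine_density a b : 0 < a -> forall B : set R, measurable B ->
  normal_prob 0 s ((fun x : R => a * x + b) @^-1` B) =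
  (\int[normal_prob 0 s]_(x in B) (affine_density a b x)%:E)%E.
Proof.
move=> a0 B mB; rewrite normal_prob_affine// integral_mkcond.
have mf : measurable_fun setT ((EFin \o affine_density a b) \_ B).
  apply/(measurable_restrictT _ mB)/measurable_funTS/measurable_EFinP.
  exact: measurable_affine_density.
have f0 x : (0 <= ((EFin \o affine_density a b) \_ B) x)%E.
  by rewrite patchE; case: ifP => // _; rewrite lee_fin ltW// affine_density_gt0.
rewrite (@ge0_integral_density _ _ R (normal_prob 0 s) leb (normal_pdf 0 s)
  (measurable_normal_pdf 0 s) (normal_pdf_ge0 0 s) (fun E mE => erefl))//.
rewrite /normal_prob integral_mkcond; apply: eq_integral => x _.
by rewrite !patchE; case: ifP => _; rewrite ?mul0e//= -EFinM affine_densityE.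
Qed.

Lemma Rintegral_affine_density a b : 0 < a ->
  (normal_prob 0 s).-integrable setT (EFin \o affine_density a b) /\
  \int[normal_prob 0 s]_x affine_density a b x = 1.
Proof.
move=> a0; have h := normal_affine_density b a0 measurableT.
have {h} h : (\int[normal_prob 0 s]_x (affine_density a b x)%:E = 1)%E.
  by rewrite -h; exact: probability_setT.
split; last by rewrite /Rintegral h.
apply/integrableP; split; first by apply/measurable_EFinP; exact: measurable_affine_density.
under eq_integral do rewrite /= ger0_norm ?(ltW (affine_density_gt0 _ _ a0))//.
by rewrite h ltry.
Qed.

End affine_normal.

Section affine_family.
Context d (T : measurableType d) (R : realType) (P : probability T R).
Context (J : finType) (xi : J -> T -> R) (s : R).
Hypothesis s2 : s ^+ 2 *+ 2 = 1.
Hypothesis mxi : forall j, measurable_fun setT (xi j).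
Hypothesis iid : forall B : J -> set R, (forall j, measurable (B j)) ->
  P [set w | forall j, B j (xi j w)] = (\prod_j normal_prob 0 s (B j))%E.
Context d0 (D : measurableType d0) (pi : J -> D -> R).
Hypothesis mpi : forall j, measurable_fun setT (pi j).
Hypothesis gen : forall d1 (S : measurableType d1) (f : S -> D),
  (forall j, measurable_fun setT (pi j \o f)) -> measurable_fun setT f.
Variables (F G : T -> D) (a b : J -> R).
Hypothesis a0 : forall j, 0 < a j.
Hypothesis piF : forall j w, pi j (F w) = xi j w.
Hypothesis piG : forall j w, pi j (G w) = a j * xi j w + b j.

Let mF : measurable_fun setT F.
Proof.
by apply: gen => j; rewrite (_ : _ \o _ = xi j)//; apply/funext => w; exact: piF.
Qed.

Let mG : measurable_fun setT G.
Proof.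
apply: gen => j; rewrite (_ : _ \o _ = fun w => a j * xi j w + b j).
  by apply: measurable_funD => //; exact: measurable_funM.
by apply/funext => w; exact: piG.
Qed.

Let g w := \prod_j affine_density (a j) (b j) (xi j w).

Let g0 w : 0 <= g w.
Proof. by apply: prodr_ge0 => j _; rewrite ltW// affine_density_gt0. Qed.

Let ig : P.-integrable setT (EFin \o g) /\ \int[P]_w g w = 1.
Proof.
have [ig ->] := ge0_integral_prod_iid (Q := normal_prob 0 s) mxi iid
  (fun j => measurable_affine_density (a j) (b j))
  (fun j x => ltW (affine_density_gt0 (b j) x (a0 j)))
  (fun j => (Rintegral_affine_density s2 (b j) (a0 j)).1).
split => //; rewrite big1// => j _.
by have [_ ->] := Rintegral_affine_density s2 (b j) (a0 j).
Qed.

Let gT : density_measure ig.1 g0 setT = 1%E.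
Proof.
rewrite /density_measure -EFin_Rintegral//; last exact: ig.1.
by rewrite ig.2.
Qed.

(** The sample space reweighted by the product density [g]. The density formula then compares two
    laws: that of [G] under [P] and that of [F] under [P']. *)
Let P' : probability T R :=
  HB.pack (density_measure ig.1 g0) (Measure_isProbability.Build _ _ _ _ gT).

(** It is enough to look at boxes, where independence splits both sides into one-dimensional
    factors, each given by [normal_affine_density]. *)
Lemma affine_family_density E : measurable E ->
  P (G @^-1` E) = (\int[P]_(w in F @^-1` E) (g w)%:E)%E.
Proof.
move: E; apply: (law_unique_box (P' := P') mpi gen mG mF) => B mB.
transitivity (P [set w | forall j, ((fun x : R => a j * x + b j) @^-1` B j) (xi j w)]).
  congr (P _); apply/seteqP; split => w /= h j; have := h j; by rewrite piG.
have mfx j : measurable_fun setT (fun x : R => a j * x + b j).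
  by apply: measurable_funD => //; exact: measurable_funM.
transitivity (\prod_j normal_prob 0 s ((fun x : R => (a j * x + b j)%R) @^-1` B j))%E.
  by apply: iid => j; rewrite -[_ @^-1` _]setTI; exact: mfx.
have mBi j : measurable_fun setT (\1_(B j) : R -> R).
  exact: measurable_indic.
have hj j := normal_affine_density s2 (b j) (a0 j) (mB j).
have ifj j : (normal_prob 0 s).-integrable setT
    (EFin \o (fun x : R => affine_density (a j) (b j) x * \1_(B j) x)).
  have [i1 _] := Rintegral_affine_density s2 (b j) (a0 j).
  apply: le_integrable_EFin i1 => //.
    apply: measurable_funM; first exact: measurable_affine_density.
    exact: mBi.
  by move=> x _; rewrite normrM indicE; case: (_ \in _); rewrite ?normr1 ?mulr1// normr0 mulr0.
have mfj j : measurable_fun setT (fun x : R => affine_density (a j) (b j) x * \1_(B j) x).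
  apply: measurable_funM; first exact: measurable_affine_density.
  exact: mBi.
have fj0 j (x : R) : 0 <= affine_density (a j) (b j) x * \1_(B j) x.
  by rewrite mulr_ge0 ?indicE// ltW// affine_density_gt0.
have [ip ep] := ge0_integral_prod_iid (Q := normal_prob 0 s) mxi iid mfj fj0 ifj.
transitivity (\int[P]_w (\prod_j (affine_density (a j) (b j) (xi j w) * \1_(B j) (xi j w))))%:E.
  rewrite ep -prodEFin; apply: eq_bigr => j _; rewrite hj EFin_Rintegral//.
  rewrite [LHS]integral_mkcond; apply: eq_integral => x _.
  by rewrite patchE indicE; case: (_ \in _); rewrite ?mulr1 ?mulr0.
rewrite EFin_Rintegral// /P' /density_measure [RHS]integral_mkcond.
apply: eq_integral => w _; rewrite patchE big_split/=.
have [/set_mem/= h|h] := boolP (w \in _).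
  rewrite [X in _ * X]big1 ?mulr1// => j _; rewrite indicE mem_set//.
  by have := h j; rewrite piF.
rewrite [X in _ * X](_ : _ = 0) ?mulr0//.
apply/eqP; rewrite prodf_seq_eq0; apply: contraNT h => /hasPn h.
apply/mem_set => j /=; have := h j; rewrite mem_index_enum => /(_ isT)/=.
by rewrite indicE piF; have [/set_mem|_] := boolP (_ \in _); last by rewrite eqxx.
Qed.

End affine_family.

(** * Complex normal families *)


Section complex_tools.
Variable R : realType.
Implicit Types z : R[i].

Lemma Re_sum I (r : seq I) (p : pred I) (F : I -> R[i]) :
  Re (\sum_(i <- r | p i) F i) = \sum_(i <- r | p i) Re (F i).
Proof. exact: (raddf_sum (@Re R : Rcomplex R -> R)). Qed.

Lemma ReD z z' : Re (z + z') = Re z + Re z'.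
Proof. by case: z z' => ? ? []. Qed.

Lemma ImD z z' : Im (z + z') = Im z + Im z'.
Proof. by case: z z' => ? ? []. Qed.

Lemma ReM z z' : Re (z * z') = Re z * Re z' - Im z * Im z'.
Proof. by case: z z' => ? ? []. Qed.

Lemma ImM z z' : Im (z * z') = Re z * Im z' + Im z * Re z'.
Proof. by case: z z' => ? ? []. Qed.

Lemma ReC z : Re z^* = Re z. Proof. by case: z. Qed.

Lemma ImC z : Im z^* = - Im z. Proof. by case: z. Qed.

Lemma sqr_normcE z : normc z ^+ 2 = Re z ^+ 2 + Im z ^+ 2.
Proof. by case: z => x y; rewrite /= sqr_sqrtr// addr_ge0 ?sqr_ge0. Qed.

Lemma normc_ge0 z : 0 <= normc z.
Proof. by case: z => x y; rewrite /= sqrtr_ge0. Qed.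

Lemma normcJ_real z : normc z^* = normc z.
Proof. by case: z => x y; rewrite /= sqrrN. Qed.

Lemma mul_conjc z : z * z^* = (normc z ^+ 2)%:C.
Proof.
by rewrite sqr_normcE; apply/eqP; rewrite eq_complex ReM ImM ReC ImC /=; apply/andP; split; apply/eqP; ring.
Qed.

Lemma conjcM z z' : (z * z')^* = z^* * z'^*.
Proof. exact: rmorphM. Qed.

Lemma conjc_sum I (r : seq I) (p : pred I) (F : I -> R[i]) :
  (\sum_(i <- r | p i) F i)^* = \sum_(i <- r | p i) (F i)^*.
Proof. exact: rmorph_sum. Qed.

Lemma ReZ (a : R) z : Re (a%:C * z) = a * Re z.
Proof. by rewrite ReM /= mul0r subr0. Qed.

Lemma ImZ (a : R) z : Im (a%:C * z) = a * Im z.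
Proof. by rewrite ImM /= mul0r addr0. Qed.

Lemma complex_ext z z' : Re z = Re z' -> Im z = Im z' -> z = z'.
Proof. by case: z z' => ? ? [? ?] /= -> ->. Qed.

End complex_tools.

Section spectral.
Variable R : realType.
Variable J : finType.

Definition cform (c x : J -> R[i]) : R := Re (\sum_j c j * x j).

(** For the covariance [K] of a family this is the mean of |sum_j c_j X_j|^2, as [cquad_covariance]
    shows. *)
Definition cquad (K : J -> J -> R[i]) (c : J -> R[i]) : R :=
  Re (\sum_i \sum_j c i * K i j * (c j)^*).

Let n := #|J|.
Let ev : 'I_n -> J := @enum_val J predT.
Let er : J -> 'I_n := @enum_rank J.

Let evK i : er (ev i) = i.
Proof. exact: enum_valK. Qed.

Let erK j : ev (er j) = j.
Proof. exact: enum_rankK. Qed.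

Let sumE (F : J -> R[i]) : \sum_j F j = \sum_(i < n) F (ev i).
Proof. by apply: reindex; exists er => ? _; rewrite ?evK ?erK. Qed.

Let sumR (F : J -> R) : \sum_j F j = \sum_(i < n) F (ev i).
Proof. by apply: reindex; exists er => ? _; rewrite ?evK ?erK. Qed.

(** The spectral theorem for matrices, carried to a finite index type by enumeration. The rows of
    [U] are orthonormal and [A] is the conjugate transpose of [U], times the diagonal, times [U];
    the last clause computes the trace of A^2 in two bases. It diagonalises both the divergence of
    the output and the quadratic form of the noise. *)
Lemma hermitian_spectral (A : J -> J -> R[i]) :
  (forall i j, A i j = (A j i)^*) ->
  exists (U : J -> J -> R[i]) (lam : J -> R),
  [/\ forall k, lam k = cquad A (U k),
      forall i j, \sum_k (U k i)^* * U k j = (i == j)%:R,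
      forall k m, \sum_i U k i * (U m i)^* = (k == m)%:R,
      forall i j, A i j = \sum_k (U k i)^* * (lam k)%:C * U k j &
      \sum_k lam k ^+ 2 = \sum_i \sum_j normc (A i j) ^+ 2].
Proof.
move=> hA.
pose M : 'M[R[i]]_n := \matrix_(i, j) A (ev i) (ev j).
have hM : M \is hermsymmx.
  apply/is_hermitianmxP; rewrite expr0 scale1r; apply/matrixP => i j.
  by rewrite !mxE hA.
pose Q := spectralmx M; pose D := spectral_diag M.
have uQ : Q \is unitarymx by exact: spectral_unitarymx.
have iQ : invmx Q = (map_mx Num.conj Q^T) by exact: invmx_unitary.
have ME : M = (map_mx Num.conj Q^T) *m diag_mx D *m Q.
  by rewrite -iQ; apply/orthomx_spectralP/hermitian_normalmx.
have Dr k : D 0 k = (Re (D 0 k))%:C.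
  have /mxOverP/(_ 0 k) := hermitian_spectral_diag_real hM.
  by move/RRe_real => ->.
have QQ : Q *m (map_mx Num.conj Q^T) = 1%:M by exact/unitarymxP.
have QQ' : (map_mx Num.conj Q^T) *m Q = 1%:M by rewrite -iQ mulVmx// spectral_unit.
pose U k i := Q (er k) (er i).
pose lam k := Re (D 0 (er k)).
have U1 i j : \sum_k (U k i)^* * U k j = (i == j)%:R.
  have := congr1 (fun X : 'M[R[i]]_n => X (er i) (er j)) QQ'.
  rewrite !mxE (inj_eq enum_rank_inj) => <-; rewrite sumE.
  by apply: eq_bigr => k _; rewrite !mxE /U evK.
have U2 k m : \sum_i U k i * (U m i)^* = (k == m)%:R.
  have := congr1 (fun X : 'M[R[i]]_n => X (er k) (er m)) QQ.
  rewrite !mxE (inj_eq enum_rank_inj) => <-; rewrite sumE.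
  by apply: eq_bigr => i _; rewrite !mxE /U evK.
have AE i j : A i j = \sum_k (U k i)^* * (lam k)%:C * U k j.
  have := congr1 (fun X : 'M[R[i]]_n => X (er i) (er j)) ME.
  rewrite !mxE !erK => ->; rewrite sumE; apply: eq_bigr => k _.
  rewrite mul_mx_diag !mxE /U /lam evK; congr (_ * _ * _); exact: Dr.
exists U, lam; split => //.
- move=> k; rewrite /cquad (_ : \sum_i \sum_j _ = (lam k)%:C)//.
  transitivity (\sum_m (\sum_i U k i * (U m i)^*) * (lam m)%:C * (\sum_j U m j * (U k j)^*)).
    rewrite (eq_bigr (fun i => \sum_m U k i * (U m i)^* * (lam m)%:C * (\sum_j U m j * (U k j)^*))); last first.
      move=> i _; under [RHS]eq_bigr do rewrite mulr_sumr.
      rewrite exchange_big/=; apply: eq_bigr => j _.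
      rewrite AE mulr_sumr mulr_suml; apply: eq_bigr => m _; ring.
    rewrite exchange_big/=; apply: eq_bigr => m _.
    by rewrite !mulr_suml.
  rewrite (bigD1 k)//= !U2 eqxx mul1r mulr1 big1 ?addr0// => m /negbTE mk.
  by rewrite U2 eq_sym mk !mul0r.
- apply: (@complexI R); rewrite !rmorph_sum/=.
  transitivity (\sum_i \sum_j A i j * A j i); last first.
    apply: eq_bigr => i _; rewrite rmorph_sum; apply: eq_bigr => j _.
    by rewrite [A j i]hA mul_conjc.
  transitivity (\sum_k \sum_m (lam k)%:C * (lam m)%:C * ((\sum_j U k j * (U m j)^*) * (\sum_i U m i * (U k i)^*))).
    apply: eq_bigr => k _; rewrite (bigD1 k)//= !U2 eqxx mul1r mulr1 big1 ?addr0.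
      by rewrite rmorphXn.
    by move=> m /negbTE mk; rewrite !U2 eq_sym mk !mul0r mulr0.
  transitivity (\sum_i \sum_j \sum_k \sum_m (lam k)%:C * (lam m)%:C * ((U k j * (U m j)^*) * (U m i * (U k i)^*))).
    rewrite [RHS]exchange_big/=.
    under eq_bigr => k _.
      under eq_bigr => m _.
        rewrite big_distrlr/= mulr_sumr; under eq_bigr do rewrite mulr_sumr; over.
      rewrite exchange_big/=; over.
    rewrite exchange_big/=; apply: eq_bigr => j _.
    under eq_bigr => k _ do rewrite exchange_big/=.
    by rewrite exchange_big.
  apply: eq_bigr => i _; apply: eq_bigr => j _; rewrite !AE mulr_suml.
  apply: eq_bigr => k _; rewrite mulr_sumr; apply: eq_bigr => m _; ring.
Qed.

End spectral.



Section complex_normal.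
Context (R : realType) (J : finType).

(* Characteristic function of the proper complex normal law with zero mean and
   covariance K i j = E[X_i X_j^*]: the variance of Re (\sum_j c_j X_j) is half of
   c K c^*. *)
Definition cnormal d (T : measurableType d) (P : probability T R)
    (X : J -> T -> R[i]) (K : J -> J -> R[i]) : Prop :=
  (forall j, measurable_fun setT (X j)) /\
  forall (c : J -> R[i]) theta,
    \int[P]_w cos (cform c (X^~ w) + theta) = cos theta * expR (- (cquad K c / 4)).

Lemma measurable_cform d (T : measurableType d) (X : J -> T -> R[i]) c :
  (forall j, measurable_fun setT (X j)) ->
  measurable_fun setT (fun w => cform c (X^~ w)).
Proof.
move=> mX; apply: (measurableT_comp (@measurable_Re R)).
apply: measurable_sumc => j; apply: measurable_funMc; last exact: mX.
exact: measurable_cst.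
Qed.

End complex_normal.

(** A linear form of the images is a linear form of [X], with coefficients [c] multiplied by [M];
    the covariance transforms accordingly. *)
Lemma cnormal_linear (R : realType) (J J' : finType) d (T : measurableType d)
    (P : probability T R) (X : J -> T -> R[i]) K (M : J' -> J -> R[i]) :
  cnormal P X K ->
  cnormal P (fun i w => \sum_j M i j * X j w)
    (fun i i' => \sum_j \sum_j' M i j * K j j' * (M i' j')^*).
Proof.
move=> [mX cX]; split.
  by move=> i; apply: measurable_sumc => j; apply: measurable_funMc.
move=> c theta; pose c' (j : J) : R[i] := \sum_i c i * M i j.
transitivity (\int[P]_w cos (cform c' (X^~ w) + theta)).
  apply: eq_Rintegral => w _; congr (cos (_ + _)); rewrite /cform; congr Re.
  rewrite /c'; under [RHS]eq_bigr do rewrite mulr_suml.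
  rewrite [RHS]exchange_big/=; apply: eq_bigr => i _; rewrite mulr_sumr.
  by apply: eq_bigr => j _; rewrite mulrA.
have -> : cquad (fun i i' => \sum_j \sum_j' M i j * K j j' * (M i' j')^*) c = cquad K c'.
  2: exact: cX.
apply/esym; rewrite /cquad; congr Re; rewrite /c'.
transitivity (\sum_j \sum_j' \sum_i \sum_i' c i * (M i j * K j j' * (M i' j')^*) * (c i')^*).
  apply: eq_bigr => j _; apply: eq_bigr => j' _.
  rewrite conjc_sum mulr_suml mulr_suml; apply: eq_bigr => i _.
  rewrite mulr_sumr; apply: eq_bigr => i' _; rewrite conjcM; ring.
transitivity (\sum_i \sum_i' \sum_j \sum_j' c i * (M i j * K j j' * (M i' j')^*) * (c i')^*).
  under eq_bigr => j _ do rewrite exchange_big/=.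
  rewrite exchange_big/=; apply: eq_bigr => i _.
  under eq_bigr => j _ do rewrite exchange_big/=.
  by rewrite exchange_big.
apply: eq_bigr => i _; apply: eq_bigr => i' _.
rewrite mulr_sumr mulr_suml; apply: eq_bigr => j _.
by rewrite mulr_sumr mulr_suml.
Qed.

Section uniqueness.
Context (R : realType) (J : finType).
Context d (T : measurableType d) (P : probability T R).
Context d' (T' : measurableType d') (P' : probability T' R).
Context d0 (D : measurableType d0) (co : J -> D -> R[i]).
Hypothesis mco : forall j, measurable_fun setT (co j).
Hypothesis gen : forall d1 (S : measurableType d1) (f : S -> D),
  (forall j, measurable_fun setT (co j \o f)) -> measurable_fun setT f.

(** Real parts of complex linear forms exhaust the real linear forms of real and imaginary parts:
    the weights t and t' come from the coefficient t - i t'. So [cnormal] fixes the whole real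
    characteristic function and [cramer_wold_orthant] applies. *)
Lemma cnormal_law X X' K (F : T -> D) (F' : T' -> D) :
  cnormal P X K -> cnormal P' X' K ->
  (forall j w, co j (F w) = X j w) -> (forall j w, co j (F' w) = X' j w) ->
  forall A, measurable A -> P (F @^-1` A) = P' (F' @^-1` A).
Proof.
move=> [mX cX] [mX' cX'] FX FX'.
pose part (jb : J * bool) (z : R[i]) := if jb.2 then Im z else Re z.
pose pi (jb : J * bool) y := part jb (co jb.1 y).
have mpart jb d1 (S : measurableType d1) (f : S -> R[i]) :
    measurable_fun setT f -> measurable_fun setT (fun s => part jb (f s)).
  move=> /measurable_fun_complexP[mr mi]; rewrite /part.
  by case: jb => j [].
have mF : measurable_fun setT F.
  by apply: gen => j; rewrite (_ : _ \o _ = X j)//; apply/funext => w; exact: FX.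
have mF' : measurable_fun setT F'.
  by apply: gen => j; rewrite (_ : _ \o _ = X' j)//; apply/funext => w; exact: FX'.
apply: (@law_unique_orthant R (J * bool)%type _ _ P _ _ P' _ D pi) => //.
- by move=> jb; apply: mpart; exact: mco.
- move=> d1 S f mf; apply: gen => j; apply/measurable_fun_complexP; split.
    exact: (mf (j, false)).
  exact: (mf (j, true)).
- move=> a.
  pose Y jb w := part jb (X jb.1 w); pose Y' jb w := part jb (X' jb.1 w).
  have mY jb : measurable_fun setT (Y jb) by exact: mpart.
  have mY' jb : measurable_fun setT (Y' jb) by exact: mpart.
  rewrite (_ : _ @^-1` _ = [set w | forall j, a j <= Y j w]); last first.
    by apply/seteqP; split => w /= h j; have := h j; rewrite /pi /Y FX.
  rewrite (_ : F' @^-1` _ = [set w | forall j, a j <= Y' j w]); last first.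
    by apply/seteqP; split => w /= h j; have := h j; rewrite /pi /Y' FX'.
  apply: cramer_wold_orthant => // t theta.
  pose c j := (t (j, false) +i* - t (j, true)) : R[i].
  have lin (x : J -> R[i]) : \sum_jb t jb * part jb (x jb.1) = cform c x.
    rewrite /cform Re_sum; under [RHS]eq_bigr do rewrite ReM.
    rewrite (eq_bigr (fun jb => t (jb.1, jb.2) * part (jb.1, jb.2) (x jb.1))); last by case.
    rewrite -(pair_bigA _ (fun j b => t (j, b) * part (j, b) (x j)))/=.
    by apply: eq_bigr => j _; rewrite big_bool/=; ring.
  transitivity (\int[P]_w cos (cform c (X^~ w) + theta)).
    by apply: eq_Rintegral => w _; rewrite -lin.
  by rewrite (cX c) -(cX' c); apply: eq_Rintegral => w _; rewrite -lin.
Qed.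

End uniqueness.

Lemma cnormal_iid (R : realType) (J : finType) d (T : measurableType d) (P : probability T R) (s : R)
    (xi : J * bool -> T -> R) : s ^+ 2 *+ 2 = 1 ->
  (forall j, measurable_fun setT (xi j)) ->
  (forall B : J * bool -> set R, (forall j, measurable (B j)) ->
    P [set w | forall j, B j (xi j w)] = (\prod_j normal_prob 0 s (B j))%E) ->
  cnormal P (fun j w => xi (j, false) w +i* xi (j, true) w) (fun i j => (i == j)%:R).
Proof.
move=> s2 mxi iid; have s0 : s != 0.
  by apply/eqP => s0; move/eqP: s2; rewrite s0 expr0n/= mul0rn eq_sym oner_eq0.
have E t c : \int[normal_prob 0 s]_x cos (t * x + c) = cos c * expR (- (t ^+ 2 / 4)).
  rewrite (integral_normal 0 s); last first.
    apply: measurableT_comp; last by apply: measurable_funD => //; exact: measurable_funM.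
    by apply: continuous_measurable_fun => x; exact: continuous_cos.
  rewrite normal_cos_lebesgue//; congr (_ * expR (- _)).
  have -> : s ^+ 2 = 2^-1 by move: s2; rewrite mulr2n; lra.
  by field.
split.
  by move=> j; apply/measurable_fun_complexP; split; exact: mxi.
move=> c theta.
pose t (jb : J * bool) := if jb.2 then - Im (c jb.1) else Re (c jb.1).
transitivity (\int[P]_w cos (\sum_j t j * xi j w + theta)).
  apply: eq_Rintegral => w _; congr (cos (_ + _)).
  rewrite /cform Re_sum.
  rewrite [RHS](eq_bigr (fun jb => t (jb.1, jb.2) * xi (jb.1, jb.2) w)); last by case.
  rewrite -(pair_bigA _ (fun j b => t (j, b) * xi (j, b) w))/=.
  by apply: eq_bigr => j _; rewrite big_bool/= /t/= ReM/=; ring.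
rewrite (Rintegral_cos_sum_iid (Q := normal_prob 0 s))//; last first.
  (* With phase - pi/2 the cosine formula says that the sine integrates to 0. *)
  move=> u; have := E u (- (pi / 2)); rewrite cosN cos_pihalf mul0r.
  by move=> h; rewrite -[RHS]h; apply: eq_Rintegral => x _; rewrite cosBpihalf.
congr (_ * _).
transitivity (\prod_(j : J * bool) expR (- (t j ^+ 2 / 4))).
  apply: eq_bigr => j _; have := E (t j) 0; rewrite cos0 mul1r => <-.
  by apply: eq_Rintegral => x _; rewrite addr0.
rewrite -expR_sum; congr expR.
rewrite (eq_bigr (fun jb => - (t (jb.1, jb.2) ^+ 2 / 4))); last by case.
rewrite -(pair_bigA _ (fun j b => - (t (j, b) ^+ 2 / 4)))/=.
rewrite /cquad Re_sum mulr_suml -sumrN; apply: eq_bigr => j _.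
rewrite big_bool/= /t/= (bigD1 j)//= eqxx mulr1 big1 ?addr0; last first.
  by move=> i /negbTE; rewrite eq_sym => ->; rewrite mulr0 mul0r.
by rewrite ReM ReC ImC; field.
Qed.


(** * Polynomial bounds for the logarithm *)

Section logarithm_bounds.
Variable R : realType.
Implicit Types x u : R.

Lemma derive_ge0_le (f df : R -> R) : (forall x : R, 0 <= x -> is_derive x 1 f (df x)) ->
  (forall x, 0 <= x -> 0 <= df x) -> forall x, 0 <= x -> f 0 <= f x.
Proof.
move=> fd df0 x x0; have [] := @MVT_segment R f df 0 x x0.
- by move=> y; rewrite in_itv/= => /andP[y0 _]; apply: fd; exact: ltW.
- apply: derivable_within_continuous => y; rewrite in_itv/= => /andP[y0 _].
  by have [] := fd y y0.
move=> c; rewrite in_itv/= => /andP[c0 _] e.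
by rewrite -subr_ge0 e mulr_ge0 ?df0// subr0.
Qed.

Lemma is_derive_ln_poly (p q : {poly R}) (x : R) : 0 < p.[x] ->
  is_derive x 1 (fun x => ln p.[x] - q.[x]) (p^`().[x] / p.[x] - q^`().[x]).
Proof.
move=> p0; apply: (@is_deriveB _ _ _ (@ln R \o horner p) (horner q)).
by apply: is_derive1_eq; [apply: is_derive1_comp; exact: is_derive1_ln|rewrite mulrC].
Qed.

(** The hypothesis compares p'/p with q', so that ln p - q is nondecreasing on the half-line. With
    polynomials the derivatives are computed formally. *)
Lemma ln_poly_ge (p q : {poly R}) : (forall x, 0 <= x -> 0 < p.[x]) ->
  (forall x, 0 <= x -> q^`().[x] * p.[x] <= p^`().[x]) ->
  forall x, 0 <= x -> ln p.[0] - q.[0] <= ln p.[x] - q.[x].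
Proof.
move=> p0 qp x x0; apply: (derive_ge0_le (f := fun x => ln p.[x] - q.[x])
  (df := fun x => p^`().[x] / p.[x] - q^`().[x])) => // y y0.
- by apply: is_derive_ln_poly; exact: p0.
- by rewrite subr_ge0 ler_pdivlMr ?p0// qp.
Qed.

Lemma ln_poly_le (p q : {poly R}) : (forall x, 0 <= x -> 0 < p.[x]) ->
  (forall x, 0 <= x -> p^`().[x] <= q^`().[x] * p.[x]) ->
  forall x, 0 <= x -> ln p.[x] - q.[x] <= ln p.[0] - q.[0].
Proof.
move=> p0 qp x x0; rewrite -lerN2.
apply: (derive_ge0_le (f := fun x => - (ln p.[x] - q.[x]))
  (df := fun x => - (p^`().[x] / p.[x] - q^`().[x]))) => // y y0.
- by apply: is_deriveN; apply: is_derive_ln_poly; exact: p0.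
- by rewrite opprB subr_ge0 ler_pdivrMr ?p0// qp.
Qed.

Lemma ln1p_ge x : 0 <= x -> x - x ^+ 2 / 2 <= ln (1 + x).
Proof.
move=> x0; pose p : {poly R} := 1%:P + 'X; pose q : {poly R} := 'X - 2^-1 *: 'X^2.
have pE y : p.[y] = 1 + y by rewrite /p !(hornerD, hornerN, hornerZ, hornerXn, hornerX, hornerC); field.
have qE y : q.[y] = y - y ^+ 2 / 2 by rewrite /q !(hornerD, hornerN, hornerZ, hornerXn, hornerX, hornerC); field.
have p'E y : p^`().[y] = 1 by rewrite /p !(derivD, derivN, derivZ, derivXn, derivX, derivC) /= !(hornerD, hornerN, hornerZ, hornerMn, hornerXn, hornerX, hornerC); field.
have q'E y : q^`().[y] = 1 - y by rewrite /q !(derivD, derivN, derivZ, derivXn, derivX, derivC) /= !(hornerD, hornerN, hornerZ, hornerMn, hornerXn, hornerX, hornerC); field.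
have := @ln_poly_ge p q _ _ x x0; rewrite !pE !qE addr0 ln1 => h.
have {}h := h (fun y y0 => ltac:(rewrite pE; lra)).
have : forall y, 0 <= y -> q^`().[y] * p.[y] <= p^`().[y].
  by move=> y y0; rewrite q'E pE p'E; have := sqr_ge0 y; rewrite expr2; nra.
by move=> /h; lra.
Qed.

Lemma ln1p_le x : 0 <= x -> ln (1 + x) <= x - x ^+ 2 / 2 + x ^+ 3 / 3.
Proof.
move=> x0; pose p : {poly R} := 1%:P + 'X.
pose q : {poly R} := 'X - 2^-1 *: 'X^2 + 3^-1 *: 'X^3.
have pE y : p.[y] = 1 + y by rewrite /p !(hornerD, hornerN, hornerZ, hornerXn, hornerX, hornerC); field.
have qE y : q.[y] = y - y ^+ 2 / 2 + y ^+ 3 / 3 by rewrite /q !(hornerD, hornerN, hornerZ, hornerXn, hornerX, hornerC); field.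
have p'E y : p^`().[y] = 1 by rewrite /p !(derivD, derivN, derivZ, derivXn, derivX, derivC) /= !(hornerD, hornerN, hornerZ, hornerMn, hornerXn, hornerX, hornerC); field.
have q'E y : q^`().[y] = 1 - y + y ^+ 2 by rewrite /q !(derivD, derivN, derivZ, derivXn, derivX, derivC) /= !(hornerD, hornerN, hornerZ, hornerMn, hornerXn, hornerX, hornerC); field.
have := @ln_poly_le p q _ _ x x0; rewrite !pE !qE addr0 ln1 => h.
have {}h := h (fun y y0 => ltac:(rewrite pE; lra)).
have : forall y, 0 <= y -> p^`().[y] <= q^`().[y] * p.[y].
  move=> y y0; rewrite q'E pE p'E; have : 0 <= y ^+ 3 by exact: exprn_ge0.
  by rewrite !exprS expr0; nra.
by move=> /h; lra.
Qed.

(** The logarithm of the quadratic test function loses only a third-order term. For u < 0 even u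
    itself is a lower bound, since 1 - x + x^2/2 dominates exp(- x) for x >= 0. *)
Lemma ln_quadratic_ge u : u - `|u| ^+ 3 / 6 <= ln (1 + u + u ^+ 2 / 2).
Proof.
have [u0|u0] := leP 0 u.
  rewrite ger0_norm//; pose p : {poly R} := 1%:P + 'X + 2^-1 *: 'X^2.
  pose q : {poly R} := 'X - 6^-1 *: 'X^3.
  have pE y : p.[y] = 1 + y + y ^+ 2 / 2 by rewrite /p !(hornerD, hornerN, hornerZ, hornerXn, hornerX, hornerC); field.
  have qE y : q.[y] = y - y ^+ 3 / 6 by rewrite /q !(hornerD, hornerN, hornerZ, hornerXn, hornerX, hornerC); field.
  have p'E y : p^`().[y] = 1 + y by rewrite /p !(derivD, derivN, derivZ, derivXn, derivX, derivC) /= !(hornerD, hornerN, hornerZ, hornerMn, hornerXn, hornerX, hornerC); field.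
  have q'E y : q^`().[y] = 1 - y ^+ 2 / 2 by rewrite /q !(derivD, derivN, derivZ, derivXn, derivX, derivC) /= !(hornerD, hornerN, hornerZ, hornerMn, hornerXn, hornerX, hornerC); field.
  have := @ln_poly_ge p q _ _ u u0; rewrite !pE !qE.
  rewrite (_ : 1 + 0 + 0 ^+ 2 / 2 = 1) ?ln1; last by lra.
  have p0 y : 0 <= y -> 0 < p.[y] by move=> y0; rewrite pE; have := sqr_ge0 y; lra.
  move=> /(_ p0) h; have : forall y, 0 <= y -> q^`().[y] * p.[y] <= p^`().[y].
    move=> y y0; rewrite q'E pE p'E; have : 0 <= y ^+ 4 by exact: exprn_ge0.
    have : 0 <= y ^+ 3 by exact: exprn_ge0.
    by rewrite !exprS expr0; nra.
  by move=> /h; lra.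
pose p : {poly R} := 1%:P - 'X + 2^-1 *: 'X^2; pose q : {poly R} := - 'X.
have pE y : p.[y] = 1 - y + y ^+ 2 / 2 by rewrite /p !(hornerD, hornerN, hornerZ, hornerXn, hornerX, hornerC); field.
have qE y : q.[y] = - y by rewrite /q !(hornerD, hornerN, hornerZ, hornerXn, hornerX, hornerC); field.
have p'E y : p^`().[y] = - 1 + y by rewrite /p !(derivD, derivN, derivZ, derivXn, derivX, derivC) /= !(hornerD, hornerN, hornerZ, hornerMn, hornerXn, hornerX, hornerC); field.
have q'E y : q^`().[y] = - 1 by rewrite /q !(derivD, derivN, derivZ, derivXn, derivX, derivC) /= !(hornerD, hornerN, hornerZ, hornerMn, hornerXn, hornerX, hornerC); field.
have nu0 : 0 <= - u by lra.
have := @ln_poly_ge p q _ _ (- u) nu0; rewrite !pE !qE.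
rewrite (_ : 1 - 0 + 0 ^+ 2 / 2 = 1) ?ln1; last by lra.
have p0 y : 0 <= y -> 0 < p.[y].
  by move=> y0; rewrite pE; have := sqr_ge0 (1 - y); have := sqr_ge0 y; rewrite !expr2; nra.
move=> /(_ p0) h; have : forall y, 0 <= y -> q^`().[y] * p.[y] <= p^`().[y].
  by move=> y y0; rewrite q'E pE p'E; have := sqr_ge0 y; rewrite expr2; nra.
move=> /h; rewrite sqrrN opprK => {}h.
have : 0 <= `|u| ^+ 3 by exact: exprn_ge0.
rewrite (_ : 1 - - u + u ^+ 2 / 2 = 1 + u + u ^+ 2 / 2) in h; last by ring.
lra.
Qed.

End logarithm_bounds.

Lemma ae_eq_integrable d (T : measurableType d) (R : realType)
    (mu : {measure set T -> \bar R}) (f g : T -> R) :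
  measurable_fun setT f -> ae_eq mu setT (EFin \o f) (EFin \o g) ->
  mu.-integrable setT (EFin \o g) ->
  mu.-integrable setT (EFin \o f) /\ \int[mu]_x f x = \int[mu]_x g x.
Proof.
move=> mf fg ig; have mg := measurable_int _ ig.
have mf' : measurable_fun setT (EFin \o f) by exact/measurable_EFinP.
split; last by rewrite /Rintegral; congr fine; exact: ae_eq_integral.
apply/integrableP; split => //.
rewrite (ae_eq_integral (fun x => `|(EFin \o g) x|%E))//.
- by case/integrableP : ig.
- exact: measurableT_comp.
- exact: measurableT_comp.
- by apply: filterS fg => x /= h hx; exact: (congr1 abse (h hx)).
Qed.

(** * Divergence of a Gaussian vector from white noise *)

Section gaussian_divergence.
Context (R : realType) (J : finType).
Context d (T : measurableType d) (P : probability T R).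
Context (s : R) (xi : J * bool -> T -> R).
Hypothesis s2 : s ^+ 2 *+ 2 = 1.
Hypothesis mxi : forall j, measurable_fun setT (xi j).
Hypothesis iid : forall B : J * bool -> set R, (forall j, measurable (B j)) ->
  P [set w | forall j, B j (xi j w)] = (\prod_j normal_prob 0 s (B j))%E.

Lemma iid_normal_law j B : measurable B -> P (xi j @^-1` B) = normal_prob 0 s B.
Proof.
move=> mB; have := iid (B := fun i => if i == j then B else setT).
rewrite (bigD1 j)//= eqxx big1 ?mule1; last first.
  by move=> i /negbTE ->; exact: probability_setT.
rewrite (_ : [set w | _] = xi j @^-1` B); last first.
  apply/seteqP; split => w /=; first by move=> /(_ j); rewrite eqxx.
  by move=> h i; case: eqP => [->|].
by apply => i; case: ifP.
Qed.

Let sn0 : s != 0.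
Proof. by apply/eqP => s0; move/eqP: s2; rewrite s0 expr0n/= mul0rn eq_sym oner_eq0. Qed.

Let s2E : s ^+ 2 = 2^-1.
Proof. by move: s2; rewrite mulr2n; lra. Qed.

Lemma iid_normal_moment j :
  [/\ forall k, P.-integrable setT (EFin \o (fun w => xi j w ^+ k)),
      \int[P]_w xi j w = 0, \int[P]_w (xi j w ^+ 2) = 2^-1 &
      \int[P]_w (xi j w ^+ 4) = 3 / 4].
Proof.
have mk k : measurable_fun setT (fun x : R => x ^+ k) by exact: measurable_funX.
have E k : \int[P]_w (xi j w ^+ k) = \int[lebesgue_measure]_x ((x - 0) ^+ k * normal_pdf 0 s x).
  rewrite (Rintegral_law (Q := normal_prob 0 s) (mxi j) (@iid_normal_law j) (mk k)).
  by rewrite integral_normal//; apply: eq_Rintegral => x _; rewrite subr0.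
split.
- move=> k; apply: (integrable_law (P := P) (Q := normal_prob 0 s) (mxi j) (@iid_normal_law j) (mk k)).2.
  apply: (integrable_normal 0 s (mk k)).2.
  have := integrable_exprn_pdf 0 sn0 k.
  by apply: eq_integrable => // x _ /=; rewrite subr0.
- by rewrite -(normal_moment1 0 sn0) -E; apply: eq_Rintegral => w _; rewrite expr1.
- by rewrite E normal_moment_rec// normal_moment0 s2E; field.
- by rewrite E !normal_moment_rec// normal_moment0 s2E; field.
Qed.

Context d' (T' : measurableType d') (P' : probability T' R).
Context (X : J -> T' -> R[i]) (A : J -> J -> R[i]).
Hypothesis hA : forall i j, A i j = (A j i)^*.
Hypothesis psdA : forall c, 0 <= cquad A c.
Hypothesis nX : cnormal P' X (fun i j => (i == j)%:R + A i j).
Context d0 (D : measurableType d0) (co : J -> D -> R[i]) (mk : (J -> R[i]) -> D).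
Hypothesis mco : forall j, measurable_fun setT (co j).
Hypothesis gen : forall d1 (S : measurableType d1) (f : S -> D),
  (forall j, measurable_fun setT (co j \o f)) -> measurable_fun setT f.
Hypothesis mkK : forall f j, co j (mk f) = f j.
Hypothesis coK : forall y, mk (co^~ y) = y.

Let W j w : R[i] := xi (j, false) w +i* xi (j, true) w.
Let FW w := mk (W^~ w).
Let FX w := mk (X^~ w).

Variable p : D -> R.
Hypotheses (mp : measurable_fun setT p) (p0 : forall y, 0 < p y).
Hypothesis pd : forall E, measurable E ->
  P' (FX @^-1` E) = (\int[P]_(w in FW @^-1` E) (p (FW w))%:E)%E.

Let mW j : measurable_fun setT (W j).
Proof. by apply/measurable_fun_complexP; split; exact: mxi. Qed.

Let mF d1 (S : measurableType d1) (f : J -> S -> R[i]) :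
  (forall j, measurable_fun setT (f j)) -> measurable_fun setT (fun w => mk (f^~ w)).
Proof.
move=> mf; apply: gen => j; rewrite (_ : _ \o _ = f j)//.
by apply/funext => w /=; rewrite mkK.
Qed.

Let mFW : measurable_fun setT FW.
Proof. exact: mF. Qed.

Let mFX : measurable_fun setT FX.
Proof. by apply: mF; case: nX. Qed.

Let gamma : probability D R := distribution P (mfun_of mFW).
Let nu : probability D R := distribution P' (mfun_of mFX).

Let nW : cnormal P W (fun i j => (i == j)%:R).
Proof. exact: cnormal_iid s2 mxi iid. Qed.

Let integral_gamma (f : D -> \bar R) E : measurable E -> measurable_fun setT f ->
  (forall x, (0 <= f x)%E) ->
  (\int[gamma]_(y in E) f y = \int[P]_(w in FW @^-1` E) f (FW w))%E.
Proof.
move=> mE mf f0; rewrite integral_mkcond [RHS]integral_mkcond.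
rewrite -(@integral_law _ _ _ _ R P gamma FW mFW (fun _ _ => erefl)); first last.
- by move=> y; rewrite patchE; case: ifP.
- by apply/(measurable_restrictT _ mE)/measurable_funTS.
apply: eq_integral => w _; rewrite !patchE.
by rewrite (_ : (w \in FW @^-1` E) = (FW w \in E))//; apply/idP/idP => /set_mem h; apply/mem_set.
Qed.

(** In an eigenbasis of [A] white noise remains white and coordinate [k] of [X] is noise scaled by
    the root of 1 + lam k. The divergence is therefore the sum of lam k - ln(1 + lam k), and ln(1 +
    x) >= x - x^2/2 bounds it by half the sum of the squared eigenvalues. *)
Lemma gaussian_divergence :
  P'.-integrable setT (EFin \o (fun w => ln (p (FX w)))) /\
  \int[P']_w ln (p (FX w)) <= 2^-1 * \sum_i \sum_j normc (A i j) ^+ 2.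
Proof.
have [U [lam [lamq U1 U2 AE lamE]]] := hermitian_spectral hA.
have lam0 k : 0 <= lam k by rewrite lamq psdA.
pose a k := Num.sqrt (1 + lam k).
have lam1 k : 0 < 1 + lam k by have := lam0 k; lra.
have a0 k : 0 < a k by rewrite sqrtr_gt0.
have a2 k : a k ^+ 2 = 1 + lam k by rewrite sqr_sqrtr// ltW.
(* [Phi] maps eigenbasis coordinates to the original ones, and [Psi] is a left inverse of it. *)
pose Phi y := mk (fun i => \sum_k (U k i)^* * co k y).
pose Psi y := mk (fun k => \sum_i U k i * co i y).
have mlin (M : J -> J -> R[i]) d1 (S : measurableType d1) (f : J -> S -> R[i]) :
    (forall j, measurable_fun setT (f j)) ->
    forall j, measurable_fun setT (fun w => \sum_k M j k * f k w).
  by move=> mf j; apply: measurable_sumc => k; apply: measurable_funMc.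
have mPhi : measurable_fun setT Phi.
  exact: (mF (mlin (fun i k => (U k i)^*) _ _ _ mco)).
have mPsi : measurable_fun setT Psi by exact: (mF (mlin U _ _ _ mco)).
have PhiK y : Psi (Phi y) = y.
  rewrite -[RHS]coK; congr mk; apply/funext => k.
  under eq_bigr do rewrite mkK mulr_sumr.
  rewrite exchange_big/= (bigD1 k)//= [X in _ + X]big1 ?addr0 => [|m /negbTE mk0].
    by under eq_bigr do rewrite mulrA; rewrite -mulr_suml U2 eqxx mul1r.
  by under eq_bigr do rewrite mulrA; rewrite -mulr_suml U2 eq_sym mk0 mul0r.
pose FDW w := mk (fun k => (a k)%:C * W k w).
pose part (jb : J * bool) y := if jb.2 then Im (co jb.1 y) else Re (co jb.1 y).
have mpart jb : measurable_fun setT (part jb).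
  have /measurable_fun_complexP[mr mi] := mco jb.1.
  by rewrite /part; case: jb.2.
have genp d1 (S : measurableType d1) (f : S -> D) :
    (forall j, measurable_fun setT (part j \o f)) -> measurable_fun setT f.
  move=> mf; apply: gen => j; apply/measurable_fun_complexP; split.
    exact: (mf (j, false)).
  exact: (mf (j, true)).
pose h y := \prod_(jb : J * bool) affine_density (a jb.1) 0 (part jb y).
have partW jb w : part jb (FW w) = xi jb w.
  by rewrite /part mkK; case: jb => j [].
have partDW jb w : part jb (FDW w) = a jb.1 * xi jb w.
  case: jb => j []; rewrite /part mkK.
    by rewrite -[LHS]/(Im ((a j)%:C * W j w)) ImZ.
  by rewrite -[LHS]/(Re ((a j)%:C * W j w)) ReZ.
have mh : measurable_fun setT h.
  by apply: measurable_prod => jb _; apply: measurableT_comp => //; exact: measurable_affine_density.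
have h0 y : 0 < h y by apply: prodr_gt0 => jb _; exact: affine_density_gt0.
have dens E : measurable E ->
    P (FDW @^-1` E) = (\int[P]_(w in FW @^-1` E) (h (FW w))%:E)%E.
  move=> mE; rewrite (affine_family_density s2 mxi iid mpart genp (F := FW) (G := FDW)
    (a := fun jb => a jb.1) (b := fun _ => 0))//.
  - by apply: eq_integral => w _; congr EFin; apply: eq_bigr => jb _; rewrite partW.
  - by move=> jb w; rewrite addr0; exact: partDW.
have lawV E : measurable E -> P ((Phi \o FW) @^-1` E) = P (FW @^-1` E).
  move=> mE; have := cnormal_linear (fun i k => (U k i)^*) nW.
  rewrite (_ : (fun i i' => _) = (fun i j => (i == j)%:R)); last first.
    apply/funext => i; apply/funext => i'; rewrite -U1; apply: eq_bigr => k _.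
    rewrite (bigD1 k)//= eqxx mulr1 conjCK big1 ?addr0// => m /negbTE mk0.
    by rewrite eq_sym mk0 mulr0 mul0r.
  move=> nV; apply: (cnormal_law mco gen nV nW) => // j w /=; rewrite ?mkK//.
  by apply: eq_bigr => k _; rewrite mkK.
have lawG E : measurable E -> P ((Phi \o FDW) @^-1` E) = P' (FX @^-1` E).
  move=> mE; have := cnormal_linear (fun i k => (U k i)^* * (a k)%:C) nW.
  rewrite (_ : (fun i i' => _) = (fun i j => (i == j)%:R + A i j)); last first.
    apply/funext => i; apply/funext => i'; rewrite -U1 AE -big_split/=; apply: eq_bigr => k _.
    rewrite (bigD1 k)//= eqxx mulr1 big1 ?addr0 => [|m /negbTE mk0]; last first.
      by rewrite eq_sym mk0 mulr0 mul0r.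
    rewrite rmorphM/= conjCK -[LHS]mulrA.
    have -> : ((a k)%:C)^* = (a k)%:C by rewrite -[LHS]/(conjc _) conjc_real.
    have : (a k)%:C * (a k)%:C = 1 + (lam k)%:C by rewrite -rmorphM -expr2 a2 rmorphD rmorph1.
    move: ((a k)%:C) ((lam k)%:C) => x y xy.
    transitivity ((U k i)^* * (x * x) * U k i'); first by ring.
    by rewrite xy; ring.
  move=> nV; apply: (cnormal_law mco gen nV nX) => // j w /=; rewrite ?mkK//.
  by apply: eq_bigr => k _; rewrite mkK mulrA.
(* The explicit density of [X]: it has the law of [Phi] applied to the scaled noise, while [Phi]
   preserves the law of the noise. The given [p] must agree with [q] almost everywhere. *)
pose q y := h (Psi y).
have mq : measurable_fun setT q by exact: measurableT_comp.
have q0 y : 0 < q y by exact: h0.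
have mpre E (F : D -> D) : measurable_fun setT F -> measurable E -> measurable (F @^-1` E).
  by move=> mF0 mE; rewrite -[_ @^-1` _]setTI; exact: mF0.
have qd E : measurable E ->
    P' (FX @^-1` E) = (\int[P]_(w in FW @^-1` E) (q (FW w))%:E)%E.
  move=> mE; rewrite -lawG//.
  rewrite [LHS](dens (Phi @^-1` E)); last exact: mpre.
  pose f := (EFin \o q) \_ E.
  have mf : measurable_fun setT f.
    by apply/(measurable_restrictT _ mE)/measurable_funTS/measurable_EFinP.
  have f0 y : (0 <= f y)%E by rewrite /f patchE; case: ifP => //= _; rewrite lee_fin ltW.
  transitivity (\int[P]_w f (FW w))%E.
    rewrite (@integral_law _ _ _ _ R P gamma FW mFW (fun _ _ => erefl))//.
    have mPhiFW : measurable_fun setT (Phi \o FW) by exact: measurableT_comp.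
    rewrite -(@integral_law _ _ _ _ R P gamma (Phi \o FW) mPhiFW lawV)//.
    rewrite integral_mkcond; apply: eq_integral => w _; rewrite /f !patchE /=.
    rewrite (_ : (w \in FW @^-1` (Phi @^-1` E)) = (Phi (FW w) \in E)); last first.
      by apply/idP/idP => /set_mem ?; apply/mem_set.
    by rewrite /q PhiK.
  rewrite [RHS]integral_mkcond; apply: eq_integral => w _; rewrite /f !patchE /=.
  by rewrite (_ : (w \in FW @^-1` E) = (FW w \in E))//; apply/idP/idP => /set_mem ?; apply/mem_set.
have pg E : measurable E -> nu E = (\int[gamma]_(y in E) (p y)%:E)%E.
  move=> mE; rewrite integral_gamma//; first exact: pd.
  - exact/measurable_EFinP.
  - by move=> y; rewrite lee_fin ltW.
have qg E : measurable E -> nu E = (\int[gamma]_(y in E) (q y)%:E)%E.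
  move=> mE; rewrite integral_gamma//; first exact: qd.
  - exact/measurable_EFinP.
  - by move=> y; rewrite lee_fin ltW.
have pq : ae_eq gamma setT (EFin \o p) (EFin \o q).
  apply: integral_ae_eq => //.
  - apply/integrableP; split; first exact/measurable_EFinP.
    under eq_integral do rewrite /= ger0_norm ?(ltW (p0 _))//.
    by rewrite -pg// (le_lt_trans (probability_le1 _ _))// ltry.
  - exact/measurable_EFinP.
  - by move=> E _ mE; rewrite -pg// qg.
have nug : nu `<< gamma by have [] := density_ae mp (fun y => ltW (p0 y)) pg.
have pqnu : ae_eq nu setT (EFin \o (fun y => ln (p y))) (EFin \o (fun y => ln (q y))).
  case: pq => N [mN N0 hN]; exists N; split => //.
    exact: (null_content_dominatesP _ _).1 nug N mN N0.
  move=> y /= hy; apply: hN => /= e; apply: hy => _.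
  by have -> : p y = q y by apply: EFin_inj; exact: e.
have mln (f : D -> R) : measurable_fun setT f -> measurable_fun setT (fun y => ln (f y)).
  by move=> mf; exact: measurableT_comp.
have mFDW : measurable_fun setT FDW.
  by apply: mF => k; apply: measurable_funMc.
have mG : measurable_fun setT (Phi \o FDW) by exact: measurableT_comp.
have lnh w : ln (q ((Phi \o FDW) w)) =
    \sum_(jb : J * bool) (- ln (a jb.1) + lam jb.1 * xi jb w ^+ 2).
  rewrite /q /= PhiK /h.
  transitivity (ln (\prod_(jb : J * bool) expR (- ln (a jb.1) + lam jb.1 * xi jb w ^+ 2))); last first.
    by rewrite -expR_sum expRK.
  congr ln; apply: eq_bigr.
  move=> jb _; rewrite /affine_density [in RHS]expRD expRN lnK ?posrE//; congr (_ * expR _).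
  rewrite partDW.
  rewrite subr0 mulrAC divff ?gt_eqF// mul1r exprMn a2; ring.
have ilnh : P.-integrable setT (EFin \o (fun w => ln (q ((Phi \o FDW) w)))).
  rewrite (_ : (fun w => _) = fun w => \sum_(jb : J * bool) (- ln (a jb.1) + lam jb.1 * xi jb w ^+ 2)).
    apply: integrable_EFin_sum => // jb _; apply: integrable_EFinD => //.
      exact: finite_measure_integrable_cst.
    by apply: integrable_EFinZl => //; have [] := iid_normal_moment jb.
  by apply/funext => w; exact: lnh.
have iq : nu.-integrable setT (EFin \o (fun y => ln (q y))).
  apply: (integrable_law (P := P) (Q := nu) mG lawG (mln _ mq)).1 => //.
have [ip ep] := ae_eq_integrable (mln _ mp) pqnu iq.
split; first exact: (integrable_law (P := P') (Q := nu) (X := FX) mFX (fun _ _ => erefl) (mln _ mp)).2.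
rewrite (Rintegral_law (P := P') (Q := nu) (X := FX) mFX (fun _ _ => erefl) (mln _ mp)).
rewrite ep -(Rintegral_law (P := P) (Q := nu) mG lawG (mln _ mq)).
under eq_Rintegral do rewrite lnh.
have isq (jb : J * bool) : P.-integrable setT (EFin \o (fun w => xi jb w ^+ 2)).
  by have [] := iid_normal_moment jb.
have ic (r : R) : P.-integrable setT (EFin \o (fun=> r)).
  exact: finite_measure_integrable_cst.
rewrite Rintegral_sum//; last first.
  by move=> jb _; apply: integrable_EFinD => //; exact: integrable_EFinZl.
rewrite (eq_bigr (fun jb => - ln (a jb.1) + lam jb.1 / 2)); last first.
  move=> jb _; rewrite RintegralD//; last exact: integrable_EFinZl.
  rewrite Rintegral_prob_cst RintegralZl//.
  by have [_ _ -> _] := iid_normal_moment jb.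
rewrite -(pair_bigA _ (fun j (b : bool) => - ln (a j) + lam j / 2))/= -lamE mulr_sumr.
apply: ler_sum => j _; rewrite big_bool/=.
have -> : ln (a j) = ln (1 + lam j) / 2.
  by rewrite -a2 lnXn// mulr2n; field.
have := ln1p_ge (lam0 j); lra.
Qed.

End gaussian_divergence.

(** * Moments and complex expectations *)

Section moments.
Context d (T : measurableType d) (R : realType) (P : probability T R).

Implicit Types f g : T -> R.

(** A class closed under sums and products: integrability of every polynomial in Gaussian variables
    then follows from its structure. *)
Definition all_moments (f : T -> R) : Prop :=
  measurable_fun setT f /\ forall k, P.-integrable setT (EFin \o (fun w => f w ^+ k)).

Lemma all_moments_integrable f : all_moments f -> P.-integrable setT (EFin \o f).
Proof. by move=> [_ /(_ 1%N)]; apply: eq_integrable => // w _ /=; rewrite expr1. Qed.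

Lemma all_moments_norm f k : all_moments f ->
  P.-integrable setT (EFin \o (fun w => `|f w| ^+ k)).
Proof.
move=> [mf /(_ k)] /(integrable_abse) ; apply: eq_integrable => // w _ /=.
by rewrite normrX.
Qed.

Lemma all_moments_cst c : all_moments (fun=> c).
Proof. by split => // k; exact: finite_measure_integrable_cst. Qed.

Lemma all_momentsD f g : all_moments f -> all_moments g ->
  all_moments (fun w => f w + g w).
Proof.
move=> mf mg; have mfg : measurable_fun setT (fun w => f w + g w).
  by apply: measurable_funD; [exact: mf.1|exact: mg.1].
split => // k.
have : P.-integrable setT (EFin \o (fun w => 2 ^+ k * (`|f w| ^+ k + `|g w| ^+ k))).
  apply: integrable_EFinZl => //; apply: integrable_EFinD => //; exact: all_moments_norm.
apply: le_integrable_EFin => //; first exact: measurable_funX.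
move=> w _; rewrite [leRHS]ger0_norm; last first.
  by rewrite mulr_ge0 ?exprn_ge0// addr_ge0// exprn_ge0.
rewrite normrX; apply: (@le_trans _ _ ((2 * Num.max `|f w| `|g w|) ^+ k)).
  rewrite lerXn2r ?nnegrE// ?mulr_ge0// ?le_max ?normr_ge0//.
  apply: le_trans (ler_normD _ _) _.
  by rewrite mulr_natl mulr2n lerD// le_max lexx ?orbT.
rewrite exprMn ler_pM2l ?exprn_gt0//.
by case: (leP `|f w| `|g w|) => _; rewrite ?lerDl ?lerDr exprn_ge0.
Qed.

Lemma all_momentsM f g : all_moments f -> all_moments g ->
  all_moments (fun w => f w * g w).
Proof.
move=> mf mg; have mfg : measurable_fun setT (fun w => f w * g w).
  by apply: measurable_funM; [exact: mf.1|exact: mg.1].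
split => // k.
have : P.-integrable setT (EFin \o (fun w => f w ^+ (k * 2) + g w ^+ (k * 2))).
  by apply: integrable_EFinD => //; [exact: mf.2|exact: mg.2].
apply: le_integrable_EFin => //; first exact: measurable_funX.
move=> w _; rewrite exprMn !exprM normrM.
rewrite [leRHS]ger0_norm; last by rewrite addr_ge0// sqr_ge0.
rewrite -(real_normK (num_real (f w ^+ k))) -(real_normK (num_real (g w ^+ k))).
have := sqr_ge0 (`|f w ^+ k| - `|g w ^+ k|).
have := normr_ge0 (f w ^+ k); have := normr_ge0 (g w ^+ k); rewrite !expr2; nra.
Qed.

Lemma all_momentsZ c f : all_moments f -> all_moments (fun w => c * f w).
Proof. by move=> mf; apply: all_momentsM => //; exact: all_moments_cst. Qed.

Lemma all_momentsN f : all_moments f -> all_moments (fun w => - f w).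
Proof.
move=> mf; rewrite (_ : (fun w => _) = (fun w => -1 * f w)); first exact: all_momentsZ.
by apply/funext => w; rewrite mulN1r.
Qed.

Lemma all_momentsB f g : all_moments f -> all_moments g ->
  all_moments (fun w => f w - g w).
Proof. by move=> mf mg; apply: all_momentsD => //; exact: all_momentsN. Qed.

Lemma all_momentsX f k : all_moments f -> all_moments (fun w => f w ^+ k).
Proof.
move=> mf; elim: k => [|k IH].
  by rewrite (_ : (fun w => _) = cst 1); [exact: all_moments_cst|apply/funext].
by under eq_fun do rewrite exprS; exact: all_momentsM.
Qed.

Lemma all_moments_sum I (r : seq I) (p : pred I) (f : I -> T -> R) :
  (forall i, all_moments (f i)) -> all_moments (fun w => \sum_(i <- r | p i) f i w).
Proof.
move=> mf; elim: r => [|i r IH].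
  by under eq_fun do rewrite big_nil; exact: all_moments_cst.
under eq_fun do rewrite big_cons.
by case: (p i) => //; exact: all_momentsD.
Qed.

Definition complex_moments (f : T -> R[i]) : Prop :=
  all_moments (fun w => Re (f w)) /\ all_moments (fun w => Im (f w)).

Lemma complex_moments_measurable (f : T -> R[i]) : complex_moments f -> measurable_fun setT f.
Proof. by move=> [[mr _] [mi _]]; exact/measurable_fun_complexP. Qed.

Lemma complex_moments_cst c : complex_moments (fun=> c).
Proof. by split; exact: all_moments_cst. Qed.

Lemma complex_momentsD (f g : T -> R[i]) : complex_moments f -> complex_moments g ->
  complex_moments (fun w => f w + g w).
Proof.
move=> [fr fi] [gr gi]; split.
  rewrite (_ : (fun w => _) = fun w => Re (f w) + Re (g w)); first exact: all_momentsD.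
  by apply/funext => w; case: (f w) (g w) => ? ? [].
rewrite (_ : (fun w => _) = fun w => Im (f w) + Im (g w)); first exact: all_momentsD.
by apply/funext => w; case: (f w) (g w) => ? ? [].
Qed.

Lemma complex_momentsM (f g : T -> R[i]) : complex_moments f -> complex_moments g ->
  complex_moments (fun w => f w * g w).
Proof.
move=> [fr fi] [gr gi]; split.
  rewrite (_ : (fun w => _) = fun w => Re (f w) * Re (g w) - Im (f w) * Im (g w)).
    by apply: all_momentsB; exact: all_momentsM.
  by apply/funext => w; rewrite ReM.
rewrite (_ : (fun w => _) = fun w => Re (f w) * Im (g w) + Im (f w) * Re (g w)).
  by apply: all_momentsD; exact: all_momentsM.
by apply/funext => w; rewrite ImM.
Qed.

Lemma complex_momentsZ c (f : T -> R[i]) : complex_moments f -> complex_moments (fun w => c * f w).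
Proof. by move=> mf; apply: complex_momentsM => //; exact: complex_moments_cst. Qed.

Lemma complex_momentsJ (f : T -> R[i]) : complex_moments f -> complex_moments (fun w => (f w)^*).
Proof.
move=> [fr fi]; split.
  by rewrite (_ : (fun w => _) = fun w => Re (f w))//; apply/funext => w; rewrite ReC.
rewrite (_ : (fun w => _) = fun w => - Im (f w)); first exact: all_momentsN.
by apply/funext => w; rewrite ImC.
Qed.

Lemma complex_moments_sum I (r : seq I) (f : I -> T -> R[i]) :
  (forall i, complex_moments (f i)) -> complex_moments (fun w => \sum_(i <- r) f i w).
Proof.
move=> mf; elim: r => [|i r IH].
  by under eq_fun do rewrite big_nil; exact: complex_moments_cst.
by under eq_fun do rewrite big_cons; exact: complex_momentsD.
Qed.

Lemma complex_moments_normc (f : T -> R[i]) : complex_moments f -> all_moments (fun w => normc (f w) ^+ 2).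
Proof.
move=> [fr fi]; under eq_fun do rewrite sqr_normcE.
by apply: all_momentsD; exact: all_momentsX.
Qed.

Lemma cexpectationE (f : T -> R[i]) :
  cexpectation P f = (\int[P]_w Re (f w)) +i* (\int[P]_w Im (f w)).
Proof. by rewrite /cexpectation unlock. Qed.

Lemma Re_cexpectation (f : T -> R[i]) : Re (cexpectation P f) = \int[P]_w Re (f w).
Proof. by rewrite cexpectationE. Qed.

Lemma Im_cexpectation (f : T -> R[i]) : Im (cexpectation P f) = \int[P]_w Im (f w).
Proof. by rewrite cexpectationE. Qed.

Lemma cexpectationD (f g : T -> R[i]) : complex_moments f -> complex_moments g ->
  cexpectation P (fun w => f w + g w) = cexpectation P f + cexpectation P g.
Proof.
move=> [fr fi] [gr gi]; apply: complex_ext.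
  rewrite Re_cexpectation ReD !Re_cexpectation -RintegralD//; last 2 first.
  - exact: all_moments_integrable.
  - exact: all_moments_integrable.
  by apply: eq_Rintegral => w _; rewrite ReD.
rewrite Im_cexpectation ImD !Im_cexpectation -RintegralD//; last 2 first.
- exact: all_moments_integrable.
- exact: all_moments_integrable.
by apply: eq_Rintegral => w _; rewrite ImD.
Qed.

Lemma cexpectationZ c (f : T -> R[i]) : complex_moments f ->
  cexpectation P (fun w => c * f w) = c * cexpectation P f.
Proof.
move=> [/all_moments_integrable fr /all_moments_integrable fi]; apply: complex_ext.
  rewrite ReM !Re_cexpectation Im_cexpectation -!RintegralZl// -RintegralB//.
  - by apply: eq_Rintegral => w _; rewrite ReM.
  - exact: integrable_EFinZl.
  - exact: integrable_EFinZl.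
rewrite ImM !Im_cexpectation Re_cexpectation -!RintegralZl// -RintegralD//.
- by apply: eq_Rintegral => w _; rewrite ImM.
- exact: integrable_EFinZl.
- exact: integrable_EFinZl.
Qed.

Lemma cexpectationZr c (f : T -> R[i]) : complex_moments f ->
  cexpectation P (fun w => f w * c) = cexpectation P f * c.
Proof. by move=> mf; rewrite mulrC -cexpectationZ//; under eq_fun do rewrite mulrC. Qed.

Lemma cexpectation_sum I (r : seq I) (f : I -> T -> R[i]) :
  (forall i, complex_moments (f i)) ->
  cexpectation P (fun w => \sum_(i <- r) f i w) = \sum_(i <- r) cexpectation P (f i).
Proof.
move=> mf; elim: r => [|i r IH].
  rewrite big_nil cexpectationE; apply: complex_ext => /=.
    under eq_Rintegral do rewrite big_nil; exact: Rintegral_prob_cst.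
  under eq_Rintegral do rewrite big_nil; exact: Rintegral_prob_cst.
rewrite big_cons -IH -cexpectationD//; last exact: complex_moments_sum.
by under eq_fun do rewrite big_cons.
Qed.

Lemma cexpectationJ (f : T -> R[i]) : complex_moments f ->
  cexpectation P (fun w => (f w)^*) = (cexpectation P f)^*.
Proof.
move=> [_ fi]; apply: complex_ext; rewrite ?ReC ?ImC ?Re_cexpectation ?Im_cexpectation.
  by apply: eq_Rintegral => w _; rewrite ReC.
rewrite -mulN1r -RintegralZl//; last exact: all_moments_integrable.
by apply: eq_Rintegral => w _; rewrite ImC mulN1r.
Qed.

End moments.

Section proper_normal.
Context d (T : measurableType d) (R : realType) (P : probability T R).
Context (I : eqType) (G : I -> T -> R[i]).
Hypotheses (mG : forall i, measurable_fun setT (G i)) (nG : jointly_proper_normal P G).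
Hypothesis G0 : forall i, cexpectation P (G i) = 0.

Let mre i : measurable_fun setT (fun w => Re (G i w)).
Proof. by have /measurable_fun_complexP[] := mG i. Qed.

Let mim i : measurable_fun setT (fun w => Im (G i w)).
Proof. by have /measurable_fun_complexP[] := mG i. Qed.

Lemma proper_normal_moments i : complex_moments P (G i).
Proof.
split.
  have gR : gaussian P (fun w => Re (G i w)).
    have := nG.1 [:: i] (fun=> 1) (fun=> 0); congr gaussian.
    by apply/funext => w; rewrite big_seq1 mul1r mul0r addr0.
  have [|_ h _ _] := gaussian_centered (mre i) gR; last by split.
  by have := congr1 (@Re R) (G0 i); rewrite Re_cexpectation.
have gR : gaussian P (fun w => Im (G i w)).
  have := nG.1 [:: i] (fun=> 0) (fun=> 1); congr gaussian.
  by apply/funext => w; rewrite big_seq1 mul1r mul0r add0r.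
have [|_ h _ _] := gaussian_centered (mim i) gR; last by split.
by have := congr1 (@Im R) (G0 i); rewrite Im_cexpectation.
Qed.

Lemma proper_normal_pseudo i j : cexpectation P (fun w => G i w * G j w) = 0.
Proof. by have := nG.2 i j; rewrite !G0; under eq_fun do rewrite !subr0. Qed.

(** For S = sum_k c_k G_k the square of Re S is half of Re(S^2) + |S|^2. Properness cancels the mean
    of S^2, so the centred Gaussian Re S has half of the mean of |S|^2 as variance, and exp(- v/2)
    becomes exp(- cquad/4). *)
Lemma proper_normal_cnormal (K : finType) (e : K -> I) : injective e ->
  cnormal P (fun k => G (e k))
    (fun k k' => cexpectation P (fun w => G (e k) w * (G (e k') w)^*)).
Proof.
move=> inj; split; first by move=> k; exact: mG.
move=> c theta; set Kc := cquad _ _.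
have mo k := proper_normal_moments (e k).
have mS : complex_moments P (fun w => \sum_k c k * G (e k) w).
  by apply: complex_moments_sum => k; exact: complex_momentsZ.
pose X w := cform c (fun k => G (e k) w).
have mX : measurable_fun setT X by exact: (measurable_cform c (fun k => mG (e k))).
have gX : gaussian P X.
  (* Joint normality takes coefficients indexed by [I]; those of [K] are carried along the injection
     [e], with 0 elsewhere. *)
  pose cc i := if [pick k | e k == i] is Some k then c k else 0.
  have ccE k : cc (e k) = c k.
    rewrite /cc; case: pickP => [k' /eqP/inj -> //|/(_ k)]; by rewrite eqxx.
  have := nG.1 [seq e k | k <- enum K] (fun i => Re (cc i)) (fun i => - Im (cc i)).
  congr gaussian; apply/funext => w; rewrite big_map big_enum/= /X /cform Re_sum.
  by apply: eq_bigr => k _; rewrite ccE ReM mulNr.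
have X0 : \int[P]_w X w = 0.
  rewrite -[LHS](Re_cexpectation P (fun w => \sum_k c k * G (e k) w)).
  rewrite cexpectation_sum; last by move=> k; exact: complex_momentsZ.
  by rewrite big1// => k _; rewrite cexpectationZ// G0 mulr0.
have [_ _ hcos _] := gaussian_centered mX gX X0.
rewrite -[LHS]/(\int[P]_w cos (X w + theta)) hcos; congr (_ * expR (- _)).
pose S w := \sum_k c k * G (e k) w.
have mSS : complex_moments P (fun w => S w * S w) by exact: complex_momentsM.
have mSJ : complex_moments P (fun w => S w * (S w)^*).
  by apply: complex_momentsM => //; exact: complex_momentsJ.
have ESS : cexpectation P (fun w => S w * S w) = 0.
  transitivity (cexpectation P (fun w => \sum_k \sum_k' c k * c k' * (G (e k) w * G (e k') w))).
    congr (cexpectation P); apply/funext => w; rewrite /S big_distrlr/=.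
    apply: eq_bigr => k _; apply: eq_bigr => k' _; ring.
  have mkk k k' : complex_moments P (fun w => c k * c k' * (G (e k) w * G (e k') w)).
    by apply: complex_momentsZ; exact: complex_momentsM.
  rewrite cexpectation_sum; last by move=> k; exact: complex_moments_sum.
  rewrite big1// => k _; rewrite cexpectation_sum// big1// => k' _.
  by rewrite cexpectationZ ?proper_normal_pseudo ?mulr0//; exact: complex_momentsM.
have ESJ : Re (cexpectation P (fun w => S w * (S w)^*)) = Kc.
  rewrite /Kc /cquad; congr Re.
  transitivity (cexpectation P (fun w => \sum_k \sum_k' c k * (c k')^* * (G (e k) w * (G (e k') w)^*))).
    congr (cexpectation P); apply/funext => w; rewrite /S conjc_sum big_distrlr/=.
    apply: eq_bigr => k _; apply: eq_bigr => k' _; rewrite conjcM; ring.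
  have mkk k k' : complex_moments P (fun w => c k * (c k')^* * (G (e k) w * (G (e k') w)^*)).
    by apply: complex_momentsZ; apply: complex_momentsM => //; exact: complex_momentsJ.
  rewrite cexpectation_sum; last by move=> k; exact: complex_moments_sum.
  apply: eq_bigr => k _; rewrite cexpectation_sum//; apply: eq_bigr => k' _.
  rewrite cexpectationZ; last by apply: complex_momentsM => //; exact: complex_momentsJ.
  ring.
have -> : \int[P]_w (X w ^+ 2) = 2^-1 * (\int[P]_w Re (S w * S w) + \int[P]_w Re (S w * (S w)^*)).
  rewrite -RintegralD//; last 2 first.
  - exact: all_moments_integrable mSS.1.
  - exact: all_moments_integrable mSJ.1.
  rewrite -RintegralZl//; last first.
    apply: integrable_EFinD => //.
    - exact: all_moments_integrable mSS.1.
    - exact: all_moments_integrable mSJ.1.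
  apply: eq_Rintegral => w _; rewrite !ReM ReC ImC -[X w]/(Re (S w)).
  by move: (Re (S w)) (Im (S w)) => x y; field.
by rewrite -!Re_cexpectation ESS ESJ /= add0r; field.
Qed.

End proper_normal.

Section complex_family.
Context d (T : measurableType d) (R : realType) (P : probability T R).

Lemma cexpectation_indep (X Y : T -> R[i]) : complex_moments P X -> complex_moments P Y ->
  (forall A B : set R[i], measurable A -> measurable B ->
    P (X @^-1` A `&` Y @^-1` B) = (P (X @^-1` A) * P (Y @^-1` B))%E) ->
  cexpectation P (fun w => X w * Y w) = cexpectation P X * cexpectation P Y.
Proof.
move=> mX mY ind.
have mX' := complex_moments_measurable mX; have mY' := complex_moments_measurable mY.
have E (f g : R[i] -> R) : measurable_fun setT f -> measurable_fun setT g ->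
    all_moments P (fun w => f (X w)) -> all_moments P (fun w => g (Y w)) ->
    P.-integrable setT (EFin \o (fun w => f (X w) * g (Y w))) /\
    \int[P]_w (f (X w) * g (Y w)) = \int[P]_w f (X w) * \int[P]_w g (Y w).
  move=> mf mg af ag; apply: (indep_Rintegral mX' mY' ind mf mg).
    exact: all_moments_integrable af.
  exact: all_moments_integrable ag.
have mRe := @measurable_Re R; have mIm := @measurable_Im R.
have [i1 e1] := E _ _ mRe mRe mX.1 mY.1; have [i2 e2] := E _ _ mIm mIm mX.2 mY.2.
have [i3 e3] := E _ _ mRe mIm mX.1 mY.2; have [i4 e4] := E _ _ mIm mRe mX.2 mY.1.
apply: complex_ext.
  rewrite ReM !Re_cexpectation !Im_cexpectation -e1 -e2 -RintegralB//.
  by apply: eq_Rintegral => w _; rewrite ReM.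
rewrite ImM !Re_cexpectation !Im_cexpectation -e3 -e4 -RintegralD//.
by apply: eq_Rintegral => w _; rewrite ImM.
Qed.

Lemma cexpectation_ge0 (X : T -> R[i]) : complex_moments P X ->
  cexpectation P (fun w => X w * (X w)^*) = (\int[P]_w normc (X w) ^+ 2)%:C.
Proof.
move=> mX; under eq_fun do rewrite mul_conjc.
by rewrite cexpectationE; congr (_ +i* _); exact: Rintegral_prob_cst.
Qed.

Section covariance.
Context (J : finType) (X : J -> T -> R[i]).
Hypothesis mX : forall j, complex_moments P (X j).

Definition covariance_of (i j : J) : R[i] := cexpectation P (fun w => X i w * (X j w)^*).

Lemma covariance_herm i j : covariance_of i j = (covariance_of j i)^*.
Proof.
rewrite /covariance_of -cexpectationJ; last first.
  by apply: complex_momentsM => //; exact: complex_momentsJ.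
by congr (cexpectation P); apply/funext => w; rewrite conjcM conjCK mulrC.
Qed.

Lemma covariance_linear (J' : finType) (M : J' -> J -> R[i]) i i' :
  cexpectation P (fun w => (\sum_j M i j * X j w) * (\sum_j M i' j * X j w)^*) =
  \sum_j \sum_j' M i j * covariance_of j j' * (M i' j')^*.
Proof.
have mXX j j' : complex_moments P (fun w => X j w * (X j' w)^*).
  by apply: complex_momentsM => //; exact: complex_momentsJ.
transitivity (cexpectation P (fun w =>
    \sum_j \sum_j' M i j * (M i' j')^* * (X j w * (X j' w)^*))).
  congr (cexpectation P); apply/funext => w; rewrite conjc_sum big_distrlr/=.
  apply: eq_bigr => j _; apply: eq_bigr => j' _; rewrite conjcM; ring.
rewrite cexpectation_sum => [|j]; last first.
  by apply: complex_moments_sum => j'; exact: complex_momentsZ.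
apply: eq_bigr => j _; rewrite cexpectation_sum => [|j']; last exact: complex_momentsZ.
apply: eq_bigr => j' _; rewrite cexpectationZ// /covariance_of; ring.
Qed.

Lemma cquad_covariance c :
  cquad covariance_of c = \int[P]_w normc (\sum_j c j * X j w) ^+ 2.
Proof.
rewrite /cquad -(covariance_linear (fun (_ : unit) => c) tt tt) cexpectation_ge0//.
by apply: complex_moments_sum => j; exact: complex_momentsZ.
Qed.

Lemma cquad_covariance_ge0 c : 0 <= cquad covariance_of c.
Proof. by rewrite cquad_covariance Rintegral_ge0// => w _; exact: sqr_ge0. Qed.

End covariance.

(** The cosine of a sum is a difference of products, the sines being cosines with phase lowered by
    pi/2. By independence the product of sines integrates to a multiple of cos(pi/2), that is 0. *)
Lemma cnormal_add (J : finType) (X Y : J -> T -> R[i]) K L :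
  cnormal P X K -> cnormal P Y L ->
  (forall f g : (J -> R[i]) -> R, (exists c, f = cform c) -> (exists c, g = cform c) ->
    forall A B : set R, measurable A -> measurable B ->
    P ((fun w => f (X^~ w)) @^-1` A `&` (fun w => g (Y^~ w)) @^-1` B) =
    (P ((fun w => f (X^~ w)) @^-1` A) * P ((fun w => g (Y^~ w)) @^-1` B))%E) ->
  cnormal P (fun j w => X j w + Y j w) (fun i j => K i j + L i j).
Proof.
move=> [mX cX] [mY cY] ind; split.
  by move=> j; exact: measurable_funDc.
move=> c theta; pose A w := cform c (X^~ w); pose B w := cform c (Y^~ w).
have mA : measurable_fun setT A by exact: measurable_cform.
have mB : measurable_fun setT B by exact: measurable_cform.
have indAB := ind (cform c) (cform c) (ex_intro _ c erefl) (ex_intro _ c erefl).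
have mc a : measurable_fun setT (fun x : R => cos (x + a)).
  apply: measurableT_comp; last exact: measurable_funD.
  by apply: continuous_measurable_fun => x; exact: continuous_cos.
have ib (F : T -> R) a : measurable_fun setT F -> P.-integrable setT (EFin \o (fun w => cos (F w + a))).
  move=> mF; apply: (@integrable_bounded _ _ _ P _ 1); last by move=> w; exact: cos_max.
  exact: (measurableT_comp (mc a) mF).
have E a b : P.-integrable setT (EFin \o (fun w => cos (A w + a) * cos (B w + b))) /\
    \int[P]_w (cos (A w + a) * cos (B w + b)) =
    cos a * expR (- (cquad K c / 4)) * (cos b * expR (- (cquad L c / 4))).
  have [i e] := indep_Rintegral mA mB indAB (mc a) (mc b) (ib A a mA) (ib B b mB).
  by split => //; rewrite e -(cX c) -(cY c).
have [i1 e1] := E theta 0; have [i2 e2] := E (theta - pi / 2) (- (pi / 2)).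
transitivity (\int[P]_w (cos (A w + theta) * cos (B w + 0) -
    cos (A w + (theta - pi / 2)) * cos (B w + - (pi / 2)))).
  apply: eq_Rintegral => w _.
  have -> : cform c (fun j => X j w + Y j w) = A w + B w.
    rewrite /A /B /cform -ReD -big_split/=; congr Re; apply: eq_bigr => j _.
    by rewrite mulrDr.
  rewrite addr0 (addrA (A w)) !cosBpihalf -cosD; congr cos; ring.
rewrite RintegralB// e1 e2 cosN cos_pihalf cos0 mul0r mulr0 subr0 mul1r -mulrA -expRD.
congr (_ * expR _).
have -> : cquad (fun i j => K i j + L i j) c = cquad K c + cquad L c.
  rewrite /cquad -ReD -big_split/=; congr Re; apply: eq_bigr => i _.
  by rewrite -big_split/=; apply: eq_bigr => j _; ring.
by field.
Qed.

End complex_family.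

Section block_coordinates.
Context (R : realType) (N n : nat).
Local Notation block := (N.-tuple (n.-tuple R[i])).

Definition block_coord (j : 'I_N * 'I_n) (y : block) : R[i] := tnth (tnth y j.1) j.2.

Definition block_of (f : 'I_N * 'I_n -> R[i]) : block :=
  [tuple [tuple f (m, l) | l < n] | m < N].

Lemma block_ofK f j : block_coord j (block_of f) = f j.
Proof. by rewrite /block_coord /block_of !tnth_mktuple; case: j. Qed.

Lemma block_coordK y : block_of (block_coord^~ y) = y.
Proof.
apply: eq_from_tnth => m; apply: eq_from_tnth => l.
by rewrite !tnth_mktuple.
Qed.

Lemma measurable_block_coord j : measurable_fun setT (block_coord j).
Proof.
apply: (measurableT_comp (measurable_tnth j.2)); exact: measurable_tnth.
Qed.

Lemma measurable_blockP d (S : measurableType d) (f : S -> block) :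
  (forall j, measurable_fun setT (block_coord j \o f)) -> measurable_fun setT f.
Proof.
move=> mf; apply/measurable_fun_tnthP => m; apply/measurable_fun_tnthP => l.
exact: (mf (m, l)).
Qed.

End block_coordinates.

(** * The laws of fading, noise and output *)

Section stationarity.
Context d (Omega : measurableType d) (R : realType) (P : probability Omega R).
Variable X : int -> {RV P >-> R[i]}.
Hypothesis sX : stationary X.

(** An event on two coordinates is a measurable set of paths, so one shift preserves covariances.
    Iterated shifts bring the second index to 0, in a direction that depends on its sign. *)
Lemma stationary_covariance n m :
  cexpectation P (fun w => X n w * (X m w)^*) = autocorrelation X (n - m).
Proof.
pose cov (n m : int) := cexpectation P (fun w => X n w * (X m w)^*).
have step a b : cov (a + 1) (b + 1) = cov a b.
  pose U w := (X a w, X b w); pose U' w := (X (a + 1) w, X (b + 1) w).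
  have mU : measurable_fun setT U by exact: measurable_fun_pair.
  have mU' : measurable_fun setT U' by exact: measurable_fun_pair.
  pose Q : probability (R[i] * R[i])%type R := distribution P (mfun_of mU).
  have law C : measurable C -> P (U' @^-1` C) = Q C.
    move=> mC; have pC : path_measurable [set x : int -> R[i] | C (x a, x b)].
      pose G : set (set (int -> R[i])) :=
        \bigcup_n preimage_set_system setT (fun x : int -> R[i] => x n) measurable.
      have mx n0 : measurable_fun setT (fun x : g_sigma_algebraType G => x n0).
        move=> _ B mB; apply: sub_sigma_algebra; exists n0 => //; exists B => //.
      have := measurable_fun_pair (mx a) (mx b).
      by move=> /(_ measurableT C mC); rewrite setTI.
    exact: (sX pC).
  have mg (f : R[i] -> R) : measurable_fun setT f ->
      measurable_fun setT (fun u : R[i] * R[i] => f (u.1 * (u.2)^*)).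
    move=> mf; apply: (measurableT_comp mf); apply: measurable_funMc => //.
    have /measurable_fun_complexP[m1 m2] := @measurable_snd _ _ R[i] R[i].
    apply/measurable_fun_complexP; split.
      by under eq_fun do rewrite ReC.
    by under eq_fun do rewrite ImC; exact: measurable_funN.
  rewrite /cov !cexpectationE; congr (_ +i* _).
    rewrite (Rintegral_law (P := P) (Q := Q) mU' law (mg _ (@measurable_Re R))).
    by rewrite -(Rintegral_law (P := P) (Q := Q) mU (fun _ _ => erefl) (mg _ (@measurable_Re R))).
  rewrite (Rintegral_law (P := P) (Q := Q) mU' law (mg _ (@measurable_Im R))).
  by rewrite -(Rintegral_law (P := P) (Q := Q) mU (fun _ _ => erefl) (mg _ (@measurable_Im R))).
have stepn a b (k : nat) : cov (a + k%:Z) (b + k%:Z) = cov a b.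
  elim: k => [|k IH]; first by rewrite !addr0.
  by rewrite -addn1 PoszD !addrA step.
rewrite -[LHS]/(cov n m) -[RHS]/(cov (n - m) 0).
case: m => k.
  by have := stepn (n - k%:Z) 0 k; rewrite subrK add0r.
by have := stepn n (Negz k) k.+1; rewrite NegzE opprK addNr.
Qed.

End stationarity.

Section channel_law.
Context d (Omega : measurableType d) (R : realType) (P : probability Omega R).
Variables NT NR : nat.
Variable H : 'I_NT -> 'I_NR -> int -> {RV P >-> R[i]}.
Variable W : 'I_NR -> nat -> {RV P >-> R[i]}.
Hypothesis ch : rayleigh_fading_channel H W.

Definition noise_std : R := Num.sqrt 2^-1.

Lemma noise_std2 : noise_std ^+ 2 *+ 2 = 1.
Proof. by rewrite sqr_sqrtr// mulr2n; lra. Qed.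

Local Notation N01 := (normal_prob 0 noise_std).

Let mW l n : measurable_fun setT (W l n).
Proof. exact: measurable_funPT. Qed.

Let mH k l n : measurable_fun setT (H k l n).
Proof. exact: measurable_funPT. Qed.

Lemma noise_moments l n : complex_moments P (W l n).
Proof.
apply: (proper_normal_moments (G := fun _ : unit => W l n) _ (noise_normal ch l n) _ tt) => //.
by move=> _; exact: noise_zero_mean ch l n.
Qed.

Lemma noise_power l n : \int[P]_w normc (W l n w) ^+ 2 = 1.
Proof. by have := noise_unit_variance ch l n; rewrite unlock /Rintegral => ->. Qed.

(* The law of one noise sample is compared, through characteristic functions,
   with that of a pair of independent real normal variables. *)
Lemma noise_law l n (B0 B1 : set R) : measurable B0 -> measurable B1 ->
  P [set w | B0 (Re (W l n w)) /\ B1 (Im (W l n w))] = (N01 B0 * N01 B1)%E.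
Proof.
move=> mB0 mB1.
pose T0 := (measurableTypeR R * measurableTypeR R)%type.
pose P0 : probability T0 R := (N01 \x N01)%E.
pose xi (jb : unit * bool) (u : T0) : R := if jb.2 then u.2 else u.1.
have mxi jb : measurable_fun setT (xi jb).
  by rewrite /xi; case: jb.2; [exact: measurable_snd|exact: measurable_fst].
have iid (B : unit * bool -> set R) : (forall j, measurable (B j)) ->
    P0 [set u | forall j, B j (xi j u)] = (\prod_j N01 (B j))%E.
  move=> mB; rewrite (eq_bigr (fun jb => N01 (B (jb.1, jb.2)))); last by case.
  rewrite -(pair_bigA _ (fun j b => N01 (B (j, b))))/= (big_pred1 tt)/=; last by case.
  rewrite big_bool/= muleC -(product_measure1E (N01) (N01) (mB (tt, false)) (mB (tt, true))).
  rewrite /P0; congr (_ _); apply/seteqP; split => [[u v] /= h|[u v] /= [h1 h2] [[] []]//].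
  by split; [exact: (h (tt, false))|exact: (h (tt, true))].
have n0 := cnormal_iid noise_std2 mxi iid.
have nW : cnormal P (fun (_ : unit) => W l n) (fun i j : unit => (i == j)%:R).
  have := proper_normal_cnormal (G := fun _ : unit => W l n) (fun _ => mW l n) (noise_normal ch l n)
    (fun _ => noise_zero_mean ch l n) (K := unit) (e := idfun) (fun _ _ => id).
  congr cnormal; apply/funext => -[]; apply/funext => -[].
  by rewrite (cexpectation_ge0 (noise_moments l n)) noise_power.
have := @cnormal_law _ _ _ _ P _ _ P0 _ R[i] (fun _ => idfun)
  (fun _ => @measurable_id _ _ _) (fun d1 S f h => h tt) _ _ _ (W l n)
  (fun u : T0 => u.1 +i* u.2) nW n0 (fun _ _ => erefl) (fun _ _ => erefl).
move=> /(_ ((@Re R) @^-1` B0 `&` (@Im R) @^-1` B1)) h.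
transitivity (P (W l n @^-1` ((@Re R) @^-1` B0 `&` (@Im R) @^-1` B1))).
  by congr (P _); apply/seteqP; split.
rewrite h; last first.
  by apply: measurableI; rewrite -[_ @^-1` _]setTI; [exact: measurable_Re|exact: measurable_Im].
rewrite -(product_measure1E (N01) (N01) mB0 mB1)/=.
by rewrite /P0; congr (_ _); apply/seteqP; split.
Qed.

Definition complex_part (b : bool) (z : R[i]) : R := if b then Im z else Re z.

Lemma measurable_complex_part b d1 (S : measurableType d1) (f : S -> R[i]) :
  measurable_fun setT f -> measurable_fun setT (fun s => complex_part b (f s)).
Proof. by move=> /measurable_fun_complexP[mr mi]; case: b. Qed.

(** The channel provides independence of the complex samples, and [noise_law] splits each sample
    into two independent real parts. Events are given on all antenna and time pairs, so those of [J]
    are carried along [e] and completed by the full space. *)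
Lemma noise_iid (J : finType) (e : J -> 'I_NR * nat) : injective e ->
  forall B : J * bool -> set R, (forall j, measurable (B j)) ->
    P [set w | forall j, B j (complex_part j.2 (W (e j.1).1 (e j.1).2 w))] =
    (\prod_j N01 (B j))%E.
Proof.
move=> inj B mB.
pose A (i : 'I_NR * nat) : set Omega :=
  if [pick j | e j == i] is Some j then
    [set w | B (j, false) (Re (W i.1 i.2 w)) /\ B (j, true) (Im (W i.1 i.2 w))]
  else setT.
have AE j : A (e j) = [set w | B (j, false) (Re (W (e j).1 (e j).2 w)) /\
    B (j, true) (Im (W (e j).1 (e j).2 w))].
  by rewrite /A; case: pickP => [j' /eqP/inj -> //|/(_ j)]; rewrite eqxx.
have := noise_independent ch (s := [seq e j | j <- enum J]) (A := A).
rewrite map_inj_uniq// enum_uniq => /(_ isT) h.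
transitivity (P (\big[setI/setT]_(i <- [seq e j | j <- enum J]) A i)).
  congr (P _); rewrite big_map big_enum/=.
  apply/seteqP; split => [w /= hw|w].
    apply: (big_ind (fun S : set Omega => S w)) => // j _.
    by rewrite AE; split; [exact: (hw (j, false))|exact: (hw (j, true))].
  move=> hw [j b] /=; have : A (e j) w.
    by move: hw; rewrite (bigD1 j)//= => -[].
  by rewrite AE => -[h0 h1]; case: b.
rewrite h; last first.
  move=> i /mapP[j _ ->]; rewrite AE.
  exists ((@Re R) @^-1` B (j, false) `&` (@Im R) @^-1` B (j, true)).
    by apply: measurableI; rewrite -[_ @^-1` _]setTI; [exact: measurable_Re|exact: measurable_Im].
  by rewrite setTI; apply/seteqP; split.
rewrite big_map big_enum/=.
rewrite [RHS](eq_bigr (fun jb => N01 (B (jb.1, jb.2)))); last by case.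
rewrite -(pair_bigA _ (fun j b => N01 (B (j, b))))/=; apply: eq_bigr => j _.
by rewrite AE noise_law// big_bool/= muleC.
Qed.

(** [Omega] with the sigma-algebra generated by the fading. A map measurable from this space depends
    on the fading alone, which is the form in which independence from the noise is used. *)
Definition fading_space :=
  g_sigma_algebraType (\bigcup_(i : 'I_NT * 'I_NR * int)
    g_sigma_algebra_preimage (H i.1.1 i.1.2 i.2)).

Definition noise_space :=
  g_sigma_algebraType (\bigcup_(i : 'I_NR * nat) g_sigma_algebra_preimage (W i.1 i.2)).

Lemma measurable_fading k l n : measurable_fun setT (H k l n : fading_space -> R[i]).
Proof.
move=> _ B mB; apply: sub_sigma_algebra; exists (k, l, n) => //.
by exists B => //; rewrite setTI.
Qed.

Lemma measurable_noise l n : measurable_fun setT (W l n : noise_space -> R[i]).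
Proof.
move=> _ B mB; apply: sub_sigma_algebra; exists (l, n) => //.
by exists B => //; rewrite setTI.
Qed.

Lemma fading_noise_indep d1 (T1 : measurableType d1) d2 (T2 : measurableType d2)
    (F : Omega -> T1) (G : Omega -> T2) :
  measurable_fun setT (F : fading_space -> T1) ->
  measurable_fun setT (G : noise_space -> T2) ->
  forall A B, measurable A -> measurable B ->
    P (F @^-1` A `&` G @^-1` B) = (P (F @^-1` A) * P (G @^-1` B))%E.
Proof.
move=> mF mG A B mA mB; apply: (fading_noise_independent ch).
  by have := mF measurableT A mA; rewrite setTI.
by have := mG measurableT B mB; rewrite setTI.
Qed.

Local Notation HH := (fun i : 'I_NT * 'I_NR * int => H i.1.1 i.1.2 i.2 : Omega -> R[i]).

Lemma fading_moments k l n : complex_moments P (H k l n).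
Proof.
apply: (proper_normal_moments (G := HH) _ (fading_normal ch) _ (k, l, n)) => //.
by move=> i; exact: fading_zero_mean ch _ _ _.
Qed.

Lemma fading_covariance k l n k' l' m :
  cexpectation P (fun w => H k l n w * (H k' l' m w)^*) =
  if (k == k') && (l == l') then autocorrelation (H k l) (n - m) else 0.
Proof.
case: ifPn => [/andP[/eqP <- /eqP <-]|neq].
  by apply: stationary_covariance; exact: (fading_stationary ch).
have mJ := complex_momentsJ (fading_moments k' l' m).
rewrite cexpectation_indep//.
- by rewrite (fading_zero_mean ch) mul0r.
- exact: fading_moments.
- move=> A B mA mB.
  have klneq : (k', l') != (k, l).
    by apply: contraNneq neq => -[-> ->]; rewrite !eqxx.
  (* The covariance involves a conjugate, so its event is pulled back through conjugation to an
     event of the process itself. *)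
  pose Bc := (fun z : R[i] => z^*) @^-1` B.
  have mBc : measurable Bc.
    rewrite /Bc -[_ @^-1` _]setTI.
    suff : measurable_fun setT (fun z : R[i] => z^*) by apply.
    apply/measurable_fun_complexP; split.
      by under eq_fun do rewrite ReC; exact: measurable_Re.
    by under eq_fun do rewrite ImC; apply: measurable_funN; exact: measurable_Im.
  have := fading_independent ch (s := [:: (k, l); (k', l')])
    (A := fun i => if i == (k, l) then H k l n @^-1` A else H k' l' m @^-1` Bc).
  rewrite /= inE eq_sym klneq => /(_ isT); rewrite !big_cons !big_nil setIT mule1 eqxx (negbTE klneq).
  apply => i; rewrite !inE => /orP[] /eqP ->; rewrite ?eqxx ?(negbTE klneq).
    apply: sub_sigma_algebra; exists n => //; exists A => //; exact: setTI.
  apply: sub_sigma_algebra; exists m => //; exists Bc => //; exact: setTI.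
Qed.

Section block.
Variables (rho : R) (N t : nat).
Local Notation input := (N.-tuple (NT.-tuple R[i])).
Local Notation J := ('I_N * 'I_NR)%type.

(* The shift t selects the time window t + 1, ..., t + N. *)
Definition faded (z : input) (j : J) (w : Omega) : R[i] :=
  (Num.sqrt rho)%:C *
    (\sum_(k < NT) H k j.2 (t + j.1.+1)%N%:Z w * tnth (tnth z j.1) k).

Definition noise (j : J) (w : Omega) : R[i] := W j.2 (t + j.1.+1) w.

Lemma faded_moments z j : complex_moments P (faded z j).
Proof.
apply: complex_momentsZ; apply: complex_moments_sum => k.
apply: complex_momentsM; [exact: fading_moments|exact: complex_moments_cst].
Qed.

Lemma faded_mean z j : cexpectation P (faded z j) = 0.
Proof.
rewrite cexpectationZ; last first.
  apply: complex_moments_sum => k.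
  apply: complex_momentsM; [exact: fading_moments|exact: complex_moments_cst].
rewrite cexpectation_sum; last first.
  by move=> k; apply: complex_momentsM; [exact: fading_moments|exact: complex_moments_cst].
rewrite big1 ?mulr0// => k _; rewrite cexpectationZr ?(fading_zero_mean ch) ?mul0r//.
exact: fading_moments.
Qed.

Lemma measurable_faded z j : measurable_fun setT (faded z j : fading_space -> R[i]).
Proof.
apply: measurable_funMc => //; apply: measurable_sumc => k.
by apply: measurable_funMc => //; exact: measurable_fading.
Qed.

Let injH : injective (fun p : 'I_NT * 'I_NR * 'I_N => (p.1.1, p.1.2, (t + p.2.+1)%N%:Z)).
Proof.
move=> [[k l] n] [[k' l'] n'] /= [-> -> e]; congr (_, _); apply: val_inj => /=; lia.
Qed.

(** The signal as a linear image of the finite family of all fading variables in the window, the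
    shape expected by [cnormal_linear] and [covariance_linear]. *)
Let faded_lin (z : input) (j : J) w : faded z j w =
  \sum_(p : 'I_NT * 'I_NR * 'I_N)
    (if (p.1.2 == j.2) && (p.2 == j.1) then (Num.sqrt rho)%:C * tnth (tnth z j.1) p.1.1 else 0) *
    H p.1.1 p.1.2 (t + p.2.+1)%N%:Z w.
Proof.
rewrite /faded mulr_sumr; under [RHS]eq_bigr do rewrite (fun_if (fun x => x * _)) mul0r.
rewrite -big_mkcond/=.
rewrite (reindex (fun k => (k, j.2, j.1)))/=; last first.
  exists (fun p => p.1.1) => // -[[k l] n]; rewrite inE /= => /andP[/eqP -> /eqP ->] //.
by apply: eq_big => k; rewrite ?eqxx// => _; ring.
Qed.

Lemma faded_cnormal z : cnormal P (faded z) (covariance_of P (faded z)).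
Proof.
have nH := proper_normal_cnormal (G := HH) (fun i => mH _ _ _) (fading_normal ch)
  (fun i => fading_zero_mean ch _ _ _) injH.
have mo (p : 'I_NT * 'I_NR * 'I_N) : complex_moments P (H p.1.1 p.1.2 (t + p.2.+1)%N%:Z).
  exact: fading_moments.
pose M (j : J) (p : 'I_NT * 'I_NR * 'I_N) : R[i] :=
  if (p.1.2 == j.2) && (p.2 == j.1) then (Num.sqrt rho)%:C * tnth (tnth z j.1) p.1.1 else 0.
have := cnormal_linear M nH.
congr cnormal; first by apply/funext => j; apply/funext => w; rewrite faded_lin.
apply/funext => i; apply/funext => j; rewrite /covariance_of.
have := covariance_linear mo M i j; rewrite /covariance_of => <-.
by congr (cexpectation P); apply/funext => w; rewrite !faded_lin.
Qed.

(** Independence and zero means across antenna pairs leave only the terms with a common transmit and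
    a common receive antenna. The shift [t] cancels in the time difference, which later makes the
    information of a block independent of its window. *)
Lemma faded_covariance z i j : 0 <= rho ->
  covariance_of P (faded z) i j =
  if i.2 == j.2 then rho%:C * \sum_(k < NT) tnth (tnth z i.1) k * (tnth (tnth z j.1) k)^* *
    autocorrelation (H k i.2) (i.1%:Z - j.1%:Z) else 0.
Proof.
move=> rho0.
have mX l n (k : 'I_NT) : complex_moments P (H k l n) by exact: fading_moments.
have mXX k k' : complex_moments P (fun w => H k i.2 (t + i.1.+1)%N%:Z w *
    (H k' j.2 (t + j.1.+1)%N%:Z w)^*).
  by apply: complex_momentsM => //; exact: complex_momentsJ.
transitivity (cexpectation P (fun w => \sum_k \sum_k' rho%:C * (tnth (tnth z i.1) k *
    (tnth (tnth z j.1) k')^*) * (H k i.2 (t + i.1.+1)%N%:Z w * (H k' j.2 (t + j.1.+1)%N%:Z w)^*))).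
  congr (cexpectation P); apply/funext => w; rewrite /faded conjcM conjc_sum.
  have -> : ((Num.sqrt rho)%:C)^* = (Num.sqrt rho)%:C by rewrite -[LHS]/(conjc _) conjc_real.
  pose s := (Num.sqrt rho)%:C.
  transitivity (s * s * ((\sum_k H k i.2 (t + i.1.+1)%N%:Z w * tnth (tnth z i.1) k) *
    (\sum_k (H k j.2 (t + j.1.+1)%N%:Z w * tnth (tnth z j.1) k)^*))).
    by rewrite -/s; move: (\sum_(i0 < NT) _) => S1; ring.
  rewrite /s -rmorphM -expr2 sqr_sqrtr// big_distrlr/= mulr_sumr.
  apply: eq_bigr => k _; rewrite mulr_sumr; apply: eq_bigr => k' _.
  by rewrite conjcM; ring.
rewrite cexpectation_sum => [|k]; last first.
  by apply: complex_moments_sum => k'; exact: complex_momentsZ.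
have e (k k' : 'I_NT) : cexpectation P (fun w => rho%:C * (tnth (tnth z i.1) k *
    (tnth (tnth z j.1) k')^*) * (H k i.2 (t + i.1.+1)%N%:Z w * (H k' j.2 (t + j.1.+1)%N%:Z w)^*)) =
    if (k == k') && (i.2 == j.2) then rho%:C * (tnth (tnth z i.1) k * (tnth (tnth z j.1) k)^*) *
    autocorrelation (H k i.2) (i.1%:Z - j.1%:Z) else 0.
  rewrite cexpectationZ// fading_covariance; case: ifP => [/andP[/eqP <- _]|_]; last by rewrite mulr0.
  by congr (_ * autocorrelation _ _); lia.
case: ifP => [l_eq|l_neq]; last first.
  apply: big1 => k _; rewrite cexpectation_sum => [|k']; last exact: complex_momentsZ.
  by rewrite big1// => k' _; rewrite e l_neq andbF.
rewrite mulr_sumr; apply: eq_bigr => k _.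
rewrite cexpectation_sum => [|k']; last exact: complex_momentsZ.
rewrite (bigD1 k)//= e eqxx l_eq/= [X in _ + X]big1 ?addr0 => [|k' /negbTE k'k].
  by rewrite !mulrA.
by rewrite e eq_sym k'k.
Qed.

Let injW : injective (fun j : J => (j.2, (t + j.1.+1)%N)).
Proof. by move=> [n l] [n' l'] /= [-> e]; congr (_, _); apply: val_inj => /=; lia. Qed.

Lemma noise_block_iid : forall B : J * bool -> set R, (forall j, measurable (B j)) ->
  P [set w | forall j, B j (complex_part j.2 (noise j.1 w))] = (\prod_j N01 (B j))%E.
Proof. exact: (noise_iid injW). Qed.

Lemma measurable_noise_part j : measurable_fun setT (fun w => complex_part j.2 (noise j.1 w)).
Proof. by apply: measurable_complex_part; exact: mW. Qed.

Lemma noise_cnormal : cnormal P noise (fun i j => (i == j)%:R).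
Proof.
have := cnormal_iid noise_std2 measurable_noise_part noise_block_iid.
congr cnormal; apply/funext => j; apply/funext => w /=; rewrite /noise.
by case: (W _ _ w).
Qed.

Lemma received_cnormal z : cnormal P (fun j w => noise j w + faded z j w)
  (fun i j => (i == j)%:R + covariance_of P (faded z) i j).
Proof.
apply: cnormal_add; [exact: noise_cnormal|exact: faded_cnormal|].
move=> _ _ [c ->] [c' ->] A B mA mB; rewrite setIC muleC.
apply: (fading_noise_indep (F := fun w => cform c' (faded z ^~ w))
  (G := fun w => cform c (noise^~ w))) => //.
- by apply: measurable_cform => j; exact: measurable_faded.
- by apply: measurable_cform => j; exact: measurable_noise.
Qed.

End block.
End channel_law.

(** * The information of a block *)

Section block_norm.
Context (R : realType) (N n : nat).
Local Notation block := (N.-tuple (n.-tuple R[i])).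

Definition block_norm2 (y : block) : R := \sum_j normc (block_coord j y) ^+ 2.

Lemma block_norm2_ge0 y : 0 <= block_norm2 y.
Proof. by apply: sumr_ge0 => j _; exact: sqr_ge0. Qed.

Lemma measurable_normc2 d (S : measurableType d) (f : S -> R[i]) :
  measurable_fun setT f -> measurable_fun setT (fun s => normc (f s) ^+ 2).
Proof.
move=> /measurable_fun_complexP[mr mi]; under eq_fun do rewrite sqr_normcE.
by apply: measurable_funD; exact: measurable_funX.
Qed.

(* Density at y of x + W with respect to the law of W, for a block W of
   independent standard complex normal variables. *)
Definition shift_density (x y : block) : R :=
  expR (\sum_j (2 * (Re (block_coord j x) * Re (block_coord j y) +
                     Im (block_coord j x) * Im (block_coord j y)) -
                normc (block_coord j x) ^+ 2)).

Lemma shift_density_gt0 x y : 0 < shift_density x y.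
Proof. exact: expR_gt0. Qed.

Lemma shift_density_le x y : shift_density x y <= expR (block_norm2 y).
Proof.
rewrite ler_expR /block_norm2; apply: ler_sum => j _; rewrite !sqr_normcE.
move: (Re _) (Im _) (Re _) (Im _) => a b a' b'.
have := sqr_ge0 (a - a'); have := sqr_ge0 (b - b'); rewrite !expr2; nra.
Qed.

Lemma measurable_shift_density d (S : measurableType d) (f g : S -> block) :
  measurable_fun setT f -> measurable_fun setT g ->
  measurable_fun setT (fun s => shift_density (f s) (g s)).
Proof.
move=> mf mg; apply: measurableT_comp; first exact: measurable_expR.
apply: measurable_sum => j.
have mcf : measurable_fun setT (fun s => block_coord j (f s)).
  exact: measurableT_comp (@measurable_block_coord R N n j) mf.
have mcg : measurable_fun setT (fun s => block_coord j (g s)).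
  exact: measurableT_comp (@measurable_block_coord R N n j) mg.
have /measurable_fun_complexP[fr fi] := mcf; have /measurable_fun_complexP[gr gi] := mcg.
apply: measurable_funB; last exact: measurable_normc2.
by apply: measurable_funM => //; apply: measurable_funD; exact: measurable_funM.
Qed.

End block_norm.

Section output_law.
Context d (Omega : measurableType d) (R : realType) (P : probability Omega R).
Variables NT NR : nat.
Variable H : 'I_NT -> 'I_NR -> int -> {RV P >-> R[i]}.
Variable W : 'I_NR -> nat -> {RV P >-> R[i]}.
Hypothesis ch : rayleigh_fading_channel H W.
Variables (rho : R) (N t : nat).
Local Notation input := (N.-tuple (NT.-tuple R[i])).
Local Notation output := (N.-tuple (NR.-tuple R[i])).
Local Notation J := ('I_N * 'I_NR)%type.

Definition noise_block (w : Omega) : output := block_of ((noise W t (N := N))^~ w).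

Definition faded_block (u : input * Omega) : output :=
  block_of (fun j => faded H rho t u.1 j u.2).

Definition received (u : input * Omega) : output :=
  block_of (fun j => noise W t j u.2 + faded H rho t u.1 j u.2).

Lemma measurable_noise_block : measurable_fun setT noise_block.
Proof.
apply: measurable_blockP => j; rewrite (_ : _ \o _ = noise W t j); first exact: measurable_funPT.
by apply/funext => w /=; rewrite block_ofK.
Qed.

Lemma measurable_faded_joint j : measurable_fun setT (fun u : input * Omega => faded H rho t u.1 j u.2).
Proof.
apply: measurable_funMc => //; apply: measurable_sumc => k; apply: measurable_funMc.
  exact: measurableT_comp.
apply: (measurableT_comp (measurable_tnth k)).
exact: (measurableT_comp (measurable_tnth j.1)).
Qed.

Lemma measurable_faded_block : measurable_fun setT faded_block.
Proof.
apply: measurable_blockP => j; rewrite (_ : _ \o _ = (fun u => faded H rho t u.1 j u.2)).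
  exact: measurable_faded_joint.
by apply/funext => w /=; rewrite block_ofK.
Qed.

Lemma measurable_received : measurable_fun setT received.
Proof.
apply: measurable_blockP => j.
rewrite (_ : _ \o _ = (fun u => noise W t j u.2 + faded H rho t u.1 j u.2)).
  apply: measurable_funDc; last exact: measurable_faded_joint.
  exact: measurableT_comp.
by apply/funext => w /=; rewrite block_ofK.
Qed.

Lemma measurable_pair1c d1 (T1 : measurableType d1) (f : input * Omega -> T1) z :
  measurable_fun setT f -> measurable_fun setT (fun w => f (z, w)).
Proof. by move=> mf; exact: measurableT_comp mf (measurable_pair1 z). Qed.

Definition noise_law_block : probability output R := distribution P (mfun_of measurable_noise_block).

Local Notation gamma := noise_law_block.

(** An affine family with scale 1: a real part contributes exp(2 x y - x^2), and the two parts of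
    each sample make up the exponent of [shift_density]. *)
Lemma shifted_noise_law (x : output) E : measurable E ->
  P ((fun w => block_of (fun j => noise W t j w + block_coord j x)) @^-1` E) =
  (\int[gamma]_(y in E) (shift_density x y)%:E)%E.
Proof.
move=> mE.
have mpi (jb : J * bool) : measurable_fun setT (fun y : output => complex_part jb.2 (block_coord jb.1 y)).
  by apply: measurable_complex_part; exact: measurable_block_coord.
have gen d1 (S : measurableType d1) (f : S -> output) :
    (forall jb : J * bool, measurable_fun setT ((fun y => complex_part jb.2 (block_coord jb.1 y)) \o f)) ->
    measurable_fun setT f.
  move=> mf; apply: measurable_blockP => j; apply/measurable_fun_complexP; split.
    exact: (mf (j, false)).
  exact: (mf (j, true)).
rewrite (affine_family_density (noise_std2 R) (@measurable_noise_part _ _ _ _ _ W N t) (@noise_block_iid _ _ _ _ _ _ _ _ ch N t)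
  mpi gen (F := noise_block) (a := fun=> 1) (b := fun jb => complex_part jb.2 (block_coord jb.1 x)))//; last 2 first.
- by move=> jb w; rewrite block_ofK.
- by move=> [j []] w; rewrite block_ofK mul1r /= ?ReD ?ImD.
have mf : measurable_fun setT (fun y => (shift_density x y)%:E).
  by apply/measurable_EFinP; apply: measurable_shift_density.
rewrite [RHS]integral_mkcond -(@integral_law _ _ _ _ R P gamma noise_block measurable_noise_block (fun _ _ => erefl)); first last.
- by move=> y; rewrite patchE; case: ifP => // _; rewrite lee_fin ltW// shift_density_gt0.
- by apply/(measurable_restrictT _ mE)/measurable_funTS.
rewrite [LHS]integral_mkcond; apply: eq_integral => w _; rewrite !patchE.
rewrite (_ : (w \in noise_block @^-1` E) = (noise_block w \in E)); last first.
  by apply/idP/idP => /set_mem h; apply/mem_set.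
case: ifP => // _; congr EFin.
rewrite (eq_bigr (fun jb => expR (2 * (complex_part jb.2 (block_coord jb.1 x) *
    complex_part jb.2 (noise W t jb.1 w)) - complex_part jb.2 (block_coord jb.1 x) ^+ 2))); last first.
  move=> jb _; rewrite /affine_density invr1 mul1r mulr1; congr expR; ring.
rewrite -expR_sum; congr expR.
rewrite (eq_bigr (fun jb => 2 * (complex_part (jb.1, jb.2).2 (block_coord (jb.1, jb.2).1 x) *
    complex_part (jb.1, jb.2).2 (noise W t (jb.1, jb.2).1 w)) - complex_part (jb.1, jb.2).2 (block_coord (jb.1, jb.2).1 x) ^+ 2)); last by case.
rewrite -(pair_bigA _ (fun (j : J) b => 2 * (complex_part b (block_coord j x) *
    complex_part b (noise W t j w)) - complex_part b (block_coord j x) ^+ 2))/=.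
by apply: eq_bigr => j _; rewrite big_bool/= block_ofK sqr_normcE; ring.
Qed.

(** The conditional density of the output relative to the noise, as a mixture of shifts over the
    fading. This form gives measurability in both variables and two-sided bounds without a matrix
    formula. *)
Definition channel_density (u : input * output) : R :=
  \int[P]_w shift_density (faded_block (u.1, w)) u.2.

Local Notation p := channel_density.

Lemma integrable_shift_density z y :
  P.-integrable setT (EFin \o (fun w => shift_density (faded_block (z, w)) y)).
Proof.
apply: (@integrable_bounded _ _ _ P _ (expR (block_norm2 y))).
  by apply: measurable_shift_density => //; exact: measurable_pair1c measurable_faded_block.
by move=> w; rewrite ger0_norm ?shift_density_le// ltW// shift_density_gt0.
Qed.

Lemma channel_densityE z y :
  (p (z, y))%:E = (\int[P]_w (shift_density (faded_block (z, w)) y)%:E)%E.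
Proof. by rewrite EFin_Rintegral//; exact: integrable_shift_density. Qed.

Lemma channel_density_le z y : p (z, y) <= expR (block_norm2 y).
Proof.
rewrite -(Rintegral_prob_cst P (expR (block_norm2 y))); apply: le_Rintegral => //.
- exact: integrable_shift_density.
- exact: finite_measure_integrable_cst.
- by move=> w _; exact: shift_density_le.
Qed.

Definition faded_power (z : input) : R := \int[P]_w block_norm2 (faded_block (z, w)).

Lemma faded_powerE z : faded_power z =
  \sum_(j : J) \int[P]_w normc (faded H rho t z j w) ^+ 2.
Proof.
rewrite -Rintegral_sum//; last first.
  by move=> j _; apply: all_moments_integrable; apply: complex_moments_normc; exact: (faded_moments ch).
by apply: eq_Rintegral => w _; apply: eq_bigr => j _; rewrite block_ofK.
Qed.

(* Jensen's inequality: the exponent of the mixture has mean - faded_power. *)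
Lemma channel_density_ge z y : expR (- faded_power z) <= p (z, y).
Proof.
pose f w := \sum_j (2 * (Re (faded H rho t z j w) * Re (block_coord j y) +
    Im (faded H rho t z j w) * Im (block_coord j y)) - normc (faded H rho t z j w) ^+ 2).
have mo j := faded_moments ch rho t z j.
have mf : all_moments P f.
  apply: all_moments_sum => j; apply: all_momentsB; last exact: complex_moments_normc.
  apply: all_momentsZ; apply: all_momentsD; apply: all_momentsM; try exact: all_moments_cst.
    exact: (mo j).1.
  exact: (mo j).2.
have Ef : \int[P]_w f w = - faded_power z.
  rewrite faded_powerE -sumrN Rintegral_sum//.
    apply: eq_bigr => j _.
    have i1 := all_moments_integrable (mo j).1; have i2 := all_moments_integrable (mo j).2.
    have i3 := all_moments_integrable (complex_moments_normc (mo j)).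
    have m1 : \int[P]_w Re (faded H rho t z j w) = 0.
      by rewrite -Re_cexpectation (faded_mean ch).
    have m2 : \int[P]_w Im (faded H rho t z j w) = 0.
      by rewrite -Im_cexpectation (faded_mean ch).
    have i4 : P.-integrable setT (EFin \o (fun w => Re (faded H rho t z j w) * Re (block_coord j y) +
        Im (faded H rho t z j w) * Im (block_coord j y))).
      by apply: integrable_EFinD => //; exact: integrable_EFinZr.
    rewrite RintegralB//; last exact: integrable_EFinZl.
    rewrite RintegralZl// RintegralD//; last 2 first.
    - exact: integrable_EFinZr.
    - exact: integrable_EFinZr.
    by rewrite !RintegralZr// m1 m2 !mul0r addr0 mulr0 sub0r.
  move=> j _; apply: all_moments_integrable; apply: all_momentsB; last exact: complex_moments_normc.
  apply: all_momentsZ; apply: all_momentsD; apply: all_momentsM; try exact: all_moments_cst.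
    exact: (mo j).1.
  exact: (mo j).2.
have if_ := all_moments_integrable mf.
set m := - faded_power z in Ef *.
(* The tangent of exp at the mean [m] lies below exp and integrates to exp m. *)
have -> : expR m = \int[P]_w (expR m * (1 + (f w - m))).
  have ic (c : R) : P.-integrable setT (EFin \o (fun=> c)) by exact: finite_measure_integrable_cst.
  rewrite RintegralZl//; last by apply: integrable_EFinD => //; exact: integrable_EFinB.
  rewrite RintegralD//; last exact: integrable_EFinB.
  by rewrite RintegralB// !Rintegral_prob_cst Ef subrr addr0 mulr1.
apply: le_Rintegral => //.
- apply: integrable_EFinZl => //; apply: integrable_EFinD => //; first exact: finite_measure_integrable_cst.
  by apply: integrable_EFinB => //; exact: finite_measure_integrable_cst.
- exact: integrable_shift_density.
- move=> w _; have -> : shift_density (faded_block (z, w)) y = expR (f w).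
    by congr expR; apply: eq_bigr => j _; rewrite !block_ofK.
  rewrite -[leRHS](mulr1 _) -(expR0 R) -(subrr m) (_ : expR (f w) = expR m * expR (f w - m)); last first.
    by rewrite -expRD; congr expR; ring.
  rewrite subrr expR0 mulr1 ler_pM2l ?expR_gt0//.
  exact: expR_ge1Dx.
Qed.

Lemma channel_density_gt0 u : 0 < p u.
Proof. by case: u => z y; apply: lt_le_trans (channel_density_ge z y); exact: expR_gt0. Qed.

Let mjoint : measurable_fun setT (fun v : (input * output) * Omega =>
  (shift_density (faded_block (v.1.1, v.2)) v.1.2)%:E).
Proof.
apply/measurable_EFinP; apply: measurable_shift_density.
  apply: (measurableT_comp measurable_faded_block); apply: measurable_fun_pair => //.
  exact: measurableT_comp.
exact: measurableT_comp.
Qed.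

Lemma measurable_channel_density : measurable_fun setT p.
Proof.
apply: measurableT_comp => //.
apply: (measurable_fun_fubini_tonelli_F (m2 := P) _ mjoint) => v.
by rewrite lee_fin ltW// shift_density_gt0.
Qed.

(** Fading and noise being independent, the law of their sum is a mixture of laws of shifted noise;
    Tonelli moves the mixture inside the density. *)
Lemma received_law z E : measurable E ->
  P ((fun w => received (z, w)) @^-1` E) = (\int[gamma]_(y in E) (p (z, y))%:E)%E.
Proof.
move=> mE.
have mX : measurable_fun setT (fun w => faded_block (z, w)).
  exact: measurable_pair1c measurable_faded_block.
have ind A B : measurable A -> measurable B ->
    P ((fun w => faded_block (z, w)) @^-1` A `&` noise_block @^-1` B) =
    (P ((fun w => faded_block (z, w)) @^-1` A) * P (noise_block @^-1` B))%E.
  apply: (fading_noise_indep ch).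
    apply: measurable_blockP => j.
    rewrite (_ : _ \o _ = (faded H rho t z j : fading_space H -> R[i])).
      exact: measurable_faded.
    by apply/funext => w /=; rewrite block_ofK.
  apply: measurable_blockP => j.
  rewrite (_ : _ \o _ = (noise W t j : noise_space W -> R[i])).
    exact: measurable_noise.
  by apply/funext => w /=; rewrite block_ofK.
pose addb (u : output * output) : output :=
  block_of (fun j => block_coord j u.2 + block_coord j u.1).
have maddb : measurable_fun setT addb.
  apply: measurable_blockP => j.
  rewrite (_ : _ \o _ = (fun u : output * output => block_coord j u.2 + block_coord j u.1)).
    by apply: measurable_funDc; apply: measurableT_comp => //; exact: measurable_block_coord.
  by apply/funext => u /=; rewrite block_ofK.
have mC : measurable (addb @^-1` E) by rewrite -[_ @^-1` _]setTI; exact: maddb.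
have := indep_law mX measurable_noise_block ind mC.
rewrite (_ : _ @^-1` (addb @^-1` E) = (fun w => received (z, w)) @^-1` E); last first.
  have e w : addb (faded_block (z, w), noise_block w) = received (z, w).
    by congr block_of; apply/funext => j; rewrite !block_ofK.
  by apply/seteqP; split => w; rewrite /preimage /mkset e.
move=> ->; rewrite /product_measure1 /=.
pose LX : probability output R := distribution P (mfun_of mX).
transitivity (\int[LX]_x \int[gamma]_(y in E) (shift_density x y)%:E)%E.
  apply: eq_integral => x _; rewrite -shifted_noise_law// /distribution /pushforward.
  have e w : addb (x, noise_block w) = block_of (fun j => noise W t j w + block_coord j x).
    by congr block_of; apply/funext => j; rewrite !block_ofK.
  congr (P _); apply/seteqP; split => w; rewrite /xsection /preimage /mkset inE /=.
    by rewrite -e.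
  by rewrite -e.
under eq_integral do rewrite integral_mkcond.
have mf : measurable_fun setT (fun u : output * output => ((fun y => (shift_density u.1 y)%:E) \_ E) u.2).
  rewrite (_ : (fun u => _) = (fun u : output * output => (shift_density u.1 u.2)%:E) \_ (setT `*` E)).
    apply/(measurable_restrictT _ (measurableX measurableT mE))/measurable_funTS/measurable_EFinP.
    exact: measurable_shift_density.
  apply/funext => u; rewrite !patchE; congr (if _ then _ else _).
  by apply/idP/idP => /set_mem h; apply/mem_set => //; case: h.
have f0 u : (0 <= ((fun y => (shift_density u.1 y)%:E) \_ E) u.2)%E.
  by rewrite patchE; case: ifP => // _; rewrite lee_fin ltW// shift_density_gt0.
transitivity (\int[gamma]_y \int[LX]_x ((fun y => (shift_density x y)%:E) \_ E) y)%E.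
  rewrite -(fubini_tonelli1 (m1 := LX) (m2 := gamma) _ mf f0).
  by rewrite (fubini_tonelli2 (m1 := LX) (m2 := gamma) _ mf f0).
rewrite [RHS]integral_mkcond; apply: eq_integral => y _; rewrite patchE.
case: ifP => yE; last first.
  by under eq_integral do rewrite patchE yE; rewrite integral0.
under eq_integral do rewrite patchE yE.
rewrite channel_densityE (integral_law (P := P) (Q := LX) mX (fun _ _ => erefl) (f := fun x => (shift_density x y)%:E))//.
- by apply/measurable_EFinP; exact: measurable_shift_density.
- by move=> x; rewrite lee_fin ltW// shift_density_gt0.
Qed.

Variable mu : probability input R.

Definition received_joint : input * Omega -> input * output := fun u => (u.1, received u).

Lemma measurable_received_joint : measurable_fun setT received_joint.
Proof. by apply: measurable_fun_pair => //; exact: measurable_received. Qed.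

Definition joint_law : probability (input * output)%type R :=
  distribution (mu \x P)%E (mfun_of measurable_received_joint).

Lemma joint_lawE C : measurable C ->
  joint_law C = (\int[mu \x gamma]_(x in C) (p x)%:E)%E.
Proof.
move=> mC; rewrite integral_mkcond.
have mf : measurable_fun setT ((EFin \o p) \_ C).
  apply/(measurable_restrictT _ mC)/measurable_funTS/measurable_EFinP.
  exact: measurable_channel_density.
rewrite (fubini_tonelli1 (m1 := mu) (m2 := gamma) _ mf); last first.
  by move=> u; rewrite patchE; case: ifP => //= _; rewrite lee_fin ltW// channel_density_gt0.
rewrite /joint_law /distribution /pushforward /= /product_measure1 /=.
apply: eq_integral => z _.
transitivity (P ((fun w => received (z, w)) @^-1` (xsection C z))).
  by congr (P _); apply/seteqP; split => w /=; rewrite /xsection /= !inE.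
rewrite received_law; last exact: measurable_xsection.
rewrite /fubini_F [LHS]integral_mkcond; apply: eq_integral => y _; rewrite !patchE.
by congr (if _ then _ else _); rewrite /xsection; apply/idP/idP => /set_mem /= h; apply/mem_set => //=; rewrite inE in h *.
Qed.

End output_law.

(** * The upper bound *)

Arguments Normc.normc : simpl never.
Arguments cexpectation : simpl never.
Arguments covariance_of : simpl never.

Section relative_entropy_ext.
Context d (T : measurableType d) (R : realType).

(* Probabilities that agree on measurable sets need not be equal as structures. *)
Lemma relative_entropy_ext (nu nu' mu mu' : probability T R) (f : T -> R) :
  measurable_fun setT f -> (forall x, 0 <= f x) ->
  (forall E, measurable E -> nu E = (\int[mu]_(x in E) (f x)%:E)%E) ->
  (forall E, measurable E -> nu E = nu' E) -> (forall E, measurable E -> mu E = mu' E) ->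
  relative_entropy nu mu = relative_entropy nu' mu'.
Proof.
move=> mf f0 nuf nuE muE.
rewrite (relative_entropy_density mf f0 nuf).
rewrite (@relative_entropy_density _ _ _ nu' mu' f mf f0); last first.
  move=> E mE; rewrite -nuE// nuf//; apply: eq_measure_integral => A mA _; exact: muE.
by apply: eq_measure_integral => A mA _; exact: nuE.
Qed.

End relative_entropy_ext.

Section finite_sums.
Variable R : realType.

Lemma normc_real (x : R) : normc x%:C = `|x|.
Proof. by rewrite /normc /= expr0n addr0 sqrtr_sqr. Qed.

Lemma measurable_conjc d (T : measurableType d) (f : T -> R[i]) :
  measurable_fun setT f -> measurable_fun setT (fun w => (f w)^*).
Proof.
move=> /measurable_fun_complexP[mr mi]; apply/measurable_fun_complexP; split.
  by under eq_fun do rewrite ReC.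
by under eq_fun do rewrite ImC; exact: measurable_funN.
Qed.

(** Lagrange's identity: the difference of the two sides is half a sum of squares. *)
Lemma cauchy_schwarz_sum (I : finType) (a b : I -> R) :
  (\sum_i a i * b i) ^+ 2 <= (\sum_i a i ^+ 2) * (\sum_i b i ^+ 2).
Proof.
have : 0 <= \sum_i \sum_j (a i * b j - a j * b i) ^+ 2.
  by apply: sumr_ge0 => i _; apply: sumr_ge0 => j _; exact: sqr_ge0.
have -> : \sum_i \sum_j (a i * b j - a j * b i) ^+ 2 =
    2 * ((\sum_i a i ^+ 2) * (\sum_i b i ^+ 2)) - 2 * (\sum_i a i * b i) ^+ 2.
  rewrite expr2 !big_distrlr/=.
  transitivity (\sum_i \sum_j (a i ^+ 2 * b j ^+ 2 + a j ^+ 2 * b i ^+ 2 - 2 * (a i * b i * (a j * b j)))).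
    by apply: eq_bigr => i _; apply: eq_bigr => j _; ring.
  rewrite (eq_bigr (fun i => \sum_j a i ^+ 2 * b j ^+ 2 + \sum_j a j ^+ 2 * b i ^+ 2 -
    \sum_j 2 * (a i * b i * (a j * b j)))); last first.
    by move=> i _; rewrite -big_split -sumrB.
  rewrite sumrB big_split/=.
  have -> : \sum_i \sum_j a j ^+ 2 * b i ^+ 2 = \sum_i \sum_j a i ^+ 2 * b j ^+ 2.
    by rewrite exchange_big.
  rewrite -mulr2n -[_ *+ 2]mulr_natl; congr (_ - _).
  by rewrite mulr_sumr; apply: eq_bigr => i _; rewrite mulr_sumr.
lra.
Qed.

Lemma normc_sum_le I (r : seq I) (F : I -> R[i]) :
  normc (\sum_(i <- r) F i) <= \sum_(i <- r) normc (F i).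
Proof.
elim: r => [|i r IH]; first by rewrite !big_nil Normc.normc0.
by rewrite !big_cons (le_trans (le_normcD _ _))// lerD2l.
Qed.

Lemma normc_sum_cauchy (I : finType) (x y : I -> R[i]) :
  normc (\sum_i x i * y i) ^+ 2 <= (\sum_i normc (x i) ^+ 2) * (\sum_i normc (y i) ^+ 2).
Proof.
apply: le_trans (cauchy_schwarz_sum _ _).
rewrite lerXn2r ?nnegrE ?normc_ge0//.
  by apply: sumr_ge0 => i _; rewrite mulr_ge0// normc_ge0.
apply: le_trans (normc_sum_le _ _) _.
by apply: ler_sum => i _; rewrite Normc.normcM.
Qed.

(** Indices below [n] are at distances 1, ..., n and those above at distances 1, ..., N - n - 1. *)
Lemma sum_distanceE (r : nat -> R) (N : nat) (n : nat) : (n < N)%N ->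
  \sum_(m < N) r `|(n%:Z - m%:Z)|%N =
  r 0%N + \sum_(1 <= h < n.+1) r h + \sum_(1 <= h < (N - n)%N) r h.
Proof.
move=> nN; rewrite -(big_mkord xpredT (fun m => r `|(n%:Z - m%:Z)|%N)).
rewrite (@big_cat_nat _ _ _ n)//=; last exact: ltnW.
rewrite [X in _ + X]big_ltn// subrr absz0.
have -> : \sum_(0 <= m < n) r `|n%:Z - m%:Z|%N = \sum_(1 <= h < n.+1) r h.
  rewrite big_nat_rev/= add0n big_add1/=; apply: eq_big_nat => m /andP[_ mn].
  by congr r; lia.
have -> : \sum_(n.+1 <= m < N) r `|n%:Z - m%:Z|%N = \sum_(1 <= h < (N - n)%N) r h.
  rewrite -[n.+1]addn1 addnC big_addn; apply: eq_big_nat => m /andP[_ mn].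
  by congr r; lia.
by rewrite addrA [r 0%N + _]addrC.
Qed.

Lemma sum_distance_le (r : nat -> R) (s : R) (N : nat) (n : 'I_N) :
  (forall h, 0 <= r h) -> (forall M, \sum_(1 <= h < M) r h <= s) ->
  \sum_(m < N) r `|(n%:Z - m%:Z)|%N <= r 0%N + 2 * s.
Proof.
move=> r0 rs; rewrite sum_distanceE//.
by have := rs n.+1; have := rs (N - n)%N; lra.
Qed.

End finite_sums.

Section channel_bounds.
Context d (Omega : measurableType d) (R : realType) (P : probability Omega R).
Variables NT NR : nat.
Variable H : 'I_NT -> 'I_NR -> int -> {RV P >-> R[i]}.
Variable W : 'I_NR -> nat -> {RV P >-> R[i]}.
Hypothesis ch : rayleigh_fading_channel H W.
Local Notation R0 k l := (autocorrelation0 (H k l)).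

Lemma autocorrelation_zero k l : autocorrelation (H k l) 0 = (R0 k l)%:C.
Proof.
rewrite /autocorrelation0 /autocorrelation cexpectation_ge0//.
exact: fading_moments ch k l 0.
Qed.

Lemma autocorrelation0_ge0 k l : 0 <= R0 k l.
Proof.
rewrite /autocorrelation0 /autocorrelation cexpectation_ge0/=; last exact: fading_moments ch k l 0.
by apply: Rintegral_ge0 => w _; exact: sqr_ge0.
Qed.

Lemma autocorrelationN k l n : autocorrelation (H k l) (- n) = (autocorrelation (H k l) n)^*.
Proof.
have := fading_covariance ch k l 0 k l n; rewrite !eqxx/= sub0r => <-.
rewrite /autocorrelation -cexpectationJ; last first.
  apply: complex_momentsM; first exact: fading_moments ch k l n.
  by apply: complex_momentsJ; exact: fading_moments ch k l 0.
by congr (cexpectation P); apply/funext => w; rewrite conjcM conjCK mulrC.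
Qed.

Lemma normc_autocorrelation_abs k l (n : int) :
  normc (autocorrelation (H k l) n) = normc (autocorrelation (H k l) `|n|%N%:Z).
Proof.
case: n => n //; rewrite NegzE autocorrelationN normcJ_real.
by congr (normc (autocorrelation _ _)); lia.
Qed.

Hypothesis phi_finite : forall k l, (phi (H k l) < +oo)%E.

Lemma sum_autocorrelation_le k l M :
  \sum_(1 <= h < M) normc (autocorrelation (H k l) h%:Z) ^+ 2 <= fine (phi (H k l)).
Proof.
rewrite -lee_fin -sumEFin fineK; last first.
  rewrite ge0_fin_numE ?phi_finite//.
  by apply: nneseries_ge0 => n _ _; rewrite lee_fin sqr_ge0.
by apply: nneseries_lim_ge => n _ _; rewrite lee_fin sqr_ge0.
Qed.

(** This is where [lambda] comes from: in a row of the covariance matrix the lag 0 occurs once and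
    every positive lag at most twice. The bound holds for all [N], hence for the capacity. *)
Lemma sum_autocorrelation_lambda k l N (n : 'I_N) :
  \sum_(m < N) normc (autocorrelation (H k l) (n%:Z - m%:Z)) ^+ 2 <= lambda (H k l).
Proof.
under eq_bigr do rewrite normc_autocorrelation_abs.
have := sum_distance_le (r := fun h => normc (autocorrelation (H k l) h%:Z) ^+ 2) n
  (fun h => sqr_ge0 _) (sum_autocorrelation_le k l).
by rewrite autocorrelation_zero normc_real real_normK ?num_real.
Qed.

Lemma lambda_ge0 k l : 0 <= lambda (H k l).
Proof.
rewrite /lambda addr_ge0 ?sqr_ge0// mulr_ge0// fine_ge0//.
by apply: nneseries_ge0 => n _ _; rewrite lee_fin sqr_ge0.
Qed.

Section block.
Variables (rho : R) (N t : nat).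
Hypothesis rho0 : 0 <= rho.
Local Notation input := (N.-tuple (NT.-tuple R[i])).
Local Notation output := (N.-tuple (NR.-tuple R[i])).
Local Notation J := ('I_N * 'I_NR)%type.
Local Notation A z := (covariance_of P (faded (N := N) H rho t z)).

Lemma faded_second_moment (z : input) (j : J) :
  \int[P]_w normc (faded H rho t z j w) ^+ 2 =
  rho * \sum_(k < NT) normc (tnth (tnth z j.1) k) ^+ 2 * R0 k j.2.
Proof.
have := faded_covariance ch t z j j rho0.
rewrite /covariance_of cexpectation_ge0; last exact: (faded_moments ch).
rewrite eqxx subrr => /(congr1 (@Re R)) /= ->.
rewrite ReZ Re_sum; congr (_ * _); apply: eq_bigr => k _.
by rewrite mul_conjc autocorrelation_zero -rmorphM.
Qed.

(** The cross terms vanish, because fading and noise are independent and centred. *)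
Lemma received_second_moment (z : input) (j : J) :
  P.-integrable setT (EFin \o (fun w => normc (noise W t j w + faded H rho t z j w) ^+ 2)) /\
  \int[P]_w normc (noise W t j w + faded H rho t z j w) ^+ 2 =
  1 + \int[P]_w normc (faded H rho t z j w) ^+ 2.
Proof.
have mW : complex_moments P (noise W t j) by exact: (noise_moments ch).
have mX : complex_moments P (faded H rho t z j) by exact: (faded_moments ch).
have mS : complex_moments P (fun w => noise W t j w + faded H rho t z j w).
  exact: complex_momentsD.
split; first by apply: all_moments_integrable; exact: complex_moments_normc.
apply: (@complexI R); rewrite -cexpectation_ge0// rmorphD/= -cexpectation_ge0//.
have -> : (1%:C : R[i]) = cexpectation P (fun w => noise W t j w * (noise W t j w)^*).
  by rewrite cexpectation_ge0// (noise_power ch).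
have mJ f : complex_moments P f -> complex_moments P (fun w => (f w)^*).
  exact: complex_momentsJ.
have mM f g : complex_moments P f -> complex_moments P g -> complex_moments P (fun w => f w * (g w)^*).
  by move=> mf mg; apply: complex_momentsM => //; exact: mJ.
have cross : cexpectation P (fun w => faded H rho t z j w * (noise W t j w)^*) = 0.
  rewrite cexpectation_indep//; first by rewrite (faded_mean ch) mul0r.
    exact: mJ.
  apply: (fading_noise_indep ch); first exact: measurable_faded.
  exact: (measurable_conjc (@measurable_noise _ _ _ _ _ W j.2 (t + j.1.+1))).
have cross' : cexpectation P (fun w => noise W t j w * (faded H rho t z j w)^*) = 0.
  rewrite (_ : (fun w => _) = (fun w => (faded H rho t z j w * (noise W t j w)^*)^*)); last first.
    by apply/funext => w; rewrite conjcM conjCK mulrC.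
  rewrite cexpectationJ; last exact: mM.
  by rewrite cross; exact: conjc0.
transitivity (cexpectation P (fun w => (noise W t j w * (noise W t j w)^* + noise W t j w * (faded H rho t z j w)^*) +
    (faded H rho t z j w * (noise W t j w)^* + faded H rho t z j w * (faded H rho t z j w)^*))).
  by congr (cexpectation P); apply/funext => w; rewrite rmorphD/=; ring.
rewrite cexpectationD; last 2 first.
- by apply: complex_momentsD; exact: mM.
- by apply: complex_momentsD; exact: mM.
rewrite !cexpectationD; try exact: mM.
by rewrite cross cross' addr0 add0r.
Qed.

(** Cauchy-Schwarz over the antennas, with the autocorrelation attached to the factor at time [n].
    The peak constraint bounds the factor at time [m] by 1, and the result is linear in the powers
    at time [n], so that averaging over the input involves mean powers only. *)
Lemma faded_covariance_norm (z : input) : (forall n, sqr_norm2 (tnth z n) <= 1) ->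
  \sum_(i : J) \sum_(j : J) normc (A z i j) ^+ 2 <=
  rho ^+ 2 * \sum_(i : J) \sum_(k < NT) normc (tnth (tnth z i.1) k) ^+ 2 * lambda (H k i.2).
Proof.
move=> peak; rewrite mulr_sumr; apply: ler_sum => -[n l] _.
have -> : \sum_(j : J) normc (A z (n, l) j) ^+ 2 = \sum_(m < N) normc (A z (n, l) (m, l)) ^+ 2.
  rewrite [LHS](eq_bigr (fun j => normc (A z (n, l) (j.1, j.2)) ^+ 2)); last by case.
  rewrite -(pair_bigA _ (fun m l' => normc (A z (n, l) (m, l')) ^+ 2))/=.
  apply: eq_bigr => m _; rewrite (bigD1 l)//= big1 ?addr0// => l' /negbTE l'l.
  by rewrite (faded_covariance ch)// eq_sym l'l Normc.normc0 expr0n.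
apply: (@le_trans _ _ (\sum_(m < N) rho ^+ 2 * \sum_(k < NT) normc (tnth (tnth z n) k) ^+ 2 *
    normc (autocorrelation (H k l) (n%:Z - m%:Z)) ^+ 2)); last first.
  rewrite -mulr_sumr ler_wpM2l ?sqr_ge0// exchange_big/=; apply: ler_sum => k _.
  by rewrite -mulr_sumr ler_wpM2l ?sqr_ge0// sum_autocorrelation_lambda.
apply: ler_sum => m _; rewrite (faded_covariance ch)// eqxx Normc.normcM exprMn.
rewrite normc_real real_normK ?num_real// ler_wpM2l ?sqr_ge0//.
have := normc_sum_cauchy (fun k : 'I_NT => (tnth (tnth z m) k)^*)
  (fun k => tnth (tnth z n) k * autocorrelation (H k l) (n%:Z - m%:Z)).
rewrite (eq_bigr (fun k => tnth (tnth z n) k * (tnth (tnth z m) k)^* *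
  autocorrelation (H k l) (n%:Z - m%:Z))) => [|k _]; last by ring.
move=> /le_trans; apply.
rewrite -[leRHS]mul1r ler_pM//.
- by apply: sumr_ge0 => k _; exact: sqr_ge0.
- by apply: sumr_ge0 => k _; exact: sqr_ge0.
- by apply: le_trans (peak m); apply: ler_sum => k _; rewrite normcJ_real.
- by apply: ler_sum => k _; rewrite Normc.normcM exprMn.
Qed.

Lemma integral_noise_law E (f : output -> \bar R) : measurable E ->
  measurable_fun setT f -> (forall y, (0 <= f y)%E) ->
  (\int[noise_law_block W N t]_(y in E) f y =
   \int[P]_(w in noise_block W N t @^-1` E) f (noise_block W N t w))%E.
Proof.
move=> mE mf f0; rewrite integral_mkcond [RHS]integral_mkcond.
rewrite -(@integral_law _ _ _ _ R P (noise_law_block W N t) (noise_block W N t)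
  (@measurable_noise_block _ _ _ _ _ W N t) (fun _ _ => erefl)); first last.
- by move=> y; rewrite patchE; case: ifP.
- by apply/(measurable_restrictT _ mE)/measurable_funTS.
apply: eq_integral => w _; rewrite !patchE.
rewrite (_ : (w \in noise_block W N t @^-1` E) = (noise_block W N t w \in E))//.
Qed.

(** For a fixed input the output is complex normal with covariance exceeding the identity by [A z],
    so [gaussian_divergence] applies with the mixture density in the role of [p]. *)
Lemma channel_divergence (z : input) :
  P.-integrable setT (EFin \o (fun w =>
    ln (channel_density H rho t (z, received H W rho t (z, w))))) /\
  \int[P]_w ln (channel_density H rho t (z, received H W rho t (z, w))) <=
  2^-1 * \sum_(i : J) \sum_(j : J) normc (A z i j) ^+ 2.
Proof.
pose p y := channel_density H rho t (z, y).
have mp : measurable_fun setT p.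
  apply: (@measurableT_comp _ _ _ _ _ _ (channel_density H rho t) _ (pair z)).
    exact: measurable_channel_density.
  exact: measurable_pair1.
have p0 y : 0 < p y by exact: (channel_density_gt0 ch).
have mo j := faded_moments ch rho t z j.
apply: (gaussian_divergence (noise_std2 R) (@measurable_noise_part _ _ _ _ _ W N t)
  (@noise_block_iid _ _ _ _ _ _ _ _ ch N t) (covariance_herm mo)
  (cquad_covariance_ge0 mo) (received_cnormal ch rho t z)
  (@measurable_block_coord R N NR) (@measurable_blockP R N NR) (@block_ofK R N NR)
  (@block_coordK R N NR) mp p0).
move=> E mE.
have mp' : measurable_fun setT (fun y => (channel_density H rho t (z, y))%:E).
  exact/measurable_EFinP.
have p0' y : (0 <= (channel_density H rho t (z, y))%:E)%E by rewrite lee_fin ltW// p0.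
have := etrans (received_law ch rho t z mE) (integral_noise_law mE mp' p0').
have -> : noise_block W N t = (fun w => block_of ((fun (j : J) w =>
    complex_part false (noise W t j w) +i* complex_part true (noise W t j w))^~ w)).
  apply/funext => w; congr block_of; apply/funext => j.
  by rewrite /complex_part; case: (noise _ _ _ _).
exact.
Qed.

End block.
End channel_bounds.

Section product_integrals.
Context (R : realType).

Lemma Rintegral_prod d1 d2 (T1 : measurableType d1) (T2 : measurableType d2)
    (m1 : probability T1 R) (m2 : probability T2 R) (F : T1 * T2 -> R) :
  (m1 \x m2)%E.-integrable setT (EFin \o F) ->
  (forall x, m2.-integrable setT (EFin \o (fun y => F (x, y)))) ->
  m1.-integrable setT (EFin \o (fun x => \int[m2]_y F (x, y))) /\
  \int[(m1 \x m2)%E]_u F u = \int[m1]_x \int[m2]_y F (x, y).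
Proof.
move=> iF i2.
have e : EFin \o (fun x => \int[m2]_y F (x, y)) = fubini_F m2 (EFin \o F).
  by apply/funext => x /=; rewrite EFin_Rintegral//; exact: i2.
split; first by rewrite e; exact: integrable_fubini_F.
rewrite /Rintegral; congr fine; rewrite -(integral12_prod_meas1 iF) -e.
by apply: eq_integral.
Qed.

Lemma ae_integrable_bounded d (T : measurableType d) (P : probability T R) (f : T -> R) (K : R) :
  measurable_fun setT f -> {ae P, forall x, `|f x| <= K} ->
  P.-integrable setT (EFin \o f).
Proof.
move=> mf fK; apply/integrableP; split; first exact/measurable_EFinP.
apply: (@le_lt_trans _ _ (\int[P]_x (`|K|)%:E)%E).
  apply: ae_ge0_le_integral => //.
  - by do 2 apply: measurableT_comp => //.
  - by apply: filterS fK => x fK _; rewrite lee_fin (le_trans fK)// ler_norm.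
by rewrite integral_cst//= probability_setT mule1 ltry.
Qed.

Lemma ae_le_Rintegral d (T : measurableType d) (P : probability T R) (f g : T -> R) :
  P.-integrable setT (EFin \o f) -> P.-integrable setT (EFin \o g) ->
  {ae P, forall x, f x <= g x} -> \int[P]_x f x <= \int[P]_x g x.
Proof.
move=> if_ ig fg; rewrite -lee_fin !EFin_Rintegral//.
apply: ae_le_integral; [exact: measurable_int if_|exact: measurable_int ig|by left|].
by apply: filterS fg => x; rewrite lee_fin.
Qed.

End product_integrals.

Section information_bounds.
Context d (Omega : measurableType d) (R : realType) (P : probability Omega R).
Variables NT NR : nat.
Variable H : 'I_NT -> 'I_NR -> int -> {RV P >-> R[i]}.
Variable W : 'I_NR -> nat -> {RV P >-> R[i]}.
Hypothesis ch : rayleigh_fading_channel H W.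
Hypothesis phi_finite : forall k l, (phi (H k l) < +oo)%E.
Local Notation R0 k l := (autocorrelation0 (H k l)).
Variables (rho beta : R) (N t : nat).
Hypotheses (rho0 : 0 <= rho) (beta1 : 1 <= beta).
Local Notation input := (N.-tuple (NT.-tuple R[i])).
Local Notation output := (N.-tuple (NR.-tuple R[i])).
Local Notation J := ('I_N * 'I_NR)%type.
Variable mu : probability input R.
Hypothesis power : sum_power_constraints beta mu.
Local Notation p := (channel_density H rho t).
Local Notation gamma := (noise_law_block W N t).
Local Notation nu := (joint_law H W rho t mu).
Local Notation rec z w := (received H W rho t (z, w)).
Local Notation amp z n k := (normc (tnth (tnth (z : input) n) k) ^+ 2).

Lemma measurable_amp n k : measurable_fun setT (fun z : input => amp z n k).
Proof.
apply: measurable_normc2; apply: (measurableT_comp (measurable_tnth k)).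
exact: measurable_tnth.
Qed.

Lemma peak_power : {ae mu, forall z n, sqr_norm2 (tnth z n) <= 1}.
Proof. by case: power. Qed.

Lemma amp_le1 (z : input) : (forall n, sqr_norm2 (tnth z n) <= 1) ->
  forall n k, amp z n k <= 1.
Proof.
move=> pz n k; apply: le_trans (pz n); rewrite /sqr_norm2 (bigD1 k)//= lerDl.
by apply: sumr_ge0 => i _; exact: sqr_ge0.
Qed.

Lemma integrable_amp n k : mu.-integrable setT (EFin \o (fun z => amp z n k)).
Proof.
apply: (@ae_integrable_bounded _ _ _ mu _ 1); first exact: measurable_amp.
apply: filterS peak_power => z pz.
by rewrite ger0_norm ?sqr_ge0// amp_le1.
Qed.

Definition mean_power (n : 'I_N) (k : 'I_NT) : R := \int[mu]_z amp z n k.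

Lemma mean_power_ge0 n k : 0 <= mean_power n k.
Proof. by apply: Rintegral_ge0 => z _; exact: sqr_ge0. Qed.

(** The mean powers at one time are a competitor in the maximum of the theorem: this is the only use
    of the average power constraint in the upper bound. *)
Lemma mean_power_A n : mean_power n \in A_ beta.
Proof.
apply/mem_set; split; first by move=> k; exact: mean_power_ge0.
have ia k := integrable_amp n k.
have e : (\int[mu]_z (sqr_norm2 (tnth z n))%:E = (\sum_(k < NT) mean_power n k)%:E)%E.
  rewrite /mean_power -(@Rintegral_sum _ _ _ mu setT measurableT)// EFin_Rintegral//.
  by apply: integrable_EFin_sum => // k _; exact: ia.
case: power => _ /(_ n); rewrite unlock => h.
by rewrite -lee_fin -e; exact: h.
Qed.

Lemma mean_power_le1 n k : mean_power n k <= 1.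
Proof.
have /set_mem[a0 a1] := mean_power_A n.
apply: (@le_trans _ _ (\sum_(k < NT) mean_power n k)).
  by rewrite (bigD1 k)//= lerDl; apply: sumr_ge0 => i _; exact: a0.
by apply: le_trans a1 _; rewrite invf_le1// (lt_le_trans ltr01).
Qed.

Lemma integral_mean_power (c : J -> 'I_NT -> R) :
  mu.-integrable setT (EFin \o (fun z => \sum_(i : J) \sum_(k < NT) amp z i.1 k * c i k)) /\
  \int[mu]_z (\sum_(i : J) \sum_(k < NT) amp z i.1 k * c i k) =
  \sum_(i : J) \sum_(k < NT) mean_power i.1 k * c i k.
Proof.
have i1 (i : J) k : mu.-integrable setT (EFin \o (fun z => amp z i.1 k * c i k)).
  by apply: integrable_EFinZr => //; exact: integrable_amp.
have i2 i : mu.-integrable setT (EFin \o (fun z => \sum_(k < NT) amp z i.1 k * c i k)).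
  by apply: integrable_EFin_sum => // k _; exact: i1.
split; first by apply: integrable_EFin_sum => // i _; exact: i2.
rewrite Rintegral_sum//; apply: eq_bigr => i _.
rewrite Rintegral_sum//; apply: eq_bigr => k _.
by rewrite RintegralZr//; exact: integrable_amp.
Qed.

Definition received_power (z : input) : R :=
  \sum_(j : J) (1 + rho * \sum_(k < NT) amp z j.1 k * R0 k j.2).

Lemma integrable_rec_norm2 (z : input) : P.-integrable setT (EFin \o (fun w => block_norm2 (rec z w))) /\
  \int[P]_w block_norm2 (rec z w) = received_power z.
Proof.
have e w : block_norm2 (rec z w) = \sum_(j : J) normc (noise W t j w + faded H rho t z j w) ^+ 2.
  by apply: eq_bigr => j _; rewrite block_ofK.
have i1 (j : J) := received_second_moment ch rho t z j.
split.
  rewrite (_ : (fun w => _) = fun w => \sum_(j : J) normc (noise W t j w + faded H rho t z j w) ^+ 2).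
    by apply: integrable_EFin_sum => // j _; exact: (i1 j).1.
  by apply/funext => w; exact: e.
under eq_Rintegral do rewrite e.
rewrite Rintegral_sum//; last by move=> j _; exact: (i1 j).1.
by apply: eq_bigr => j _; rewrite (i1 j).2 (faded_second_moment ch).
Qed.

(** Bounds the received power under the peak constraint, uniformly in the input; it is used for
    integrability only. *)
Definition max_power : R := \sum_(j : J) (1 + rho * \sum_(k < NT) R0 k j.2).

Lemma received_power_le (z : input) : (forall n, sqr_norm2 (tnth z n) <= 1) ->
  received_power z <= max_power.
Proof.
move=> pz; apply: ler_sum => j _; rewrite lerD2l ler_wpM2l//; apply: ler_sum => k _.
by rewrite ler_piMl ?amp_le1//; exact: (autocorrelation0_ge0 ch).
Qed.

Lemma faded_power_le (z : input) : (forall n, sqr_norm2 (tnth z n) <= 1) ->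
  faded_power H rho t z <= max_power.
Proof.
move=> pz; apply: le_trans (received_power_le pz).
rewrite (faded_powerE ch); apply: ler_sum => j _.
by rewrite (faded_second_moment ch)// lerDr.
Qed.

(** A common criterion for functions with at most quadratic growth in the output. The coefficients
    may depend on the input and are bounded almost everywhere, as the peak constraint itself holds
    almost everywhere. *)
Lemma joint_integral (f : input * output -> R) (K M : input -> R) (K0 M0 : R) :
  measurable_fun setT f -> (forall z, 0 <= M z) ->
  (forall z y, `|f (z, y)| <= K z + M z * block_norm2 y) ->
  {ae mu, forall z, K z <= K0} -> {ae mu, forall z, M z <= M0} ->
  [/\ nu.-integrable setT (EFin \o f),
      forall z, P.-integrable setT (EFin \o (fun w => f (z, rec z w))),
      mu.-integrable setT (EFin \o (fun z => \int[P]_w f (z, rec z w))) &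
      \int[nu]_x f x = \int[mu]_z \int[P]_w f (z, rec z w)].
Proof.
move=> mf M_ge0 fK KK0 MM0.
have mJ := measurable_received_joint H W rho t (N := N).
pose F u := f (received_joint H W rho t u).
have mF : measurable_fun setT F by exact: measurableT_comp mf mJ.
have mFz z : measurable_fun setT (fun w => F (z, w)) by exact: measurable_pair1c mF.
have iz z : P.-integrable setT (EFin \o (fun w => K z + M z * block_norm2 (rec z w))).
  apply: integrable_EFinD => //; first exact: finite_measure_integrable_cst.
  by apply: integrable_EFinZl => //; exact: (integrable_rec_norm2 z).1.
have iF z : P.-integrable setT (EFin \o (fun w => F (z, w))).
  apply: le_integrable_EFin (iz z) => //.
  by move=> w _; apply: le_trans (fK z _) (ler_norm _).
have iprod : (mu \x P)%E.-integrable setT (EFin \o F).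
  apply/integrable12ltyP; first exact/measurable_EFinP.
  apply: (@le_lt_trans _ _ (\int[mu]_z (`|K0 + M0 * max_power|)%:E)%E); last first.
    by rewrite integral_cst//= probability_setT mule1 ltry.
  have mabs : measurable_fun setT (fun u : input * Omega => `|(EFin \o F) u|%E).
    by apply: measurableT_comp => //; exact/measurable_EFinP.
  apply: ae_ge0_le_integral => //.
  - by move=> z _; exact: integral_ge0.
  - exact: (measurable_fun_fubini_tonelli_F (m2 := P) _ mabs).
  - apply: filterS3 peak_power KK0 MM0 => z pz Kz Mz _.
    apply: (@le_trans _ _ (\int[P]_w (K z + M z * block_norm2 (rec z w))%:E)%E).
      apply: ge0_le_integral => //.
      + apply: measurableT_comp => //; exact/measurable_EFinP.
      + exact: measurable_int (iz z).
      + by move=> w _; rewrite lee_fin; exact: fK.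
    have -> : (\int[P]_w (K z + M z * block_norm2 (rec z w))%:E = (K z + M z * received_power z)%:E)%E.
      rewrite -(integrable_rec_norm2 z).2 -[X in (X + _)%:E](Rintegral_prob_cst P).
      rewrite -RintegralZl//; last exact: (integrable_rec_norm2 z).1.
      rewrite -RintegralD//; last 2 first.
      - exact: finite_measure_integrable_cst.
      - by apply: integrable_EFinZl => //; exact: (integrable_rec_norm2 z).1.
      by rewrite EFin_Rintegral//; exact: iz.
    rewrite lee_fin (le_trans _ (ler_norm _))//.
    have rp0 : 0 <= received_power z.
      by rewrite -(integrable_rec_norm2 z).2 Rintegral_ge0// => w _; exact: block_norm2_ge0.
    by rewrite lerD// ler_pM// received_power_le.
have [im e] := Rintegral_prod iprod iF.
split => //.
  exact: (integrable_law (P := (mu \x P)%E) (Q := nu) (X := received_joint H W rho t) mJ (fun _ _ => erefl) mf).1.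
by rewrite -(Rintegral_law (P := (mu \x P)%E) (Q := nu) (X := received_joint H W rho t) mJ (fun _ _ => erefl) mf).
Qed.

Lemma ln_channel_density_bound (z : input) (y : output) : `|ln (p (z, y))| <= faded_power H rho t z + block_norm2 y.
Proof.
have p0 := channel_density_gt0 ch rho t (z, y).
have h1 : - faded_power H rho t z <= ln (p (z, y)).
  by rewrite -ler_expR lnK ?posrE//; exact: (channel_density_ge ch).
have h2 : ln (p (z, y)) <= block_norm2 y.
  by rewrite -ler_expR lnK ?posrE//; exact: channel_density_le.
have n0 := block_norm2_ge0 y.
have f0 : 0 <= faded_power H rho t z by apply: Rintegral_ge0 => w _; exact: block_norm2_ge0.
by rewrite ler_norml; apply/andP; split; lra.
Qed.

Lemma measurable_ln_channel_density : measurable_fun setT (fun u : input * output => ln (p u)).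
Proof. by apply: measurableT_comp => //; exact: measurable_channel_density. Qed.

Lemma ln_density_integral :
  [/\ nu.-integrable setT (EFin \o (fun u => ln (p u))),
      forall z : input, P.-integrable setT (EFin \o (fun w => ln (p (z, rec z w)))),
      mu.-integrable setT (EFin \o (fun z : input => \int[P]_w ln (p (z, rec z w)))) &
      \int[nu]_x ln (p x) = \int[mu]_z \int[P]_w ln (p (z, rec z w))].
Proof.
apply: (joint_integral (K := faded_power H rho t) (K0 := max_power) (M := fun=> 1) (M0 := 1)) => //.
- exact: measurable_ln_channel_density.
- by move=> z y; rewrite mul1r; exact: ln_channel_density_bound.
- by apply: filterS peak_power => z; exact: faded_power_le.
- exact: aeW.
Qed.

Definition output_law_block : probability output R :=
  distribution (mu \x P)%E (mfun_of (measurable_received H W rho t (N := N))).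

Local Notation la := output_law_block.

Lemma output_law_blockE E : measurable E -> la E = nu (setT `*` E).
Proof.
by move=> mE; rewrite /la /joint_law /distribution /pushforward; congr ((mu \x P)%E _); apply/seteqP; split => u //= [].
Qed.

Lemma integral_channel_density_lty (y : output) : (\int[mu]_z (p (z, y))%:E < +oo)%E.
Proof.
apply: (@le_lt_trans _ _ (\int[mu]_z (expR (block_norm2 y))%:E)%E); last first.
  by rewrite integral_cst//= probability_setT mule1 ltry.
apply: ge0_le_integral => //.
- by move=> z _; rewrite lee_fin ltW// (channel_density_gt0 ch).
- apply: measurableT_comp => //.
  apply: (@measurableT_comp _ _ _ _ _ _ p _ (fun z => (z, y))).
    exact: measurable_channel_density.
  exact: measurable_pair2.
- by move=> z _; rewrite lee_fin; exact: channel_density_le.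
Qed.

(** The mean variance that fading adds to the unit noise variance at output [j]. *)
Definition noise_scale (j : J) : R := rho * \sum_(k < NT) mean_power j.1 k * R0 k j.2.

Lemma noise_scale_ge0 j : 0 <= noise_scale j.
Proof.
rewrite mulr_ge0//; apply: sumr_ge0 => k _; rewrite mulr_ge0//; first exact: mean_power_ge0.
exact: (autocorrelation0_ge0 ch).
Qed.

(* The reference output law: independent complex normal samples with the same
   variances as the true output. *)
Definition reference_density (y : output) : R :=
  \prod_(jb : J * bool) affine_density (Num.sqrt (1 + noise_scale jb.1)) 0
    (complex_part jb.2 (block_coord jb.1 y)).

Let scale_gt0 j : 0 < 1 + noise_scale j.
Proof. by have := noise_scale_ge0 j; lra. Qed.

Let sqrt_gt0 j : 0 < Num.sqrt (1 + noise_scale j).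
Proof. by rewrite sqrtr_gt0. Qed.

Lemma reference_density_gt0 y : 0 < reference_density y.
Proof. by apply: prodr_gt0 => j _; exact: affine_density_gt0. Qed.

Lemma measurable_reference_density : measurable_fun setT reference_density.
Proof.
apply: measurable_prod => jb _; apply: measurableT_comp; first exact: measurable_affine_density.
by apply: measurable_complex_part; exact: measurable_block_coord.
Qed.

Lemma integral_reference_density : (\int[gamma]_y (reference_density y)%:E <= 1)%E.
Proof.
have [ip ep] := ge0_integral_prod_iid (Q := normal_prob 0 (noise_std R))
  (@measurable_noise_part _ _ _ _ _ W N t) (@noise_block_iid _ _ _ _ _ _ _ _ ch N t)
  (fun jb => measurable_affine_density (Num.sqrt (1 + noise_scale jb.1)) 0)
  (fun jb x => ltW (affine_density_gt0 0 x (sqrt_gt0 jb.1)))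
  (fun jb => (Rintegral_affine_density (noise_std2 R) 0 (sqrt_gt0 jb.1)).1).
have mq : measurable_fun setT (fun y => (reference_density y)%:E).
  by apply/measurable_EFinP; exact: measurable_reference_density.
have q0 y : (0 <= (reference_density y)%:E)%E by rewrite lee_fin ltW// reference_density_gt0.
have := integral_noise_law W t measurableT mq q0; rewrite preimage_setT => ->.
rewrite (eq_integral (EFin \o (fun w => \prod_(jb : J * bool)
  affine_density (Num.sqrt (1 + noise_scale jb.1)) 0 (complex_part jb.2 (noise W t jb.1 w))))); last first.
  by move=> w _; congr EFin; apply: eq_bigr => jb _; rewrite block_ofK.
rewrite -EFin_Rintegral// ep big1// => jb _.
by have [_ ->] := Rintegral_affine_density (noise_std2 R) 0 (sqrt_gt0 jb.1).
Qed.

Lemma ln_reference_density y : ln (reference_density y) =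
  \sum_(j : J) (- ln (1 + noise_scale j) + noise_scale j / (1 + noise_scale j) * normc (block_coord j y) ^+ 2).
Proof.
pose a j := Num.sqrt (1 + noise_scale j).
pose g (j : J) b := - ln (a j) + noise_scale j / (1 + noise_scale j) * complex_part b (block_coord j y) ^+ 2.
have -> : reference_density y = \prod_(jb : J * bool) expR (g jb.1 jb.2).
  apply: eq_bigr => jb _; rewrite /affine_density /g [in RHS]expRD expRN lnK ?posrE//; last exact: sqrt_gt0.
  congr (_ * expR _); rewrite subr0 expr_div_n sqr_sqrtr; last exact: ltW.
  by field; rewrite gt_eqF.
rewrite -expR_sum expRK.
rewrite (eq_bigr (fun jb => g (jb.1, jb.2).1 (jb.1, jb.2).2)); last by case.
rewrite -(pair_bigA _ (fun j b => g j b))/=; apply: eq_bigr => j _.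
rewrite big_bool/= /g sqr_normcE /complex_part.
have -> : ln (a j) = ln (1 + noise_scale j) / 2.
  by rewrite -[in RHS](@sqr_sqrtr _ (1 + noise_scale j)) ?ltW// lnXn ?sqrt_gt0// mulr2n -/(a j); field.
by field; rewrite gt_eqF.
Qed.

(** With c = v/(1 + v) and v = [noise_scale j], the output sample has mean square 1 + v because the
    reference copies its variance, so the quadratic term contributes exactly v. *)
Lemma ln_reference_integral :
  nu.-integrable setT (EFin \o (fun u => ln (reference_density u.2))) /\
  \int[nu]_u ln (reference_density u.2) =
  \sum_(j : J) (noise_scale j - ln (1 + noise_scale j)).
Proof.
pose c j := noise_scale j / (1 + noise_scale j).
have c01 j : 0 <= c j <= 1.
  have := noise_scale_ge0 j; rewrite /c => h; rewrite divr_ge0//= ?ler_pdivrMr//; [|exact: ltW].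
  by rewrite mul1r lerDr.
pose f (u : input * output) := \sum_(j : J) c j * normc (block_coord j u.2) ^+ 2.
have mf : measurable_fun setT f.
  apply: measurable_sum => j; apply: measurable_funM => //; apply: measurable_normc2.
  exact: measurableT_comp (@measurable_block_coord R N NR j) measurable_snd.
have fb z y : `|f (z, y)| <= 0 + 1 * block_norm2 y.
  rewrite add0r mul1r ger0_norm; last first.
    by apply: sumr_ge0 => j _; rewrite mulr_ge0 ?sqr_ge0//; case/andP: (c01 j).
  by apply: ler_sum => j _; rewrite ler_piMl ?sqr_ge0//; case/andP: (c01 j).
have [i1 i2 i3 e] := joint_integral (K := fun=> 0) (K0 := 0) (M := fun=> 1) mf (fun=> ler01) fb (aeW _ (fun=> lexx _)) (aeW _ (fun=> lexx _)).
have lnE (u : input * output) : ln (reference_density u.2) = \sum_(j : J) (- ln (1 + noise_scale j)) + f u.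
  by rewrite ln_reference_density big_split.
have ic (r : R) : nu.-integrable setT (EFin \o (fun=> r)) by exact: finite_measure_integrable_cst.
split.
  rewrite (_ : (fun u => _) = (fun u => \sum_(j : J) (- ln (1 + noise_scale j)) + f u)).
    exact: integrable_EFinD.
  by apply/funext => u; exact: lnE.
under eq_Rintegral do rewrite lnE.
rewrite RintegralD// Rintegral_prob_cst e.
have inner z : \int[P]_w f (z, rec z w) = \sum_(j : J) c j * (1 + rho * \sum_(k < NT) amp z j.1 k * R0 k j.2).
  have i1' (j : J) := received_second_moment ch rho t z j.
  transitivity (\int[P]_w \sum_(j : J) c j * normc (noise W t j w + faded H rho t z j w) ^+ 2).
    by apply: eq_Rintegral => w _; apply: eq_bigr => j _; rewrite block_ofK.
  rewrite Rintegral_sum//; last by move=> j _; apply: integrable_EFinZl => //; exact: (i1' j).1.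
  apply: eq_bigr => j _; rewrite RintegralZl//; last exact: (i1' j).1.
  by rewrite (i1' j).2 (faded_second_moment ch).
under eq_Rintegral do rewrite inner.
have [iq eq] := integral_mean_power (fun j k => c j * rho * R0 k j.2).
transitivity (\sum_(j : J) - ln (1 + noise_scale j) + (\sum_(j : J) c j + \sum_(i : J) \sum_(k < NT) mean_power i.1 k * (c i * rho * R0 k i.2))).
  congr (_ + _); rewrite -eq -(Rintegral_prob_cst mu (\sum_(j : J) c j)) -RintegralD//; last first.
    exact: finite_measure_integrable_cst.
  apply: eq_Rintegral => z _; rewrite -big_split/=; apply: eq_bigr => j _.
  rewrite mulrDr mulr1 mulrA mulr_sumr; congr (_ + _); apply: eq_bigr => k _; ring.
rewrite -!big_split/=; apply: eq_bigr => j _.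
have -> : \sum_(k < NT) mean_power j.1 k * (c j * rho * R0 k j.2) = c j * noise_scale j.
  by rewrite /noise_scale !mulr_sumr; apply: eq_bigr => k _; ring.
by rewrite /c; field; rewrite gt_eqF.
Qed.

Lemma mean_divergence_le : \int[nu]_u ln (p u) <=
  2^-1 * rho ^+ 2 * \sum_(i : J) \sum_(k < NT) mean_power i.1 k * lambda (H k i.2).
Proof.
have [_ _ im ->] := ln_density_integral.
have [iq eq] := integral_mean_power (fun i k => lambda (H k i.2)).
rewrite -eq -RintegralZl//; apply: ae_le_Rintegral => //.
  exact: integrable_EFinZl.
apply: filterS peak_power => z pz.
have [_ hd] := channel_divergence ch rho t z.
apply: le_trans hd _; rewrite -mulrA ler_wpM2l ?invr_ge0//.
exact: (faded_covariance_norm ch phi_finite).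
Qed.

(** The second sum is the gain of the matched reference over plain noise. With v = [noise_scale j]
    each term is - v^2/2 to leading order, which becomes the subtracted square of the theorem. *)
Lemma information_upper : (relative_entropy nu (mu \x la) <=
  (2^-1 * rho ^+ 2 * (\sum_(i : J) \sum_(k < NT) mean_power i.1 k * lambda (H k i.2)) +
   \sum_(j : J) (ln (1 + noise_scale j) - noise_scale j))%:E)%E.
Proof.
have [ilp _ _ _] := ln_density_integral.
have [ilq elq] := ln_reference_integral.
have lnE (u : input * output) : ln (p u / reference_density u.2) = ln (p u) - ln (reference_density u.2).
  by rewrite ln_div ?posrE// ?reference_density_gt0// (channel_density_gt0 ch).
have ilpq : nu.-integrable setT (EFin \o (fun u => ln (p u / reference_density u.2))).
  rewrite (_ : (fun u => _) = (fun u => ln (p u) - ln (reference_density u.2))).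
    exact: integrable_EFinB.
  by apply/funext => u; exact: lnE.
apply: le_trans (information_le (@measurable_channel_density _ _ _ _ _ _ H rho N t)
  (channel_density_gt0 ch rho t) integral_channel_density_lty
  (joint_lawE ch rho t mu) output_law_blockE measurable_reference_density
  reference_density_gt0 integral_reference_density ilpq) _.
rewrite lee_fin; under eq_Rintegral do rewrite lnE.
rewrite RintegralB// elq.
have -> : \sum_(j : J) (ln (1 + noise_scale j) - noise_scale j) = - \sum_(j : J) (noise_scale j - ln (1 + noise_scale j)).
  by rewrite -sumrN; apply: eq_bigr => j _; rewrite opprB.
by rewrite lerD2r; exact: mean_divergence_le.
Qed.

End information_bounds.

Section information_ratio_integral.
Context d (Omega : measurableType d) (R : realType) (P : probability Omega R).
Variables NT NR : nat.
Variable H : 'I_NT -> 'I_NR -> int -> {RV P >-> R[i]}.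
Variable W : 'I_NR -> nat -> {RV P >-> R[i]}.
Hypothesis ch : rayleigh_fading_channel H W.
Variables (rho beta : R).
Hypothesis rho0 : 0 <= rho.

Section block.
Variables (N t : nat).
Local Notation input := (N.-tuple (NT.-tuple R[i])).
Local Notation output := (N.-tuple (NR.-tuple R[i])).
Variable mu : probability input R.
Hypothesis power : sum_power_constraints beta mu.
Local Notation p := (channel_density H rho t).
Local Notation nu := (joint_law H W rho t mu).
Local Notation la := (output_law_block H W rho t mu).
Local Notation M := (max_power H rho N).

Definition block_ratio : input * output -> R := information_ratio mu p.

Let mp := @measurable_channel_density _ _ _ _ _ _ H rho N t.
Let p0 := channel_density_gt0 ch rho t (N := N).
Let pfin := integral_channel_density_lty ch rho t mu.
Let nuE := joint_lawE ch rho t mu.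
Let laE := output_law_blockE H W rho t mu.

(** The lower bound is Jensen's bound for each input, made uniform by the peak constraint, and the
    upper bound is that of a shifted noise density. Both survive averaging over the input. *)
Lemma output_density_bounds (y : output) :
  expR (- M) <= output_density mu p y <= expR (block_norm2 y).
Proof.
have mpy : measurable_fun setT (fun z => (p (z, y))%:E).
  apply/measurable_EFinP; exact: (measurableT_comp mp (measurable_pair2 y)).
rewrite -!lee_fin (output_densityE p0 pfin).
have ec (r : R) : (\int[mu]_z (cst r%:E) z = r%:E)%E.
  by rewrite integral_cst//= probability_setT mule1.
apply/andP; split.
  rewrite -[leLHS]ec; apply: ae_ge0_le_integral => //.
  - by move=> z _; rewrite lee_fin expR_ge0.
  - by move=> z _; rewrite lee_fin ltW.
  - apply: filterS (peak_power power) => z pz _; rewrite lee_fin.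
    apply: le_trans (channel_density_ge ch rho t z y).
    by rewrite ler_expR lerN2 (faded_power_le ch).
rewrite -[leRHS]ec; apply: ge0_le_integral => //.
- by move=> z _; rewrite lee_fin ltW.
- by move=> z _; rewrite lee_fin; exact: channel_density_le.
Qed.

(** It makes the mutual information a real number, so that the informations of two blocks can be
    added inside one integral. *)
Lemma ln_block_ratio_integrable : nu.-integrable setT (EFin \o (fun u => ln (block_ratio u))).
Proof.
have mr : measurable_fun setT (fun u => ln (block_ratio u)).
  by apply: measurableT_comp => //; exact: (measurable_information_ratio mp p0).
suff [] : [/\ nu.-integrable setT (EFin \o (fun u => ln (block_ratio u))),
    forall z, P.-integrable setT (EFin \o (fun w => ln (block_ratio (z, received H W rho t (z, w))))),
    mu.-integrable setT (EFin \o (fun z => \int[P]_w ln (block_ratio (z, received H W rho t (z, w))))) &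
    \int[nu]_x ln (block_ratio x) = \int[mu]_z \int[P]_w ln (block_ratio (z, received H W rho t (z, w)))] by [].
apply: (joint_integral ch t rho0 power (f := fun u => ln (block_ratio u))
  (K := fun z => faded_power H rho t z + M) (K0 := M + M) (M := fun=> 2) (M0 := 2)) => //.
- move=> z y; rewrite /block_ratio /information_ratio /= ln_div ?posrE//; last first.
    exact: (output_density_gt0 mp p0 pfin).
  have /andP[h1 h2] := output_density_bounds y.
  have q0 : 0 < output_density mu p y by apply: lt_le_trans h1; exact: expR_gt0.
  have h3 : - M <= ln (output_density mu p y) by rewrite -ler_expR lnK.
  have h4 : ln (output_density mu p y) <= block_norm2 y by rewrite -ler_expR lnK.
  have := ln_channel_density_bound ch rho t z y; rewrite ler_norml => /andP[h5 h6].
  have n0 := block_norm2_ge0 y.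
  have M0 : 0 <= M.
    apply: sumr_ge0 => j _; rewrite addr_ge0// mulr_ge0//; apply: sumr_ge0 => k _.
    exact: (autocorrelation0_ge0 ch).
  by rewrite ler_norml; apply/andP; split; lra.
- apply: filterS (peak_power power) => z pz; rewrite lerD2r.
  exact: (faded_power_le ch).
- exact: aeW.
Qed.

Lemma block_relative_entropy :
  relative_entropy nu (mu \x la)%E = (\int[nu]_u ln (block_ratio u))%:E.
Proof.
rewrite (information_formula mp p0 pfin nuE laE) EFin_Rintegral//.
exact: ln_block_ratio_integrable.
Qed.

(** The normalisation holds at every fixed output, not merely on average over outputs;
    superadditivity relies on this. *)
Lemma integral_block_ratio y : (\int[mu]_z (block_ratio (z, y))%:E = 1)%E.
Proof.
have q0 : 0 < output_density mu p y by exact: (output_density_gt0 mp p0 pfin).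
have mpy : measurable_fun setT (fun z => (p (z, y))%:E).
  apply/measurable_EFinP; exact: (measurableT_comp mp (measurable_pair2 y)).
rewrite /block_ratio /information_ratio.
under eq_integral do rewrite /= EFinM muleC.
rewrite ge0_integralZl//.
- rewrite -(output_densityE p0 pfin) -EFinM mulVf// gt_eqF//.
- by move=> z _; rewrite lee_fin ltW.
- by rewrite lee_fin invr_ge0 ltW.
Qed.

Lemma block_ratio_gt0 u : 0 < block_ratio u.
Proof. exact: (information_ratio_gt0 mp p0 pfin). Qed.

Lemma measurable_block_ratio : measurable_fun setT block_ratio.
Proof. exact: (measurable_information_ratio mp p0). Qed.

(** The variational bound with the constant test function 1. *)
Lemma block_entropy_ge0 : (0 <= relative_entropy nu (mu \x la))%E.
Proof.
have := @relative_entropy_ge _ _ _ nu (mu \x la)%E (cst 1) 1 (measurable_cst _) (fun=> ltr01).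
rewrite (_ : @ln R \o cst 1 = cst 0); last by apply/funext => u /=; rewrite ln1.
have -> : (\int[nu]_x ln (cst 1 x) + 1 - 1) = 0.
  by under eq_Rintegral do rewrite ln1; rewrite Rintegral_prob_cst add0r subrr.
apply; first exact: finite_measure_integrable_cst.
by rewrite -[leLHS]/(\int[(mu \x la)%E]_x (1%:E))%E integral_prob_cst.
Qed.

End block.

(** The output of the definition and [received] in the window 0 differ only by the order of signal
    and noise; the laws then agree on measurable sets, and the density allows
    [relative_entropy_ext]. *)
Lemma block_informationE N (mu : probability (N.-tuple (NT.-tuple R[i])) R) :
  block_information H W rho mu =
  relative_entropy (joint_law H W rho 0 mu) (mu \x output_law_block H W rho 0 mu)%E.
Proof.
have mp := @measurable_channel_density _ _ _ _ _ _ H rho N 0.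
have p0 := channel_density_gt0 ch rho 0 (N := N).
have pfin := integral_channel_density_lty ch rho 0 mu.
have outE u : channel_output H W rho u = received H W rho 0 u.
  apply: eq_from_tnth => n; apply: eq_from_tnth => l; case: u => z w.
  by rewrite !tnth_mktuple /noise /faded /= addrC.
rewrite /block_information /mutual_information; apply/esym.
apply: (relative_entropy_ext (f := information_ratio mu (channel_density H rho 0))).
- exact: (measurable_information_ratio mp p0).
- by move=> u; rewrite ltW// (information_ratio_gt0 mp p0 pfin).
- exact: (joint_density mp p0 pfin (joint_lawE ch rho 0 mu) (output_law_blockE H W rho 0 mu)).
- move=> E mE; rewrite /joint_law /distribution /pushforward; congr ((mu \x P)%E _).
  by apply/seteqP; split => u; rewrite /preimage /mkset /= /received_joint /pairing outE.
- move=> E mE; rewrite /product_measure1 /=.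
  rewrite [RHS](_ : _ = \int[mu]_x (output_law_block H W rho 0 mu \o xsection E) x)%E.
    by [].
  rewrite [LHS](eq_measure_integral mu); last first.
    move=> A mA _; rewrite /distribution /pushforward /=.
    rewrite -[RHS]mule1 -(@probability_setT _ _ _ P) -product_measure1E//.
    by congr ((mu \x P)%E _); apply/seteqP; split => u //= [].
  apply: eq_integral => z _ /=; rewrite /output_law_block /distribution /pushforward.
  by congr ((mu \x P)%E _); apply/seteqP; split => u; rewrite /preimage /mkset /= outE.
Qed.

(** Both outputs are complex normal with the same covariance, since only time differences enter
    it. *)
Lemma received_shift N t t' (z : N.-tuple (NT.-tuple R[i])) E : measurable E ->
  P ((fun w => received H W rho t (z, w)) @^-1` E) =
  P ((fun w => received H W rho t' (z, w)) @^-1` E).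
Proof.
move=> mE; have nY := received_cnormal ch rho t z; have nY' := received_cnormal ch rho t' z.
have e : covariance_of P (faded H rho t z) = covariance_of P (faded H rho t' z).
  by apply/funext => i; apply/funext => j; rewrite !(faded_covariance ch).
rewrite e in nY.
apply: (cnormal_law (@measurable_block_coord R N NR) (@measurable_blockP R N NR) nY nY') => //.
- by move=> j w; rewrite block_ofK.
- by move=> j w; rewrite block_ofK.
Qed.

End information_ratio_integral.

(** * Superadditivity over successive blocks *)

Section concatenation.
Context (N M : nat) d (T : measurableType d).

Definition block_cat (y : N.-tuple T * M.-tuple T) : (N + M).-tuple T :=
  [tuple match fintype.split n with inl i => tnth y.1 i | inr j => tnth y.2 j end | n < N + M].

Definition block_fst (y : (N + M).-tuple T) : N.-tuple T := [tuple tnth y (lshift M n) | n < N].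
Definition block_snd (y : (N + M).-tuple T) : M.-tuple T := [tuple tnth y (rshift N n) | n < M].

Lemma block_fst_cat y : block_fst (block_cat y) = y.1.
Proof.
by apply: eq_from_tnth => n; rewrite !tnth_mktuple -[lshift M n]/(unsplit (inl n)) unsplitK.
Qed.

Lemma block_snd_cat y : block_snd (block_cat y) = y.2.
Proof.
by apply: eq_from_tnth => n; rewrite !tnth_mktuple -[rshift N n]/(unsplit (inr n)) unsplitK.
Qed.

Lemma measurable_block_cat : measurable_fun setT block_cat.
Proof.
apply/measurable_fun_tnthP => n; rewrite (_ : _ \o _ = fun y : N.-tuple T * M.-tuple T =>
    match fintype.split n with inl i => tnth y.1 i | inr j => tnth y.2 j end).
  case: (fintype.split n) => i.
    exact: (measurableT_comp (measurable_tnth i) measurable_fst).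
  exact: (measurableT_comp (measurable_tnth i) measurable_snd).
by apply/funext => y /=; rewrite tnth_mktuple.
Qed.

Lemma measurable_block_fst : measurable_fun setT block_fst.
Proof.
apply/measurable_fun_tnthP => n; rewrite (_ : _ \o _ = (fun y => tnth y (lshift M n))).
  exact: measurable_tnth.
by apply/funext => y /=; rewrite tnth_mktuple.
Qed.

Lemma measurable_block_snd : measurable_fun setT block_snd.
Proof.
apply/measurable_fun_tnthP => n; rewrite (_ : _ \o _ = (fun y => tnth y (rshift N n))).
  exact: measurable_tnth.
by apply/funext => y /=; rewrite tnth_mktuple.
Qed.

End concatenation.

Section superadditivity.
Context d (Omega : measurableType d) (R : realType) (P : probability Omega R).
Variables NT NR : nat.
Variable H : 'I_NT -> 'I_NR -> int -> {RV P >-> R[i]}.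
Variable W : 'I_NR -> nat -> {RV P >-> R[i]}.
Hypothesis ch : rayleigh_fading_channel H W.
Variables (rho beta : R).
Hypothesis rho0 : 0 <= rho.
Local Notation input N := (N.-tuple (NT.-tuple R[i])).
Local Notation output N := (N.-tuple (NR.-tuple R[i])).

Lemma measurable_power N (n : 'I_N) : measurable_fun setT (fun z : input N => sqr_norm2 (tnth z n)).
Proof.
apply: measurable_sum => k; apply: measurable_normc2; apply: (measurableT_comp (measurable_tnth k)).
exact: measurable_tnth.
Qed.

Lemma measurable_peak N (n : 'I_N) : measurable [set z : input N | sqr_norm2 (tnth z n) <= 1].
Proof.
rewrite (_ : [set z | _] = (fun z : input N => sqr_norm2 (tnth z n)) @^-1` `]-oo, 1]).
  by rewrite -[_ @^-1` _]setTI; apply: measurable_power => //; exact: measurable_itv.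
by apply/seteqP; split => z; rewrite /= in_itv.
Qed.

Lemma sum_power_constraintsP N (mu : probability (input N) R) :
  (forall n, mu [set z : input N | sqr_norm2 (tnth z n) <= 1] = 1%E) ->
  (forall n, (\int[mu]_z (sqr_norm2 (tnth z n))%:E <= (beta^-1)%:E)%E) ->
  sum_power_constraints beta mu.
Proof.
move=> peak mean; split; last by move=> n; rewrite unlock; exact: mean.
have h (n : 'I_N) : {ae mu, forall z, sqr_norm2 (tnth z n) <= 1}.
  exists (~` [set z : input N | sqr_norm2 (tnth z n) <= 1]); split => //.
  - exact: measurableC (measurable_peak n).
  - rewrite probability_setC; last exact: measurable_peak.
    by rewrite peak subee.
have : {ae mu, forall z, forall n, n \in enum 'I_N -> sqr_norm2 (tnth z n) <= 1}.
  elim: (enum 'I_N) => [|n s IH]; first exact: aeW.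
  apply: filterS2 (h n) IH => z hz IH m; rewrite inE => /orP[/eqP -> //|]; exact: IH.
by apply: filterS => z hz n; apply: hz; rewrite mem_enum.
Qed.

Lemma peak_probability N (mu : probability (input N) R) n : sum_power_constraints beta mu ->
  mu [set z : input N | sqr_norm2 (tnth z n) <= 1] = 1%E.
Proof.
move=> [[A [mA A0 hA]] _]; have mp := measurable_peak n.
have : mu (~` [set z : input N | sqr_norm2 (tnth z n) <= 1]) = 0%E.
  apply: (subset_measure0 _ mA _ A0); first exact: measurableC.
  by move=> z hz; apply: hA => h; apply: hz => /=; exact: h.
rewrite probability_setC// => /eqP; rewrite sube_eq ?add0e ?fin_num_measure//.
by move=> /eqP <-.
Qed.

Variables (N M : nat) (mu1 : probability (input N) R) (mu2 : probability (input M) R).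
Hypotheses (power1 : sum_power_constraints beta mu1) (power2 : sum_power_constraints beta mu2).

Definition concat_law : probability (input (N + M)) R :=
  distribution (mu1 \x mu2)%E (mfun_of (@measurable_block_cat N M _ (NT.-tuple R[i]))).

Local Notation mu := concat_law.

Lemma concat_integral (f : input (N + M) -> \bar R) : measurable_fun setT f ->
  (forall z, (0 <= f z)%E) ->
  (\int[mu]_z f z = \int[mu1]_z1 \int[mu2]_z2 f (block_cat (z1, z2)))%E.
Proof.
move=> mf f0.
have mc := @measurable_block_cat N M _ (NT.-tuple R[i]).
rewrite -(@integral_law _ _ _ _ R (mu1 \x mu2)%E mu _ mc (fun _ _ => erefl))//.
rewrite (fubini_tonelli1 (m1 := mu1) (m2 := mu2))//.
by apply: (measurableT_comp mf mc).
Qed.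

Lemma concat_fst (f : input N -> \bar R) : measurable_fun setT f ->
  (forall z, (0 <= f z)%E) -> (\int[mu]_z f (block_fst z) = \int[mu1]_z f z)%E.
Proof.
move=> mf f0; rewrite concat_integral//; last first.
  exact: (measurableT_comp mf (@measurable_block_fst N M _ _)).
apply: eq_integral => z1 _; under eq_integral do rewrite block_fst_cat /=.
by rewrite integral_cst//= probability_setT mule1.
Qed.

Lemma concat_snd (f : input M -> \bar R) : measurable_fun setT f ->
  (forall z, (0 <= f z)%E) -> (\int[mu]_z f (block_snd z) = \int[mu2]_z f z)%E.
Proof.
move=> mf f0; rewrite concat_integral//; last first.
  exact: (measurableT_comp mf (@measurable_block_snd N M _ _)).
under eq_integral do (under eq_integral do rewrite block_snd_cat /=).
by rewrite integral_cst//= probability_setT mule1.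
Qed.

Let mu_preim n (m : nat) (g : input (N + M) -> input m) (mum : probability (input m) R) (i : 'I_m) :
  measurable_fun setT g ->
  (forall f : input m -> \bar R, measurable_fun setT f ->
    (forall z, (0 <= f z)%E) -> (\int[mu]_z f (g z) = \int[mum]_z f z)%E) ->
  (forall z, tnth z n = tnth (g z) i) -> sum_power_constraints beta mum ->
  mu [set z : input (N + M) | sqr_norm2 (tnth z n) <= 1] = 1%E /\
  (\int[mu]_z (sqr_norm2 (tnth z n))%:E <= (beta^-1)%:E)%E.
Proof.
move=> mg hg e pw; split.
  have ind k (Q : probability (input k) R) (j : 'I_k) :
      Q [set z : input k | sqr_norm2 (tnth z j) <= 1] =
      (\int[Q]_z (\1_[set z : input k | sqr_norm2 (tnth z j) <= 1] z)%:E)%E.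
    by rewrite integral_indic ?setIT//; exact: measurable_peak.
  rewrite -(peak_probability i pw) !ind.
  rewrite -(hg (fun z => (\1_[set z : input m | sqr_norm2 (tnth z i) <= 1] z)%:E)).
  - apply: eq_integral => z _; rewrite !indicE.
    by congr ((nat_of_bool _)%:R%:E); apply/idP/idP => /set_mem /= h; apply/mem_set; rewrite /= ?e// -e.
  - by apply/measurable_EFinP; apply: measurable_indic; exact: measurable_peak.
  - by move=> z; rewrite lee_fin.
case: (pw) => _ /(_ i); rewrite unlock -hg; last 2 first.
- by apply/measurable_EFinP; exact: measurable_power.
- by move=> z; rewrite lee_fin; apply: sumr_ge0 => k _; exact: sqr_ge0.
by apply: le_trans; rewrite le_eqVlt; apply/orP; left; apply/eqP; apply: eq_integral => z _; rewrite e.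
Qed.

Lemma concat_power : sum_power_constraints beta mu.
Proof.
suff h n : mu [set z : input (N + M) | sqr_norm2 (tnth z n) <= 1] = 1%E /\
  (\int[mu]_z (sqr_norm2 (tnth z n))%:E <= (beta^-1)%:E)%E.
  by apply: sum_power_constraintsP => n; have [] := h n.
rewrite -(splitK n); case: (fintype.split n) => i /=.
  apply: (mu_preim (@measurable_block_fst N M _ _) concat_fst _ power1 (i := i)) => z.
  by rewrite tnth_mktuple.
apply: (mu_preim (@measurable_block_snd N M _ _) concat_snd _ power2 (i := i)) => z.
by rewrite tnth_mktuple.
Qed.

Lemma block_fst_received (z : input (N + M)) (w : Omega) :
  block_fst (received H W rho 0 (z, w)) = received H W rho 0 (block_fst z : input N, w) :> output N.
Proof.
apply: eq_from_tnth => n; apply: eq_from_tnth => l.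
rewrite !tnth_mktuple /noise /faded /=; congr (_ + _ * _).
by apply: eq_bigr => k _; rewrite tnth_mktuple.
Qed.

(** The second block occupies the window that starts after [N]: the shift [t] is carried through the
    channel lemmas for this purpose. *)
Lemma block_snd_received (z : input (N + M)) (w : Omega) :
  block_snd (received H W rho 0 (z, w)) = received H W rho N (block_snd z : input M, w) :> output M.
Proof.
apply: eq_from_tnth => n; apply: eq_from_tnth => l.
rewrite !tnth_mktuple /noise /faded /=; congr (_ + _ * _).
  by rewrite add0n addnS.
by apply: eq_bigr => k _; rewrite tnth_mktuple add0n addnS.
Qed.

(** A part of the long block is received in its own window [t]. Stationarity moves this window to 0,
    where the law is that of the short block. *)
Let joint_marginal m (g : input (N + M) -> input m) (g' : output (N + M) -> output m) t
    (mum : probability (input m) R) C :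
  (forall f : input m -> \bar R, measurable_fun setT f ->
    (forall z, (0 <= f z)%E) -> (\int[mu]_z f (g z) = \int[mum]_z f z)%E) ->
  (forall z w, g' (received H W rho 0 (z, w)) = received H W rho t (g z, w)) ->
  measurable C ->
  joint_law H W rho 0 mu ((fun u => (g u.1, g' u.2)) @^-1` C) =
  joint_law H W rho 0 mum C.
Proof.
move=> hg e mC.
pose h (z : input m) : \bar R := P ((fun w => (z, received H W rho 0 (z, w))) @^-1` C).
have hE : h = P \o xsection (received_joint H W rho 0 @^-1` C).
  apply/funext => z; rewrite /h /= /xsection; congr (P _).
  by apply/seteqP; split => w /=; rewrite !inE.
have mpre : measurable (received_joint H W rho 0 @^-1` C : set (input m * Omega)).
  by rewrite -[_ @^-1` _]setTI; exact: measurable_received_joint.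
have mh : measurable_fun setT h by rewrite hE; exact: measurable_fun_xsection.
transitivity (\int[mu]_z h (g z))%E; last by rewrite hg// hE.
rewrite /joint_law /distribution /pushforward /= /product_measure1 /=.
apply: eq_integral => z _; rewrite /h.
have mCx : measurable (xsection C (g z)) by exact: measurable_xsection.
transitivity (P ((fun w => received H W rho t (g z, w)) @^-1` (xsection C (g z)))).
  congr (P _); apply/seteqP; split => w; rewrite /xsection /= !inE /=.
    by rewrite e.
  by rewrite e.
rewrite (received_shift ch rho0 t 0 (g z) mCx); congr (P _).
by apply/seteqP; split => w; rewrite /xsection /= inE.
Qed.

Local Notation nu := (joint_law H W rho 0 mu).
Local Notation nu1 := (joint_law H W rho 0 mu1).
Local Notation nu2 := (joint_law H W rho 0 mu2).
Local Notation r1 := (block_ratio H rho 0 mu1).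
Local Notation r2 := (block_ratio H rho 0 mu2).
Local Notation la := (output_law_block H W rho 0 mu).

Let pi1 (u : input (N + M) * output (N + M)) : input N * output N := (block_fst u.1, block_fst u.2).
Let pi2 (u : input (N + M) * output (N + M)) : input M * output M := (block_snd u.1, block_snd u.2).

Let mpi1 : measurable_fun setT pi1.
Proof.
apply: measurable_fun_pair.
  exact: (measurableT_comp (@measurable_block_fst N M _ _) measurable_fst).
exact: (measurableT_comp (@measurable_block_fst N M _ _) measurable_snd).
Qed.

Let mpi2 : measurable_fun setT pi2.
Proof.
apply: measurable_fun_pair.
  exact: (measurableT_comp (@measurable_block_snd N M _ _) measurable_fst).
exact: (measurableT_comp (@measurable_block_snd N M _ _) measurable_snd).
Qed.

Let law1 C : measurable C -> nu (pi1 @^-1` C) = nu1 C.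
Proof. exact: (joint_marginal concat_fst block_fst_received). Qed.

Let law2 C : measurable C -> nu (pi2 @^-1` C) = nu2 C.
Proof. exact: (joint_marginal concat_snd block_snd_received). Qed.

Let mr1 := measurable_block_ratio ch rho 0 mu1.
Let mr2 := measurable_block_ratio ch rho 0 mu2.
Let r10 := block_ratio_gt0 ch rho 0 mu1.
Let r20 := block_ratio_gt0 ch rho 0 mu2.

(** The output being fixed, the two ratios depend on independent halves of the input, and each
    averages to 1. *)
Let mean_ratio y : (\int[mu]_z (r1 (pi1 (z, y)) * r2 (pi2 (z, y)))%:E = 1)%E.
Proof.
have m1 : measurable_fun setT (fun z => r1 (pi1 (z, y))).
  exact: (measurableT_comp (measurableT_comp mr1 mpi1) (measurable_pair2 y)).
have m2 : measurable_fun setT (fun z => r2 (pi2 (z, y))).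
  exact: (measurableT_comp (measurableT_comp mr2 mpi2) (measurable_pair2 y)).
have r0 z : 0 <= r1 (pi1 (z, y)) * r2 (pi2 (z, y)) by rewrite mulr_ge0// ltW.
rewrite concat_integral//; last exact/measurable_EFinP/measurable_funM.
rewrite -[RHS](integral_block_ratio ch rho 0 mu1 (block_fst y)).
apply: eq_integral => z1 _.
under eq_integral => z2 _ do rewrite /pi1 /pi2 /= block_fst_cat block_snd_cat /= EFinM.
rewrite ge0_integralZl//.
- by rewrite (integral_block_ratio ch rho 0 mu2) mule1.
- apply/measurable_EFinP; exact: (measurableT_comp mr2 (measurable_pair2 _)).
- by move=> z2 _; rewrite lee_fin ltW.
- by rewrite lee_fin ltW.
Qed.

(** The variational bound for the long block, tested with the product of the two ratios. By
    [mean_ratio] its mean under the product law is 1 although the two output blocks may be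
    dependent, and its logarithm integrates to the sum of the two informations. *)
Lemma information_superadditive :
  (block_information H W rho mu1 + block_information H W rho mu2 <=
   block_information H W rho mu)%E.
Proof.
rewrite !(block_informationE ch).
rewrite (block_relative_entropy ch rho0 0 power1) (block_relative_entropy ch rho0 0 power2).
pose g u := r1 (pi1 u) * r2 (pi2 u).
have mg : measurable_fun setT g.
  by apply: measurable_funM; [exact: (measurableT_comp mr1 mpi1)|exact: (measurableT_comp mr2 mpi2)].
have g0 u : 0 < g u by rewrite mulr_gt0.
have ml1 : measurable_fun setT (fun u => ln (r1 u)) by exact: measurableT_comp.
have ml2 : measurable_fun setT (fun u => ln (r2 u)) by exact: measurableT_comp.
have i1 := (integrable_law (P := nu) (Q := nu1) mpi1 law1 ml1).2 (ln_block_ratio_integrable ch rho0 0 power1).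
have i2 := (integrable_law (P := nu) (Q := nu2) mpi2 law2 ml2).2 (ln_block_ratio_integrable ch rho0 0 power2).
have lnE u : ln (g u) = ln (r1 (pi1 u)) + ln (r2 (pi2 u)) by rewrite lnM ?posrE.
have ig : nu.-integrable setT (EFin \o (@ln R \o g)).
  rewrite (_ : @ln R \o g = (fun u => ln (r1 (pi1 u)) + ln (r2 (pi2 u)))).
    exact: integrable_EFinD.
  by apply/funext => u; exact: lnE.
have gC : (\int[(mu \x la)%E]_u (g u)%:E <= 1%:E)%E.
  rewrite (fubini_tonelli2 (m1 := mu) (m2 := la))//; last 2 first.
  - exact/measurable_EFinP.
  - by move=> u; rewrite lee_fin ltW.
  rewrite (eq_integral (cst 1%E)); last by move=> y _; rewrite /fubini_G mean_ratio.
  by rewrite integral_cst//= probability_setT mule1.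
have := relative_entropy_ge mg g0 ig gC; rewrite addrK.
have -> : \int[nu]_u ln (g u) = \int[nu1]_u ln (r1 u) + \int[nu2]_u ln (r2 u).
  under eq_Rintegral do rewrite lnE.
  rewrite RintegralD//.
  by rewrite (Rintegral_law (P := nu) (Q := nu1) mpi1 law1 ml1) (Rintegral_law (P := nu) (Q := nu2) mpi2 law2 ml2).
by rewrite EFinD.
Qed.

End superadditivity.

(** * The lower bound *)

Section quadratic_form.
Context (R : realType) (J : finType).
Implicit Types (B : J -> J -> R[i]) (x y w : J -> R[i]).

Definition qform B y : R := Re (\sum_i \sum_j (y i)^* * B i j * y j).

Definition entry_norm B : R := \sum_i \sum_j normc (B i j).

Definition retrace B : R := \sum_i Re (B i i).

Lemma entry_norm_ge0 B : 0 <= entry_norm B.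
Proof. by apply: sumr_ge0 => i _; apply: sumr_ge0 => j _; exact: normc_ge0. Qed.

Lemma Re_le_normc (z : R[i]) : `|Re z| <= normc z.
Proof. by rewrite -(@ler_pXn2r _ 2) ?nnegrE ?normc_ge0// sqr_normcE real_normK ?num_real// lerDl sqr_ge0. Qed.

Lemma term_le B x y (S : R) : (forall i j, normc (x i) * normc (y j) <= S) ->
  `|Re (\sum_i \sum_j (x i)^* * B i j * y j)| <= entry_norm B * S.
Proof.
move=> h; apply: le_trans (Re_le_normc _) _; apply: le_trans (normc_sum_le _ _) _.
rewrite mulr_suml; apply: ler_sum => i _; apply: le_trans (normc_sum_le _ _) _.
rewrite mulr_suml; apply: ler_sum => j _; rewrite !Normc.normcM normcJ_real.
rewrite mulrAC mulrC ler_wpM2l ?normc_ge0//; exact: h.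
Qed.

Lemma prod_normc_le x y i j : normc (x i) * normc (y j) <=
  \sum_k normc (x k) ^+ 2 + \sum_k normc (y k) ^+ 2.
Proof.
apply: (@le_trans _ _ (normc (x i) ^+ 2 + normc (y j) ^+ 2)).
  have := sqr_ge0 (normc (x i) - normc (y j)); have := normc_ge0 (x i); have := normc_ge0 (y j).
  by rewrite !expr2; nra.
rewrite (bigD1 i)//= [X in _ <= _ + X](bigD1 j)//=.
have h1 : 0 <= \sum_(k | k != i) normc (x k) ^+ 2 by apply: sumr_ge0 => k _; exact: sqr_ge0.
have h2 : 0 <= \sum_(k | k != j) normc (y k) ^+ 2 by apply: sumr_ge0 => k _; exact: sqr_ge0.
by lra.
Qed.

Lemma qform_le B y : `|qform B y| <= entry_norm B * \sum_k normc (y k) ^+ 2.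
Proof.
apply: term_le => i j.
have h (m : J) : normc (y m) ^+ 2 <= \sum_k normc (y k) ^+ 2.
  by rewrite (bigD1 m)//= lerDl; apply: sumr_ge0 => k _; exact: sqr_ge0.
have := sqr_ge0 (normc (y i) - normc (y j)); have := h i; have := h j; rewrite !expr2; nra.
Qed.

(** Two cross terms and one quadratic term, each at most [entry_norm B] times the sum of squares:
    hence the factor 3. As s <= 1, the quadratic term also carries a single factor s. *)
Lemma qform_perturb B w x (s : R) : 0 <= s <= 1 ->
  `|qform B (fun j => w j + s%:C * x j) - qform B w| <=
  s * (3 * entry_norm B * (\sum_k normc (x k) ^+ 2 + \sum_k normc (w k) ^+ 2)).
Proof.
move=> /andP[s0 s1]; set S := \sum_k _ + _.
pose c1 := Re (\sum_i \sum_j (x i)^* * B i j * w j).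
pose c2 := Re (\sum_i \sum_j (w i)^* * B i j * x j).
pose c3 := Re (\sum_i \sum_j (x i)^* * B i j * x j).
have -> : qform B (fun j => w j + s%:C * x j) - qform B w = s * (c1 + c2 + s * c3).
  rewrite /qform /c1 /c2 /c3.
  have -> : \sum_i \sum_j (w i + s%:C * x i)^* * B i j * (w j + s%:C * x j) =
      \sum_i \sum_j (w i)^* * B i j * w j + s%:C * (\sum_i \sum_j (x i)^* * B i j * w j +
      \sum_i \sum_j (w i)^* * B i j * x j + s%:C * (\sum_i \sum_j (x i)^* * B i j * x j)).
    rewrite !mulrDr !mulr_sumr -!big_split/=; apply: eq_bigr => i _.
    rewrite !mulr_sumr -!big_split/=; apply: eq_bigr => j _.
    have -> : (w i + s%:C * x i)^* = (w i)^* + s%:C * (x i)^*.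
      by rewrite rmorphD rmorphM; congr (_ + _ * _); exact: conjc_real.
    ring.
  by rewrite ReD ReZ !ReD ReZ; ring.
rewrite normrM ger0_norm// ler_wpM2l//.
have e0 := entry_norm_ge0 B.
have S0 : 0 <= S by rewrite addr_ge0//; apply: sumr_ge0 => k _; exact: sqr_ge0.
have h1 : `|c1| <= entry_norm B * S by apply: term_le => i j; exact: prod_normc_le.
have h2 : `|c2| <= entry_norm B * S.
  by apply: term_le => i j; rewrite /S addrC; exact: prod_normc_le.
have h3 : `|c3| <= entry_norm B * S.
  apply: le_trans (qform_le B x) _; rewrite ler_wpM2l// lerDl.
  by apply: sumr_ge0 => k _; exact: sqr_ge0.
have h4 : `|s * c3| <= entry_norm B * S.
  by rewrite normrM ger0_norm//; apply: le_trans h3; rewrite ler_piMl.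
have := ler_normD (c1 + c2) (s * c3); have := ler_normD c1 c2; lra.
Qed.

Section moments.
Context d (T : measurableType d) (P : probability T R).
Variable Y : J -> T -> R[i].
Hypothesis mY : forall j, complex_moments P (Y j).

Let mYY i j b : complex_moments P (fun t => (Y i t)^* * b * Y j t).
Proof.
apply: complex_momentsM => //; apply: complex_momentsM; first exact: complex_momentsJ.
exact: complex_moments_cst.
Qed.

Lemma qform_moments B : all_moments P (fun t => qform B (Y^~ t)).
Proof.
have : complex_moments P (fun t => \sum_i \sum_j (Y i t)^* * B i j * Y j t).
  by apply: complex_moments_sum => i; apply: complex_moments_sum => j; exact: mYY.
by case.
Qed.

Lemma Rintegral_qform B : \int[P]_t qform B (Y^~ t) =
  Re (\sum_i \sum_j B i j * covariance_of P Y j i).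
Proof.
rewrite -[LHS](Re_cexpectation P (fun t => \sum_i \sum_j (Y i t)^* * B i j * Y j t)).
congr Re; rewrite cexpectation_sum => [|i]; last exact: complex_moments_sum.
apply: eq_bigr => i _; rewrite cexpectation_sum//; apply: eq_bigr => j _.
rewrite /covariance_of -cexpectationZ; last first.
  by apply: complex_momentsM => //; exact: complex_momentsJ.
by congr (cexpectation P); apply/funext => t; ring.
Qed.

End moments.

End quadratic_form.

Section discrete_law.
Context (R : realType) (I : finType) (w : I -> R).
Hypotheses (w0 : forall i, 0 <= w i) (w1 : \sum_i w i = 1).
Context d (T : measurableType d) (z : I -> T).

(** A weighted sum of Dirac masses, built by recursion on the index list. *)
Lemma discrete_law : exists mu : probability T R,
  forall f : T -> \bar R, measurable_fun setT f -> (forall x, (0 <= f x)%E) ->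
    (\int[mu]_x f x = \sum_i (w i)%:E * f (z i))%E.
Proof.
have [m hm] : exists m : {measure set T -> \bar R}, forall f : T -> \bar R,
    measurable_fun setT f -> (forall x, (0 <= f x)%E) ->
    (\int[m]_x f x = \sum_(i <- index_enum I) (w i)%:E * f (z i))%E.
  elim: (index_enum I) => [|i s [m IH]].
    by exists mzero => f mf f0; rewrite big_nil integral_measure_zero.
  exists (measure_add (mscale (NngNum (w0 i)) (\d_(z i))) m) => f mf f0.
  rewrite ge0_integral_measure_add// big_cons -IH//; congr (_ + _)%E.
  by rewrite ge0_integral_mscale//= integral_dirac// diracT mul1e.
have mT : m setT = 1%E.
  have := hm (cst 1%E) (measurable_cst _) (fun=> lee01).
  rewrite integral_cst//= mul1e => ->; under eq_bigr do rewrite mule1.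
  by rewrite sumEFin w1.
have gT : mscale (NngNum (@ler01 R)) m setT = 1%E by rewrite /mscale/= mT mul1e.
pose mu : probability T R := HB.pack (mscale (NngNum (@ler01 R)) m)
  (Measure_isProbability.Build _ _ _ _ gT).
exists mu => f mf f0.
by rewrite -[RHS](hm f mf f0)/= ge0_integral_mscale//= mul1e.
Qed.

End discrete_law.

Section noise_quadratic.
Context d (Omega : measurableType d) (R : realType) (P : probability Omega R).
Variables NT NR : nat.
Variable H : 'I_NT -> 'I_NR -> int -> {RV P >-> R[i]}.
Variable W : 'I_NR -> nat -> {RV P >-> R[i]}.
Hypothesis ch : rayleigh_fading_channel H W.
Variables (N t : nat).
Local Notation J := ('I_N * 'I_NR)%type.
Local Notation no := (@noise _ _ _ _ _ W N t).
Local Notation output := (N.-tuple (NR.-tuple R[i])).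

Lemma noise_covariance (i j : J) : covariance_of P no i j = (i == j)%:R.
Proof.
rewrite /covariance_of; case: eqP => [<-|/eqP neq].
  by rewrite cexpectation_ge0 ?(noise_power ch)//; exact: (noise_moments ch).
pose e (j : J) := (j.2, (t + j.1.+1)%N).
have ne : e i != e j.
  apply: contra neq => /eqP; case: i j => [n l] [n' l'] [-> h]; apply/eqP; congr (_, _).
  by apply: val_inj => /=; lia.
rewrite cexpectation_indep.
- by rewrite (noise_zero_mean ch) mul0r.
- exact: (noise_moments ch).
- by apply: complex_momentsJ; exact: (noise_moments ch).
- move=> A B mA mB.
  pose Bc := (fun z : R[i] => z^*) @^-1` B.
  have mBc : measurable Bc.
    rewrite /Bc -[_ @^-1` _]setTI.
    have mcj : measurable_fun setT (fun z : R[i] => z^*).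
      by apply: measurable_conjc; exact: measurable_id.
    exact: mcj.
  have := noise_independent ch (s := [:: e i; e j])
    (A := fun k => if k == e i then no i @^-1` A else no j @^-1` Bc).
  rewrite /= inE ne => /(_ isT); rewrite !big_cons !big_nil setIT mule1 eqxx eq_sym (negbTE ne).
  apply => k; rewrite !inE => /orP[] /eqP ->; rewrite ?eqxx.
    by exists A => //; exact: setTI.
  by rewrite eq_sym (negbTE ne); exists Bc => //; exact: setTI.
Qed.

Lemma received_covariance (rho : R) (z : N.-tuple (NT.-tuple R[i])) (i j : J) :
  covariance_of P (fun j w => no j w + faded H rho t z j w) i j =
  (i == j)%:R + covariance_of P (faded H rho t z) i j.
Proof.
have mW k : complex_moments P (no k) by exact: (noise_moments ch).
have mX k : complex_moments P (faded H rho t z k) by exact: (faded_moments ch).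
have mM f g : complex_moments P f -> complex_moments P g -> complex_moments P (fun w => f w * (g w)^*).
  by move=> mf mg; apply: complex_momentsM => //; exact: complex_momentsJ.
have cross k k' : cexpectation P (fun w => faded H rho t z k w * (no k' w)^*) = 0.
  rewrite cexpectation_indep//; first by rewrite (faded_mean ch) mul0r.
    exact: complex_momentsJ.
  apply: (fading_noise_indep ch); first exact: measurable_faded.
  exact: (measurable_conjc (@measurable_noise _ _ _ _ _ W k'.2 (t + k'.1.+1))).
have cross' k k' : cexpectation P (fun w => no k w * (faded H rho t z k' w)^*) = 0.
  rewrite (_ : (fun w => _) = (fun w => (faded H rho t z k' w * (no k w)^*)^*)); last first.
    by apply/funext => w; rewrite conjcM conjCK mulrC.
  rewrite cexpectationJ; last exact: mM.
  by rewrite cross; exact: conjc0.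
rewrite -noise_covariance /covariance_of.
transitivity (cexpectation P (fun w => (no i w * (no j w)^* + no i w * (faded H rho t z j w)^*) +
    (faded H rho t z i w * (no j w)^* + faded H rho t z i w * (faded H rho t z j w)^*))).
  by congr (cexpectation P); apply/funext => w; rewrite rmorphD/=; ring.
rewrite cexpectationD; last 2 first.
- by apply: complex_momentsD; exact: mM.
- by apply: complex_momentsD; exact: mM.
rewrite !cexpectationD; try exact: mM.
by rewrite cross cross' addr0 add0r.
Qed.

(* In an eigenbasis of B the noise is again standard, and the quadratic form
   becomes a sum of independent terms. *)
Lemma noise_qform_variance (B : J -> J -> R[i]) : (forall i j, B i j = (B j i)^*) ->
  \int[P]_w (qform B (no^~ w) - retrace B) ^+ 2 = \sum_i \sum_j normc (B i j) ^+ 2.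
Proof.
move=> hB; have [U [lam [_ U1 U2 BE <-]]] := hermitian_spectral hB.
pose xi (jb : J * bool) w := complex_part jb.2 (no jb.1 w).
have mxi jb : measurable_fun setT (xi jb) by exact: measurable_noise_part.
have iid := @noise_block_iid _ _ _ _ _ _ _ _ ch N t.
pose V i w := \sum_k (U k i)^* * no k w.
have UV k w : \sum_i U k i * V i w = no k w.
  rewrite /V; under eq_bigr do rewrite mulr_sumr.
  rewrite exchange_big/= (bigD1 k)//= [X in _ + X]big1 ?addr0 => [|m /negbTE mk0].
    by under eq_bigr do rewrite mulrA; rewrite -mulr_suml U2 eqxx mul1r.
  by under eq_bigr do rewrite mulrA; rewrite -mulr_suml U2 eq_sym mk0 mul0r.
have qV w : qform B (V^~ w) = \sum_k lam k * normc (no k w) ^+ 2.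
  rewrite /qform.
  have -> : \sum_i \sum_j (V i w)^* * B i j * V j w =
      \sum_k (lam k)%:C * ((\sum_i U k i * V i w)^* * (\sum_j U k j * V j w)).
    transitivity (\sum_i \sum_j \sum_k (lam k)%:C * ((U k i * V i w)^* * (U k j * V j w))).
      apply: eq_bigr => i _; apply: eq_bigr => j _; rewrite BE mulr_sumr mulr_suml.
      by apply: eq_bigr => k _; rewrite conjcM; ring.
    under eq_bigr => i _ do rewrite exchange_big/=.
    rewrite exchange_big/=; apply: eq_bigr => k _.
    have hab (c : R[i]) (a b : J -> R[i]) :
        c * ((\sum_i a i)^* * (\sum_j b j)) = \sum_i \sum_j c * ((a i)^* * b j).
      by rewrite conjc_sum big_distrlr/= mulr_sumr; apply: eq_bigr => i _; rewrite mulr_sumr.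
    by rewrite hab.
  rewrite Re_sum; apply: eq_bigr => k _; rewrite UV ReZ; congr (_ * _).
  by rewrite mulrC mul_conjc.
have trE : retrace B = \sum_k lam k.
  rewrite /retrace; under eq_bigr do rewrite BE Re_sum.
  rewrite exchange_big/=; apply: eq_bigr => k _.
  rewrite -Re_sum (_ : \sum_i _ = (lam k)%:C * \sum_i U k i * (U k i)^*); last first.
    by rewrite mulr_sumr; apply: eq_bigr => i _; ring.
  by rewrite U2 eqxx mulr1.
pose f (y : output) := (qform B (fun j => block_coord j y) - retrace B) ^+ 2.
have mf : measurable_fun setT f.
  apply: measurable_funX; apply: measurable_funB => //.
  apply: (measurableT_comp (@measurable_Re R)); apply: measurable_sumc => i.
  apply: measurable_sumc => j; apply: measurable_funMc; last exact: measurable_block_coord.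
  apply: measurable_funMc; last exact: measurable_cst.
  by apply: measurable_conjc; exact: measurable_block_coord.
pose FV w : output := block_of (V^~ w).
have nW := noise_cnormal ch N t.
have lawV E : measurable E -> P (FV @^-1` E) = P (noise_block W N t @^-1` E).
  move=> mE; have := cnormal_linear (fun i k => (U k i)^*) nW.
  rewrite (_ : (fun i i' => _) = (fun i j => (i == j)%:R)); last first.
    apply/funext => i; apply/funext => i'; rewrite -U1; apply: eq_bigr => k _.
    rewrite (bigD1 k)//= eqxx mulr1 conjCK big1 ?addr0// => m /negbTE mk0.
    by rewrite eq_sym mk0 mulr0 mul0r.
  move=> nV; apply: (cnormal_law (@measurable_block_coord R N NR) (@measurable_blockP R N NR) nV nW) => // j w.
    by rewrite block_ofK.
  by rewrite block_ofK.
have mFV : measurable_fun setT FV.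
  apply: measurable_blockP => j; rewrite (_ : _ \o _ = V j).
    by apply: measurable_sumc => k; apply: measurable_funMc => //; exact: measurable_funPT.
  by apply/funext => w /=; rewrite block_ofK.
transitivity (\int[P]_w f (noise_block W N t w)).
  by apply: eq_Rintegral => w _; rewrite /f /qform; under [in RHS]eq_bigr do under eq_bigr do rewrite !block_ofK.
rewrite (Rintegral_law (P := P) (Q := noise_law_block W N t) (@measurable_noise_block _ _ _ _ _ W N t) (fun _ _ => erefl) mf).
rewrite -(Rintegral_law (P := P) (Q := noise_law_block W N t) mFV lawV mf).
(* A squared modulus is split into two real squares of mean 1/2. The centred squares are
   uncorrelated with variance 3/4 - 1/4 = 1/2, so each eigenvalue contributes its square once. *)
pose g (jb : J * bool) w := lam jb.1 * (xi jb w ^+ 2 - 2^-1).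
transitivity (\int[P]_w (\sum_jb g jb w) ^+ 2).
  apply: eq_Rintegral => w _; rewrite /f; congr (_ ^+ 2).
  have -> : qform B (fun j => block_coord j (FV w)) = qform B (V^~ w).
    by congr (qform B); apply/funext => j; rewrite block_ofK.
  rewrite qV trE -sumrB.
  rewrite [RHS](eq_bigr (fun jb => g (jb.1, jb.2) w)); last by case.
  rewrite -(pair_bigA _ (fun j b => g (j, b) w))/=; apply: eq_bigr => j _.
  by rewrite big_bool/= /g /xi /= sqr_normcE; field.
have Mxi jb : all_moments P (xi jb).
  by have [h _ _ _] := iid_normal_moment (noise_std2 R) mxi iid jb.
have Mg jb : all_moments P (g jb).
  apply: all_momentsZ; apply: all_momentsB; last exact: all_moments_cst.
  exact: all_momentsX.
have Egg jb jb' : \int[P]_w (g jb w * g jb' w) = if jb == jb' then lam jb.1 ^+ 2 / 2 else 0.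
  have [_ _ s2 s4] := iid_normal_moment (noise_std2 R) mxi iid jb.
  have [_ _ s2' _] := iid_normal_moment (noise_std2 R) mxi iid jb'.
  have prod2 : \int[P]_w (xi jb w ^+ 2 * xi jb' w ^+ 2) = if jb == jb' then 3 / 4 else 4^-1.
    case: eqP => [<-|/eqP neq].
      by rewrite -s4; apply: eq_Rintegral => w _; rewrite -exprD.
    pose h (k : J * bool) (x : R) := if (k == jb) || (k == jb') then x ^+ 2 else 1.
    have hE k : h k = (fun x => x ^+ 2) \/ h k = (fun=> 1).
      by case hk: ((k == jb) || (k == jb')); [left|right]; apply/funext => x; rewrite /h hk.
    have mX2 : measurable_fun setT (fun x : R => x ^+ 2 : R) by exact: measurable_funX.
    have mh k : measurable_fun setT (h k : R -> R).
      by have [->|->] := hE k; [exact: mX2|exact: measurable_cst].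
    have h0 k x : 0 <= h k x by rewrite /h; case: ifP => _ //; exact: sqr_ge0.
    have sq : \int[normal_prob 0 (noise_std R)]_x (x ^+ 2) = 2^-1.
      rewrite -s2; apply/esym; apply: (Rintegral_law (P := P) (Q := normal_prob 0 (noise_std R)) (X := xi jb) (mxi jb)).
        by move=> B0 mB0; exact: (iid_normal_law iid).
      exact: measurable_funX.
    have ih k : (normal_prob 0 (noise_std R)).-integrable setT (EFin \o h k).
      have [->|->] := hE k; last exact: finite_measure_integrable_cst.
      apply: (integrable_law (P := P) (Q := normal_prob 0 (noise_std R)) (X := xi jb) (mxi jb) _ _).1.
      - by move=> B0 mB0; exact: (iid_normal_law iid).
      - exact: measurable_funX.
      - exact: (Mxi jb).2.
    have [_ e] := ge0_integral_prod_iid (Q := normal_prob 0 (noise_std R)) mxi iid mh h0 ih.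
    transitivity (\int[P]_w \prod_j h j (xi j w)).
      apply: eq_Rintegral => w _; rewrite (bigD1 jb)//= (bigD1 jb')/=; last by rewrite eq_sym.
      rewrite big1 ?mulr1 => [|k /andP[/negbTE k1 /negbTE k2]]; last by rewrite /h k1 k2.
      by rewrite /h !eqxx orbT.
    rewrite e (bigD1 jb)//= (bigD1 jb')/=; last by rewrite eq_sym.
    rewrite big1 ?mulr1 => [|k /andP[/negbTE k1 /negbTE k2]]; last first.
      by rewrite /h k1 k2; exact: Rintegral_prob_cst.
    by rewrite /h !eqxx orbT sq; field.
  have i2 := all_moments_integrable (all_momentsX 2 (Mxi jb)).
  have i2' := all_moments_integrable (all_momentsX 2 (Mxi jb')).
  have i22 := all_moments_integrable (all_momentsM (all_momentsX 2 (Mxi jb)) (all_momentsX 2 (Mxi jb'))).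
  transitivity (\int[P]_w (lam jb.1 * lam jb'.1 * (xi jb w ^+ 2 * xi jb' w ^+ 2 - (2^-1 * (xi jb w ^+ 2 + xi jb' w ^+ 2) - 4^-1)))).
    by apply: eq_Rintegral => w _; rewrite /g; field.
  have ic (r : R) : P.-integrable setT (EFin \o (fun=> r)) by exact: finite_measure_integrable_cst.
  have i3 : P.-integrable setT (EFin \o (fun w => 2^-1 * (xi jb w ^+ 2 + xi jb' w ^+ 2))).
    by apply: integrable_EFinZl => //; exact: integrable_EFinD.
  have i4 : P.-integrable setT (EFin \o (fun w => 2^-1 * (xi jb w ^+ 2 + xi jb' w ^+ 2) - 4^-1)).
    exact: integrable_EFinB.
  rewrite RintegralZl//; last exact: integrable_EFinB.
  rewrite RintegralB// RintegralB// RintegralZl//; last exact: integrable_EFinD.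
  rewrite RintegralD// Rintegral_prob_cst prod2 s2 s2'.
  by case: eqP => [<-|_]; field.
transitivity (\int[P]_w \sum_jb \sum_jb' g jb w * g jb' w).
  by apply: eq_Rintegral => w _; rewrite expr2 big_distrlr.
have igg jb jb' := all_moments_integrable (all_momentsM (Mg jb) (Mg jb')).
rewrite Rintegral_sum//; last by move=> jb _; apply: integrable_EFin_sum => // jb' _; exact: igg.
rewrite (eq_bigr (fun jb => lam jb.1 ^+ 2 / 2)); last first.
  move=> jb _; transitivity (\sum_jb' \int[P]_w (g jb w * g jb' w)).
    by apply: Rintegral_sum => // jb' _; exact: igg.
  rewrite (bigD1 jb)//= Egg eqxx big1 ?addr0// => jb' /negbTE h.
  by rewrite Egg eq_sym h.
rewrite (eq_bigr (fun jb => lam (jb.1, jb.2).1 ^+ 2 / 2)); last by case.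
rewrite -(pair_bigA _ (fun j (b : bool) => lam j ^+ 2 / 2))/=; apply: eq_bigr => j _.
by rewrite big_bool/=; field.
Qed.

End noise_quadratic.

Section discrete_integrals.
Context (R : realType) (I : finType) (w : I -> R) (w0 : forall i, 0 <= w i).
Context d (T : measurableType d) (z : I -> T) (mu : probability T R).
Hypothesis muE : forall f : T -> \bar R, measurable_fun setT f -> (forall x, (0 <= f x)%E) ->
  (\int[mu]_x f x = \sum_i (w i)%:E * f (z i))%E.

Lemma discrete_Rintegral (f : T -> R) : measurable_fun setT f ->
  \int[mu]_x f x = \sum_i w i * f (z i).
Proof.
move=> mf; have mf' : measurable_fun setT (EFin \o f) by exact/measurable_EFinP.
rewrite /Rintegral integralE (muE (measurable_funepos mf'))// (muE (measurable_funeneg mf'))//.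
have ep i : ((EFin \o f)^\+ (z i) = (Num.max (f (z i)) 0)%:E)%E by rewrite funeposE -EFin_max.
have en i : ((EFin \o f)^\- (z i) = (Num.max (- f (z i)) 0)%:E)%E by rewrite funenegE -EFinN -EFin_max.
under eq_bigr do rewrite ep -EFinM; under [X in (_ - X)%E]eq_bigr do rewrite en -EFinM.
rewrite !sumEFin -EFinB /= -sumrB; apply: eq_bigr => i _.
rewrite -mulrBr; congr (_ * _); rewrite /Num.max; case: ifPn => [|]; case: ifPn => [|]; lra.
Qed.

Lemma discrete_probability (A : set T) : measurable A -> (forall i, A (z i)) ->
  \sum_i w i = 1 -> mu A = 1%E.
Proof.
move=> mA Az w1; have mI : measurable_fun setT (EFin \o (\1_A : T -> R)) by exact/measurable_EFinP.
rewrite -[mu A]mul1e -(@integral_cst _ _ _ mu A mA 1).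
transitivity (\int[mu]_x (\1_A x)%:E)%E.
  by rewrite integral_indic// setIT integral_cst// mul1e.
rewrite (muE (f := fun x => (\1_A x)%:E))//.
under eq_bigr do rewrite indicE mem_set// mule1.
by rewrite sumEFin w1.
Qed.

Lemma discrete_ae_le (f : T -> R) (K : R) : measurable_fun setT f -> (forall i, f (z i) <= K) ->
  \sum_i w i = 1 -> {ae mu, forall x, f x <= K}.
Proof.
move=> mf fK w1.
have mA : measurable [set x | f x <= K].
  rewrite (_ : [set x | _] = f @^-1` `]-oo, K]).
    by rewrite -[_ @^-1` _]setTI; apply: mf => //; exact: measurable_itv.
  by apply/seteqP; split => x; rewrite /= in_itv.
exists (~` [set x | f x <= K]); split => //; first exact: measurableC.
by rewrite probability_setC// (discrete_probability mA)// subee.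
Qed.

End discrete_integrals.

Section hermitian_trace.
Context (R : realType) (J : finType).
Implicit Types A B C : J -> J -> R[i].

Definition trace_product A C : R := Re (\sum_i \sum_j A i j * C j i).

Lemma trace_productB A B C :
  trace_product A (fun i j => B i j - C i j) = trace_product A B - trace_product A C.
Proof.
rewrite /trace_product !Re_sum -sumrB; apply: eq_bigr => i _.
rewrite !Re_sum -sumrB; apply: eq_bigr => j _; rewrite mulrBr.
by rewrite ReD; congr (_ + _); case: (_ * _).
Qed.

Lemma trace_product_herm A : (forall i j, A i j = (A j i)^*) ->
  trace_product A A = \sum_i \sum_j normc (A i j) ^+ 2.
Proof.
move=> hA; rewrite /trace_product Re_sum; apply: eq_bigr => i _.
by rewrite Re_sum; apply: eq_bigr => j _; rewrite [A j i]hA mul_conjc.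
Qed.

Lemma trace_product_suml (I : finType) (w : I -> R) (A : I -> J -> J -> R[i]) C :
  \sum_a w a * trace_product (A a) C =
  trace_product (fun i j => \sum_a (w a)%:C * A a i j) C.
Proof.
rewrite /trace_product; under eq_bigr do rewrite -ReZ; rewrite -Re_sum; congr Re.
under eq_bigr do rewrite mulr_sumr; rewrite exchange_big/=; apply: eq_bigr => i _.
under eq_bigr do rewrite mulr_sumr; rewrite exchange_big/=; apply: eq_bigr => j _.
by rewrite mulr_suml; apply: eq_bigr => a _; rewrite mulrA.
Qed.

(** The centred quadratic form is linear in its matrix: averaging over the inputs may be done on the
    matrices. *)
Lemma qform_retraceE A (y : J -> R[i]) : qform A y - retrace A =
  trace_product A (fun j i => (y i)^* * y j - (i == j)%:R).
Proof.
rewrite /qform /retrace /trace_product !Re_sum -sumrB; apply: eq_bigr => i _.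
transitivity (Re (\sum_j (y i)^* * A i j * y j - \sum_j A i j * (i == j)%:R)).
  rewrite [X in _ = Re (_ - X)](bigD1 i)//= eqxx mulr1 [X in A i i + X]big1 ?addr0 => [|j /negbTE ji]; last by rewrite eq_sym ji mulr0.
  by rewrite ReD; congr (_ + _); case: (A i i).
by congr Re; rewrite -sumrB; apply: eq_bigr => j _; ring.
Qed.

Lemma retrace_le B : `|retrace B| <= entry_norm B.
Proof.
apply: le_trans (ler_norm_sum _ _ _) _; apply: ler_sum => i _.
rewrite (bigD1 i)//=; apply: le_trans (Re_le_normc _) _; rewrite lerDl.
by apply: sumr_ge0 => j _; exact: normc_ge0.
Qed.

End hermitian_trace.

Section input_covariance.
Context d (Omega : measurableType d) (R : realType) (P : probability Omega R).
Variables NT NR : nat.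
Variable H : 'I_NT -> 'I_NR -> int -> {RV P >-> R[i]}.
Variable W : 'I_NR -> nat -> {RV P >-> R[i]}.
Hypothesis ch : rayleigh_fading_channel H W.
Variable N : nat.
Local Notation input := (N.-tuple (NT.-tuple R[i])).
Local Notation output := (N.-tuple (NR.-tuple R[i])).
Local Notation J := ('I_N * 'I_NR)%type.

Definition input_covariance (z : input) (i j : J) : R[i] :=
  if i.2 == j.2 then \sum_(k < NT) tnth (tnth z i.1) k * (tnth (tnth z j.1) k)^* *
    autocorrelation (H k i.2) (i.1%:Z - j.1%:Z) else 0.

Lemma faded_input_covariance (rho : R) t z i j : 0 <= rho ->
  covariance_of P (faded H rho t z) i j = rho%:C * input_covariance z i j.
Proof.
move=> rho0; rewrite (faded_covariance ch)// /input_covariance.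
by case: ifP => // _; rewrite mulr0.
Qed.

Lemma input_covariance_herm z i j : input_covariance z i j = (input_covariance z j i)^*.
Proof.
have e (i' j' : J) : input_covariance z i' j' = covariance_of P (faded H 1 0 z) i' j'.
  by rewrite faded_input_covariance// mul1r.
by rewrite !e; apply: covariance_herm => k; exact: (faded_moments ch).
Qed.

Lemma measurable_input_covariance i j : measurable_fun setT (fun z => input_covariance z i j).
Proof.
rewrite /input_covariance; case: eqP => _; last exact: measurable_cst.
have mt n k : measurable_fun setT (fun z : input => tnth (tnth z n) k).
  by apply: (measurableT_comp (measurable_tnth k)); exact: measurable_tnth.
apply: measurable_sumc => k; apply: measurable_funMc; last exact: measurable_cst.
by apply: measurable_funMc => //; exact: measurable_conjc.
Qed.

Lemma fadedE (rho : R) t (z : input) (j : J) w : faded H rho t z j w = (Num.sqrt rho)%:C * faded H 1 t z j w.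
Proof. by rewrite /faded sqrtr1 mul1r. Qed.

End input_covariance.

(** * The information of a finitely supported input *)

Section discrete_information.
Context d (Omega : measurableType d) (R : realType) (P : probability Omega R).
Variables NT NR : nat.
Variable H : 'I_NT -> 'I_NR -> int -> {RV P >-> R[i]}.
Variable W : 'I_NR -> nat -> {RV P >-> R[i]}.
Hypothesis ch : rayleigh_fading_channel H W.
Variables (N : nat) (beta : R).
Local Notation input := (N.-tuple (NT.-tuple R[i])).
Local Notation output := (N.-tuple (NR.-tuple R[i])).
Local Notation J := ('I_N * 'I_NR)%type.
Variables (I : finType) (w : I -> R) (z : I -> input).
Hypotheses (w0 : forall a, 0 <= w a) (w1 : \sum_a w a = 1).
Hypothesis peak : forall a n, sqr_norm2 (tnth (z a) n) <= 1.
Hypothesis mean : forall n, \sum_a w a * sqr_norm2 (tnth (z a) n) <= beta^-1.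

Definition mean_covariance (i j : J) : R[i] := \sum_a (w a)%:C * input_covariance H (z a) i j.

(** The matrix of the test function. Subtracting the mean makes the average of the test form over
    the inputs vanish at every output, so that no first-order term survives under the product
    law. *)
Definition centered_covariance (x : input) (i j : J) : R[i] :=
  input_covariance H x i j - mean_covariance i j.

(** Half of this number is the coefficient of rho^2 in the lower bound. *)
Definition covariance_variance : R :=
  \sum_a w a * \sum_i \sum_j normc (centered_covariance (z a) i j) ^+ 2.

Local Notation B := centered_covariance.
Local Notation no := (@noise _ _ _ _ _ W N 0).

Lemma centered_covariance_herm x i j : B x i j = (B x j i)^*.
Proof.
rewrite /B rmorphB/= -(input_covariance_herm ch); congr (_ - _).
rewrite /mean_covariance conjc_sum; apply: eq_bigr => a _.
by rewrite conjcM -(input_covariance_herm ch); congr (_ * _); apply/esym; exact: conjc_real.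
Qed.

Lemma sum_centered_covariance i j : \sum_a (w a)%:C * B (z a) i j = 0.
Proof.
under eq_bigr do rewrite mulrBr; rewrite sumrB -mulr_suml.
by rewrite -rmorph_sum w1 mul1r subrr.
Qed.

(** Centred matrices average to 0, so pairing them with the constant mean gives nothing and the
    centring of one factor may be dropped. *)
Lemma covariance_varianceE :
  covariance_variance = \sum_a w a * trace_product (B (z a)) (input_covariance H (z a)).
Proof.
rewrite -[RHS]subr0; transitivity (\sum_a w a * trace_product (B (z a)) (input_covariance H (z a)) -
    \sum_a w a * trace_product (B (z a)) mean_covariance); last first.
  rewrite trace_product_suml; congr (_ - _); rewrite /trace_product big1// => i _.
  by rewrite big1// => j _; rewrite sum_centered_covariance mul0r.
rewrite -sumrB; apply: eq_bigr => a _; rewrite -mulrBr -trace_productB.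
by rewrite -(trace_product_herm (centered_covariance_herm (z a))).
Qed.

Let X a : J -> Omega -> R[i] := faded H 1 0 (z a).
(** Up to the factor sqrt(rho), the change caused by the faded signal of input [b] in the quadratic
    form attached to input [a]. *)
Let D a b t : R := 3 * entry_norm (B (z a)) *
  (\sum_k normc (X b k t) ^+ 2 + \sum_k normc (no k t) ^+ 2).

Let mnorm (V : J -> Omega -> R[i]) : (forall k, complex_moments P (V k)) ->
  all_moments P (fun t => \sum_k normc (V k t) ^+ 2).
Proof. by move=> mV; apply: all_moments_sum => k; exact: complex_moments_normc. Qed.

Let mno k : complex_moments P (no k). Proof. exact: (noise_moments ch). Qed.
Let mX a k : complex_moments P (X a k). Proof. exact: (faded_moments ch). Qed.

Let mD a b : all_moments P (D a b).
Proof. by apply: all_momentsZ; apply: all_momentsD; exact: mnorm. Qed.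

(** Dominates the test form divided by rho when the tested input is the one sent. *)
Let G a t := entry_norm (B (z a)) * \sum_k normc (no k t) ^+ 2 + D a a t + entry_norm (B (z a)).

(** Collects the cubic remainder of the logarithm and the effect of the signal on second moments.
    The signal is taken at rho = 1 throughout, so the constant does not depend on rho. *)
Definition information_defect : R := \sum_a w a * (\int[P]_t G a t ^+ 3 / 6) +
  covariance_variance / 2 + \sum_a w a * \sum_b w b * \int[P]_t D a b t ^+ 2.

Let weighted_sum_split (U T : I -> I -> R) c : (forall b, \sum_a w a * U a b = 0) ->
  \sum_a w a * \sum_b w b * (1 + U a b + c * T a b) = 1 + c * \sum_a w a * \sum_b w b * T a b.
Proof.
move=> U0; transitivity (\sum_a (w a + w a * (\sum_b w b * U a b) + c * (w a * \sum_b w b * T a b))).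
  apply: eq_bigr => a _; have -> : \sum_b w b * (1 + U a b + c * T a b) =
      1 + \sum_b w b * U a b + c * \sum_b w b * T a b.
    by rewrite -[X in _ = X + _ + _]w1 mulr_sumr -!big_split/=; apply: eq_bigr => b _; ring.
  ring.
rewrite !big_split/= -mulr_sumr w1 [X in _ + X + _](_ : _ = 0) ?addr0//.
under eq_bigr do rewrite mulr_sumr; rewrite exchange_big/= big1// => b _.
transitivity (w b * \sum_a w a * U a b); last by rewrite U0 mulr0.
by rewrite mulr_sumr; apply: eq_bigr => a _; ring.
Qed.

Section scale.
Variable rho : R.
Hypothesis rho01 : 0 <= rho <= 1.
Let s := Num.sqrt rho.

Let s01 : 0 <= s <= 1.
Proof. by case/andP: rho01 => h0 h1; rewrite sqrtr_ge0 -sqrtr1 ler_wsqrtr. Qed.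

Let rho0 : 0 <= rho. Proof. by case/andP: rho01. Qed.
Let ss : s ^+ 2 = rho. Proof. by rewrite sqr_sqrtr. Qed.

Let Y a : J -> Omega -> R[i] := fun j t => no j t + faded H rho 0 (z a) j t.
Let mY a k : complex_moments P (Y a k).
Proof. by apply: complex_momentsD; [exact: mno|exact: (faded_moments ch)]. Qed.

(** The leading term in rho of the log-likelihood ratio: for covariance I + rho K it is rho times
    the form of K minus its trace, and here K is centred by its mean over the inputs. *)
Let u (xy : input * output) : R :=
  rho * (qform (B xy.1) (fun j => block_coord j xy.2) - retrace (B xy.1)).
Let g xy := 1 + u xy + u xy ^+ 2 / 2.

Let uE a b t : u (z a, received H W rho 0 (z b, t)) =
  rho * (qform (B (z a)) (fun j => Y b j t) - retrace (B (z a))).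
Proof.
rewrite /u; congr (_ * (_ - _)); congr (qform _); apply/funext => j.
by rewrite block_ofK.
Qed.

Let perturb a b t : `|qform (B (z a)) (fun j => Y b j t) - qform (B (z a)) (fun j => no j t)| <= s * D a b t.
Proof.
have := qform_perturb (B (z a)) (no^~ t) (X b ^~ t) s01.
by rewrite /Y; congr (`|qform _ _ - _| <= _); apply/funext => j; rewrite fadedE.
Qed.

Let D0 a b t : 0 <= D a b t.
Proof.
rewrite /D mulr_ge0//; first by rewrite mulr_ge0// entry_norm_ge0.
by rewrite addr_ge0//; apply: sumr_ge0 => k _; exact: sqr_ge0.
Qed.

Let u_le a t : `|u (z a, received H W rho 0 (z a, t))| <= rho * G a t.
Proof.
rewrite uE normrM ger0_norm// ler_wpM2l// /G.
have := perturb a a t; have := qform_le (B (z a)) (no^~ t); have := retrace_le (B (z a)).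
have h : s * D a a t <= D a a t by case/andP: s01 => _ h; rewrite ler_piMl.
set q := qform _ _; set p := qform _ _; rewrite -/p => h1 h2 h3.
have := ler_normB p (retrace (B (z a))).
have := ler_normD (p - q) q; rewrite subrK; lra.
Qed.

Let mu_moments a b : all_moments P (fun t => u (z a, received H W rho 0 (z b, t))).
Proof.
rewrite (_ : (fun t => _) = fun t => rho * (qform (B (z a)) (fun j => Y b j t) - retrace (B (z a)))).
  apply: all_momentsZ; apply: all_momentsB; last exact: all_moments_cst.
  exact: (qform_moments (mY b)).
by apply/funext => t; exact: uE.
Qed.

Let G_moments a : all_moments P (G a).
Proof.
apply: all_momentsD; last exact: all_moments_cst.
apply: all_momentsD; last exact: mD.
by apply: all_momentsZ; exact: mnorm.
Qed.

(** The noise part of the covariance yields the trace, which the centring removes; the signal part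
    carries the second factor rho. *)
Let mean_u a : \int[P]_t u (z a, received H W rho 0 (z a, t)) =
  rho ^+ 2 * trace_product (B (z a)) (input_covariance H (z a)).
Proof.
transitivity (\int[P]_t (rho * (qform (B (z a)) (fun j => Y a j t) - retrace (B (z a))))).
  by apply: eq_Rintegral => t _; exact: uE.
have mq := all_moments_integrable (qform_moments (mY a) (B (z a))).
have ic : P.-integrable setT (EFin \o (fun=> retrace (B (z a)))) by exact: finite_measure_integrable_cst.
rewrite RintegralZl//; last exact: integrable_EFinB.
rewrite RintegralB// Rintegral_prob_cst (Rintegral_qform (mY a)) expr2 -mulrA; congr (_ * _).
rewrite /trace_product -ReZ mulr_sumr !Re_sum /retrace -sumrB; apply: eq_bigr => i _.
transitivity (Re (\sum_j (B (z a) i j * (j == i)%:R + rho%:C * (B (z a) i j * input_covariance H (z a) j i))) - Re (B (z a) i i)).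
  congr (Re _ - _); apply: eq_bigr => j _.
  rewrite (received_covariance ch) (faded_input_covariance ch)//; ring.
rewrite big_split/= ReD -mulr_sumr (bigD1 i)//= eqxx mulr1 big1 ?addr0; first by rewrite addrC addKr.
by move=> j /negbTE ->; rewrite mulr0.
Qed.

(** With q the form of the noise and |v| <= s D, expand (q + v)^2 and use 2 q v <= s q^2 + s D^2
    together with s^2 <= s. The variance of q is known exactly from [noise_qform_variance]. *)
Let second_u a b : \int[P]_t u (z a, received H W rho 0 (z b, t)) ^+ 2 <=
  rho ^+ 2 * ((1 + s) * \sum_i \sum_j normc (B (z a) i j) ^+ 2 + s * (2 * \int[P]_t D a b t ^+ 2)).
Proof.
case/andP: s01 => s0 s1.
have iD := all_moments_integrable (all_momentsX 2 (mD a b)).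
pose q t := qform (B (z a)) (fun j => no j t) - retrace (B (z a)).
have mq : all_moments P q.
  by apply: all_momentsB; [exact: (qform_moments mno)|exact: all_moments_cst].
have iq := all_moments_integrable (all_momentsX 2 mq).
rewrite -(noise_qform_variance ch 0 (centered_covariance_herm (z a))).
have i1 : P.-integrable setT (EFin \o (fun t => (1 + s) * q t ^+ 2)) by exact: integrable_EFinZl.
have i2 : P.-integrable setT (EFin \o (fun t => (s * 2) * D a b t ^+ 2)) by exact: integrable_EFinZl.
rewrite [X in _ <= _ * X](_ : _ = \int[P]_t ((1 + s) * q t ^+ 2 + (s * 2) * D a b t ^+ 2)); last first.
  by rewrite RintegralD// !RintegralZl// mulrA.
rewrite -RintegralZl//; last exact: integrable_EFinD.
apply: le_Rintegral => //.
- exact: (all_moments_integrable (all_momentsX 2 (mu_moments a b))).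
- by apply: integrable_EFinZl => //; exact: integrable_EFinD.
move=> t _; rewrite uE exprMn ler_wpM2l ?sqr_ge0//.
have := perturb a b t; have := D0 a b t; rewrite -/(q t).
have -> : qform (B (z a)) (fun j => Y b j t) - retrace (B (z a)) =
  q t + (qform (B (z a)) (fun j => Y b j t) - qform (B (z a)) (fun j => no j t)) by rewrite /q; ring.
move: (q t) (D a b t) (_ - _) => x y v y0 /ler_normlP[v1 v2].
have h1 : v ^+ 2 <= (s * y) ^+ 2 by rewrite !expr2; nra.
have h2 : 2 * x * v <= s * x ^+ 2 + s * y ^+ 2.
  have : 0 <= s * (x ^+ 2 + y ^+ 2 - 2 * `|x| * y).
    by rewrite mulr_ge0//; have := sqr_ge0 (`|x| - y); rewrite -(real_normK (num_real x)) !expr2; lra.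
  have : 2 * x * v <= 2 * `|x| * (s * y).
    rewrite -!mulrA ler_wpM2l//; apply: le_trans (ler_norm _) _; rewrite normrM ler_wpM2l//.
    by apply/ler_normlP.
  nra.
have h3 : (s * y) ^+ 2 <= s * y ^+ 2.
  by rewrite exprMn ler_wpM2r ?sqr_ge0// expr2 ler_piMl.
rewrite sqrrD; move: h1 h2 h3; rewrite -mulr_natr; lra.
Qed.

Variable mu : probability input R.
Hypothesis muE : forall f : input -> \bar R, measurable_fun setT f -> (forall x, (0 <= f x)%E) ->
  (\int[mu]_x f x = \sum_a (w a)%:E * f (z a))%E.
Hypothesis power : sum_power_constraints beta mu.
Local Notation nu := (joint_law H W rho 0 mu).
Local Notation la := (output_law_block H W rho 0 mu).

Let measurable_B i j : measurable_fun setT (fun x : input => B x i j).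
Proof.
by apply: measurable_funDc; [exact: measurable_input_covariance|exact: measurable_cst].
Qed.

Let measurable_u : measurable_fun setT u.
Proof.
have mB i j : measurable_fun setT (fun xy : input * output => B xy.1 i j).
  exact: (measurableT_comp (measurable_B i j) measurable_fst).
have my (j : J) : measurable_fun setT (fun xy : input * output => block_coord j xy.2).
  exact: (measurableT_comp (@measurable_block_coord R N NR j) measurable_snd).
apply: measurable_funM => //; apply: measurable_funB.
  apply: (measurableT_comp (@measurable_Re R)); apply: measurable_sumc => i; apply: measurable_sumc => j.
  apply: measurable_funMc; last exact: my.
  by apply: measurable_funMc; [exact: measurable_conjc|exact: mB].
by apply: measurable_sum => i; apply: (measurableT_comp (@measurable_Re R)); exact: mB.
Qed.

Let measurable_g : measurable_fun setT g.
Proof.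
apply: measurable_funD; first by apply: measurable_funD => //; exact: measurable_u.
by apply: measurable_funM => //; apply: measurable_funX; exact: measurable_u.
Qed.

(** Twice g is 1 + (1 + u)^2: the test function stays away from 0 and its logarithm grows at most
    like |u|. *)
Let g_ge xy : 1 <= 2 * g xy.
Proof. by rewrite /g; have := sqr_ge0 (1 + u xy); rewrite !expr2; lra. Qed.

Let g_gt0 xy : 0 < g xy. Proof. by have := g_ge xy; lra. Qed.

Let ln_g xy : `|ln (g xy)| <= 1 + 2 * `|u xy|.
Proof.
have n0 : 0 <= `|u xy| by [].
have h1 : - ln (g xy) <= 1.
  have i2 : (g xy)^-1 <= 2 by rewrite -[leLHS]mulr1 ler_pdivrMl// mulrC.
  have i0 : 0 < (g xy)^-1 by rewrite invr_gt0.
  have h : -1 < (g xy)^-1 - 1 by lra.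
  have := le_ln1Dx h; rewrite addrC subrK lnV ?posrE//; lra.
have h2 : ln (g xy) <= 2 * `|u xy|.
  apply: (@le_trans _ _ (ln ((1 + `|u xy|) ^+ 2))).
    have p1 : 0 < 1 + `|u xy| by rewrite ltr_wpDr.
    rewrite ler_ln ?posrE ?exprn_gt0//.
    have := ler_norm (u xy); have := sqr_ge0 (u xy); rewrite /g sqrrD -mulr_natr real_normK ?num_real//; lra.
  rewrite lnXn// -[leLHS]mulr_natl ler_wpM2l//; apply: le_ln1Dx.
  by apply: lt_le_trans n0; rewrite ltrN10.
by rewrite ler_norml; apply/andP; split; lra.
Qed.

(** A majorant of [entry_norm], by n <= 1 + n^2, whose measurability in the input is immediate. *)
Let e (x : input) : R := \sum_i \sum_j (1 + normc (B x i j) ^+ 2).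

Let measurable_e : measurable_fun setT e.
Proof.
apply: measurable_sum => i; apply: measurable_sum => j; apply: measurable_funD => //.
by apply: measurable_normc2; exact: measurable_B.
Qed.

Let entry_norm_e x : entry_norm (B x) <= e x.
Proof.
apply: ler_sum => i _; apply: ler_sum => j _.
have := sqr_ge0 (1 - normc (B x i j)); have := normc_ge0 (B x i j); rewrite !expr2; lra.
Qed.

Let e_sum a : e (z a) <= \sum_a' e (z a').
Proof.
rewrite (bigD1 a)//= lerDl; apply: sumr_ge0 => a' _; apply: sumr_ge0 => i _.
by apply: sumr_ge0 => j _; rewrite addr_ge0// sqr_ge0.
Qed.

Let u_e x y : `|u (x, y)| <= e x * (1 + block_norm2 y).
Proof.
case/andP: rho01 => _ r1; rewrite normrM ger0_norm// -[leRHS]mul1r ler_pM//=.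
apply: le_trans (ler_normB _ _) _; rewrite mulrDr mulr1 addrC lerD//.
  exact: le_trans (retrace_le _) (entry_norm_e x).
apply: le_trans (qform_le _ _) _; rewrite ler_wpM2r//.
by apply: sumr_ge0 => k _; exact: sqr_ge0.
Qed.

Let sum_u y : \sum_a w a * u (z a, y) = 0.
Proof.
under eq_bigr do rewrite /u /= mulrCA qform_retraceE.
rewrite -mulr_sumr trace_product_suml /trace_product big1 ?mulr0// => i _.
by rewrite big1// => j _; rewrite sum_centered_covariance mul0r.
Qed.

(** Under the product law the tested input is drawn independently of the output. Averaging over it
    removes the first-order term by [sum_u], and half of the second moment remains. *)
Let product_moment : (\int[mu \x la]_xy (g xy)%:E <=
  (1 + rho ^+ 2 / 2 * \sum_a w a * \sum_b w b * ((1 + s) * \sum_i \sum_j normc (B (z a) i j) ^+ 2 +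
     s * (2 * \int[P]_t D a b t ^+ 2)))%:E)%E.
Proof.
have mg : measurable_fun setT (fun xy => (g xy)%:E) by exact/measurable_EFinP.
have g0 xy : (0 <= (g xy)%:E)%E by rewrite lee_fin ltW.
rewrite (fubini_tonelli1 (m1 := mu) (m2 := la) _ mg g0).
rewrite muE; first last.
- by move=> x; apply: integral_ge0.
- exact: (measurable_fun_fubini_tonelli_F (m2 := la) _ mg).
have inner a : (\int[la]_y (g (z a, y))%:E =
    (\sum_b w b * \int[P]_t g (z a, received H W rho 0 (z b, t)))%:E)%E.
  have mga : measurable_fun setT (fun y => (g (z a, y))%:E) by exact: measurableT_comp mg (measurable_pair1 _).
  rewrite -(integral_law (P := (mu \x P)%E) (Q := la) (@measurable_received _ _ _ _ _ _ H W rho N 0) (fun _ _ => erefl) mga)//.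
  have mgr : measurable_fun setT (fun xt : input * Omega => (g (z a, received H W rho 0 xt))%:E).
    exact: measurableT_comp mga (@measurable_received _ _ _ _ _ _ H W rho N 0).
  rewrite (fubini_tonelli1 (m1 := mu) (m2 := P) _ mgr)//.
  rewrite muE; first last.
  - by move=> x; apply: integral_ge0.
  - exact: (measurable_fun_fubini_tonelli_F (m2 := P) _ mgr).
  rewrite -sumEFin; apply: eq_bigr => b _; rewrite EFinM; congr (_ * _)%E.
  rewrite /fubini_F /= -EFin_Rintegral//.
  apply: (all_moments_integrable (P := P)); apply: all_momentsD.
    by apply: all_momentsD; [exact: all_moments_cst|exact: mu_moments].
  by apply: all_momentsM; [exact: all_momentsX|exact: all_moments_cst].
rewrite /fubini_F; under eq_bigr do rewrite inner -EFinM.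
rewrite sumEFin lee_fin.
have mom a b : \int[P]_t g (z a, received H W rho 0 (z b, t)) =
   1 + \int[P]_t u (z a, received H W rho 0 (z b, t)) +
   2^-1 * \int[P]_t u (z a, received H W rho 0 (z b, t)) ^+ 2.
  have i1 := all_moments_integrable (mu_moments a b).
  have i2 := all_moments_integrable (all_momentsX 2 (mu_moments a b)).
  have ic : P.-integrable setT (EFin \o (fun=> 1 : R)) by exact: finite_measure_integrable_cst.
  rewrite -RintegralZl// -[X in X + _ + _](@Rintegral_prob_cst _ _ _ P) -RintegralD// -RintegralD//.
  + by apply: eq_Rintegral => t _; rewrite /g mulrC.
  + exact: integrable_EFinD.
  + exact: integrable_EFinZl.
have zero b : \sum_a w a * \int[P]_t u (z a, received H W rho 0 (z b, t)) = 0.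
  have i1 a := all_moments_integrable (mu_moments a b).
  transitivity (\sum_a \int[P]_t (w a * u (z a, received H W rho 0 (z b, t)))).
    by apply: eq_bigr => a _; rewrite RintegralZl//; exact: i1.
  rewrite -Rintegral_sum//; last by move=> a _; apply: integrable_EFinZl => //; exact: i1.
  by under eq_Rintegral do rewrite sum_u; rewrite Rintegral_prob_cst.
rewrite -(weighted_sum_split _ _ zero); apply: ler_sum => a _; rewrite ler_wpM2l//.
apply: ler_sum => b _; rewrite ler_wpM2l// mom lerD2l.
rewrite -[leRHS]mulrA [leRHS]mulrC -mulrA ler_wpM2l// mulrC; exact: second_u.
Qed.

(** The mean of the logarithm is at least rho^2 V minus a cubic term, the normalisation costs rho^2
    V/2 up to a relative error sqrt(rho), and the difference is the claim. As rho <= sqrt(rho), both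
    errors merge into one constant. *)
Lemma discrete_information_ge :
  ((rho ^+ 2 * (covariance_variance / 2 - information_defect * s))%:E <=
    relative_entropy nu (mu \x la))%E.
Proof.
case/andP: s01 => s0 s1.
have [] := joint_integral ch 0 rho0 power (f := fun xy => ln (g xy)) (K := fun x => 1 + 2 * e x)
  (M := fun x => 2 * e x) (K0 := 1 + 2 * \sum_a e (z a)) (M0 := 2 * \sum_a e (z a)) _ _ _ _ _.
- by apply: measurableT_comp => //; exact: measurable_g.
- move=> x; rewrite mulr_ge0//; apply: sumr_ge0 => i _; apply: sumr_ge0 => j _.
  by rewrite addr_ge0// sqr_ge0.
- move=> x y; apply: le_trans (ln_g _) _; have := u_e x y; lra.
- apply: (discrete_ae_le muE) => [|a|//].
    by apply: measurable_funD => //; apply: measurable_funM => //; exact: measurable_e.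
  by rewrite lerD2l ler_wpM2l// e_sum.
- apply: (discrete_ae_le muE) => [|a|//]; first by apply: measurable_funM => //; exact: measurable_e.
  by rewrite ler_wpM2l// e_sum.
move=> ig igP igmu nuE.
apply: le_trans (relative_entropy_ge measurable_g g_gt0 ig product_moment).
rewrite lee_fin nuE (discrete_Rintegral muE); last first.
  by apply/measurable_EFinP; exact: measurable_int igmu.
have low a : rho ^+ 2 * trace_product (B (z a)) (input_covariance H (z a)) -
    rho ^+ 3 * (\int[P]_t G a t ^+ 3 / 6) <= \int[P]_t ln (g (z a, received H W rho 0 (z a, t))).
  have i1 := all_moments_integrable (mu_moments a a).
  have i3 : P.-integrable setT (EFin \o (fun t => rho ^+ 3 / 6 * G a t ^+ 3)).
    by apply: integrable_EFinZl => //; exact: (all_moments_integrable (all_momentsX 3 (G_moments a))).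
  have -> : rho ^+ 3 * (\int[P]_t G a t ^+ 3 / 6) = \int[P]_t (rho ^+ 3 / 6 * G a t ^+ 3).
    rewrite RintegralZl//; first by rewrite mulrCA mulrC mulrAC.
    exact: (all_moments_integrable (all_momentsX 3 (G_moments a))).
  rewrite -mean_u -RintegralB//; apply: le_Rintegral => //; first exact: integrable_EFinB.
  move=> t _; apply: le_trans (ln_quadratic_ge _); rewrite lerB// [leRHS]mulrAC ler_wpM2r// -exprMn.
  by rewrite lerXn2r ?nnegrE// ?u_le//; apply: le_trans (u_le a t).
have total : rho ^+ 2 * covariance_variance - rho ^+ 3 * (\sum_a w a * (\int[P]_t G a t ^+ 3 / 6)) <=
    \sum_a w a * \int[P]_t ln (g (z a, received H W rho 0 (z a, t))).
  rewrite covariance_varianceE !mulr_sumr -sumrB; apply: ler_sum => a _.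
  by rewrite (mulrCA (rho ^+ 2)) (mulrCA (rho ^+ 3)) -mulrBr ler_wpM2l.
have prod : \sum_a w a * (\sum_b w b * ((1 + s) * (\sum_i \sum_j normc (B (z a) i j) ^+ 2) +
     s * (2 * \int[P]_t D a b t ^+ 2))) = (1 + s) * covariance_variance +
     2 * s * \sum_a w a * \sum_b w b * \int[P]_t D a b t ^+ 2.
  rewrite /covariance_variance !mulr_sumr -big_split/=; apply: eq_bigr => a _.
  have -> : \sum_b w b * ((1 + s) * (\sum_i \sum_j normc (B (z a) i j) ^+ 2) + s * (2 * \int[P]_t D a b t ^+ 2)) =
     (1 + s) * (\sum_i \sum_j normc (B (z a) i j) ^+ 2) + 2 * s * \sum_b w b * \int[P]_t D a b t ^+ 2.
    transitivity (\sum_b (w b * ((1 + s) * (\sum_i \sum_j normc (B (z a) i j) ^+ 2)) +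
        2 * s * (w b * \int[P]_t D a b t ^+ 2))); first by apply: eq_bigr => b _; ring.
    by rewrite big_split/= -mulr_suml w1 mul1r -mulr_sumr.
  ring.
rewrite prod /information_defect.
have Gam0 : 0 <= \sum_a w a * (\int[P]_t G a t ^+ 3 / 6).
  apply: sumr_ge0 => a _; rewrite mulr_ge0// divr_ge0//; apply: Rintegral_ge0 => t _.
  apply: exprn_ge0; apply: addr_ge0; last exact: entry_norm_ge0.
  apply: addr_ge0; last exact: D0.
  by apply: mulr_ge0; [exact: entry_norm_ge0|apply: sumr_ge0 => k _; exact: sqr_ge0].
move: Gam0 total; set Gam := \sum_a w a * (_ / 6); set De := \sum_a w a * \sum_b _.
set V := covariance_variance => Gam0; move: (\sum_a _) => L total.
have : rho ^+ 2 * (rho * Gam) <= rho ^+ 2 * (s * Gam).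
  by rewrite ler_wpM2l ?sqr_ge0// ler_wpM2r// -ss expr2 ler_piMl.
by move: total; rewrite exprSr; lra.
Qed.

End scale.

(** One input law serves all rho in [0, 1], so its block length can be fixed before rho tends to
    0. *)
Lemma discrete_information : exists2 mu : probability input R, sum_power_constraints beta mu &
  forall rho : R, 0 <= rho <= 1 ->
  ((rho ^+ 2 * (covariance_variance / 2 - information_defect * Num.sqrt rho))%:E <=
    block_information H W rho mu)%E.
Proof.
have [mu muE] := discrete_law w0 w1 z.
have power : sum_power_constraints beta mu.
  apply: sum_power_constraintsP => n.
    exact: (discrete_probability muE (measurable_peak n) (fun a => peak a n) w1).
  rewrite muE.
  - by under eq_bigr do rewrite -EFinM; rewrite sumEFin lee_fin.
  - by apply/measurable_EFinP; exact: measurable_power.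
  - by move=> x; rewrite lee_fin; apply: sumr_ge0 => k _; exact: sqr_ge0.
exists mu => // rho rho01; have /andP[rho0 _] := rho01; rewrite (block_informationE ch)//.
exact: discrete_information_ge.
Qed.

End discrete_information.

(** * Random signs and Cesaro sums of squared autocorrelations *)

Section cesaro_sums.
Variable R : realType.
Implicit Types r : nat -> R.

Lemma partial_sum_le r (M M' : nat) : (forall h, 0 <= r h) -> (1 <= M <= M')%N ->
  \sum_(1 <= h < M) r h <= \sum_(1 <= h < M') r h.
Proof.
move=> r0 /andP[M1 MM]; rewrite [leRHS](@big_cat_nat _ _ _ M)//= lerDl.
by apply: sumr_ge0.
Qed.

(** A row at distance at least [M] from both ends sees every lag below [M] twice; the other 2 M rows
    are a vanishing fraction. The tolerance e/4 on the partial sum counts twice, and e/2 is left for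
    the lost rows. *)
Lemma cesaro_sum_ge r (s e : R) : (forall h, 0 <= r h) -> 0 < e ->
  (forall e', 0 < e' -> exists M : nat, s - e' <= \sum_(1 <= h < M) r h) ->
  \forall N \near \oo, N%:R * (r 0%N + 2 * s - e) <= \sum_(n < N) \sum_(m < N) r `|(n%:Z - m%:Z)|%N.
Proof.
move=> r0 e0 /(_ (e / 4)) -[|M]; first by rewrite divr_gt0.
set T := \sum_(1 <= h < M) r h => hM.
have T0 : 0 <= T by apply: sumr_ge0.
near=> N.
have NM : (2 * M <= N)%N by near: N; exact: nbhs_infty_ge.
have Ne : 2 * M%:R * (r 0%N + 2 * T) / (e / 2) <= N%:R by near: N; exact: nbhs_infty_ger.
apply: (@le_trans _ _ ((N - 2 * M)%:R * (r 0%N + 2 * T))).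
  rewrite natrB// natrM mulrBl; move: Ne; rewrite ler_pdivrMr ?divr_gt0//.
  have n0 : (0 : R) <= N%:R by [].
  nra.
rewrite -(big_mkord xpredT (fun n => \sum_(m < N) r `|(n%:Z - m%:Z)|%N)).
rewrite (@big_cat_nat _ _ _ M)//=; last by lia.
rewrite [X in _ <= _ + X](@big_cat_nat _ _ _ (N - M))//=; [|lia|lia].
have -> : (N - 2 * M)%:R * (r 0%N + 2 * T) = \sum_(M <= n < N - M) (r 0%N + 2 * T).
  by rewrite sumr_const_nat -[RHS]mulr_natl; have -> : (N - 2 * M = N - M - M)%N by lia.
rewrite -[leLHS]add0r lerD//; first by apply: sumr_ge0 => n _; apply: sumr_ge0.
rewrite -[leLHS]addr0 lerD//; last by apply: sumr_ge0 => n _; apply: sumr_ge0.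
rewrite !big_nat; apply: ler_sum => n /andP[n1 n2].
rewrite sum_distanceE; last by lia.
have h1 : T <= \sum_(1 <= h < n.+1) r h.
  by rewrite /T; case: (M) n1 => [|M'] n1; [rewrite big_geq// sumr_ge0|apply: partial_sum_le => //; lia].
have h2 : T <= \sum_(1 <= h < (N - n)%N) r h.
  by rewrite /T; case: (M) n2 => [|M'] n2; [rewrite big_geq// sumr_ge0|apply: partial_sum_le => //; lia].
lra.
Unshelve. all: by end_near.
Qed.

End cesaro_sums.

Section trace_sums.
Context (R : realType) (J : finType).

Lemma trace_productC (A C : J -> J -> R[i]) : trace_product A C = trace_product C A.
Proof.
rewrite /trace_product exchange_big/=; congr Re.
by apply: eq_bigr => i _; apply: eq_bigr => j _; rewrite mulrC.
Qed.

End trace_sums.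

Section sign_sums.
Context (R : numFieldType) (N : nat).

(** Flipping the sign at [n] alone is an involution of the sign patterns that negates each term when
    m differs from n. *)
Lemma sum_signs (n m : 'I_N) :
  \sum_(s : {ffun 'I_N -> bool}) ((-1) ^+ (s n) * (-1) ^+ (s m) : R) = if n == m then 2 ^+ N else 0.
Proof.
case: eqP => [<-|/eqP nm].
  rewrite (eq_bigr (fun=> 1)); last by move=> s _; rewrite -expr2 sqrr_sign.
  by rewrite sumr_const -[#|_|]/#|{ffun 'I_N -> bool}| card_ffun card_bool card_ord natrX.
pose flip (s : {ffun 'I_N -> bool}) : {ffun 'I_N -> bool} := [ffun i => if i == n then ~~ s i else s i].
have flipK : involutive flip.
  by move=> s; apply/ffunP => i; rewrite !ffunE; case: eqP => // _; rewrite negbK.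
have : \sum_(s : {ffun 'I_N -> bool}) ((-1) ^+ (s n) * (-1) ^+ (s m) : R) =
    - \sum_(s : {ffun 'I_N -> bool}) ((-1) ^+ (s n) * (-1) ^+ (s m) : R).
  rewrite -sumrN (reindex_inj (inv_inj flipK))/=; apply: eq_bigr => s _.
  by rewrite !ffunE eqxx eq_sym (negbTE nm) signrN mulNr.
by move/eqP; rewrite -subr_eq0 opprK -mulr2n mulrn_eq0/= => /eqP.
Qed.

End sign_sums.

Section sign_input.
Context d (Omega : measurableType d) (R : realType) (P : probability Omega R).
Variables NT NR : nat.
Variable H : 'I_NT -> 'I_NR -> int -> {RV P >-> R[i]}.
Variable W : 'I_NR -> nat -> {RV P >-> R[i]}.
Hypothesis ch : rayleigh_fading_channel H W.
Hypothesis phi_finite : forall k l, (phi (H k l) < +oo)%E.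
Local Notation R0 k l := (autocorrelation0 (H k l)).

(** Twice the limit of the theorem before maximisation, as a function of the antenna powers. *)
Definition quadratic_gain (a : 'I_NT -> R) : R := \sum_(l < NR)
  (\sum_(k < NT) a k * lambda (H k l) - (\sum_(k < NT) a k * R0 k l) ^+ 2).

Lemma phi_partial_sum k l (e : R) : 0 < e -> exists M : nat,
  fine (phi (H k l)) - e <= \sum_(1 <= h < M) normc (autocorrelation (H k l) h%:Z) ^+ 2.
Proof.
move=> e0; apply: contrapT => /forallNP h.
have f0 : (0 <= phi (H k l))%E by apply: nneseries_ge0 => n _ _; rewrite lee_fin sqr_ge0.
have ff : phi (H k l) \is a fin_num by rewrite ge0_fin_numE.
have : (phi (H k l) <= (fine (phi (H k l)) - e)%:E)%E.
  apply: lime_le; first by apply: is_cvg_nneseries => n _ _; rewrite lee_fin sqr_ge0.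
  near=> M; rewrite sumEFin lee_fin ltW// ltNge; apply/negP; exact: h.
by rewrite -{1}(fineK ff) lee_fin; lra.
Unshelve. all: by end_near.
Qed.

Lemma autocorrelation_cesaro k l (e : R) : 0 < e -> \forall N \near \oo,
  N%:R * (lambda (H k l) - e) <=
  \sum_(n < N) \sum_(m < N) normc (autocorrelation (H k l) (n%:Z - m%:Z)) ^+ 2.
Proof.
move=> e0; have := cesaro_sum_ge (r := fun h => normc (autocorrelation (H k l) h%:Z) ^+ 2)
  (s := fine (phi (H k l))) (fun=> sqr_ge0 _) e0 (@phi_partial_sum k l).
apply: filterS => N; rewrite (autocorrelation_zero ch) normc_real real_normK ?num_real// => h.
apply: le_trans h _; apply: ler_sum => n _; apply: ler_sum => m _.
by rewrite -(normc_autocorrelation_abs ch).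
Qed.

Variables (beta : R) (a : 'I_NT -> R).
Hypotheses (beta1 : 1 <= beta) (aA : A_ beta a).

Section block.
Variable N : nat.
Local Notation input := (N.-tuple (NT.-tuple R[i])).
Local Notation J := ('I_N * 'I_NR)%type.
Local Notation index := ('I_NT.+1 * {ffun 'I_N -> bool})%type.

(* The index 0 stands for the zero input, k + 1 for random signs sent by antenna k. *)
Definition sign_weight (i : index) : R :=
  (if unlift ord0 i.1 is Some k then a k else 1 - \sum_k a k) / 2 ^+ N.

Definition sign_block (i : index) : input :=
  [tuple [tuple if unlift ord0 i.1 == Some k then (-1) ^+ (i.2 n) else 0 | k < NT] | n < N].

Lemma sum_sign_index (V : nmodType) (F : index -> V) : \sum_i F i =
  \sum_s F (ord0, s) + \sum_(k < NT) \sum_s F (lift ord0 k, s).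
Proof.
rewrite [LHS](eq_bigr (fun i => F (i.1, i.2))); last by case.
by rewrite -(pair_bigA _ (fun o s => F (o, s)))/= big_ord_recl.
Qed.

Lemma sign_weight0 s : sign_weight (ord0, s) = (1 - \sum_k a k) / 2 ^+ N.
Proof. by rewrite /sign_weight unlift_none. Qed.

Lemma sign_weightS k s : sign_weight (lift ord0 k, s) = a k / 2 ^+ N.
Proof. by rewrite /sign_weight liftK. Qed.

Lemma sum_sign_cst (x : R) : \sum_(s : {ffun 'I_N -> bool}) (x / 2 ^+ N) = x.
Proof.
rewrite sumr_const -[#|_|]/#|{ffun 'I_N -> bool}| card_ffun card_bool card_ord.
by rewrite -[LHS]mulr_natr natrX divfK// expf_neq0// pnatr_eq0.
Qed.

Lemma sum_a_le1 : \sum_k a k <= 1.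
Proof. by case: aA => _ /le_trans; apply; rewrite invf_le1// (lt_le_trans ltr01). Qed.

Lemma sign_weight_ge0 i : 0 <= sign_weight i.
Proof.
rewrite /sign_weight divr_ge0 ?exprn_ge0//; case: unlift => [k|]; first by case: aA.
by rewrite subr_ge0 sum_a_le1.
Qed.

Lemma sum_sign_weight : \sum_i sign_weight i = 1.
Proof.
rewrite sum_sign_index; under eq_bigr do rewrite sign_weight0.
under [X in _ + X]eq_bigr do under eq_bigr do rewrite sign_weightS.
by rewrite sum_sign_cst; under eq_bigr do rewrite sum_sign_cst; rewrite subrK.
Qed.

Lemma tnth_sign_block i n k : tnth (tnth (sign_block i) n) k =
  if unlift ord0 i.1 == Some k then (-1) ^+ (i.2 n) else 0.
Proof. by rewrite !tnth_mktuple. Qed.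

Lemma normc_sign (b : bool) : normc ((-1) ^+ b : R[i]) = 1.
Proof.
have -> : ((-1) ^+ b : R[i]) = ((-1) ^+ b)%:C by rewrite rmorph_sign.
by rewrite normc_real normr_sign.
Qed.

Lemma sign_block_power i n :
  sqr_norm2 (tnth (sign_block i) n) = if unlift ord0 i.1 is Some _ then 1 else 0.
Proof.
rewrite /sqr_norm2; under eq_bigr do rewrite tnth_sign_block.
case: (unlift ord0 i.1) => [k|].
  rewrite (bigD1 k)//= eqxx normc_sign expr1n big1 ?addr0// => k' /negbTE kk'.
  by rewrite (inj_eq Some_inj) eq_sym kk' Normc.normc0 expr0n.
by rewrite big1// => k _; rewrite Normc.normc0 expr0n.
Qed.

Lemma sign_block_peak i n : sqr_norm2 (tnth (sign_block i) n) <= 1.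
Proof. by rewrite sign_block_power; case: unlift. Qed.

Lemma sign_block_mean n : \sum_i sign_weight i * sqr_norm2 (tnth (sign_block i) n) <= beta^-1.
Proof.
under eq_bigr do rewrite sign_block_power; rewrite sum_sign_index/= big1 ?add0r => [|s _]; last first.
  by rewrite unlift_none mulr0.
case: aA => _ /(le_trans _); apply; apply: ler_sum => k _.
under eq_bigr do rewrite liftK mulr1 sign_weightS; by rewrite sum_sign_cst.
Qed.

Local Notation K i := (input_covariance H (sign_block i)).

Lemma sign_covariance0 s i j : K (ord0, s) i j = 0.
Proof.
rewrite /input_covariance; case: ifP => // _; apply: big1 => k _.
by rewrite !tnth_sign_block unlift_none/= !mul0r.
Qed.

Lemma sign_covarianceS k s i j : K (lift ord0 k, s) i j =
  if i.2 == j.2 then (-1) ^+ (s i.1) * (-1) ^+ (s j.1) * autocorrelation (H k i.2) (i.1%:Z - j.1%:Z)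
  else 0.
Proof.
rewrite /input_covariance; case: ifP => // _; rewrite (bigD1 k)//= big1 ?addr0 => [|k' /negbTE kk'].
  by rewrite !tnth_sign_block liftK eqxx rmorph_sign.
by rewrite !tnth_sign_block liftK (inj_eq Some_inj) eq_sym kk' !mul0r.
Qed.

(** Signs at distinct times average to 0, so the mean covariance is diagonal. Each single sign
    pattern keeps the moduli of all autocorrelations, and the information comes from this
    contrast. *)
Lemma sign_mean_covariance i j : mean_covariance H sign_weight sign_block i j =
  if i == j then (\sum_k a k * R0 k i.2)%:C else 0.
Proof.
rewrite /mean_covariance sum_sign_index/= big1 ?add0r => [|s _]; last by rewrite sign_covariance0 mulr0.
transitivity (\sum_(k < NT) if i.2 == j.2 then
    (a k / 2 ^+ N)%:C * autocorrelation (H k i.2) (i.1%:Z - j.1%:Z) *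
    (\sum_(s : {ffun 'I_N -> bool}) (-1) ^+ (s i.1) * (-1) ^+ (s j.1)) else 0).
  apply: eq_bigr => k _; case: eqP => ij.
    rewrite mulr_sumr; apply: eq_bigr => s _.
    by rewrite sign_weightS sign_covarianceS ij eqxx; ring.
  by apply: big1 => s _; rewrite sign_covarianceS; case: eqP => //; rewrite mulr0.
case: i j => [n l] [m l'] /=; rewrite xpair_eqE; case: (eqVneq l l') => [_|ll']; last first.
  by rewrite andbF big1.
rewrite andbT sum_signs; case: eqP => [<-|nm]; last by rewrite big1// => k _; rewrite mulr0.
rewrite rmorph_sum; apply: eq_bigr => k _; rewrite subrr (autocorrelation_zero ch).
have -> : (2 : R[i]) ^+ N = (2 ^+ N)%:C by rewrite rmorphXn rmorph_nat.
by rewrite -!rmorphM; congr (_%:C); rewrite mulrAC divfK// expf_neq0// pnatr_eq0.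
Qed.

(** Variance as mean of the squared norm minus squared norm of the mean. The signs disappear from
    the first part, and the diagonal mean gives the second. *)
Lemma sign_covariance_variance : covariance_variance H sign_weight sign_block =
  \sum_(l < NR) (\sum_(k < NT) a k *
     (\sum_(n < N) \sum_(m < N) normc (autocorrelation (H k l) (n%:Z - m%:Z)) ^+ 2) -
   N%:R * (\sum_(k < NT) a k * R0 k l) ^+ 2).
Proof.
rewrite (covariance_varianceE ch sign_block sum_sign_weight).
transitivity (\sum_i sign_weight i * trace_product (K i) (K i) -
    trace_product (mean_covariance H sign_weight sign_block) (mean_covariance H sign_weight sign_block)).
  rewrite -[X in _ - X]trace_product_suml -sumrB; apply: eq_bigr => i _.
  by rewrite -mulrBr trace_productC trace_productB.
rewrite sumrB; congr (_ - _).
  rewrite sum_sign_index/= big1 ?add0r => [|s _]; last first.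
    rewrite /trace_product big1 ?mulr0// => i _; rewrite big1// => j _.
    by rewrite sign_covariance0 mul0r.
  rewrite [RHS]exchange_big/=; apply: eq_bigr => k _.
  transitivity (\sum_(s : {ffun 'I_N -> bool}) a k * (\sum_(l < NR)
      \sum_(n < N) \sum_(m < N) normc (autocorrelation (H k l) (n%:Z - m%:Z)) ^+ 2) / 2 ^+ N).
    apply: eq_bigr => s _; rewrite sign_weightS mulrAC; congr (_ * _ / _).
    rewrite trace_product_herm; last by move=> i j; exact: (input_covariance_herm ch).
    rewrite [LHS](eq_bigr (fun i => \sum_j normc (K (lift ord0 k, s) (i.1, i.2) j) ^+ 2)); last by case.
    rewrite -(pair_bigA _ (fun n l => \sum_j normc (K (lift ord0 k, s) (n, l) j) ^+ 2))/= exchange_big/=.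
    apply: eq_bigr => l _; apply: eq_bigr => n _.
    rewrite [LHS](eq_bigr (fun j => normc (K (lift ord0 k, s) (n, l) (j.1, j.2)) ^+ 2)); last by case.
    rewrite -(pair_bigA _ (fun m l' => normc (K (lift ord0 k, s) (n, l) (m, l')) ^+ 2))/=.
    apply: eq_bigr => m _; rewrite (bigD1 l)//= big1 ?addr0 => [|l' /negbTE ll'].
      by rewrite sign_covarianceS eqxx /= !Normc.normcM !normc_sign !mul1r.
    by rewrite sign_covarianceS /= eq_sym ll' Normc.normc0 expr0n.
  by rewrite sum_sign_cst mulr_sumr.
rewrite /trace_product Re_sum [LHS](eq_bigr (fun i => (\sum_k a k * R0 k (i.1, i.2).2) ^+ 2)); last first.
  move=> i _; rewrite (bigD1 i)//= big1 ?addr0 => [|j /negbTE ij].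
    by rewrite sign_mean_covariance eqxx -rmorphM/= expr2; case: i.
  by rewrite sign_mean_covariance eq_sym ij mul0r.
rewrite -(pair_bigA _ (fun (n : 'I_N) l => (\sum_k a k * R0 k l) ^+ 2))/= sumr_const card_ord -mulr_sumr.
by rewrite mulr_natl.
Qed.

End block.

Lemma sign_input_information (e : R) : 0 < e -> exists2 N : nat, (0 < N)%N &
  exists mu : probability (N.-tuple (NT.-tuple R[i])) R, exists C : R,
  sum_power_constraints beta mu /\ forall rho : R, 0 <= rho <= 1 ->
  ((rho ^+ 2 * (N%:R * (quadratic_gain a - e) / 2 - C * Num.sqrt rho))%:E <=
    block_information H W rho mu)%E.
Proof.
(* Each of the [NR] receive antennas loses at most e/M, and the added 1 keeps [M] positive when
   there is none. *)
move=> e0; pose M : R := 1 + NR%:R.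
have M0 : 0 < M by rewrite ltr_wpDr.
have near_all : \forall N \near \oo, forall kl : 'I_NT * 'I_NR, N%:R * (lambda (H kl.1 kl.2) - e / M) <=
    \sum_(n < N) \sum_(m < N) normc (autocorrelation (H kl.1 kl.2) (n%:Z - m%:Z)) ^+ 2.
  by apply: filter_forall => kl; apply: autocorrelation_cesaro; exact: divr_gt0.
have [N [N0 hN]] : exists N : nat, (0 < N)%N /\ forall kl : 'I_NT * 'I_NR,
    N%:R * (lambda (H kl.1 kl.2) - e / M) <=
    \sum_(n < N) \sum_(m < N) normc (autocorrelation (H kl.1 kl.2) (n%:Z - m%:Z)) ^+ 2.
  by near \oo => N; exists N; split; [near: N; exact: nbhs_infty_gt|near: N].
exists N => //.
have [mu power info] := discrete_information ch (@sign_weight_ge0 N) (@sum_sign_weight N)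
  (@sign_block_peak N) (@sign_block_mean N).
exists mu; exists (information_defect H W (@sign_weight N) (@sign_block N)); split => // rho rho01.
apply: le_trans (info rho rho01); rewrite lee_fin ler_wpM2l ?sqr_ge0// lerB// ler_wpM2r//.
rewrite sign_covariance_variance /quadratic_gain.
apply: (@le_trans _ _ (\sum_(l < NR) N%:R * (\sum_(k < NT) a k * (lambda (H k l) - e / M) -
    (\sum_(k < NT) a k * R0 k l) ^+ 2))); last first.
  apply: ler_sum => l _; rewrite mulrBr lerB// mulr_sumr; apply: ler_sum => k _.
  by rewrite mulrCA ler_wpM2l ?(hN (k, l))//; case: aA.
rewrite -mulr_sumr ler_wpM2l//.
apply: (@le_trans _ _ (\sum_(l < NR) ((\sum_(k < NT) a k * lambda (H k l) - (\sum_(k < NT) a k * R0 k l) ^+ 2) - e / M))).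
  rewrite [leRHS]sumrB lerB// sumr_const card_ord -[leLHS]mulr_natl mulrCA -[leRHS]mulr1 ler_wpM2l//; first exact: ltW.
  by rewrite ler_pdivrMr// mul1r lerDr.
apply: ler_sum => l _; under [X in _ <= X - _]eq_bigr do rewrite mulrBr.
rewrite sumrB -mulr_suml; have := sum_a_le1; have : 0 <= e / M by rewrite divr_ge0// ltW.
nra.
Unshelve. all: by end_near.
Qed.

End sign_input.

(** * The capacity *)

Section superadditive_sequences.
Variables (R : realType) (b : R^nat) (u : R).
Hypotheses (b0 : forall n, 0 <= b n) (bu : forall n, b n <= n%:R * u).
Hypothesis bD : forall n m, b n + b m <= b (n + m)%N.

Lemma superadditive_mul q n : q%:R * b n <= b (q * n)%N.
Proof.
elim: q => [|q IH]; first by rewrite mul0r mul0n.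
by rewrite -natr1 mulrDl mul1r mulSn addnC; apply: le_trans (bD _ _); rewrite lerD2r.
Qed.

Lemma superadditive_cvg : exists l : R, [/\ b n / n%:R @[n --> \oo] --> l, l <= u &
  forall n, (0 < n)%N -> b n <= n%:R * l].
Proof.
pose E := [set b n / n%:R | n in [set n : nat | (0 < n)%N]].
have Eu : ubound E u.
  by move=> _ [n /= n0 <-]; rewrite ler_pdivrMr ?ltr0n// mulrC.
have supE : has_sup E by split; [exists (b 1 / 1%:R), 1%N|exists u].
exists (sup E); split.
- apply/cvgrPdist_le => /= e e0.
  have [|_ [n /= n0 <-] hn] := @sup_adherent _ E (e / 2) _ supE; first exact: divr_gt0.
  set x := b n / n%:R in hn.
  near=> N.
  have Ne : n%:R * x / (e / 2) <= N%:R by near: N; exact: nbhs_infty_ger.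
  have N0 : (0 < N)%N by near: N; exact: nbhs_infty_gt.
  have Nr : 0 < N%:R :> R by rewrite ltr0n.
  have nr : 0 < n%:R :> R by rewrite ltr0n.
  have up : b N / N%:R <= sup E by apply: ub_le_sup; [exact: supE.2|exists N].
  have bx : b n = n%:R * x by rewrite /x mulrCA divff ?mulr1// gt_eqF.
  have x0 : 0 <= x by rewrite divr_ge0.
  have low : N%:R * x - n%:R * x <= b N.
    have dm := divn_eq N n; have rm := ltn_pmod N n0.
    apply: (@le_trans _ _ (b ((N %/ n) * n)%N)); last first.
      rewrite {2}dm; apply: le_trans (bD _ _); rewrite lerDl; exact: b0.
    apply: le_trans (superadditive_mul _ _); rewrite bx mulrA -mulrBl ler_wpM2r//.
    by rewrite lerBlDr -natrM -natrD ler_nat {1}dm leq_add2l ltnW.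
  have low' : x - e / 2 <= b N / N%:R.
    rewrite ler_pdivlMr// mulrBl (mulrC x); apply: le_trans low; rewrite lerB//.
    by move: Ne; rewrite ler_pdivrMr ?divr_gt0// mulrC (mulrC N%:R).
  by rewrite ger0_norm ?subr_ge0//; lra.
- by apply: ge_sup => //; exact: supE.1.
- move=> n n0; have : b n / n%:R <= sup E by apply: ub_le_sup; [exact: supE.2|exists n].
  by rewrite ler_pdivrMr ?ltr0n// mulrC.
Unshelve. all: by end_near.
Qed.

End superadditive_sequences.

Section capacity.
Context d (Omega : measurableType d) (R : realType) (P : probability Omega R).
Variables NT NR : nat.
Variable H : 'I_NT -> 'I_NR -> int -> {RV P >-> R[i]}.
Variable W : 'I_NR -> nat -> {RV P >-> R[i]}.
Hypothesis ch : rayleigh_fading_channel H W.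
Hypothesis phi_finite : forall k l, (phi (H k l) < +oo)%E.
Local Notation R0 k l := (autocorrelation0 (H k l)).
Variable beta : R.
Hypothesis beta1 : 1 <= beta.
Variable L : R.
Hypothesis gainL : forall a, A_ beta a -> quadratic_gain H a <= 2 * L.
Local Notation input N := (N.-tuple (NT.-tuple R[i])).

(** Bounds the remainder x^3/3 of ln(1 + x) after division by rho^3, every mean power being at most
    1. *)
Definition cubic_constant : R := \sum_(l < NR) (\sum_(k < NT) R0 k l) ^+ 3 / 3.

(** The bound of [information_upper] is a sum over time instants, and at each of them the mean
    powers lie in [A_ beta]. Hence the second-order part is at most rho^2 L per instant. *)
Lemma block_information_le (rho : R) N (mu : probability (input N) R) : 0 <= rho ->
  sum_power_constraints beta mu ->
  (block_information H W rho mu <= (N%:R * (rho ^+ 2 * L + rho ^+ 3 * cubic_constant))%:E)%E.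
Proof.
move=> rho0 power; rewrite (block_informationE ch).
apply: le_trans (information_upper ch phi_finite 0 rho0 power) _; rewrite lee_fin.
pose m n := mean_power mu n.
have mA n : A_ beta (m n) by exact/set_mem/(mean_power_A power).
have m1 n k : m n k <= 1 by exact: (mean_power_le1 beta1 power).
pose x (j : 'I_N * 'I_NR) := \sum_(k < NT) m j.1 k * R0 k j.2.
have x0 j : 0 <= x j.
  apply: sumr_ge0 => k _; rewrite mulr_ge0//; first by case: (mA j.1).
  exact: (autocorrelation0_ge0 ch).
have xr j : x j <= \sum_(k < NT) R0 k j.2.
  apply: ler_sum => k _; rewrite ler_piMl ?m1//; exact: (autocorrelation0_ge0 ch).
apply: (@le_trans _ _ (\sum_(j : 'I_N * 'I_NR) (2^-1 * rho ^+ 2 * (\sum_(k < NT) m j.1 k * lambda (H k j.2) - x j ^+ 2) +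
    rho ^+ 3 * ((\sum_(k < NT) R0 k j.2) ^+ 3 / 3)))).
  rewrite mulr_sumr -big_split/=; apply: ler_sum => j _.
  have s0 : 0 <= rho * x j by rewrite mulr_ge0.
  have := ln1p_le s0; rewrite -/(noise_scale H rho mu j) -/(m j.1).
  have : (rho * x j) ^+ 3 <= rho ^+ 3 * (\sum_(k < NT) R0 k j.2) ^+ 3.
    by rewrite exprMn ler_wpM2l ?exprn_ge0// lerXn2r ?nnegrE// (le_trans (x0 j)).
  have -> : noise_scale H rho mu j = rho * x j by [].
  rewrite !exprMn; lra.
rewrite [leLHS](eq_bigr (fun j => 2^-1 * rho ^+ 2 * (\sum_(k < NT) m (j.1, j.2).1 k * lambda (H k (j.1, j.2).2) -
    x (j.1, j.2) ^+ 2) + rho ^+ 3 * ((\sum_(k < NT) R0 k (j.1, j.2).2) ^+ 3 / 3))); last by case.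
rewrite -(pair_bigA _ (fun n l => 2^-1 * rho ^+ 2 * (\sum_(k < NT) m n k * lambda (H k l) -
    x (n, l) ^+ 2) + rho ^+ 3 * ((\sum_(k < NT) R0 k l) ^+ 3 / 3)))/=.
have -> : N%:R * (rho ^+ 2 * L + rho ^+ 3 * cubic_constant) =
    \sum_(n < N) (rho ^+ 2 * L + rho ^+ 3 * cubic_constant).
  by rewrite sumr_const card_ord -[RHS]mulr_natl.
apply: ler_sum => n _; rewrite big_split/= -!mulr_sumr lerD2r.
have := gainL (mA n); rewrite /quadratic_gain => h.
by have := ler_wpM2l (sqr_ge0 rho) h; rewrite /x/=; lra.
Qed.

Local Notation rates rho N := [set block_information H W rho mu | mu in @sum_power_constraints R NT beta N].

(** Keeps the supremum over admissible laws from being that of an empty set, which would be - oo. *)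
Lemma zero_input N : exists mu : probability (input N) R, sum_power_constraints beta mu.
Proof.
have aA : A_ beta (fun _ : 'I_NT => 0 : R).
  by split => //; rewrite big1// invr_ge0 (le_trans ler01).
have [mu power _] := discrete_information ch (sign_weight_ge0 beta1 aA (N := N))
  (sum_sign_weight (fun _ : 'I_NT => 0 : R) N) (@sign_block_peak R NT N) (sign_block_mean aA (N := N)).
by exists mu.
Qed.

(** The three facts needed for the limit. The last one bounds each finite block by the capacity,
    since a superadditive sequence never exceeds N times its limit rate. *)
Lemma capacity_fin (rho : R) : 0 <= rho -> exists l : R, [/\ capacity H W rho beta = l%:E,
  l <= rho ^+ 2 * L + rho ^+ 3 * cubic_constant &
  forall N (mu : probability (input N) R), (0 < N)%N -> sum_power_constraints beta mu ->
    (block_information H W rho mu <= (N%:R * l)%:E)%E].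
Proof.
move=> rho0; set u := rho ^+ 2 * L + rho ^+ 3 * cubic_constant.
pose s N := ereal_sup (rates rho N).
have sI N (mu : probability (input N) R) : sum_power_constraints beta mu ->
    (block_information H W rho mu <= s N)%E.
  by move=> power; apply: ereal_sup_ubound; exists mu.
have su N : (s N <= (N%:R * u)%:E)%E.
  by apply: ge_ereal_sup => _ [mu power <-]; exact: block_information_le.
have s0 N : (0 <= s N)%E.
  have [mu power] := zero_input N; apply: le_trans (sI _ _ power).
  rewrite (block_informationE ch); exact: (block_entropy_ge0 H W).
have sfin N : s N \is a fin_num by rewrite ge0_fin_numE// (le_lt_trans (su N)) ?ltry.
pose b N := fine (s N).
have bE N : s N = (b N)%:E by rewrite fineK.
have Ifin N (mu : probability (input N) R) : sum_power_constraints beta mu ->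
    exists2 r : R, block_information H W rho mu = r%:E & r <= b N.
  move=> power; have h := sI _ _ power; have h0 : (0 <= block_information H W rho mu)%E.
    rewrite (block_informationE ch); exact: (block_entropy_ge0 H W).
  exists (fine (block_information H W rho mu)).
    by rewrite fineK// ge0_fin_numE// (le_lt_trans h)// bE ltry.
  by rewrite -lee_fin -bE fineK// ge0_fin_numE// (le_lt_trans h)// bE ltry.
(* Suprema are added one at a time, each by a subtraction that is legitimate because both are
   finite. *)
have bD n m : b n + b m <= b (n + m)%N.
  have h1 (mu1 : probability (input n) R) : sum_power_constraints beta mu1 ->
      (block_information H W rho mu1 <= (b (n + m)%N - b m)%:E)%E.
    move=> power1; have [r1 e1 _] := Ifin _ _ power1; rewrite e1 lee_fin lerBrDr -lerBrDl.
    rewrite -lee_fin -bE; apply: ge_ereal_sup => _ [mu2 power2 <-].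
    have [r2 e2 _] := Ifin _ _ power2; rewrite e2 lee_fin lerBrDl -lee_fin EFinD -e1 -e2 -bE.
    apply: le_trans (information_superadditive ch rho0 power1 power2) _; apply: sI.
    exact: concat_power.
  by rewrite -lerBrDr -lee_fin -bE; apply: ge_ereal_sup => _ [mu1 power1 <-]; exact: h1.
have b0 n : 0 <= b n by rewrite fine_ge0.
have bu n : b n <= n%:R * u by rewrite -lee_fin -bE.
have [l [bl lu lb]] := superadditive_cvg b0 bu bD.
exists l; split => //; last first.
  move=> N mu N0 power; have [r -> rb] := Ifin _ _ power; rewrite lee_fin.
  exact: le_trans rb (lb _ N0).
rewrite /capacity; apply: cvg_lim => //.
rewrite (_ : (fun N => _) = (fun N => (b N / N%:R)%:E)).
  by apply: cvg_EFin => //; near=> N.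
by apply/funext => N; rewrite -/(s N) bE -EFinM mulrC.
Unshelve. all: by end_near.
Qed.

Hypothesis gain_max : exists2 a, A_ beta a & quadratic_gain H a = 2 * L.

(** The block length and the constant [C] depend on [e] only, and rho is made small afterwards. The
    order is allowed because the capacity dominates the rate of the chosen block. *)
Lemma capacity_limit : (capacity H W rho beta * ((rho ^+ 2)^-1)%:E)%E @[rho --> 0^'+] --> L%:E.
Proof.
have [a aA gaE] := gain_max.
pose g rho := fine (capacity H W rho beta) / rho ^+ 2.
suff gL : g rho @[rho --> 0^'+] --> L.
  have fin : \forall rho \near (0 : R)^'+, exists l, capacity H W rho beta = l%:E.
    near=> rho; have rho0 : 0 <= rho by near: rho; exact: nbhs_right_ge.
    by have [l [-> _ _]] := capacity_fin rho0; exists l.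
  apply: cvg_EFin; first by apply: filterS fin => rho [l ->].
  apply: cvg_trans gL; apply: near_eq_cvg; apply: filterS fin => rho [l lE].
  by rewrite /g /= lE.
apply/cvgrPdist_le => /= e e0.
have [N N0 [mu [C [power info]]]] := sign_input_information ch phi_finite beta1 aA e0.
have Nr : 0 < N%:R :> R by rewrite ltr0n.
have c0 : 0 <= cubic_constant.
  apply: sumr_ge0 => l _; rewrite divr_ge0// exprn_ge0//; apply: sumr_ge0 => k _.
  exact: (autocorrelation0_ge0 ch).
(* For rho below this value, C sqrt(rho) is at most e/2. *)
have q0 : 0 < (e / 2 / (1 + `|C|)) ^+ 2 by rewrite exprn_gt0// !divr_gt0// ltr_wpDr.
near=> rho.
have rho0 : 0 < rho by near: rho; exact: nbhs_right_gt.
have rho1 : rho <= 1 by near: rho; exact: nbhs_right_le.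
have rc : rho * (1 + cubic_constant) <= e.
  by rewrite -ler_pdivlMr ?ltr_wpDr//; near: rho; apply: nbhs_right_le; rewrite divr_gt0// ltr_wpDr.
have rs : Num.sqrt rho * (1 + `|C|) <= e / 2.
  rewrite -ler_pdivlMr ?ltr_wpDr//.
  rewrite -[leRHS]ger0_norm; last by rewrite !divr_ge0// ?addr_ge0// ltW.
  rewrite -sqrtr_sqr ler_wsqrtr//.
  by near: rho; apply: nbhs_right_le.
have r2 : 0 < rho ^+ 2 by rewrite exprn_gt0.
have [l [cl lu lI]] := capacity_fin (ltW rho0).
have h1 : rho ^+ 2 * (N%:R * (quadratic_gain H a - e) / 2 - C * Num.sqrt rho) <= N%:R * l.
  by rewrite -lee_fin; apply: le_trans (info rho _) (lI _ _ N0 power); rewrite ltW//= rho1.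
have N1 : 1 <= N%:R :> R by rewrite ler1n.
rewrite /g cl /= distrC ler_norml; apply/andP; split.
  rewrite lerBrDr ler_pdivlMr//; rewrite -(ler_pM2l Nr); apply: le_trans h1.
  rewrite gaE [leLHS]mulrA [leRHS]mulrC ler_wpM2r ?(ltW r2)//.
  have s0 := sqrtr_ge0 rho.
  have : C * Num.sqrt rho <= e / 2.
    apply: le_trans rs; rewrite mulrC ler_wpM2l//; have := ler_norm C; lra.
  nra.
rewrite lerBlDr ler_pdivrMr//; apply: le_trans lu _; rewrite exprSr.
have : rho ^+ 2 * (rho * cubic_constant) <= rho ^+ 2 * e.
  rewrite (ler_wpM2l (ltW r2))//; apply: le_trans rc; rewrite mulrDr mulr1 lerDr; exact: ltW.
lra.
Unshelve. all: by end_near.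
Qed.

End capacity.

(** * The spectral density *)

Section dominated.
Context d (T : measurableType d) (R : realType) (mu : {measure set T -> \bar R}).
Variables (D : set T) (mD : measurable D).

Lemma cvg_Rintegral_dominated (f_ : nat -> T -> R) (f g : T -> R) :
  (forall n, measurable_fun D (f_ n)) -> measurable_fun D f ->
  {ae mu, forall x, D x -> f_ n x @[n --> \oo] --> f x} ->
  mu.-integrable D (EFin \o g) -> (forall n x, D x -> `|f_ n x| <= g x) ->
  mu.-integrable D (EFin \o f) /\ \int[mu]_(x in D) f_ n x @[n --> \oo] --> \int[mu]_(x in D) f x.
Proof.
move=> mf_ mf cvf ig fg.
have [iF _ cvF] : [/\ mu.-integrable D (EFin \o f),
    [sequence (\int[mu]_(x in D) (`|(EFin \o f_ n) x - (EFin \o f) x|))%E]_n @ \oo --> 0%E &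
    [sequence (\int[mu]_(x in D) ((EFin \o f_ n) x))%E]_n @ \oo --> (\int[mu]_(x in D) ((EFin \o f) x))%E].
  apply: (@dominated_convergence _ _ _ mu D mD (fun n => EFin \o f_ n) (EFin \o f) (EFin \o g)) => //.
  - by move=> n; exact/measurable_EFinP.
  - exact/measurable_EFinP.
  - by apply: filterS cvf => x h Dx; apply: cvg_EFin; [near=> n|exact: h].
  - by apply: aeW => x n Dx; rewrite lee_fin fg.
split => //; have if_ n : mu.-integrable D (EFin \o f_ n).
  by apply: le_integrable_EFin ig => // x Dx; apply: le_trans (fg n x Dx) (ler_norm _).
have : (\int[mu]_(x in D) f_ n x)%:E @[n --> \oo] --> (\int[mu]_(x in D) f x)%:E.
  rewrite EFin_Rintegral//; apply: cvg_trans cvF; apply: near_eq_cvg; near=> n.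
  by rewrite EFin_Rintegral//; exact: if_.
by move/fine_cvgP => [].
Unshelve. all: by end_near.
Qed.

End dominated.

Section trigonometric_integrals.
Variable R : realType.
Local Notation mu := (@lebesgue_measure R).
Local Notation D := [set` `[- pi, (pi : R)]].
Local Notation L1 f := (mu.-integrable D (EFin \o f)).

Lemma sin_nat_pi n : sin (n%:R * pi) = 0 :> R.
Proof.
elim: n => [|n IH]; first by rewrite mul0r sin0.
by rewrite -natr1 mulrDl mul1r sinD IH sinpi mul0r mulr0 addr0.
Qed.

Lemma sin_int_pi (k : int) : sin (k%:~R * pi) = 0 :> R.
Proof. by case: k => n; rewrite ?NegzE ?mulrNz ?mulNr ?sinN sin_nat_pi ?oppr0. Qed.

Lemma pi_symmetric_lt : - pi < pi :> R.
Proof. by rewrite gtrN// pi_gt0. Qed.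

Lemma measure_circle : mu D = (2 * pi)%:E.
Proof.
rewrite lebesgue_measure_itv/= lte_fin pi_symmetric_lt; congr (_%:E); ring.
Qed.

Lemma integrable_circle (f : R -> R) (K : R) : measurable_fun D f ->
  (forall t, D t -> `|f t| <= K) -> L1 f.
Proof.
move=> mf fK; apply: (@le_integrable_EFin _ _ _ mu D (measurable_itv _) f (fun=> K)) => //.
  by move=> t Dt; apply: le_trans (fK t Dt) (ler_norm _).
apply/integrableP; split; first exact/measurable_EFinP/measurable_cst.
have e : (\int[mu]_(x in D) `|(EFin \o (fun=> K)) x| = (`|K| * (2 * pi))%:E)%E.
  by rewrite EFinM -measure_circle; exact: (integral_cst mu (measurable_itv _) `|K|%:E).
by rewrite e ltry.
Qed.

Lemma Rintegral_FTC (f F : R -> R) : continuous f -> (forall x, is_derive x (1 : R) F (f x)) ->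
  \int[mu]_(t in D) f t = F pi - F (- pi).
Proof.
move=> cf dF; rewrite /Rintegral (continuous_FTC2 (F := F)) ?EFinB//.
- exact: pi_symmetric_lt.
- exact: continuous_subspaceT.
- split.
  + by move=> x _; exact: ex_derive.
  + apply: cvg_at_right_filter; apply/differentiable_continuous.
    by apply/derivable1_diffP; exact: ex_derive.
  + apply: cvg_at_left_filter; apply/differentiable_continuous.
    by apply/derivable1_diffP; exact: ex_derive.
- by move=> x _; rewrite derive1E; exact: derive_val.
Qed.

Lemma Rintegral_cos (k : int) :
  \int[mu]_(t in D) cos (k%:~R * t) = if k == 0 then 2 * pi else 0.
Proof.
case: eqP => [->|/eqP k0].
  under eq_Rintegral do rewrite mul0r cos0.
  by rewrite Rintegral_cst//= measure_circle/= mul1r.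
have kr : (k%:~R : R) != 0 by rewrite intr_eq0.
have cc : continuous (fun t : R => cos (k%:~R * t)).
  move=> x; apply: continuous_comp; last exact: continuous_cos.
  by apply: continuousM; [exact: cst_continuous|exact: cvg_id].
have dF x : is_derive x (1 : R) (fun t => k%:~R^-1 * sin (k%:~R * t)) (cos (k%:~R * x)).
  by apply: is_derive_eq; rewrite /GRing.scale/= ; field.
by rewrite (Rintegral_FTC cc dF) mulrN sinN sin_int_pi oppr0 mulr0 subrr.
Qed.

Lemma Rintegral_sin (k : int) : \int[mu]_(t in D) sin (k%:~R * t) = 0.
Proof.
have [->|k0] := eqVneq k 0.
  under eq_Rintegral do rewrite mul0r sin0.
  by rewrite Rintegral_cst//= mul0r.
have kr : (k%:~R : R) != 0 by rewrite intr_eq0.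
have cs : continuous (fun t : R => sin (k%:~R * t)).
  move=> x; apply: continuous_comp; last exact: continuous_sin.
  by apply: continuousM; [exact: cst_continuous|exact: cvg_id].
have dF x : is_derive x (1 : R) (fun t => - (k%:~R^-1 * cos (k%:~R * t))) (sin (k%:~R * x)).
  by apply: is_derive_eq; rewrite /GRing.scale/= ; field.
by rewrite (Rintegral_FTC cs dF) mulrN cosN subrr.
Qed.

Definition fourier_basis (i : nat * bool) (t : R) : R :=
  if i.2 then sin (i.1%:R * t) else cos (i.1%:R * t).

(** The mean square of a basis function over the circle. It is 0 for the index of sin(0 t), which is
    the zero function. *)
Definition basis_norm (i : nat * bool) : R :=
  if i.1 == 0%N then (if i.2 then 0 else 1) else 2^-1.

Lemma fourier_basis_le1 i t : `|fourier_basis i t| <= 1.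
Proof.
rewrite /fourier_basis; case: ifP => _; rewrite ler_norml.
  by rewrite sin_geN1 sin_le1.
by rewrite cos_geN1 cos_le1.
Qed.

Lemma continuous_fourier_basis i : continuous (fourier_basis i).
Proof.
rewrite /fourier_basis; case: (i.2) => x; apply: continuous_comp.
- by apply: continuousM; [exact: cst_continuous|exact: cvg_id].
- exact: continuous_sin.
- by apply: continuousM; [exact: cst_continuous|exact: cvg_id].
- exact: continuous_cos.
Qed.

Lemma measurable_fourier_basis E i : measurable_fun E (fourier_basis i).
Proof. by apply: measurable_funTS; apply: continuous_measurable_fun; exact: continuous_fourier_basis. Qed.

Lemma fourier_basis_orthogonal (i j : nat * bool) :
  \int[mu]_(t in D) (fourier_basis i t * fourier_basis j t) =
  if i == j then 2 * pi * basis_norm i else 0.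
Proof.
case: i j => [m b] [n c]; rewrite /fourier_basis /basis_norm /=.
have ang (t : R) : (m%:R * t - n%:R * t = (m%:Z - n%:Z)%:~R * t) * (m%:R * t + n%:R * t = (m%:Z + n%:Z)%:~R * t).
  by rewrite intrB intrD -!pmulrn mulrBl mulrDl.
have ic (k : int) : L1 (fun t => cos (k%:~R * t)).
  apply: (@integrable_circle _ 1) => [|t _]; last by rewrite ler_norml cos_geN1 cos_le1.
  apply: measurable_funTS; apply: continuous_measurable_fun => x; apply: continuous_comp; last exact: continuous_cos.
  by apply: continuousM; [exact: cst_continuous|exact: cvg_id].
have is_ (k : int) : L1 (fun t => sin (k%:~R * t)).
  apply: (@integrable_circle _ 1) => [|t _]; last by rewrite ler_norml sin_geN1 sin_le1.
  apply: measurable_funTS; apply: continuous_measurable_fun => x; apply: continuous_comp; last exact: continuous_sin.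
  by apply: continuousM; [exact: cst_continuous|exact: cvg_id].
have mix (p q : nat) : \int[mu]_(t in D) (sin (p%:R * t) * cos (q%:R * t)) = 0.
  have ang' (t : R) : (p%:R * t - q%:R * t = (p%:Z - q%:Z)%:~R * t) * (p%:R * t + q%:R * t = (p%:Z + q%:Z)%:~R * t).
    by rewrite intrB intrD -!pmulrn mulrBl mulrDl.
  transitivity (\int[mu]_(t in D) (2^-1 * (sin ((p%:Z - q%:Z)%:~R * t) + sin ((p%:Z + q%:Z)%:~R * t)))).
    by apply: eq_Rintegral => t _; rewrite -!ang' sinB sinD; field.
  rewrite RintegralZl//; last exact: integrable_EFinD.
  by rewrite RintegralD// !Rintegral_sin addr0 mulr0.
have eqz : ((m%:Z - n%:Z) == 0) = (m == n) by rewrite subr_eq0.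
have eqz' : ((m%:Z + n%:Z) == 0) = (m == 0%N) && (n == 0%N) by rewrite -PoszD eqz_nat addn_eq0.
case: b c => [] []; rewrite xpair_eqE/= ?andbT ?andbF.
- transitivity (\int[mu]_(t in D) (2^-1 * (cos ((m%:Z - n%:Z)%:~R * t) - cos ((m%:Z + n%:Z)%:~R * t)))).
    by apply: eq_Rintegral => t _; rewrite -!ang cosB cosD; field.
  rewrite RintegralZl//; last exact: integrable_EFinB.
  rewrite RintegralB// !Rintegral_cos eqz eqz'; case: (eqVneq m n) => [<-|mn].
    by rewrite andbb; case: eqP => _; field.
  by case: eqP => [m0|_]; case: eqP => [n0|_]; rewrite ?subrr ?mulr0//; move: mn; rewrite m0 n0 eqxx.
- exact: mix.
- by under eq_Rintegral do rewrite mulrC; exact: mix.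
- transitivity (\int[mu]_(t in D) (2^-1 * (cos ((m%:Z - n%:Z)%:~R * t) + cos ((m%:Z + n%:Z)%:~R * t)))).
    by apply: eq_Rintegral => t _; rewrite -!ang cosB cosD; field.
  rewrite RintegralZl//; last exact: integrable_EFinD.
  rewrite RintegralD// !Rintegral_cos eqz eqz'; case: (eqVneq m n) => [<-|mn].
    by rewrite andbb; case: eqP => _; field.
  by case: eqP => [m0|_]; case: eqP => [n0|_]; rewrite ?addr0 ?mulr0//; move: mn; rewrite m0 n0 eqxx.
Qed.

Section polynomials.
Variables (N : nat).
Local Notation J := ('I_N * bool)%type.
Implicit Types A : J -> R.

Local Notation e i := (fourier_basis (nat_of_ord i.1, i.2)).

Definition fourier_poly A (t : R) : R := \sum_(i : J) A i * e i t.

Lemma fourier_poly_le A t : `|fourier_poly A t| <= \sum_i `|A i|.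
Proof.
apply: le_trans (ler_norm_sum _ _ _) _; apply: ler_sum => i _.
by rewrite normrM ler_piMr// fourier_basis_le1.
Qed.

Lemma measurable_fourier_poly E A : measurable_fun E (fourier_poly A).
Proof.
by apply: measurable_sum => i; apply: measurable_funM => //; exact: measurable_fourier_basis.
Qed.

Lemma fourier_poly_norm A : \int[mu]_(t in D) fourier_poly A t ^+ 2 =
  2 * pi * \sum_(i : J) A i ^+ 2 * basis_norm (nat_of_ord i.1, i.2).
Proof.
transitivity (\int[mu]_(t in D) \sum_(i : J) \sum_(j : J) A i * A j * (e i t * e j t)).
  apply: eq_Rintegral => t _; rewrite /fourier_poly expr2 big_distrlr/=.
  by apply: eq_bigr => i _; apply: eq_bigr => j _; ring.
have iee (i j : J) : L1 (fun t => A i * A j * (e i t * e j t)).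
  apply: integrable_EFinZl => //; apply: (@integrable_circle _ 1).
    by apply: measurable_funM; exact: measurable_fourier_basis.
  by move=> t _; rewrite normrM mulr_ile1// fourier_basis_le1.
rewrite Rintegral_sum//; last by move=> i _; apply: integrable_EFin_sum => // j _; exact: iee.
rewrite mulr_sumr; apply: eq_bigr => i _.
transitivity (\sum_(j : J) \int[mu]_(t in D) (A i * A j * (e i t * e j t))).
  by apply: Rintegral_sum => // j _; exact: iee.
have iee' (j : J) : L1 (fun t => e i t * e j t).
  apply: (@integrable_circle _ 1).
    by apply: measurable_funM; exact: measurable_fourier_basis.
  by move=> t _; rewrite normrM mulr_ile1// fourier_basis_le1.
rewrite (bigD1 i)//= big1 ?addr0 => [|j ji].
  by rewrite RintegralZl// fourier_basis_orthogonal eqxx; ring.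
rewrite RintegralZl// fourier_basis_orthogonal; case: eqP => [[h1 h2]|_]; last by rewrite mulr0.
by move: ji; rewrite (_ : j = i) ?eqxx//; case: (i) (j) h1 h2 => [a b] [a' b'] /= h1 ->; congr (_, _); apply/esym/val_inj.
Qed.

Variables (S : R -> R) (iS : L1 S).

Definition fourier_coef (i : nat * bool) : R := \int[mu]_(t in D) (S t * fourier_basis i t).

Lemma integrable_mul_bounded (f : R -> R) (K : R) : measurable_fun D f ->
  (forall t, D t -> `|f t| <= K) -> L1 (fun t => S t * f t).
Proof.
move=> mf fK; have mS : measurable_fun D S by apply/measurable_EFinP; exact: measurable_int iS.
apply: (@le_integrable_EFin _ _ _ mu D (measurable_itv _) _ (fun t => K * S t)).
- exact: measurable_funM.
- move=> t Dt; rewrite !normrM mulrC ler_wpM2r//; apply: le_trans (fK t Dt) (ler_norm _).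
- exact: integrable_EFinZl.
Qed.

Lemma Rintegral_mul_fourier_poly A :
  \int[mu]_(t in D) (S t * fourier_poly A t) = \sum_(i : J) A i * fourier_coef (nat_of_ord i.1, i.2).
Proof.
have ie (i : J) : L1 (fun t => S t * e i t).
  apply: (@integrable_mul_bounded _ 1); first exact: measurable_fourier_basis.
  by move=> t _; exact: fourier_basis_le1.
transitivity (\int[mu]_(t in D) \sum_(i : J) A i * (S t * e i t)).
  by apply: eq_Rintegral => t _; rewrite /fourier_poly mulr_sumr; apply: eq_bigr => i _; ring.
rewrite Rintegral_sum//; last by move=> i _; exact: integrable_EFinZl.
by apply: eq_bigr => i _; rewrite RintegralZl//; exact: ie.
Qed.

End polynomials.

End trigonometric_integrals.

(** * Approximation by trigonometric polynomials *)

Section cosine_kernel.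
Variable R : realType.
Local Notation mu := (@lebesgue_measure R).
Local Notation D := [set` `[- pi, (pi : R)]].
Local Notation L1 f := (mu.-integrable D (EFin \o f)).

(** The function cos(x/2)^(2n), de la Vallee Poussin's kernel without its normalisation:
    nonnegative, a cosine polynomial, and concentrated at the multiples of 2 pi. *)
Definition cosine_kernel n (x : R) : R := ((1 + cos x) / 2) ^+ n.

Lemma cosine_kernel_bounds n x : 0 <= cosine_kernel n x <= 1.
Proof.
have h : 0 <= (1 + cos x) / 2 <= 1 by have := cos_geN1 x; have := cos_le1 x; lra.
by case/andP: h => h0 h1; rewrite exprn_ge0// exprn_ile1.
Qed.

Lemma continuous_cosine_kernel n (t : R) : continuous (fun s : R => cosine_kernel n (t - s)).
Proof.
have cc : continuous (fun s : R => (1 + cos (t - s)) / 2).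
  move=> s; apply: cvgM; last exact: cvg_cst.
  apply: cvgD; first exact: cvg_cst.
  apply: continuous_comp; last exact: continuous_cos.
  by apply: cvgB; [exact: cvg_cst|exact: cvg_id].
move=> s; apply: (continuous_comp (f := fun s : R => (1 + cos (t - s)) / 2) (g := fun x : R => x ^+ n)).
  exact: cc.
exact: exprn_continuous.
Qed.

Lemma measurable_cosine_kernel E n (t : R) : measurable_fun E (fun s : R => cosine_kernel n (t - s)).
Proof. by apply: measurable_funTS; apply: continuous_measurable_fun; exact: continuous_cosine_kernel. Qed.

(** Multiplication by (1 + cos)/2 sends the frequency m to m, m + 1 and |m - 1| with weights 1/2,
    1/4 and 1/4; the case m = 0 explains the branch with value 1. *)
Lemma cosine_kernel_sum n : exists s : seq (R * nat), forall x,
  cosine_kernel n x = \sum_(p <- s) p.1 * cos (p.2%:R * x).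
Proof.
elim: n => [|n [s IH]].
  by exists [:: (1, 0%N)] => x; rewrite big_seq1/= mul0r cos0 mulr1 /cosine_kernel expr0.
exists ([seq (p.1 / 2, p.2) | p <- s] ++ [seq (p.1 / 4, p.2.+1) | p <- s] ++
  [seq (p.1 / 4, if p.2 is m.+1 then m else 1%N) | p <- s]) => x.
rewrite /cosine_kernel exprS -/(cosine_kernel n x) IH !big_cat/= !big_map/= -!big_split/= mulr_sumr.
apply: eq_bigr => -[a m] _ /=.
have -> : cos (m.+1%:R * x) = cos (m%:R * x) * cos x - sin (m%:R * x) * sin x.
  by rewrite -natr1 mulrDl mul1r cosD.
have -> : cos ((if m is m'.+1 then m' else 1%N)%:R * x) = cos (m%:R * x) * cos x + sin (m%:R * x) * sin x.
  case: m => [|m]; first by rewrite !mul0r cos0 sin0 !mul1r mul0r addr0.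
  have {1}-> : m%:R * x = m.+1%:R * x - x by rewrite -natr1; ring.
  by rewrite cosB.
by field.
Qed.

(* The kernel is a function of t - s, so smoothing by it produces a trigonometric polynomial. *)
Lemma cosine_kernel_convolution n : exists (N : nat) (k : nat -> R), forall c : R -> R,
  L1 c -> forall t, \int[mu]_(s in D) (cosine_kernel n (t - s) * c s) =
    fourier_poly (fun i : 'I_N * bool => k i.1 * fourier_coef c (nat_of_ord i.1, i.2)) t.
Proof.
have [s hs] := cosine_kernel_sum n.
pose N := (\max_(p <- s) p.2).+1.
exists N, (fun m => \sum_(p <- s | p.2 == m) p.1) => c ic t.
have L1b i : L1 (fun s => c s * fourier_basis i s).
  apply: (integrable_mul_bounded ic (K := 1)); first exact: measurable_fourier_basis.
  by move=> x _; exact: fourier_basis_le1.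
have bE (m : nat) (x : R) : cos (m%:R * (t - x)) =
    \sum_(b : bool) fourier_basis (m, b) t * fourier_basis (m, b) x.
  by rewrite big_bool/= /fourier_basis/= mulrBr cosB addrC.
transitivity (\int[mu]_(x in D) \sum_(p <- s) \sum_(b : bool)
    (p.1 * fourier_basis (p.2, b) t) * (c x * fourier_basis (p.2, b) x)).
  apply: eq_Rintegral => x _; rewrite hs mulr_suml; apply: eq_bigr => p _.
  by rewrite bE mulr_sumr mulr_suml; apply: eq_bigr => b _; ring.
have ib (p : R * nat) (b : bool) : L1 (fun x => (p.1 * fourier_basis (p.2, b) t) * (c x * fourier_basis (p.2, b) x)).
  by apply: integrable_EFinZl => //; exact: L1b.
rewrite Rintegral_sum//; last by move=> p _; apply: integrable_EFin_sum => // b _; exact: ib.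
transitivity (\sum_(p <- s) \sum_(b : bool) p.1 * fourier_basis (p.2, b) t * fourier_coef c (p.2, b)).
  apply: eq_bigr => p _.
  transitivity (\sum_(b : bool) \int[mu]_(x in D) ((p.1 * fourier_basis (p.2, b) t) * (c x * fourier_basis (p.2, b) x))).
    by apply: Rintegral_sum => // b _; exact: ib.
  by apply: eq_bigr => b _; rewrite RintegralZl//; exact: L1b.
rewrite /fourier_poly.
transitivity (\sum_(i : 'I_N * bool) \sum_(p <- s) (if p.2 == i.1 :> nat then
    p.1 * fourier_basis (nat_of_ord i.1, i.2) t * fourier_coef c (nat_of_ord i.1, i.2) else 0)); last first.
  apply: eq_bigr => i _; rewrite -big_mkcond/= [in RHS]mulr_suml mulr_suml.
  by apply: eq_bigr => p _; ring.
rewrite [RHS]exchange_big/= [LHS]big_seq [RHS]big_seq; apply: eq_bigr => p ps.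
have pN : (p.2 < N)%N by rewrite ltnS; exact: (@leq_bigmax_seq _ s xpredT (fun p => p.2) p ps isT).
rewrite [RHS](eq_bigr (fun i : 'I_N * bool => if p.2 == (i.1, i.2).1 :> nat then
    p.1 * fourier_basis (nat_of_ord (i.1, i.2).1, (i.1, i.2).2) t *
    fourier_coef c (nat_of_ord (i.1, i.2).1, (i.1, i.2).2) else 0)); last by case.
rewrite -(pair_bigA _ (fun (m : 'I_N) b => if p.2 == m :> nat then
    p.1 * fourier_basis (nat_of_ord m, b) t * fourier_coef c (nat_of_ord m, b) else 0))/=.
rewrite (bigD1 (Ordinal pN))//= [X in _ = _ + X]big1 ?addr0 => [|m mp].
  by apply: eq_bigr => b _; rewrite eqxx.
rewrite big1// => b _; case: eqP => // pm; move: mp; rewrite (_ : m = Ordinal pN) ?eqxx//.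
by apply: val_inj; rewrite /= pm.
Qed.

Lemma L1_cst (c : R) : L1 (fun=> c).
Proof. by apply: (@integrable_circle _ _ `|c|) => // ; exact: measurable_cst. Qed.

Lemma cos_norm (x : R) : cos `|x| = cos x.
Proof. by have [x0|x0] := leP 0 x; [rewrite ger0_norm|rewrite ltr0_norm// cosN]. Qed.

Lemma cos_nonincreasing (x y : R) : 0 <= x -> x <= y -> y <= pi -> cos y <= cos x.
Proof.
move=> x0; rewrite le_eqVlt => /predU1P[->//|xy] y1; apply/ltW.
by rewrite ltr_cos ?in_itv/= ?x0 ?y1 ?(le_trans x0 (ltW xy)) ?(le_trans (ltW xy) y1).
Qed.

Definition kernel_mass n : R := \int[mu]_(s in D) cosine_kernel n (- s).

(** The kernel convolved with the constant 1 is a trigonometric polynomial in which only the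
    frequency 0 survives, so it is constant in [t]. This replaces a periodic change of variables. *)
Lemma kernel_massE n t : \int[mu]_(s in D) cosine_kernel n (t - s) = kernel_mass n.
Proof.
have [N [k h]] := cosine_kernel_convolution n.
have e t' : \int[mu]_(s in D) cosine_kernel n (t' - s) =
    fourier_poly (fun i : 'I_N * bool => k i.1 * fourier_coef (fun=> 1) (nat_of_ord i.1, i.2)) t'.
  by rewrite -h; [apply: eq_Rintegral => s _; rewrite mulr1|exact: L1_cst].
have -> : kernel_mass n = \int[mu]_(s in D) cosine_kernel n (0 - s).
  by apply: eq_Rintegral => s _; rewrite sub0r.
rewrite !e; apply: eq_bigr => -[m b] _ /=.
have cE : fourier_coef (fun _ : R => 1) (nat_of_ord m, b) = if (nat_of_ord m == 0%N) && ~~ b then 2 * pi else 0 :> R.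
  have h0 : \int[mu]_(s in D) (fourier_basis (0%N, false) s * fourier_basis (nat_of_ord m, b) s) =
      if (nat_of_ord m == 0%N) && (false == b) then 2 * pi else 0.
    by rewrite fourier_basis_orthogonal /basis_norm/= mulr1 xpair_eqE eq_sym.
  have -> : (nat_of_ord m == 0%N) && ~~ b = (nat_of_ord m == 0%N) && (false == b) by case: b {h0}.
  rewrite -h0; apply: eq_Rintegral => s _.
  by rewrite [fourier_basis (0%N, false) s]/fourier_basis/= mul0r cos0.
rewrite cE; case: eqP => [->|_]; last by rewrite mulr0 !mul0r.
by case: b {cE} => /=; rewrite ?mulr0 ?mul0r// /fourier_basis/= !mul0r.
Qed.

Lemma L1_cosine_kernel n t : L1 (fun s : R => cosine_kernel n (t - s)).
Proof.
apply: (@integrable_circle _ _ 1); first exact: measurable_cosine_kernel.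
by move=> s _; have /andP[h0 h1] := cosine_kernel_bounds n (t - s); rewrite ger0_norm.
Qed.

(** Only the arc [-r, r] is counted, on which the kernel is at least its value at r. *)
Lemma kernel_mass_ge n (r : R) : 0 < r < pi / 2 ->
  2 * r * ((1 + cos r) / 2) ^+ n <= kernel_mass n.
Proof.
move=> /andP[r0 r1]; have p0 := pi_gt0 R.
pose E0 : set R := [set` `[- r, r]].
have mE0 : measurable E0 by exact: measurable_itv.
have E : E0 `<=` D.
  by move=> s; rewrite /E0/= !in_itv/= => /andP[h1 h2]; apply/andP; split; lra.
rewrite -lee_fin EFin_Rintegral//; last first.
  by have := L1_cosine_kernel n 0; apply: eq_integrable => // s _ /=; rewrite sub0r.
have mk : measurable_fun D (fun s => (cosine_kernel n (- s))%:E).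
  apply/measurable_EFinP; rewrite (_ : (fun s => _) = fun s => cosine_kernel n (0 - s)).
    exact: measurable_cosine_kernel.
  by apply/funext => s; rewrite sub0r.
have h1 : (\int[mu]_(s in E0) (cosine_kernel n (- s))%:E <=
    \int[mu]_(s in D) (cosine_kernel n (- s))%:E)%E.
  apply: ge0_subset_integral => //.
  by move=> s _; rewrite lee_fin; case/andP: (cosine_kernel_bounds n (- s)).
apply: le_trans h1.
apply: (@le_trans _ _ (\int[mu]_(s in E0) (((1 + cos r) / 2) ^+ n)%:E)%E).
  have -> : (\int[mu]_(s in E0) (((1 + cos r) / 2) ^+ n)%:E = (((1 + cos r) / 2) ^+ n)%:E * mu E0)%E.
    exact: integral_cst.
  have -> : mu E0 = (2 * r)%:E.
    by rewrite /E0 lebesgue_measure_itv/= lte_fin gtrN//; congr (_%:E); ring.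
  by rewrite -EFinM lee_fin mulrC.
apply: ge0_le_integral => //.
- by apply: measurable_funS mk.
- move=> s; rewrite /E0; rewrite /= in_itv/= => /andP[s1 s2]; rewrite lee_fin /cosine_kernel lerXn2r ?nnegrE//.
  + rewrite ler_wpM2r// lerD2l cosN -(cos_norm s) cos_nonincreasing//; last by lra.
    by rewrite ler_norml s1 s2.
Qed.

Lemma kernel_mass_gt0 n : 0 < kernel_mass n.
Proof.
have p0 := pi_gt0 R.
have r : 0 < (pi : R) / 4 < pi / 2 by apply/andP; split; lra.
apply: lt_le_trans (kernel_mass_ge n r); rewrite mulr_gt0//; first by lra.
rewrite exprn_gt0// divr_gt0//; have : 0 < cos (pi / 4 : R) by apply: cos_gt0_pihalf; lra.
lra.
Qed.

Lemma cosine_kernel_away n (x r : R) : 0 < r < pi -> r <= `|x| <= 2 * pi - r ->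
  cosine_kernel n x <= ((1 + cos r) / 2) ^+ n.
Proof.
move=> /andP[r0 r1] /andP[x1 x2]; have p0 := pi_gt0 R.
rewrite /cosine_kernel lerXn2r ?nnegrE//.
- rewrite ler_wpM2r// lerD2l -cos_norm; have [h|h] := leP `|x| pi.
    by apply: cos_nonincreasing; lra.
  have -> : cos `|x| = cos (2 * pi - `|x|).
    by rewrite cosB mulr_natl cos2pi sin2pi mul1r mul0r addr0.
  by apply: cos_nonincreasing; lra.
Qed.

Section smoothing.
Variables (c : R -> R) (M : R).
Hypotheses (cc : continuous c) (cM : forall t, `|c t| <= M).

Let M0 : 0 <= M. Proof. exact: le_trans (normr_ge0 (c 0)) (cM 0). Qed.

Let mc E : measurable_fun E c.
Proof. by apply: measurable_funTS; exact: continuous_measurable_fun. Qed.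

Definition smoothing n t : R := (\int[mu]_(s in D) (cosine_kernel n (t - s) * c s)) / kernel_mass n.

Let L1kc n t : L1 (fun s : R => cosine_kernel n (t - s) * c s).
Proof.
apply: (@integrable_circle _ _ M); first by apply: measurable_funM => //; exact: measurable_cosine_kernel.
move=> s _; have /andP[h0 h1] := cosine_kernel_bounds n (t - s).
by rewrite normrM (ger0_norm h0) -[leRHS]mul1r ler_pM.
Qed.

Lemma smoothing_poly n : exists (N : nat) (A : 'I_N * bool -> R), smoothing n = fourier_poly A.
Proof.
have [N [k h]] := cosine_kernel_convolution n; exists N.
exists (fun i : 'I_N * bool => k i.1 * fourier_coef c (nat_of_ord i.1, i.2) / kernel_mass n).
apply/funext => t; rewrite /smoothing h; last by apply: (@integrable_circle _ _ M) => // x _.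
by rewrite /fourier_poly mulr_suml; apply: eq_bigr => i _; rewrite mulrAC.
Qed.

Lemma smoothing_le n t : `|smoothing n t| <= M.
Proof.
have Z0 := kernel_mass_gt0 n.
rewrite /smoothing normrM normfV (gtr0_norm Z0) ler_pdivrMr//.
have h1 : `|\int[mu]_(s in D) (cosine_kernel n (t - s) * c s)| <=
    \int[mu]_(s in D) `|cosine_kernel n (t - s) * c s|.
  by apply: le_normr_Rintegral => //; exact: L1kc.
apply: le_trans h1 _.
rewrite -(kernel_massE n t) -RintegralZl//; last exact: L1_cosine_kernel.
apply: le_Rintegral => //.
- by have := integrable_abse (L1kc n t).
- by apply: integrable_EFinZl => //; exact: L1_cosine_kernel.
move=> s _; have /andP[h0 h1] := cosine_kernel_bounds n (t - s).
by rewrite normrM (ger0_norm h0) mulrC ler_wpM2r.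
Qed.

(** Beyond distance r from t the kernel is at most q^n, while its mass is at least r q'^n, seen on
    distances up to r/2; q < q' gives geometric decay. The end points are excluded because [c] need
    not be periodic. *)
Lemma smoothing_cvg (t : R) : - pi < t < pi -> smoothing n t @[n --> \oo] --> c t.
Proof.
move=> /andP[t1 t2]; have p0 := pi_gt0 R; apply/cvgrPdist_le => /= e e0.
have e20 : 0 < e / 2 by rewrite divr_gt0.
have ct : c x @[x --> t] --> c t by exact: cc.
move/cvgrPdist_le: ct => /(_ _ e20) /nbhs_ballP [r' /= r'0 hr'].
(* The three terms ask for closeness in the continuity of [c], for distance from the opposite end of
   the circle, and for r/2 < pi/2. *)
pose r := Num.min (r' / 2) (Num.min ((pi - `|t|) / 2) (pi / 4)).
have ta : `|t| < pi by rewrite ltr_norml t1 t2.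
have r0 : 0 < r by rewrite /r !lt_min; apply/and3P; split; lra.
have rr : r <= r' / 2 by rewrite /r ge_min lexx.
have rt : r <= (pi - `|t|) / 2 by rewrite /r !ge_min lexx orbT.
have rp : r <= pi / 4 by rewrite /r !ge_min lexx !orbT.
pose q := (1 + cos r) / 2; pose q' := (1 + cos (r / 2)) / 2.
have qq : q < q' by rewrite /q /q' ltr_pM2r// ltrD2l ltr_cos ?in_itv/=; lra.
have q0 : 0 <= q by rewrite /q divr_ge0//; have := cos_geN1 r; lra.
have q'0 : 0 < q' by exact: le_lt_trans qq.
have qqlt : `|q / q'| < 1 by rewrite ger0_norm ?divr_ge0 ?(ltW q'0)// ltr_pdivrMr// mul1r.
pose K := 2 * M * (2 * pi) / r.
have K0 : 0 <= K by rewrite /K divr_ge0// ?(ltW r0)// !mulr_ge0// ltW.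
near=> n.
have small : K * (q / q') ^+ n <= e / 2.
  near: n; have : (fun n => K * (q / q') ^+ n) @ \oo --> K * 0.
    by apply: cvgM; [exact: cvg_cst|exact: cvg_expr].
  rewrite mulr0 => /cvgrPdist_le /(_ (e / 2)); rewrite divr_gt0// => /(_ isT).
  by apply: filterS => n; rewrite sub0r normrN; exact: le_trans (ler_norm _).
have Z0 := kernel_mass_gt0 n.
have Zr : r * q' ^+ n <= kernel_mass n.
  have h : 0 < r / 2 < pi / 2 by apply/andP; split; lra.
  by apply: le_trans (kernel_mass_ge n h); rewrite [2 * _]mulrC divfK.
have iK := L1_cosine_kernel n t.
rewrite distrC -[c t](mulfK (lt0r_neq0 Z0)) /smoothing -mulrBl normrM normfV (gtr0_norm Z0) ler_pdivrMr//.
rewrite -(kernel_massE n t) -RintegralZl// -RintegralB//; last exact: integrable_EFinZl.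
apply: (@le_trans _ _ (\int[mu]_(s in D) (e / 2 * cosine_kernel n (t - s) + 2 * M * q ^+ n))).
  apply: le_trans (le_normr_Rintegral _ _) _ => //.
    by apply: integrable_EFinB => //; exact: integrable_EFinZl.
  apply: le_Rintegral => //.
  - have i1 : L1 (fun s => cosine_kernel n (t - s) * c s - c t * cosine_kernel n (t - s)).
      by apply: integrable_EFinB => //; exact: integrable_EFinZl.
    by have := integrable_abse i1.
  - by apply: integrable_EFinD => //; [exact: integrable_EFinZl|exact: L1_cst].
  move=> s; rewrite /= in_itv/= => /andP[s1 s2].
  have /andP[k0 k1] := cosine_kernel_bounds n (t - s).
  rewrite (mulrC (c t)) -mulrBr normrM (ger0_norm k0).
  have cd : `|c s - c t| <= 2 * M by apply: le_trans (ler_normB _ _) _; have := cM s; have := cM t; lra.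
  have qn : 0 <= 2 * M * q ^+ n by rewrite !mulr_ge0// exprn_ge0.
  have [near|far] := ltP `|t - s| r.
    rewrite -[leLHS]addr0 lerD// mulrC ler_wpM2r// distrC; apply: hr'.
    by rewrite /ball/=; lra.
  rewrite -[leLHS]add0r lerD//; first by rewrite mulr_ge0// ltW// divr_gt0.
  rewrite mulrC ler_pM//; apply: cosine_kernel_away; first by apply/andP; split; lra.
  rewrite far/=; apply: le_trans (ler_normB _ _) _.
  have : `|s| <= pi by rewrite ler_norml s1 s2.
  lra.
rewrite RintegralD//; [|exact: integrable_EFinZl|exact: L1_cst].
rewrite RintegralZl// kernel_massE Rintegral_cst//= measure_circle/=.
have -> : e * kernel_mass n = e / 2 * kernel_mass n + e / 2 * kernel_mass n by field.
rewrite lerD2l; apply: (@le_trans _ _ (e / 2 * (r * q' ^+ n))); last by rewrite ler_wpM2l// divr_ge0// ltW.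
apply: (@le_trans _ _ (K * (q / q') ^+ n * (r * q' ^+ n))); last first.
  by rewrite ler_wpM2r// mulr_ge0 ?exprn_ge0 ?(ltW r0) ?(ltW q'0).
have e1 (x y : R) : y != 0 -> 2 * M * x * (2 * pi) = K * (x / y) * (r * y).
  by move=> y0; rewrite /K; field; rewrite y0 gt_eqF.
by rewrite [(q / q') ^+ n]expr_div_n -e1// expf_neq0// gt_eqF.
Unshelve. all: by end_near.
Qed.

End smoothing.

End cosine_kernel.

Lemma ae_imply d (T : measurableType d) (R : realType) (mu : {measure set T -> \bar R}) (p q : T -> Prop) :
  {ae mu, forall x, p x} -> (forall x, p x -> q x) -> {ae mu, forall x, q x}.
Proof. by move=> pae pq; apply: filterS pae. Qed.

(** * Square integrability and Parseval's identity *)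

Section square_integrability.
Variable R : realType.
Local Notation mu := (@lebesgue_measure R).
Local Notation D := [set` `[- pi, (pi : R)]].
Local Notation L1 f := (mu.-integrable D (EFin \o f)).

Lemma ae_interior : {ae mu, forall t, D t -> - pi < t < pi}.
Proof.
have n (a : R) : mu.-negligible [set a] by exists [set a]; split => //; exact: lebesgue_measure_set1.
apply: (negligibleS _ (negligibleU (n (- pi)) (n pi))) => t /= h; apply: contrapT => /not_orP[/= tn tp]; apply: h.
rewrite in_itv/= => /andP[t1 t2]; rewrite !lt_neqAle t1 t2 !andbT.
by apply/andP; split; apply/eqP => // /esym.
Qed.

Variables (S : R -> R) (iS : L1 S) (S0 : forall t, D t -> 0 <= S t).

Let mS : measurable_fun D S.
Proof. by apply/measurable_EFinP; exact: measurable_int iS. Qed.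

Section bound.
Variable K : R.
Hypothesis polyK : forall (N : nat) (A : 'I_N * bool -> R),
  2 * \int[mu]_(t in D) (S t * fourier_poly A t) <= \int[mu]_(t in D) fourier_poly A t ^+ 2 + K.

(** The supremum of 2 <S, p> - |p|^2 is |S|^2, finite or not, so [polyK] is a bound on the norm of S
    that does not presuppose it. It is stable under bounded convergence almost everywhere, here from
    trigonometric polynomials to continuous functions. *)
Lemma continuous_pairing_le (c : R -> R) (M : R) : continuous c -> (forall t, `|c t| <= M) ->
  2 * \int[mu]_(t in D) (S t * c t) <= \int[mu]_(t in D) c t ^+ 2 + K.
Proof.
move=> cc cM; have M0 : 0 <= M by exact: le_trans (normr_ge0 (c 0)) (cM 0).
have mc : measurable_fun D c by apply: measurable_funTS; exact: continuous_measurable_fun.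
have ms n : measurable_fun D (smoothing c n).
  by have [N [A ->]] := smoothing_poly cc cM n; exact: measurable_fourier_poly.
have sM n t := smoothing_le cc cM n t.
have cvs : {ae mu, forall t, D t -> smoothing c n t @[n --> \oo] --> c t}.
  by apply: (ae_imply ae_interior) => t h Dt; apply: (smoothing_cvg cc cM); exact: h.
have [_ h1] : L1 (fun t => S t * c t) /\
    \int[mu]_(t in D) (S t * smoothing c n t) @[n --> \oo] --> \int[mu]_(t in D) (S t * c t).
  apply: (@cvg_Rintegral_dominated _ _ _ mu D (measurable_itv _)
    (fun n t => S t * smoothing c n t) (fun t => S t * c t) (fun t => S t * M)).
  - by move=> n; apply: measurable_funM; [exact: mS|exact: ms].
  - by apply: measurable_funM; [exact: mS|exact: mc].
  - by apply: (ae_imply cvs) => t h Dt; apply: cvgM; [exact: cvg_cst|exact: h].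
  - exact: integrable_EFinZr.
  - by move=> n t Dt; rewrite normrM ger0_norm ?S0// ler_wpM2l ?S0.
have [_ h2] : L1 (fun t => c t ^+ 2) /\
    \int[mu]_(t in D) smoothing c n t ^+ 2 @[n --> \oo] --> \int[mu]_(t in D) c t ^+ 2.
  apply: (@cvg_Rintegral_dominated _ _ _ mu D (measurable_itv _)
    (fun n t => smoothing c n t ^+ 2) (fun t => c t ^+ 2) (fun=> M ^+ 2)).
  - by move=> n; apply: measurable_funX; exact: ms.
  - by apply: measurable_funX; exact: mc.
  - apply: (ae_imply cvs) => t h Dt; exact: (cvgM (h Dt) (h Dt)).
  - exact: L1_cst.
  - by move=> n t Dt; rewrite normrX lerXn2r ?nnegrE.
apply: (ler_cvg_to (f := fun n => 2 * \int[mu]_(t in D) (S t * smoothing c n t))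
  (g := fun n => \int[mu]_(t in D) smoothing c n t ^+ 2 + K) (a := \oo)).
- by apply: cvgM; [exact: cvg_cst|exact: h1].
- by apply: cvgD; [exact: h2|exact: cvg_cst].
- by near=> n; have [N [A ->]] := smoothing_poly cc cM n; exact: polyK.
Unshelve. all: by end_near.
Qed.

(** Truncation to [0, M] written with absolute values: continuity and the Lipschitz bound come from
    those of the absolute value. *)
Definition clip (M u : R) : R := (`|u| - `|u - M| + M) / 2.

Lemma clip_bounds M u : 0 <= M -> 0 <= clip M u <= M.
Proof.
by move=> M0; rewrite /clip; have [u0|u0] := leP 0 u; have [uM|uM] := leP 0 (u - M);
  [rewrite !ger0_norm|rewrite ger0_norm// ltr0_norm|rewrite ltr0_norm// ger0_norm|rewrite !ltr0_norm] => //; lra.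
Qed.

Lemma clip_id M u : 0 <= u <= M -> clip M u = u.
Proof.
move=> /andP[u0 uM]; rewrite /clip ger0_norm// ler0_norm ?subr_le0//; lra.
Qed.

Lemma clip_lipschitz M u v : `|clip M u - clip M v| <= `|u - v|.
Proof.
have h1 := ler_dist_dist u v; have h2 := ler_dist_dist (u - M) (v - M).
have e : u - M - (v - M) = u - v by ring.
rewrite e in h2; rewrite /clip -mulrBl normrM (@ger0_norm _ 2^-1)// ler_pdivrMr//.
have -> : `|u| - `|u - M| + M - (`|v| - `|v - M| + M) = (`|u| - `|v|) - (`|u - M| - `|v - M|) by ring.
by apply: le_trans (ler_normB _ _) _; lra.
Qed.

Lemma continuous_clip M (c : R -> R) : continuous c -> continuous (fun t => clip M (c t)).
Proof.
move=> cc t; apply: cvgM; last exact: cvg_cst.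
apply: cvgD; last exact: cvg_cst.
apply: cvgB; apply: cvg_norm; first exact: cc.
by apply: cvgB; [exact: cc|exact: cvg_cst].
Qed.

Lemma truncation_cvg : \int[mu]_(t in D) (S t - Num.min (S t) n%:R) @[n --> \oo] --> (0 : R).
Proof.
have [_] : L1 (fun _ : R => 0 : R) /\
    \int[mu]_(t in D) (S t - Num.min (S t) n%:R) @[n --> \oo] --> \int[mu]_(t in D) (0 : R).
  apply: (@cvg_Rintegral_dominated _ _ _ mu D (measurable_itv _)
    (fun n t => S t - Num.min (S t) n%:R) (fun=> 0) S).
  - by move=> n; apply: measurable_funB => //; exact: measurable_minr.
  - exact: measurable_cst.
  - apply: aeW => t Dt; apply: cvg_near_cst; near=> n.
    rewrite min_l ?subrr//; near: n; exact: nbhs_infty_ger.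
  - exact: iS.
  - move=> n t Dt; have s0 := S0 Dt; have n0 : (0 : R) <= n%:R by [].
    have [h|h] := leP (S t) n%:R; first by rewrite subrr normr0.
    by rewrite ger0_norm ?subr_ge0 ?(ltW h)// lerBlDr lerDl.
by rewrite Rintegral_cst//= mul0r.
Unshelve. all: by end_near.
Qed.

(** Continuous approximations of [g] converge in L1 only, while S is unbounded. S is cut at a level
    [B]: the part below sees the L1 error, and the part above has small integral and multiplies
    bounded functions. *)
Lemma bounded_pairing_le (g : R -> R) (M : R) : measurable_fun D g -> 
  (forall t, D t -> 0 <= g t <= M) ->
  2 * \int[mu]_(t in D) (S t * g t) <= \int[mu]_(t in D) g t ^+ 2 + K.
Proof.
move=> mg gM; have p0 := pi_gt0 R.
have M0 : 0 <= M.
  have /gM/andP[h0 h1] : D 0 by rewrite /= in_itv/=; apply/andP; split; lra.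
  exact: le_trans h0 h1.
have gn t : D t -> `|g t| <= M by move=> /gM/andP[h0 h1]; rewrite ger0_norm.
have ig : L1 g by apply: (@integrable_circle _ _ M).
have Dfin : (mu D < +oo)%E by rewrite measure_circle ltry.
have [g_ [cg ig_ cvg_]] := @approximation_continuous_integrable R D g (measurable_itv _) Dfin ig.
apply/ler_addgt0Pr => e e0.
(* Chosen so that M e' and (B + M) e'' are at most e/4; each enters the final inequality twice. *)
pose e' := e / (4 * (M + 1)).
have e'0 : 0 < e' by rewrite divr_gt0// mulr_gt0// ltr_wpDl.
have [B hB] : exists B : nat, \int[mu]_(t in D) (S t - Num.min (S t) B%:R) <= e'.
  have /cvgrPdist_le /(_ _ e'0) [B _ h] := truncation_cvg; exists B.
  by have := h B (leqnn B); rewrite sub0r normrN; exact: le_trans (ler_norm _).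
pose e'' := e / (4 * (B%:R + M + 1)).
have e''0 : 0 < e'' by rewrite divr_gt0// mulr_gt0// ltr_wpDl// addr_ge0.
have [j hj] : exists j, \int[mu]_(t in D) `|g t - g_ j t| <= e''.
  have /fine_cvgP [_ /cvgrPdist_le /(_ _ e''0) [j _ h]] := cvg_; exists j.
  by have := h j (leqnn j); rewrite sub0r normrN; exact: le_trans (ler_norm _).
pose c t := clip M (g_ j t).
have cc : continuous c by apply: continuous_clip; exact: cg.
have mc : measurable_fun D c by apply: measurable_funTS; exact: continuous_measurable_fun.
have c01 t : 0 <= c t <= M by exact: clip_bounds.
have cM t : `|c t| <= M by have /andP[h0 h1] := c01 t; rewrite ger0_norm.
have gc t : D t -> `|g t - c t| <= `|g t - g_ j t|.
  by move=> Dt; rewrite -{1}(clip_id (gM t Dt)); exact: clip_lipschitz.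
have igj : L1 (fun t => `|g t - g_ j t|).
  have igb : L1 (fun t => g t - g_ j t) by apply: integrable_EFinB => //; exact: ig_.
  by have := integrable_abse igb.
have ic2 : L1 (fun t => c t ^+ 2).
  by apply: (@integrable_circle _ _ (M ^+ 2)); [exact: measurable_funX|move=> t _; rewrite normrX lerXn2r ?nnegrE].
have ig2 : L1 (fun t => g t ^+ 2).
  by apply: (@integrable_circle _ _ (M ^+ 2)); [exact: measurable_funX|move=> t Dt; rewrite normrX lerXn2r ?nnegrE// gn].
have iSc : L1 (fun t => S t * c t) by exact: (integrable_mul_bounded iS mc (fun t _ => cM t)).
have iSg : L1 (fun t => S t * g t) by exact: (integrable_mul_bounded iS mg gn).
have imin : L1 (fun t => S t - Num.min (S t) B%:R).
  apply: integrable_EFinB => //; apply: (@integrable_circle _ _ B%:R); first exact: measurable_minr.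
  by move=> t Dt; have s0 := S0 Dt; have [h|h] := leP (S t) B%:R; rewrite ger0_norm.
have h1 : \int[mu]_(t in D) (S t * g t) <= \int[mu]_(t in D) (S t * c t) + (B%:R * e'' + M * e').
  apply: (@le_trans _ _ (\int[mu]_(t in D) (S t * c t + (B%:R * `|g t - g_ j t| + M * (S t - Num.min (S t) B%:R))))).
    apply: le_Rintegral => //.
      by do ![apply: integrable_EFinD => //|apply: integrable_EFinZl => //].
    move=> t Dt; have s0 := S0 Dt; have /andP[g0 g1] := gM t Dt; have /andP[c0 c1] := c01 t.
    have x1 := ler_norm (g t - c t).
    move: `|g t - g_ j t| (normr_ge0 (g t - g_ j t)) (gc t Dt) => x x0 x2.
    have B0 : (0 : R) <= B%:R by [].
    have [hs|hs] := leP (S t) B%:R.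
      rewrite subrr mulr0 addr0 -lerBlDl -mulrBr.
      apply: (@le_trans _ _ (S t * x)); first by rewrite ler_wpM2l// (le_trans x1).
      by rewrite ler_wpM2r.
    have : B%:R * (g t - c t) <= B%:R * x by rewrite ler_wpM2l// (le_trans x1).
    have : (S t - B%:R) * (g t - c t) <= (S t - B%:R) * M by apply: ler_wpM2l; lra.
    lra.
  rewrite RintegralD//; last by do ![apply: integrable_EFinD => //|apply: integrable_EFinZl => //].
  rewrite lerD2l RintegralD//; try exact: integrable_EFinZl.
  by rewrite !RintegralZl// lerD// ler_wpM2l.
have h2 : \int[mu]_(t in D) c t ^+ 2 <= \int[mu]_(t in D) g t ^+ 2 + 2 * M * e''.
  apply: (@le_trans _ _ (\int[mu]_(t in D) (g t ^+ 2 + 2 * M * `|g t - g_ j t|))).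
    apply: le_Rintegral => //; first by apply: integrable_EFinD => //; exact: integrable_EFinZl.
    move=> t Dt; have /andP[g0 g1] := gM t Dt; have /andP[c0 c1] := c01 t.
    have x1 := gc t Dt; have : c t - g t <= `|g t - g_ j t|.
      by apply: le_trans x1; rewrite distrC ler_norm.
    move: `|g t - g_ j t| (normr_ge0 (g t - g_ j t)) => x x0 x2.
    have : (c t - g t) * (c t + g t) <= x * (2 * M).
      apply: (@le_trans _ _ (x * (c t + g t))); first by rewrite ler_wpM2r// addr_ge0.
      by rewrite ler_wpM2l//; lra.
    rewrite !expr2; lra.
  rewrite RintegralD//; last exact: integrable_EFinZl.
  by rewrite lerD2l RintegralZl// ler_wpM2l// mulr_ge0.
have h3 := continuous_pairing_le cc cM.
have e1 : M * e' <= e / 4.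
  rewrite /e' mulrA ler_pdivrMr; last by rewrite mulr_gt0// ltr_wpDl.
  by rewrite -[leRHS]mulrA [leRHS]mulrC -mulrA; nra.
have e2 : (B%:R + M) * e'' <= e / 4.
  rewrite /e'' mulrA ler_pdivrMr; last by rewrite mulr_gt0// ltr_wpDl// addr_ge0.
  have B0 : (0 : R) <= B%:R by [].
  nra.
lra.
Qed.

(* S is tested against its own truncations, which are limits of trigonometric polynomials. *)
Lemma square_integrable : L1 (fun t => S t ^+ 2) /\ \int[mu]_(t in D) S t ^+ 2 <= K.
Proof.
pose f n t := (Num.min (S t) n%:R ^+ 2)%:E.
have mf n : measurable_fun D (f n).
  by apply/measurable_EFinP; apply: measurable_funX; apply: measurable_minr => //.
have m0 n t : D t -> 0 <= Num.min (S t) n%:R <= n%:R.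
  by move=> Dt; have s0 := S0 Dt; have [h|h] := leP (S t) n%:R; rewrite ?s0 ?lexx ?ler0n.
have f0 n t : D t -> (0 <= f n t)%E by move=> _; rewrite lee_fin sqr_ge0.
have fK n : (\int[mu]_(t in D) f n t <= K%:E)%E.
  pose g t := Num.min (S t) n%:R.
  have mg : measurable_fun D g by exact: measurable_minr.
  have ig2 : L1 (fun t => g t ^+ 2).
    apply: (@integrable_circle _ _ (n%:R ^+ 2)); first exact: measurable_funX.
    by move=> t Dt; have /andP[h0 h1] := m0 n t Dt; rewrite normrX lerXn2r ?nnegrE// ger0_norm.
  have iSg : L1 (fun t => S t * g t).
    apply: (integrable_mul_bounded iS mg (K := n%:R)) => t Dt.
    by have /andP[h0 h1] := m0 n t Dt; rewrite ger0_norm.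
  have -> : (\int[mu]_(t in D) f n t = (\int[mu]_(t in D) g t ^+ 2)%:E)%E by rewrite EFin_Rintegral.
  rewrite lee_fin; have := bounded_pairing_le mg (m0 n).
  (* The truncation satisfies S g >= g^2, so the pairing bound leaves the integral of g^2 at most
     [K]. *)
  have : \int[mu]_(t in D) g t ^+ 2 <= \int[mu]_(t in D) (S t * g t).
    apply: le_Rintegral => // t Dt; have /andP[h0 h1] := m0 n t Dt.
    by rewrite expr2 ler_wpM2r// /g ge_min lexx.
  lra.
have fS t : D t -> limn (f^~ t) = (S t ^+ 2)%:E.
  move=> Dt; apply: lim_near_cst => //; near=> n.
  rewrite /f min_l//; near: n; exact: nbhs_infty_ger.
have SK : (\int[mu]_(t in D) (S t ^+ 2)%:E <= K%:E)%E.
  have -> : (\int[mu]_(t in D) (S t ^+ 2)%:E = \int[mu]_(t in D) limn (f^~ t))%E.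
    by apply: eq_integral => t /set_mem Dt; rewrite fS.
  have fmono t : D t -> {homo f^~ t : n m / (n <= m)%N >-> (n <= m)%E}.
    move=> Dt n m nm; have /andP[h0 h1] := m0 n t Dt; have /andP[h2 h3] := m0 m t Dt.
    rewrite lee_fin lerXn2r ?nnegrE// le_min ge_min lexx/= ge_min ler_nat nm orbT.
    by [].
  rewrite (monotone_convergence mu (measurable_itv _) mf f0 fmono).
  apply: lime_le; last by near=> n.
  apply: ereal_nondecreasing_is_cvgn => n m nm; apply: ge0_le_integral => //;
    first [exact: mf | by move=> t Dt; exact: f0 | by move=> t Dt; exact: fmono].
have iS2 : L1 (fun t => S t ^+ 2).
  apply/integrableP; split; first by apply/measurable_EFinP; exact: measurable_funX.
  have -> : (\int[mu]_(t in D) `|(EFin \o (fun t => (S t ^+ 2)%R)) t| = \int[mu]_(t in D) (S t ^+ 2)%:E)%E.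
    by apply: eq_integral => t _ /=; rewrite ger0_norm ?sqr_ge0.
  by apply: le_lt_trans SK _; rewrite ltry.
by split => //; rewrite -lee_fin EFin_Rintegral.
Unshelve. all: by end_near.
Qed.

End bound.

(** The square of S minus the polynomial is nonnegative. *)
Lemma fourier_poly_pairing_le N (A : 'I_N * bool -> R) : L1 (fun t => S t ^+ 2) ->
  2 * \int[mu]_(t in D) (S t * fourier_poly A t) - \int[mu]_(t in D) fourier_poly A t ^+ 2 <=
  \int[mu]_(t in D) S t ^+ 2.
Proof.
move=> iS2; have mp : measurable_fun D (fourier_poly A) by exact: measurable_fourier_poly.
have iSp : L1 (fun t => S t * fourier_poly A t).
  exact: (integrable_mul_bounded iS mp (fun t _ => fourier_poly_le A t)).
have ip2 : L1 (fun t => fourier_poly A t ^+ 2).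
  apply: (@integrable_circle _ _ ((\sum_i `|A i|) ^+ 2)); first exact: measurable_funX.
  by move=> t _; rewrite normrX lerXn2r ?nnegrE ?sumr_ge0// fourier_poly_le.
rewrite -RintegralZl// -RintegralB//; last exact: integrable_EFinZl.
apply: le_Rintegral => //; first by apply: integrable_EFinB => //; exact: integrable_EFinZl.
by move=> t _; have := sqr_ge0 (S t - fourier_poly A t); rewrite !expr2; lra.
Qed.

(** Partial sums of Parseval's series. At the index of the zero function both numerator and
    denominator vanish, and the quotient counts as 0. *)
Definition fourier_energy N : R := \sum_(i : 'I_N * bool)
  fourier_coef S (nat_of_ord i.1, i.2) ^+ 2 / (2 * pi * basis_norm R (nat_of_ord i.1, i.2)).

Lemma fourier_coef0 : fourier_coef S (0%N, true) = 0.
Proof.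
rewrite /fourier_coef/fourier_basis/=; under eq_Rintegral do rewrite mul0r sin0 mulr0.
by rewrite Rintegral_cst//= mul0r.
Qed.

Let basis_norm_gt0 (i : nat * bool) : i != (0%N, true) -> 0 < 2 * pi * basis_norm R i.
Proof.
move=> i0; rewrite mulr_gt0//; first by rewrite mulr_gt0// pi_gt0.
case: i i0 => [[|m] [|]]; rewrite /basis_norm//=.
Qed.

(** Completing the square in each coefficient gives the pairing bound with [K] equal to [E], hence
    square integrability and the upper half. For the lower half the polynomial is the partial
    Fourier sum, for which the pairing equals the energy. *)
Lemma parseval (E : R) : (forall N, fourier_energy N <= E) ->
  (forall e, 0 < e -> exists N, E - e <= fourier_energy N) ->
  L1 (fun t => S t ^+ 2) /\ \int[mu]_(t in D) S t ^+ 2 = E.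
Proof.
move=> hE hE'.
have [|iS2 up] := @square_integrable E.
  move=> N A; rewrite (Rintegral_mul_fourier_poly iS) fourier_poly_norm -lerBlDl.
  apply: le_trans (hE N); rewrite !mulr_sumr -sumrB; apply: ler_sum => i _.
  have [e0|e0] := eqVneq (nat_of_ord i.1, i.2) (0%N, true).
    by rewrite e0 fourier_coef0 /basis_norm/= !mulr0 !expr0n/= mul0r subr0.
  have c0 := basis_norm_gt0 e0; move: (fourier_coef S _) => x.
  rewrite ler_pdivlMr//; have := sqr_ge0 (A i * (2 * pi * basis_norm R (nat_of_ord i.1, i.2)) - x).
  rewrite !expr2; lra.
split => //; apply/eqP; rewrite eq_le up/=; apply/ler_addgt0Pr => e e0.
have [N hN] := hE' e e0; rewrite -lerBlDr; apply: le_trans hN _.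
pose A (i : 'I_N * bool) := fourier_coef S (nat_of_ord i.1, i.2) / (2 * pi * basis_norm R (nat_of_ord i.1, i.2)).
apply: le_trans (fourier_poly_pairing_le A iS2).
rewrite (Rintegral_mul_fourier_poly iS) fourier_poly_norm !mulr_sumr -sumrB; apply: ler_sum => i _.
have [e1|e1] := eqVneq (nat_of_ord i.1, i.2) (0%N, true).
  by rewrite /A e1 fourier_coef0 /basis_norm/= !(mulr0, mul0r, expr0n)/= subrr.
have c0 := basis_norm_gt0 e1; rewrite /A; move: (fourier_coef S _) => x.
move: c0; set q := basis_norm R _ => c0.
have q0 : q != 0 by apply: contraTneq c0 => ->; rewrite mulr0 ltxx.
have gen (p : R) : p != 0 -> x ^+ 2 / (2 * p * q) =
    2 * (x / (2 * p * q) * x) - 2 * p * ((x / (2 * p * q)) ^+ 2 * q).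
  by move=> p0; field; rewrite q0.
by rewrite gen// gt_eqF// pi_gt0.
Qed.

End square_integrability.

(** * Second-order expansion of the spectral integral *)

Section spectral_expansion.
Context d (Omega : measurableType d) (R : realType) (P : probability Omega R).
Variables NT NR : nat.
Variable H : 'I_NT -> 'I_NR -> int -> {RV P >-> R[i]}.
Variable W : 'I_NR -> nat -> {RV P >-> R[i]}.
Hypothesis ch : rayleigh_fading_channel H W.
Hypothesis phi_finite : forall k l, (phi (H k l) < +oo)%E.
Variable S : 'I_NT -> 'I_NR -> R -> R.
Hypothesis densityS : forall k l, spectral_density (H k l) (S k l).
Local Notation R0 k l := (autocorrelation0 (H k l)).
Local Notation mu := (@lebesgue_measure R).
Local Notation D := [set` `[- pi, (pi : R)]].
Local Notation L1 f := (mu.-integrable D (EFin \o f)).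
Variables (k : 'I_NT) (l : 'I_NR).
Local Notation s := (S k l).

Lemma spectral_ge0 t : D t -> 0 <= s t.
Proof. by case: (densityS k l) => h _ _ Dt; exact: h. Qed.

Lemma spectral_integrable : L1 s.
Proof. by case: (densityS k l). Qed.

Let p0 : 0 < 2 * (pi : R). Proof. by rewrite mulr_gt0// pi_gt0. Qed.

Lemma fourier_coef_cos n : fourier_coef s (n, false) = 2 * pi * Re (autocorrelation (H k l) n%:Z).
Proof.
case: (densityS k l) => _ _ ->; rewrite [Re _]/=.
have ic : L1 (fun t => s t * fourier_basis (n, false) t).
  apply: (integrable_mul_bounded spectral_integrable (K := 1)); first exact: measurable_fourier_basis.
  by move=> t _; exact: fourier_basis_le1.
transitivity (2 * pi * \int[mu]_(t in D) (s t * fourier_basis (n, false) t / (2 * pi))).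
  by rewrite RintegralZr// mulrCA mulfV ?mulr1// gt_eqF.
by congr (_ * _); apply: eq_Rintegral => t _; rewrite /fourier_basis/= -pmulrn.
Qed.

Lemma fourier_coef_sin n : fourier_coef s (n, true) = 2 * pi * Im (autocorrelation (H k l) n%:Z).
Proof.
case: (densityS k l) => _ _ ->; rewrite [Im _]/=.
have ic : L1 (fun t => s t * fourier_basis (n, true) t).
  apply: (integrable_mul_bounded spectral_integrable (K := 1)); first exact: measurable_fourier_basis.
  by move=> t _; exact: fourier_basis_le1.
transitivity (2 * pi * \int[mu]_(t in D) (s t * fourier_basis (n, true) t / (2 * pi))).
  by rewrite RintegralZr// mulrCA mulfV ?mulr1// gt_eqF.
by congr (_ * _); apply: eq_Rintegral => t _; rewrite /fourier_basis/= -pmulrn.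
Qed.

Lemma Rintegral_spectral : \int[mu]_(t in D) s t = 2 * pi * R0 k l.
Proof.
rewrite /autocorrelation0 -(fourier_coef_cos 0).
by apply: eq_Rintegral => t _; rewrite /fourier_basis/= mul0r cos0 mulr1.
Qed.

(** A positive lag contributes a cosine and a sine, each of mean square 1/2: this is the factor 2 in
    [lambda]. *)
Lemma spectral_energyE N : fourier_energy s N.+1 = 2 * pi *
  (R0 k l ^+ 2 + 2 * \sum_(1 <= h < N.+1) normc (autocorrelation (H k l) h%:Z) ^+ 2).
Proof.
pose F (m : nat) (b : bool) := fourier_coef s (m, b) ^+ 2 / (2 * pi * basis_norm R (m, b)).
have gen (p x y : R) : p != 0 ->
   (2 * p * x) ^+ 2 / (2 * p * 2^-1) + (2 * p * y) ^+ 2 / (2 * p * 2^-1) = 2 * p * (2 * (y ^+ 2 + x ^+ 2)).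
  by move=> q0; field.
have gen0 (p x : R) : p != 0 -> (2 * p * x) ^+ 2 / (2 * p * 1) = 2 * p * x ^+ 2.
  by move=> q0; field.
have pn0 : (pi : R) != 0 by rewrite gt_eqF// pi_gt0.
transitivity (\sum_(m < N.+1) \sum_b F m b).
  rewrite pair_bigA/=; apply: eq_bigr => -[m b] _ //.
rewrite big_ord_recl mulrDr; congr (_ + _).
  rewrite big_bool/= /F fourier_coef0 expr0n/= mul0r add0r fourier_coef_cos /basis_norm/=.
  by rewrite gen0.
rewrite big_add1/= big_mkord !mulr_sumr; apply: eq_bigr => m _.
by rewrite big_bool/= /F fourier_coef_cos fourier_coef_sin /basis_norm/= gen// sqr_normcE.
Qed.

Lemma spectral_parseval : L1 (fun t => s t ^+ 2) /\
  \int[mu]_(t in D) s t ^+ 2 = 2 * pi * lambda (H k l).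
Proof.
apply: (parseval spectral_integrable spectral_ge0).
  case=> [|N]; first rewrite /fourier_energy big1.
  - by apply: mulr_ge0; [exact: ltW|exact: lambda_ge0].
  - by case=> -[].
  rewrite spectral_energyE ler_wpM2l ?(ltW p0)// lerD2l ler_wpM2l//.
  exact: sum_autocorrelation_le.
move=> e e0; have e'0 : 0 < e / (2 * pi * 2) by rewrite divr_gt0// mulr_gt0.
have [M hM] := phi_partial_sum phi_finite k l e'0; exists M.+1.
rewrite spectral_energyE.
have : \sum_(1 <= h < M) normc (autocorrelation (H k l) h%:Z) ^+ 2 <=
    \sum_(1 <= h < M.+1) normc (autocorrelation (H k l) h%:Z) ^+ 2.
  case: (M) => [|m]; first by rewrite !big_geq.
  by rewrite [leRHS]big_nat_recr//= lerDl sqr_ge0.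
move=> /(le_trans hM); rewrite /lambda => h.
have -> : 2 * pi * (R0 k l ^+ 2 + 2 * fine (phi (H k l))) - e =
  2 * pi * (R0 k l ^+ 2 + 2 * (fine (phi (H k l)) - e / (2 * pi * 2))).
  have gen (p x y : R) : p != 0 -> 2 * p * (x + 2 * y) - e = 2 * p * (x + 2 * (y - e / (2 * p * 2))).
    by move=> q0; field.
  by apply: gen; rewrite gt_eqF// pi_gt0.
by rewrite ler_wpM2l ?(ltW p0)// lerD2l ler_wpM2l.
Qed.

(** Equivalently, x - ln(1 + x) is nondecreasing for x >= 0: in a lower bound S may then be replaced
    by its truncation. *)
Lemma ln1p_increment (x y : R) : 0 <= x -> x <= y -> ln (1 + y) - ln (1 + x) <= y - x.
Proof.
move=> x0 xy; have x1 : 0 < 1 + x by lra.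
have y1 : 0 < 1 + y by lra.
rewrite -ln_div ?posrE//.
have e : (1 + y) / (1 + x) = 1 + (y - x) / (1 + x) by field; rewrite gt_eqF.
have z0 : 0 <= (y - x) / (1 + x) by rewrite divr_ge0 ?subr_ge0// ltW.
have h : -1 < (y - x) / (1 + x) by lra.
rewrite e; apply: le_trans (le_ln1Dx h) _; rewrite ler_pdivrMr//.
by rewrite ler_peMr ?subr_ge0//; lra.
Qed.

Section scale.
Variable rho : R.
Hypothesis rho0 : 0 <= rho.

Let ms : measurable_fun D s.
Proof. by apply/measurable_EFinP; exact: measurable_int spectral_integrable. Qed.

Let mln : measurable_fun D (fun t => ln (1 + rho * s t)).
Proof.
apply: (measurableT_comp (@measurable_ln R)); apply: measurable_funD => //.
exact: measurable_funM.
Qed.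

Let ln_ge0' t : D t -> 0 <= ln (1 + rho * s t) <= rho * s t.
Proof.
move=> Dt; have h : 0 <= rho * s t by rewrite mulr_ge0// spectral_ge0.
by rewrite ln_ge0 ?lerDl//= le_ln1Dx//; lra.
Qed.

Let iln : L1 (fun t => ln (1 + rho * s t)).
Proof.
apply: (@le_integrable_EFin _ _ _ mu D (measurable_itv _) _ (fun t => rho * s t)) => //.
  move=> t Dt; have /andP[h0 h1] := ln_ge0' Dt; rewrite !ger0_norm//.
  exact: le_trans h0 h1.
by apply: integrable_EFinZl => //; exact: spectral_integrable.
Qed.

Let irs : L1 (fun t => rho * s t).
Proof. by apply: integrable_EFinZl => //; exact: spectral_integrable. Qed.

Lemma I_E : rho * R0 k l - I_ S k l rho =
  (\int[mu]_(t in D) (rho * s t - ln (1 + rho * s t))) / (2 * pi).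
Proof.
rewrite RintegralB// RintegralZl//; last exact: spectral_integrable.
rewrite Rintegral_spectral mulrBl /I_ RintegralZr//; congr (_ - _).
by rewrite mulrCA -mulrA mulrCA mulfV ?mulr1// gt_eqF.
Qed.

Lemma I_upper : rho * R0 k l - I_ S k l rho <= rho ^+ 2 * lambda (H k l) / 2.
Proof.
have [iS2 eS2] := spectral_parseval.
rewrite I_E ler_pdivrMr//.
have -> : rho ^+ 2 * lambda (H k l) / 2 * (2 * pi) = \int[mu]_(t in D) (rho ^+ 2 / 2 * s t ^+ 2).
  by rewrite RintegralZl// eS2; ring.
apply: le_Rintegral => //; first exact: integrable_EFinB.
  exact: integrable_EFinZl.
move=> t Dt; have h : 0 <= rho * s t by rewrite mulr_ge0// spectral_ge0.
by have := ln1p_ge h; rewrite exprMn; lra.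
Qed.

(** Truncation at [n] tames the cubic remainder: m^3 <= n m^2 for m <= n, so it becomes a small
    multiple of the quadratic term. *)
Lemma I_lower n : rho ^+ 2 / 2 * (1 - rho * n%:R) * \int[mu]_(t in D) Num.min (s t) n%:R ^+ 2 / (2 * pi) <=
  rho * R0 k l - I_ S k l rho.
Proof.
rewrite I_E ler_wpM2r ?invr_ge0 ?(ltW p0)//.
have m0 t : D t -> 0 <= Num.min (s t) n%:R <= n%:R.
  by move=> Dt; have s0 := spectral_ge0 Dt; have [h|h] := leP (s t) n%:R; rewrite ?s0 ?lexx ?ler0n.
have im2 : L1 (fun t => Num.min (s t) n%:R ^+ 2).
  apply: (@integrable_circle _ _ (n%:R ^+ 2)).
    by apply: measurable_funX; exact: measurable_minr.
  by move=> t Dt; have /andP[h0 h1] := m0 t Dt; rewrite normrX lerXn2r ?nnegrE// ger0_norm.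
rewrite -RintegralZl//; apply: le_Rintegral => //; first exact: integrable_EFinZl.
  exact: integrable_EFinB.
move=> t Dt; have /andP[h0 h1] := m0 t Dt.
have ms' : Num.min (s t) n%:R <= s t by rewrite ge_min lexx.
move: (Num.min _ _) h0 h1 ms' => m h0 h1 ms'.
have rm : 0 <= rho * m by rewrite mulr_ge0.
have rms : rho * m <= rho * s t by rewrite ler_wpM2l.
have := ln1p_increment rm rms; have := ln1p_le rm.
have : (rho * m) ^+ 3 <= rho ^+ 3 * n%:R * m ^+ 2.
  have -> : (rho * m) ^+ 3 = rho ^+ 3 * m ^+ 2 * m by ring.
  by rewrite [leRHS]mulrAC ler_wpM2l// mulr_ge0 ?sqr_ge0// exprn_ge0.
have : 0 <= rho ^+ 3 * n%:R * m ^+ 2 by rewrite !mulr_ge0// ?exprn_ge0.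
have -> : rho ^+ 2 / 2 * (1 - rho * n%:R) * m ^+ 2 = rho ^+ 2 * m ^+ 2 / 2 - rho ^+ 3 * n%:R * m ^+ 2 / 2.
  by field.
rewrite [in X in _ -> _ -> X -> _]exprMn; lra.
Qed.

End scale.

Lemma truncated_energy_cvg :
  \int[mu]_(t in D) Num.min (s t) n%:R ^+ 2 @[n --> \oo] --> 2 * pi * lambda (H k l).
Proof.
have [iS2 <-] := spectral_parseval.
have ms : measurable_fun D s by apply/measurable_EFinP; exact: measurable_int spectral_integrable.
have [] // : L1 (fun t => s t ^+ 2) /\
   \int[mu]_(t in D) Num.min (s t) n%:R ^+ 2 @[n --> \oo] --> \int[mu]_(t in D) s t ^+ 2.
apply: (@cvg_Rintegral_dominated _ _ _ mu D (measurable_itv _)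
  (fun n t => Num.min (s t) n%:R ^+ 2) (fun t => s t ^+ 2) (fun t => s t ^+ 2)) => //.
- by move=> n; apply: measurable_funX; exact: measurable_minr.
- exact: measurable_funX.
- apply: aeW => t Dt; apply: cvg_near_cst; near=> n.
  by rewrite min_l//; near: n; exact: nbhs_infty_ger.
- move=> n t Dt; have s0 := spectral_ge0 Dt; rewrite ger0_norm ?sqr_ge0//.
  by have [h|h] := leP (s t) n%:R; rewrite ?lerXn2r ?nnegrE// ltW.
Unshelve. all: by end_near.
Qed.

Lemma I_lower_near (e : R) : 0 < e -> \forall rho \near 0^'+,
  rho ^+ 2 * (lambda (H k l) / 2 - e) <= rho * R0 k l - I_ S k l rho.
Proof.
move=> e0; have lam0 := lambda_ge0 H k l.
have [n hn] : exists n : nat, 2 * pi * (lambda (H k l) - e) <= \int[mu]_(t in D) Num.min (s t) n%:R ^+ 2.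
  have pe : 0 < 2 * pi * e by rewrite mulr_gt0.
  have /cvgrPdist_le /(_ _ pe) [n _ h] := truncated_energy_cvg; exists n.
  have := h n (leqnn n); rewrite ler_norml => /andP[_]; rewrite mulrBr; lra.
(* Below this value rho n lambda is at most e; adding 1 to both factors avoids division by 0. *)
have d0 : 0 < e / ((lambda (H k l) + 1) * (n%:R + 1)).
  by rewrite divr_gt0// mulr_gt0// ltr_wpDl.
near=> rho.
have rho0 : 0 < rho by near: rho; exact: nbhs_right_gt.
have rhod : rho <= e / ((lambda (H k l) + 1) * (n%:R + 1)) by near: rho; exact: nbhs_right_le.
have rho1 : rho * n%:R <= 1.
  near: rho; have h : 0 < (n%:R + 1 : R)^-1 by rewrite invr_gt0 ltr_wpDl.
  near=> rho; have r0 : 0 < rho by near: rho; exact: nbhs_right_gt.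
  have : rho <= (n%:R + 1)^-1 by near: rho; exact: nbhs_right_le.
  rewrite -[(_ + 1)^-1]mul1r ler_pdivlMr ?ltr_wpDl// mulrDr mulr1; lra.
apply: le_trans (I_lower (ltW rho0) n).
have gen (x y z q : R) : x / 2 * y * z / q = x * (y * (z / q) / 2) by ring.
rewrite gen.
rewrite ler_wpM2l ?sqr_ge0//.
have h1 : lambda (H k l) - e <= \int[mu]_(t in D) Num.min (s t) n%:R ^+ 2 / (2 * pi).
  by rewrite ler_pdivlMr// mulrC.
have h2 : (1 - rho * n%:R) * (lambda (H k l) - e) <=
    (1 - rho * n%:R) * (\int[mu]_(t in D) Num.min (s t) n%:R ^+ 2 / (2 * pi)).
  by rewrite ler_wpM2l// subr_ge0.
have h3 : rho * n%:R * lambda (H k l) <= e.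
  move: rhod; rewrite ler_pdivlMr; last by rewrite mulr_gt0// ltr_wpDl.
  move=> /(le_trans _); apply; rewrite -mulrA ler_wpM2l ?(ltW rho0)// mulrC.
  by rewrite ler_pM//; lra.
have h4 : 0 <= rho * n%:R * e by rewrite !mulr_ge0// ltW.
lra.
Unshelve. all: by end_near.
Qed.

End spectral_expansion.

(** * Existence of the maxima and the limit of the upper bound [U_mimo_s] *)

Section maxima.
Context (R : realType) (NT : nat).
Local Notation powers := (prod_topology (fun _ : 'I_NT => R)).

Lemma max_ofE (s : set R) m : s m -> ubound s m -> max_of s = m.
Proof.
move=> sm um; apply: xget_unique; first by split.
by move=> m' [sm' um']; apply/eqP; rewrite eq_le um// um'.
Qed.

Lemma continuous_big_sum (T : topologicalType) (I : Type) (r : seq I) (f : I -> T -> R) (x : T) :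
  (forall i, {for x, continuous (f i)}) -> {for x, continuous (fun y => \sum_(i <- r) f i y)}.
Proof.
move=> cf; elim: r => [|i r IH].
  rewrite (_ : (fun y => _) = fun=> 0); first exact: cvg_cst.
  by apply/funext => y; rewrite big_nil.
rewrite (_ : (fun y => _) = fun y => f i y + \sum_(j <- r) f j y); first exact: cvgD (cf i) IH.
by apply/funext => y; rewrite big_cons.
Qed.

Section pointwise.
Context (T : topologicalType) (f g : T -> R) (x : T).
Hypotheses (cf : {for x, continuous f}) (cg : {for x, continuous g}).

Lemma continuous_sub : {for x, continuous (fun y => f y - g y)}. Proof. exact: cvgB. Qed.

Lemma continuous_mul : {for x, continuous (fun y => f y * g y)}. Proof. exact: cvgM. Qed.

Lemma continuous_affine (c r : R) : {for x, continuous (fun y => c + r * f y)}.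
Proof. by apply: cvgD; [exact: cvg_cst|apply: cvgM; [exact: cvg_cst|exact: cf]]. Qed.

End pointwise.

Lemma continuous_linear_form (c : 'I_NT -> R) (a : powers) :
  {for a, continuous (fun b : powers => \sum_(k < NT) b k * c k)}.
Proof.
have h1 k : {for a, continuous (fun b : powers => b k)} := @proj_continuous _ (fun _ : 'I_NT => R) k a.
have h2 k : {for a, continuous (fun _ : powers => c k)} := @cst_continuous powers R (c k) a.
exact: (continuous_big_sum (fun k => continuous_mul (h1 k) (h2 k))).
Qed.

Lemma continuous_coord (k : 'I_NT) (a : powers) : {for a, continuous (fun b : powers => b k)}.
Proof. exact: proj_continuous. Qed.

Variable beta : R.
Hypothesis beta1 : 1 <= beta.

(** A closed part of the cube with side [0, 1/beta], which is compact by Tychonoff's theorem. *)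
Lemma compact_A : compact (A_ beta : set powers).
Proof.
have b0 : 0 <= beta^-1 by rewrite invr_ge0 (le_trans ler01).
have -> : (A_ beta : set powers) =
    [set a : powers | forall k, [set` `[0, beta^-1]] (a k)] `&` (fun a : powers => \sum_(k < NT) a k) @^-1` [set y | y <= beta^-1].
  apply/seteqP; split => a /= [h1 h2]; split => // k; last first.
    by have := h1 k; rewrite in_itv/= => /andP[].
  rewrite in_itv/= h1/=; apply: le_trans h2; rewrite (bigD1 k)//= lerDl.
  by apply: sumr_ge0 => i _; exact: h1.
apply: compact_closedI.
  exact: (tychonoff (fun _ : 'I_NT => @segment_compact R 0 beta^-1)).
apply: preimage_closed; last exact: closed_le.
by move=> a _; apply: continuous_big_sum => k; exact: continuous_coord.
Qed.

(** [max_of] would return the default 0 without a greatest element; compactness shows that the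
    maximum is attained, so the value is genuine. *)
Lemma max_of_A (f : powers -> R) : (forall a, A_ beta a -> {for a, continuous f}) ->
  exists2 a, A_ beta a & max_of [set f a | a in A_ beta] = f a /\ forall b, A_ beta b -> f b <= f a.
Proof.
move=> cf; have A0 : (A_ beta : set powers) !=set0.
  exists (fun=> 0); split => //; by rewrite big1// invr_ge0 (le_trans ler01).
have [a /set_mem aA fa] : exists2 a, a \in (A_ beta : set powers) &
    forall b, b \in (A_ beta : set powers) -> f b <= f a.
  apply: compact_EVT_max => //; first exact: compact_A.
  by apply: continuous_in_subspaceT => b /set_mem bA; exact: cf.
exists a => //; split; last by move=> b bA; apply: fa; exact: mem_set.
by apply: max_ofE; [exists a|move=> _ [b bA <-]; apply: fa; exact: mem_set].
Qed.

End maxima.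

Section upper_bound_limit.
Context d (Omega : measurableType d) (R : realType) (P : probability Omega R).
Variables NT NR : nat.
Variable H : 'I_NT -> 'I_NR -> int -> {RV P >-> R[i]}.
Variable W : 'I_NR -> nat -> {RV P >-> R[i]}.
Hypothesis ch : rayleigh_fading_channel H W.
Hypothesis phi_finite : forall k l, (phi (H k l) < +oo)%E.
Variable S : 'I_NT -> 'I_NR -> R -> R.
Hypothesis densityS : forall k l, spectral_density (H k l) (S k l).
Local Notation R0 k l := (autocorrelation0 (H k l)).
Variable beta : R.
Hypothesis beta1 : 1 <= beta.
Local Notation powers := (prod_topology (fun _ : 'I_NT => R)).

Lemma quadratic_gain_max : exists2 a, A_ beta a &
  max_of [set quadratic_gain H a | a in A_ beta] = quadratic_gain H a /\
  forall b, A_ beta b -> quadratic_gain H b <= quadratic_gain H a.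
Proof.
apply: (max_of_A beta1 (f := quadratic_gain H : powers -> R)) => a _.
have lin := continuous_linear_form (R := R) (NT := NT).
exact: (continuous_big_sum (fun l => continuous_sub (lin (fun k => lambda (H k l)) a)
  (continuous_mul (lin (fun k => R0 k l) a) (lin (fun k => R0 k l) a)))).
Qed.

Definition U_term (rho : R) (a : 'I_NT -> R) : R := \sum_(l < NR)
  (ln (1 + rho * \sum_(k < NT) R0 k l * a k) - \sum_(k < NT) a k * I_ S k l rho).

Let R0_ge0 k l : 0 <= R0 k l. Proof. exact: (autocorrelation0_ge0 ch). Qed.

Let gain_ge0 a l : A_ beta a -> 0 <= \sum_(k < NT) R0 k l * a k.
Proof. by case=> a0 _; apply: sumr_ge0 => k _; rewrite mulr_ge0. Qed.

Let a_le1 (a : 'I_NT -> R) k : A_ beta a -> a k <= 1.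
Proof.
move=> [a0 a1]; apply: (@le_trans _ _ (\sum_(j < NT) a j)).
  by rewrite (bigD1 k)//= lerDl; apply: sumr_ge0 => j _; exact: a0.
by apply: le_trans a1 _; rewrite invf_le1// (lt_le_trans ltr01).
Qed.

Lemma U_max (rho : R) : 0 <= rho -> exists2 a, A_ beta a &
  U_mimo_s H S rho beta = U_term rho a /\ forall b, A_ beta b -> U_term rho b <= U_term rho a.
Proof.
move=> rho0; apply: (max_of_A beta1 (f := U_term rho : powers -> R)) => a aA.
have lin := continuous_linear_form (R := R) (NT := NT).
have comm l : (fun b : powers => \sum_(k < NT) R0 k l * b k) = (fun b : powers => \sum_(k < NT) b k * R0 k l).
  by apply/funext => b; apply: eq_bigr => k _; rewrite mulrC.
have cln l : {for a, continuous (fun b : powers => ln (1 + rho * \sum_(k < NT) R0 k l * b k))}.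
  apply: (continuous_comp (f := fun b : powers => 1 + rho * \sum_(k < NT) R0 k l * b k) (g := @ln R)).
    by apply: (continuous_affine (f := fun b : powers => \sum_(k < NT) R0 k l * b k)); rewrite comm; exact: lin.
  by apply: continuous_ln; have := mulr_ge0 rho0 (gain_ge0 l aA); lra.
have cU l : {for a, continuous (fun b : powers => ln (1 + rho * \sum_(k < NT) R0 k l * b k) -
    \sum_(k < NT) b k * I_ S k l rho)}.
  have hl := lin (fun k => I_ S k l rho) a.
  have hc := cln l.
  refine (@continuous_sub R powers (fun b : powers => ln (1 + rho * \sum_(k < NT) R0 k l * b k)) (fun b : powers => \sum_(k < NT) b k * I_ S k l rho) a hc hl).
have := continuous_big_sum (r := index_enum 'I_NR) cU.
exact.
Qed.

Let comm a l : \sum_(k < NT) R0 k l * a k = \sum_(k < NT) a k * R0 k l.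
Proof. by apply: eq_bigr => k _; rewrite mulrC. Qed.

(** The terms of first order in rho cancel between the logarithm and the spectral integrals. The
    rest is the third-order bound of ln(1 + x) and the second-order bound [I_upper]. *)
Lemma U_term_le (rho : R) a : 0 <= rho -> A_ beta a ->
  U_term rho a <= rho ^+ 2 * (quadratic_gain H a / 2) + rho ^+ 3 * cubic_constant H.
Proof.
move=> rho0 aA.
have -> : rho ^+ 2 * (quadratic_gain H a / 2) + rho ^+ 3 * cubic_constant H = \sum_(l < NR)
    (rho ^+ 2 / 2 * (\sum_(k < NT) a k * lambda (H k l) - (\sum_(k < NT) a k * R0 k l) ^+ 2) +
     rho ^+ 3 * ((\sum_(k < NT) R0 k l) ^+ 3 / 3)).
  by rewrite big_split/= -!mulr_sumr /quadratic_gain; congr (_ + _); rewrite mulrA mulrAC.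
apply: ler_sum => l _.
have x0 := gain_ge0 l aA; have rx : 0 <= rho * \sum_(k < NT) R0 k l * a k by rewrite mulr_ge0.
have h1 := ln1p_le rx.
have h2 : \sum_(k < NT) a k * (rho * R0 k l - I_ S k l rho) <= \sum_(k < NT) a k * (rho ^+ 2 * lambda (H k l) / 2).
  apply: ler_sum => k _; rewrite ler_wpM2l//; first by case: aA.
  exact: (I_upper phi_finite densityS k l rho0).
have e1 : \sum_(k < NT) a k * (rho * R0 k l - I_ S k l rho) =
    rho * (\sum_(k < NT) R0 k l * a k) - \sum_(k < NT) a k * I_ S k l rho.
  by rewrite mulr_sumr -sumrB; apply: eq_bigr => k _; ring.
have e2 : \sum_(k < NT) a k * (rho ^+ 2 * lambda (H k l) / 2) = rho ^+ 2 / 2 * \sum_(k < NT) a k * lambda (H k l).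
  by rewrite mulr_sumr; apply: eq_bigr => k _; ring.
have h3 : (rho * \sum_(k < NT) R0 k l * a k) ^+ 3 <= rho ^+ 3 * (\sum_(k < NT) R0 k l) ^+ 3.
  rewrite exprMn ler_wpM2l ?exprn_ge0// lerXn2r ?nnegrE ?gain_ge0 ?sumr_ge0//.
  by apply: ler_sum => k _; rewrite ler_piMr// a_le1.
rewrite e1 e2 in h2; rewrite -(comm a l) mulrBr; move: h1; rewrite [(rho * _) ^+ 2]exprMn; lra.
Qed.

(** The spectral error is weighted by powers of total at most 1, so each receive antenna loses at
    most e. *)
Lemma U_term_ge (rho e : R) a : 0 <= rho -> 0 <= e -> A_ beta a ->
  (forall k l, rho ^+ 2 * (lambda (H k l) / 2 - e) <= rho * R0 k l - I_ S k l rho) ->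
  rho ^+ 2 * (quadratic_gain H a / 2 - e * NR%:R) <= U_term rho a.
Proof.
move=> rho0 e0 aA hI.
have -> : rho ^+ 2 * (quadratic_gain H a / 2 - e * NR%:R) = \sum_(l < NR)
    (rho ^+ 2 / 2 * (\sum_(k < NT) a k * lambda (H k l) - (\sum_(k < NT) a k * R0 k l) ^+ 2) - rho ^+ 2 * e).
  rewrite sumrB -mulr_sumr (_ : \sum_(l < NR) rho ^+ 2 * e = rho ^+ 2 * e * NR%:R).
    by rewrite /quadratic_gain; field.
  by rewrite sumr_const card_ord -[LHS]mulr_natr.
apply: ler_sum => l _.
have x0 := gain_ge0 l aA; have rx : 0 <= rho * \sum_(k < NT) R0 k l * a k by rewrite mulr_ge0.
have h1 := ln1p_ge rx.
have h2 : \sum_(k < NT) a k * (rho ^+ 2 * (lambda (H k l) / 2 - e)) <= \sum_(k < NT) a k * (rho * R0 k l - I_ S k l rho).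
  by apply: ler_sum => k _; rewrite ler_wpM2l//; case: aA.
have e1 : \sum_(k < NT) a k * (rho * R0 k l - I_ S k l rho) =
    rho * (\sum_(k < NT) R0 k l * a k) - \sum_(k < NT) a k * I_ S k l rho.
  by rewrite mulr_sumr -sumrB; apply: eq_bigr => k _; ring.
have e2 : \sum_(k < NT) a k * (rho ^+ 2 * (lambda (H k l) / 2 - e)) =
    rho ^+ 2 / 2 * \sum_(k < NT) a k * lambda (H k l) - rho ^+ 2 * e * \sum_(k < NT) a k.
  by rewrite !mulr_sumr -sumrB; apply: eq_bigr => k _; field.
have s1 : \sum_(k < NT) a k <= 1.
  by case: aA => _ /le_trans; apply; rewrite invf_le1// (lt_le_trans ltr01).
have h3 : rho ^+ 2 * e * \sum_(k < NT) a k <= rho ^+ 2 * e by rewrite ler_piMr// mulr_ge0 ?sqr_ge0.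
rewrite e1 e2 in h2; rewrite -(comm a l) mulrBr; move: h1; rewrite [(rho * _) ^+ 2]exprMn; lra.
Qed.

(** The maximiser of [U_mimo_s] moves with rho. The upper estimate is uniform over [A_ beta], and
    the lower one is taken at the fixed maximiser of the quadratic gain, so no convergence of
    maximisers is involved. *)
Lemma U_limit (L : R) : max_of [set quadratic_gain H a | a in A_ beta] = 2 * L ->
  U_mimo_s H S rho beta / rho ^+ 2 @[rho --> 0^'+] --> L.
Proof.
have [a0 a0A [-> gmax]] := quadratic_gain_max => gL.
apply/cvgrPdist_le => /= e e0.
have c0 : 0 <= cubic_constant H.
  by apply: sumr_ge0 => l _; rewrite divr_ge0// exprn_ge0//; exact: sumr_ge0.
have e'0 : 0 < e / (NR%:R + 1) by rewrite divr_gt0// ltr_wpDl.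
have hI : \forall rho \near 0^'+, forall kl : 'I_NT * 'I_NR,
    rho ^+ 2 * (lambda (H kl.1 kl.2) / 2 - e / (NR%:R + 1)) <= rho * R0 kl.1 kl.2 - I_ S kl.1 kl.2 rho.
  by apply: filter_forall => kl; exact: (I_lower_near phi_finite densityS kl.1 kl.2 e'0).
have c1 : 0 < e / (cubic_constant H + 1) by rewrite divr_gt0// ltr_wpDl.
near=> rho.
have rho0 : 0 < rho by near: rho; exact: nbhs_right_gt.
have rhoc : rho <= e / (cubic_constant H + 1) by near: rho; exact: nbhs_right_le.
have hIr : forall k l, rho ^+ 2 * (lambda (H k l) / 2 - e / (NR%:R + 1)) <= rho * R0 k l - I_ S k l rho.
  have h : forall kl : 'I_NT * 'I_NR, rho ^+ 2 * (lambda (H kl.1 kl.2) / 2 - e / (NR%:R + 1)) <=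
      rho * R0 kl.1 kl.2 - I_ S kl.1 kl.2 rho by near: rho.
  by move=> k l; exact: (h (k, l)).
have r2 : 0 < rho ^+ 2 by rewrite exprn_gt0.
have [a aA [-> Umax]] := U_max (ltW rho0).
have up := U_term_le (ltW rho0) aA.
have low := le_trans (U_term_ge (ltW rho0) (ltW e'0) a0A hIr) (Umax _ a0A).
rewrite distrC ler_norml; apply/andP; split.
  rewrite lerBrDr ler_pdivlMr// mulrC; apply: le_trans low; rewrite ler_wpM2l ?(ltW r2)//.
  have : e / (NR%:R + 1) * NR%:R <= e.
    by rewrite mulrAC ler_pdivrMr ?ltr_wpDl// ler_wpM2l ?(ltW e0)// lerDl.
  rewrite gL; lra.
rewrite lerBlDr ler_pdivrMr//; apply: le_trans up _.
have h1 : rho ^+ 2 * (quadratic_gain H a / 2) <= rho ^+ 2 * L.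
  by rewrite ler_wpM2l ?(ltW r2)//; have := gmax a aA; rewrite gL; lra.
have h2 : rho ^+ 3 * cubic_constant H <= rho ^+ 2 * e.
  rewrite exprSr -mulrA ler_wpM2l ?(ltW r2)//.
  move: rhoc; rewrite ler_pdivlMr ?ltr_wpDl// mulrDr mulr1; have := ltW rho0; lra.
lra.
Unshelve. all: by end_near.
Qed.

End upper_bound_limit.

Theorem mainTheorem2 (R : realType) (NT NR : nat)
    (d : measure_display) (Omega : measurableType d) (P : probability Omega R)
    (H : 'I_NT -> 'I_NR -> int -> {RV P >-> R[i]})
    (W : 'I_NR -> nat -> {RV P >-> R[i]})
    (S : 'I_NT -> 'I_NR -> R -> R) (beta : R)
    (channelHW : rayleigh_fading_channel H W)
    (densityS : forall k l, spectral_density (H k l) (S k l))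
    (phi_finite : forall k l, (phi (H k l) < +oo)%E)
    (beta_ge1 : 1 <= beta) :
  let L := 2^-1 * max_of [set \sum_(l < NR)
      (\sum_(k < NT) a k * lambda (H k l)
         - (\sum_(k < NT) a k * autocorrelation0 (H k l)) ^+ 2)
    | a in A_ beta] in
  (capacity H W rho beta * ((rho ^+ 2)^-1)%:E)%E @[rho --> 0^'+] --> L%:E /\
  U_mimo_s H S rho beta / rho ^+ 2 @[rho --> 0^'+] --> L.
Proof.
move=> L; have LE : max_of [set quadratic_gain H a | a in A_ beta] = 2 * L.
  by rewrite /L mulrA divff ?mul1r.
split; last exact: (U_limit channelHW phi_finite densityS beta_ge1 LE).
have [a aA [aE amax]] := quadratic_gain_max H beta_ge1.
apply: (capacity_limit channelHW phi_finite beta_ge1).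
  by move=> b bA; rewrite -LE aE amax.
by exists a => //; rewrite -LE aE.
Qed.
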